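(* Let $D\subset\mathbb{R}^2$ be a sound-soft cavity, let $\Gamma$ be the source curve, and let $u(x;z)=u^i(x;z)+u^s(x;z)$ be the total field of the interior scattering problem with Dirichlet condition $u=0$ on $\partial D$ and point source at $z\in\Gamma$. Let $D'$ be a domain with boundary $\Lambda=\partial D'$, and suppose that $$\int_{\Gamma}\int_{\Lambda}|u(x;z)|\,\mathrm{d}s(x)\,\mathrm{d}s(z)=0 .$$ Then $D'=D$ and $\Lambda=\partial D$.
   Context: Setting: $k>0$ is fixed, $B_r=\{x\in\mathbb{R}^2:|x|<r\}$. $D\subset\mathbb{R}^2$ is a bounded open simply connected domain with $C^2$ boundary, and $k^2$ is not a Dirichlet eigenvalue of $-\Delta$ in $D$. The competing domain $D'$ is of the same type: bounded, open, simply connected, with $C^2$ boundary. $\mathrm{d}s$ is arc length. For $z\in D$ the incident field is $u^i(x;z)=\frac{\mathrm{i}}{4}H_0^{(1)}(k|x-z|)$, with $H_0^{(1)}$ the Hankel function of the first kind of order $0$. The scattered field $u^s=u^s(\cdot;z)\in H^1(D)$ is the unique solution of $\Delta u^s+k^2u^s=0$ in $D$, $u^i+u^s=0$ on $\partial D$ (sound-soft). Admissible curve: an open curve $\Gamma$ is called admissible with respect to a domain $\Omega$ if (i) $\Omega\subset D$ is simply connected; (ii) $\partial\Omega$ is analytic homeomorphic to the unit circle $\mathbb{S}^1$; (iii) $k^2$ is not a Dirichlet eigenvalue of $-\Delta$ in $\Omega$; (iv) $\Gamma\subset\partial\Omega$ is a one-dimensional analytic manifold with nonvanishing measure. Here $\Gamma$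 and $\Gamma_R$ are admissible curves with respect to $\Omega$ and $B_R$, respectively, where $\overline\Omega\subset B_R$ and $B_R\subset D$. It is assumed that there is a disc $B_\rho\supseteq D$ such that, for every $z\in\Gamma$, $u^s(\cdot;z)$ extends analytically to $B_\rho$ (as a solution of the Helmholtz equation); $u(\cdot;z)$ also denotes the extended total field, and $\Lambda\subset B_\rho$, so that $u(\cdot;z)$ is defined on $\Lambda$ away from $z$. *)

(* Defs.v *)
From HB Require Import structures.
From mathcomp Require Import all_boot all_order all_algebra.
From mathcomp Require Import all_classical all_reals all_analysis.
From mathcomp Require Import complex.

Set Implicit Arguments.
Unset Strict Implicit.
Unset Printing Implicit Defensive.

Import Order.TTheory GRing.Theory Num.Theory.
Import numFieldNormedType.Exports.

Local Open Scope classical_set_scope.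
Local Open Scope ring_scope.

Section plane.
Context {R : realType}.
Implicit Types (x p : R * R) (A : set (R * R)).

(* The library norm on R * R is the max norm; Euclidean quantities use enorm. *)
Definition enorm x : R := Num.sqrt (x.1 ^+ 2 + x.2 ^+ 2).

Definition disc (r : R) : set (R * R) := [set x | enorm x < r].

Definition bd A : set (R * R) := closure A `\` A°.

(* A nonempty connected set in which every loop is null-homotopic. *)
Definition simply_connected A : Prop :=
  [/\ A !=set0, connected A &
    forall c : R -> R * R,
      {within `[0, 1], continuous c} -> c 0 = c 1 -> c @` `[0, 1] `<=` A ->
      exists H : R * R -> R * R,
        [/\ {within `[0, 1] `*` `[0, 1], continuous H},
            H @` (`[0, 1] `*` `[0, 1]) `<=` A,
            forall s : R, s \in `[0, 1] -> H (s, 0) = c s /\ H (s, 1) = c 0 &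
            forall t : R, t \in `[0, 1] -> H (0, t) = c 0 /\ H (1, t) = c 0]].

Definition C2_fun (g : R -> R) : Prop :=
  [/\ forall t, derivable g t 1,
      forall t, derivable (derive1 g) t 1 &
      continuous (derive1 (derive1 g))].

(* Near each boundary point, A is the strict epigraph of a C^2 function in the
   coordinates of the orthonormal frame (a, b), (- b, a) centred at the point. *)
Definition C2_boundary A : Prop :=
  forall p, bd A p ->
  exists (r a b : R) (g : R -> R),
    [/\ 0 < r, a ^+ 2 + b ^+ 2 = 1, C2_fun g &
      forall x, enorm (x - p) < r ->
        (A x <-> g (a * (x - p).1 + b * (x - p).2)
                   < - b * (x - p).1 + a * (x - p).2)].

Definition C2_domain A : Prop :=
  [/\ open A, bounded_set A, simply_connected A & C2_boundary A].

End plane.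

(* Arc length is the one-dimensional Hausdorff measure for the Euclidean
   metric, with the normalization H^1(segment) = length, i.e. without constant
   factor in front of the diameters. *)
Section arc_length.
Local Open Scope ereal_scope.
Context {R : realType}.
Implicit Types A E C : set (R * R).

(* 0 is added to the set so that the diameter of the empty set is 0. *)
Definition ediam E : \bar R :=
  ereal_sup [set e | e = 0 \/
    exists x y : R * R, [/\ E x, E y & e = (enorm (x - y))%:E]].

Definition hausdorff1_cover (d : R) A : set (set (R * R))^nat :=
  [set F | (forall i, ediam (F i) <= d%:E) /\ A `<=` \bigcup_i F i].

Definition hausdorff1_pre (d : R) A : \bar R :=
  ereal_inf [set \sum_(i <oo) ediam (F i) | F in hausdorff1_cover d A].

Definition hausdorff1 A : \bar R :=
  ereal_sup [set hausdorff1_pre d A | d in [set d : R | (0 < d)%R]].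

Lemma ediam_ge0 E : 0 <= ediam E.
Proof. by apply: ereal_sup_ubound; left. Qed.

Lemma ediam_set0 : ediam set0 = 0.
Proof.
apply/eqP; rewrite eq_le ediam_ge0 andbT.
by apply: ge_ereal_sup => e /= [->//|[x [y []]]].
Qed.

Lemma hausdorff1_pre_ge0 d A : 0 <= hausdorff1_pre d A.
Proof.
apply: le_ereal_inf_tmp => x [F _ <-].
by apply: nneseries_ge0 => n *; exact: ediam_ge0.
Qed.

Lemma hausdorff1_pre_sigma_subadditive d : sigma_subadditive (hausdorff1_pre d).
Proof.
move=> A; have [[i ioo]|] := pselect (exists i, hausdorff1_pre d (A i) = +oo).
  rewrite (eseries_pinfty _ _ ioo) ?leey// => n _.
  by rewrite -ltNye (lt_le_trans _ (hausdorff1_pre_ge0 _ _)).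
rewrite -forallNE => Aoo.
suff add2e (e : {posnum R}) : hausdorff1_pre d (\bigcup_n A n)
    <= \sum_(i <oo) hausdorff1_pre d (A i) + e%:num%:E.
  by apply/lee_addgt0Pr => _/posnumP[].
rewrite (le_trans _ (epsilon_trick _ _ _))//; last first.
  by move=> n; exact: hausdorff1_pre_ge0.
pose P n (B : (set (R * R))^nat) := hausdorff1_cover d (A n) B /\
  \sum_(k <oo) ediam (B k)
    <= hausdorff1_pre d (A n) + (e%:num / (2 ^ n.+1)%:R)%:E.
have [G PG] : {G : ((set (R * R))^nat)^nat & forall n, P n (G n)}.
  apply: (@choice _ _ P) => n; rewrite /P /hausdorff1_pre.
  set S := (X in ereal_inf X); move infS : (ereal_inf S) => iS.
  case: iS infS => [r Sr|Soo|Soo].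
  - have en1 : (0 < e%:num / (2 ^ n.+1)%:R)%R by [].
    have /(lb_ereal_inf_adherent en1) : ereal_inf S \is a fin_num by rewrite Sr.
    move=> [x [B BA muBx] xS].
    by exists B; split => //; rewrite muBx -Sr; exact/ltW.
  - by have := Aoo n; rewrite /hausdorff1_pre Soo.
  - by have := hausdorff1_pre_ge0 d (A n); rewrite /hausdorff1_pre Soo.
have muG_ge0 x : 0 <= (ediam \o uncurry G) x by exact: ediam_ge0.
apply: (@le_trans _ _ (\esum_(i in setT) (ediam \o uncurry G) i)).
  apply: ereal_inf_lbound => /=.
  have /card_esym/ppcard_eqP[f] := card_nat2.
  exists (uncurry G \o f).
    split => [i|t [i _]].
      by rewrite /= /uncurry; case: (f i) => a b; exact: (PG a).1.1.
    move=> /(PG i).1.2[j _ Bijt]; exists (f^-1%FUN (i, j)) => //=.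
    by rewrite invK ?inE.
  rewrite -(esum_pred_image (ediam \o uncurry G) _ xpredT) ?[fun=> _]set_true//.
  by rewrite image_eq.
rewrite (_ : esum _ _ = \sum_(i <oo) \sum_(j <oo) ediam (G i j)); last first.
  pose J : nat -> set (nat * nat) := fun i => [set (i, j) | j in setT].
  rewrite (_ : setT = \bigcup_k J k); last first.
    by rewrite predeqE => -[a b]; split => // _; exists a => //; exists b.
  rewrite esum_bigcupT /=; last 2 first.
    - apply/trivIsetP => i j _ _ ij.
      rewrite predeqE => -[n m] /=; split => //= -[] [_] _ [<-{n} _].
      by move=> [m' _] [] /esym/eqP; rewrite (negbTE ij).
    - by move=> /= [n m]; exact: ediam_ge0.
  rewrite -(image_id [set: nat]) -fun_true esum_pred_image//; last first.
    by move=> n _; apply: esum_ge0 => *; exact: ediam_ge0.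
  apply: eq_eseriesr => /= j _.
  rewrite -(esum_pred_image (ediam \o uncurry G) (pair j) predT)//=.
  - by congr esum; rewrite predeqE => -[a b]; split; move=> [i _ <-]; exists i.
  - by move=> *; exact: ediam_ge0.
  - by move=> ? ? _ _; exact: (@can_inj _ _ _ snd).
apply: lee_lim.
- apply: is_cvg_nneseries => n *.
  by apply: nneseries_ge0 => m *; exact: (muG_ge0 (n, m)).
- apply: is_cvg_nneseries => n *; apply: adde_ge0 => //.
  exact: hausdorff1_pre_ge0.
- by near=> n; apply: lee_sum => i _; exact: (PG i).2.
Unshelve. all: by end_near. Qed.

Lemma hausdorff1_pre_le d A : (0 < d)%R -> hausdorff1_pre d A <= hausdorff1 A.
Proof. by move=> d0; apply: ereal_sup_ubound; exists d. Qed.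

Lemma hausdorff1_ge0 A : 0 <= hausdorff1 A.
Proof.
exact: le_trans (hausdorff1_pre_ge0 1 A) (hausdorff1_pre_le A ltr01).
Qed.

Lemma hausdorff1_set0 : hausdorff1 set0 = 0.
Proof.
apply/eqP; rewrite eq_le hausdorff1_ge0 andbT.
apply: ge_ereal_sup => _ [d /= d0 <-]; apply: ereal_inf_lbound.
exists (fun=> set0); first by split => // i; rewrite ediam_set0 lee_fin ltW.
by apply: eseries0 => i _ _; exact: ediam_set0.
Qed.

Lemma le_hausdorff1 : {homo hausdorff1 : A B / A `<=` B >-> A <= B}.
Proof.
move=> A B AB; apply: ge_ereal_sup => _ [d /= d0 <-].
apply: le_trans (hausdorff1_pre_le B d0).
apply: ereal_inf_le_tmp => _ [F [dF BF] <-]; exists F => //.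
by split => //; exact: subset_trans BF.
Qed.

Lemma hausdorff1_sigma_subadditive : sigma_subadditive hausdorff1.
Proof.
move=> F; apply: ge_ereal_sup => _ [d /= d0 <-].
apply: (le_trans (hausdorff1_pre_sigma_subadditive d F)).
apply: lee_nneseries => n *; first exact: hausdorff1_pre_ge0.
exact: hausdorff1_pre_le.
Qed.

HB.instance Definition _ := isOuterMeasure.Build R (R * R)%type hausdorff1
  hausdorff1_set0 hausdorff1_ge0 le_hausdorff1 hausdorff1_sigma_subadditive.

(* Integral with respect to ds over C: hausdorff1 is a measure on the
   sigma-algebra of its Caratheodory measurable sets. *)
Definition arc_integral C (f : R * R -> \bar R) : \bar R :=
  \int[(hausdorff1 : set (caratheodory_type (@hausdorff1)) -> \bar R)]_(x in C)
    f x.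

End arc_length.

Section sobolev.
Context {R : realType}.
Implicit Types (U : set (R * R)) (f g phi h : R * R -> R).

Definition leb2 : set (measurableTypeR R * measurableTypeR R) -> \bar R :=
  (@lebesgue_measure R \x @lebesgue_measure R)%E.

Definition d1 f : R * R -> R := fun x => 'D_((1, 0) : R * R) f x.
Definition d2 f : R * R -> R := fun x => 'D_((0, 1) : R * R) f x.

Fixpoint Ck (n : nat) f : Prop :=
  continuous f /\
  if n is m.+1 then
    [/\ forall x, derivable f x (1, 0) /\ derivable f x (0, 1),
        Ck m (d1 f) & Ck m (d2 f)]
  else True.

Definition smooth f : Prop := forall n, Ck n f.

Definition test_fun U phi : Prop :=
  smooth phi /\
  exists K : set (R * R),
    [/\ compact K, K `<=` U & forall x, ~ K x -> phi x = 0].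

Definition L2 U f : Prop :=
  measurable_fun (U : set (measurableTypeR R * measurableTypeR R)) f /\
  (\int[leb2]_(x in U) ((f x) ^+ 2)%:E < +oo)%E.

(* f is in H^1(U), with weak gradient (g1, g2). *)
Definition H1 U f g1 g2 : Prop :=
  [/\ L2 U f, L2 U g1, L2 U g2 &
    forall phi, test_fun U phi ->
      (\int[leb2]_(x in U) (f x * d1 phi x))
        = - (\int[leb2]_(x in U) (g1 x * phi x)) /\
      (\int[leb2]_(x in U) (f x * d2 phi x))
        = - (\int[leb2]_(x in U) (g2 x * phi x))].

Definition H1_cvg U (phi : nat -> R * R -> R) f g1 g2 : Prop :=
  (\int[leb2]_(x in U) ((phi n x - f x) ^+ 2 + (d1 (phi n) x - g1 x) ^+ 2
                         + (d2 (phi n) x - g2 x) ^+ 2)%:E)%E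
    @[n --> \oo] --> 0%E.

Definition H10 U f g1 g2 : Prop :=
  H1 U f g1 g2 /\
  exists phi : nat -> R * R -> R,
    (forall n, test_fun U (phi n)) /\ H1_cvg U phi f g1 g2.

(* h is the trace on the boundary of U of the H^1(U) function f: the trace
   operator is the continuous extension of the restriction of smooth functions
   to the boundary, with values in L^2(bd U, ds). *)
Definition has_trace U f g1 g2 h : Prop :=
  exists phi : nat -> R * R -> R,
    [/\ forall n, smooth (phi n), H1_cvg U phi f g1 g2 &
      arc_integral (bd U) (fun x => ((phi n x - h x) ^+ 2)%:E)
        @[n --> \oo] --> 0%E].

(* - Laplacian f = lam f in U, where (g1, g2) is the weak gradient of f. *)
Definition weak_helmholtz U (lam : R) f g1 g2 : Prop :=
  forall phi, test_fun U phi ->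
    (\int[leb2]_(x in U) (g1 x * d1 phi x + g2 x * d2 phi x))
      = lam * (\int[leb2]_(x in U) (f x * phi x)).

(* lam being real, it is enough to consider real-valued eigenfunctions. *)
Definition dirichlet_eigenvalue U (lam : R) : Prop :=
  exists f g1 g2 : R * R -> R,
    [/\ H10 U f g1 g2, weak_helmholtz U lam f g1 g2 &
        (0 < \int[leb2]_(x in U) ((f x) ^+ 2)%:E)%E].

Definition dirichlet_solution U (k : R) f h : Prop :=
  exists g1 g2 : R * R -> R,
    [/\ H1 U f g1 g2, weak_helmholtz U (k ^+ 2) f g1 g2 &
        has_trace U f g1 g2 h].

End sobolev.

Section fields.
Context {R : realType}.
Implicit Types (k t : R) (x z : R * R) (D U : set (R * R)).

Definition euler_gamma : R :=
  limn (fun n => \sum_(1 <= i < n.+1) i%:R^-1 - ln (n%:R : R)).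

Definition harmonic_number (m : nat) : R := \sum_(1 <= i < m.+1) i%:R^-1.

Definition bessel_J0 t : R :=
  limn (series (fun m : nat => (-1) ^+ m / (m`!%:R) ^+ 2 * (t / 2) ^+ m.*2)).

(* Bessel function of the second kind (Neumann function) of order 0, t > 0. *)
Definition bessel_Y0 t : R :=
  2 / pi * ((ln (t / 2) + euler_gamma) * bessel_J0 t
    - limn (series (fun m : nat =>
        (-1) ^+ m * harmonic_number m / (m`!%:R) ^+ 2 * (t / 2) ^+ m.*2))).

Definition hankel0 t : R[i] := (bessel_J0 t +i* bessel_Y0 t)%C.

Definition incident_field k z x : R[i] := 'i%C / 4 * hankel0 (k * enorm (x - z)).

(* v is the scattered field in D for the point source z; complex-valued
   functions are handled through their real and imaginary parts. *)
Definition scattered_field D k z (v : R * R -> R[i]) : Prop :=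
  dirichlet_solution D k (fun x => complex.Re (v x))
    (fun x => - complex.Re (incident_field k z x)) /\
  dirichlet_solution D k (fun x => complex.Im (v x))
    (fun x => - complex.Im (incident_field k z x)).

Definition analytic2_at (f : R * R -> R) (p : R * R) : Prop :=
  exists (a : nat -> nat -> R) (r : R), 0 < r /\
    forall h : R * R, enorm h < r ->
      cvgn (series (fun n : nat => \sum_(0 <= i < n.+1)
        `|a i (n - i)%N * h.1 ^+ i * h.2 ^+ (n - i)|)) /\
      series (fun n : nat => \sum_(0 <= i < n.+1)
        a i (n - i)%N * h.1 ^+ i * h.2 ^+ (n - i)) @ \oo --> f (p + h).

Definition analytic_helmholtz U k (f : R * R -> R) : Prop :=
  forall x, U x ->
    analytic2_at f x /\ d1 (d1 f) x + d2 (d2 f) x + k ^+ 2 * f x = 0.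

(* An element v of H^1(D) is a class of functions modulo null sets, whence the
   almost everywhere equality. *)
Definition helmholtz_extension D U k (v w : R * R -> R[i]) : Prop :=
  [/\ analytic_helmholtz U k (fun x => complex.Re (w x)),
      analytic_helmholtz U k (fun x => complex.Im (w x)) &
      {ae leb2, forall x, D x -> w x = v x}].

End fields.

Section admissible_curves.
Context {R : realType}.
Implicit Types (D Omega C Gamma : set (R * R)) (c : R -> R * R).

Definition analytic_at (f : R -> R) (t : R) : Prop :=
  exists (a : nat -> R) (r : R), 0 < r /\
    forall h : R, `|h| < r ->
      series (fun n : nat => a n * h ^+ n) @ \oo --> f (t + h).

Definition analytic_immersion_at c (t : R) : Prop :=
  [/\ analytic_at (fun s => (c s).1) t, analytic_at (fun s => (c s).2) t &
      (derive1 (fun s => (c s).1) t, derive1 (fun s => (c s).2) t) != (0, 0)].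

(* Image of the unit circle under an analytic homeomorphism with analytic
   inverse, written in the angular variable of the circle. *)
Definition analytic_circle C : Prop :=
  exists c : R -> R * R,
    [/\ forall t, analytic_immersion_at c t,
        forall t, c (t + 2 * pi) = c t,
        {in `[0, 2 * pi[ &, injective c} &
        C = range c].

(* One-dimensional analytic submanifold (without boundary) of the plane:
   s is the continuous inverse of the local parametrization c. *)
Definition analytic_1manifold C : Prop :=
  forall p, C p ->
  exists (V : set (R * R)) (c : R -> R * R) (s : R * R -> R),
    [/\ open V /\ V p,
        forall t, t \in `]-1, 1[ -> analytic_immersion_at c t,
        c @` `]-1, 1[ = C `&` V,
        {within C `&` V, continuous s} &
        forall t, t \in `]-1, 1[ -> s (c t) = t].

Record admissible D (k : R) Gamma Omega : Prop := Admissible {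
  adm_open : open Omega;
  adm_sub : Omega `<=` D;
  adm_simply_connected : simply_connected Omega;
  adm_boundary : analytic_circle (bd Omega);
  adm_eigenvalue : ~ dirichlet_eigenvalue Omega (k ^+ 2);
  adm_curve_sub : Gamma `<=` bd Omega;
  adm_curve_connected : connected Gamma;
  adm_curve_manifold : analytic_1manifold Gamma;
  adm_curve_measure : (0 < hausdorff1 Gamma)%E }.

End admissible_curves.

(* Main.v *)
(** Write G_z for the real part of u(.;z). Suppose D' <> D. If G_z vanished on Lambda for
    infinitely many z, then for infinitely many of them z would be away from the same nonempty
    set W among D \ cl D', D n D' and D' \ cl D, whose boundary lies in bd D u Lambda, and G_z
    would solve the Helmholtz equation in W and vanish on bd W. Truncating near the level 0
    yields an energy estimate for such solutions, with no regularity of bd W; with the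
    Poincare inequality on a fine grid it bounds the dimension of their span. But the G_z are
    linearly independent on W, by unique continuation up to the logarithmic singularities. On
    bd D the datum is attained in the sense of traces only, hence the cutoffs whose gradients
    are small against functions of zero trace.

    So G_z vanishes on Lambda for finitely many z in a compact arc of Gamma. For the other z
    it is bounded below on a piece of Lambda of positive length. Reciprocity makes z |->
    G_z(x) a Borel function, so that one piece and one bound serve a set of z of positive
    length, and the double integral is positive. *)
From HB Require Import structures.
Require Import Defs.
From mathcomp Require Import all_boot all_order all_algebra.
From mathcomp Require Import all_classical all_reals all_analysis.
From mathcomp Require Import measurable_realfun complex.
From mathcomp Require Import zify ring lra.

Set Implicit Arguments.
Unset Strict Implicit.
Unset Printing Implicit Defensive.

Import Order.TTheory GRing.Theory Num.Theory.
Import numFieldNormedType.Exports.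

Local Open Scope classical_set_scope.
Local Open Scope ring_scope.

(** * Hausdorff measure of the plane *)

(** One source decides nothing: [k^2] may be a Dirichlet eigenvalue of the unknown set W, and the
    field of a single source could then vanish on [Lambda]. Only an infinite independent family
    contradicts the finite multiplicity of that eigenvalue. W lies between two curves that may meet
    in any manner, so it has no charts and no traces: every estimate is made inside W, on functions
    of compact support. Real parts are taken because [i/4 (J_0 + i Y_0)] has real part [- Y_0 / 4],
    the part with the logarithm. This singularity excludes sources on [Lambda] and yields
    independence; regularized, it becomes a smooth source to which reciprocity applies. The
    hypotheses provide a solution for each [z] separately, with no regularity in [z]. Reciprocity
    moves the dependence on [z] onto explicit kernels, but only for [x] in [D]; outside, one
    continues by one-variable Taylor expansions along horizontal and vertical steps. Their radius
    depends only on [k] and on the distance to the boundary, so the same steps serve all [z] at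
    once. *)

Section hausdorff.
Context {R : realType}.
Implicit Types (A B X E : set (R * R)) (x y : R * R) (a : R).

Lemma enorm_ge0 x : 0 <= enorm x.
Proof. exact: sqrtr_ge0. Qed.

Lemma abs1_le_enorm x : `|x.1| <= enorm x.
Proof. by rewrite -sqrtr_sqr ler_sqrt ?addr_ge0 ?sqr_ge0// lerDl sqr_ge0. Qed.

Lemma abs2_le_enorm x : `|x.2| <= enorm x.
Proof. by rewrite -sqrtr_sqr ler_sqrt ?addr_ge0 ?sqr_ge0// lerDr sqr_ge0. Qed.

Lemma enorm_le_abs x : enorm x <= `|x.1| + `|x.2|.
Proof.
rewrite -(ler_pXn2r (n:=2)) ?nnegrE ?enorm_ge0 ?addr_ge0//.
rewrite sqr_sqrtr ?addr_ge0 ?sqr_ge0// sqrrD !real_normK ?num_real//.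
by rewrite lerD2r lerDl mulrn_wge0// mulr_ge0.
Qed.

(** The instances are the coordinates. Being 1-Lipschitz for [enorm] gives both the separation of
    half-planes and the comparison of length with its projection on an axis. *)
Definition lip1 (f : R * R -> R) := forall x y, `|f x - f y| <= enorm (x - y).

Lemma lip1_fst : lip1 fst.
Proof. by move=> x y; exact: (abs1_le_enorm (x - y)). Qed.

Lemma lip1_snd : lip1 snd.
Proof. by move=> x y; exact: (abs2_le_enorm (x - y)). Qed.

Local Open Scope ereal_scope.

Lemma ediam_ub E x y : E x -> E y -> (enorm (x - y))%:E <= ediam E.
Proof. by move=> Ex Ey; apply: ereal_sup_ubound; right; exists x, y. Qed.

Lemma hausdorff1_pre_anti A (d e : R) : (d <= e)%R ->
  hausdorff1_pre e A <= hausdorff1_pre d A.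
Proof.
move=> de; apply: ereal_inf_le_tmp => _ [F [dF BF] <-]; exists F => //.
by split => // i; rewrite (le_trans (dF i))// lee_fin.
Qed.

(** The pre-measures grow as the mesh shrinks, so meshes below any given [e] determine the
    supremum. *)
Lemma hausdorff1_le A (u : \bar R) (e : R) : (0 < e)%R ->
  (forall d : R, (0 < d < e)%R -> hausdorff1_pre d A <= u) -> hausdorff1 A <= u.
Proof.
move=> e0 H; apply: ge_ereal_sup => _ [d /= d0 <-].
have m0 : (0 < Num.min d (e / 2))%R by rewrite lt_min d0 divr_gt0.
have md : (Num.min d (e / 2) <= d)%R by rewrite ge_min lexx.
apply: le_trans (hausdorff1_pre_anti A md) _.
apply: H; rewrite m0/= gt_min; apply/orP; right.
by rewrite ltr_pdivrMr// ltr_pMr// ltr1n.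
Qed.

(** The metric property of the outer measure: a set of diameter less than [t - s] cannot meet both
    [A] and [B], so a fine cover of the union splits into a cover of each. *)
Lemma hausdorff1_sep (f : R * R -> R) A B (s t : R) : lip1 f -> (s < t)%R ->
  (forall x, A x -> (f x <= s)%R) -> (forall x, B x -> (t <= f x)%R) ->
  hausdorff1 A + hausdorff1 B <= hausdorff1 (A `|` B).
Proof.
move=> lf st As Bt.
have ts0 : (0 < t - s)%R by rewrite subr_gt0.
have key d : (0 < d < t - s)%R ->
    hausdorff1_pre d A + hausdorff1_pre d B <= hausdorff1_pre d (A `|` B).
  move=> /andP[d0 dts]; apply: le_ereal_inf_tmp => _ [F [dF AF] <-].
  (* Members of the cover that miss [A] become empty, of diameter 0; the sub-cover keeps the indices
     of the cover. *)
  pose FA i := if pselect (exists x, A x /\ F i x) then F i else set0.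
  pose FB i := if pselect (exists x, B x /\ F i x) then F i else set0.
  have dle (P : nat -> Prop) i :
      ediam (if pselect (P i) then F i else set0) <= d%:E.
    by case: pselect => ?; [exact: dF|rewrite ediam_set0 lee_fin ltW].
  have H1 : hausdorff1_pre d A <= \sum_(i <oo) ediam (FA i).
    apply: ereal_inf_lbound; exists FA => //; split=> [i|x Ax].
      exact: (dle (fun i => exists x, A x /\ F i x)).
    have [i _ Fix] := AF x (or_introl Ax).
    by exists i => //; rewrite /FA; case: pselect => // -[]; exists x.
  have H2 : hausdorff1_pre d B <= \sum_(i <oo) ediam (FB i).
    apply: ereal_inf_lbound; exists FB => //; split=> [i|x Ax].
      exact: (dle (fun i => exists x, B x /\ F i x)).
    have [i _ Fix] := AF x (or_intror Ax).
    by exists i => //; rewrite /FB; case: pselect => // -[]; exists x.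
  apply: (le_trans (leeD H1 H2)).
  rewrite -nneseriesD//; do ?[by move=> *; exact: ediam_ge0].
  apply: lee_nneseries => [i _ _|i _].
    by rewrite adde_ge0 ?ediam_ge0.
  rewrite /FA /FB; case: pselect => [[x [Ax Fx]]|?]; case: pselect => [[y [By Fy]]|?];
    rewrite ?ediam_set0 ?adde0 ?add0e ?ediam_ge0//.
  exfalso; have := le_trans (ediam_ub Fx Fy) (dF i); rewrite lee_fin.
  move=> /(le_trans (lf x y)); rewrite leNgt => /negP; apply.
  rewrite distrC; apply: lt_le_trans (ler_norm _).
  by apply: lt_le_trans dts _; apply: lerB; [exact: Bt|exact: As].
have [->|HX] := eqVneq (hausdorff1 (A `|` B)) +oo; first by rewrite leey.
have HAfin : hausdorff1 A \is a fin_num.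
  rewrite ge0_fin_numE ?hausdorff1_ge0//.
  by apply: le_lt_trans (le_hausdorff1 (@subsetUl _ A B)) _; rewrite ltey.
have HBfin : hausdorff1 B \is a fin_num.
  rewrite ge0_fin_numE ?hausdorff1_ge0//.
  by apply: le_lt_trans (le_hausdorff1 (@subsetUr _ A B)) _; rewrite ltey.
have preA d (C : set (R * R)) : (0 < d)%R -> hausdorff1 C \is a fin_num ->
    hausdorff1_pre d C \is a fin_num.
  move=> d0 Cf; rewrite ge0_fin_numE ?hausdorff1_pre_ge0//.
  by apply: le_lt_trans (hausdorff1_pre_le C d0) _; rewrite -ge0_fin_numE ?hausdorff1_ge0.
(* The two suprema run over independent meshes: [A] is taken at mesh [d], then [B] at a mesh
   [e < d], and monotonicity brings both to mesh [e]. *)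
rewrite -leeBrDr//; apply: (hausdorff1_le ts0) => d d01.
rewrite leeBrDr// addeC.
have dfin := preA d A (proj1 (andP d01)) HAfin.
rewrite -leeBrDr//; apply: (hausdorff1_le (proj1 (andP d01))) => e e01.
rewrite leeBrDr//.
have et : (0 < e < t - s)%R.
  move/andP: e01 => [-> ed] /=; apply: (lt_trans ed); by case/andP: d01.
apply: le_trans (hausdorff1_pre_le (A `|` B) (proj1 (andP et))).
apply: le_trans (key e et).
by rewrite addeC leeD2r// hausdorff1_pre_anti// ltW//; case/andP: e01.
Qed.

Lemma nneseries_bounded_lt (u : nat -> \bar R) (M : \bar R) :
  (forall n, 0 <= u n) -> M < +oo -> (forall n, \sum_(0 <= i < n) u i <= M) ->
  \sum_(i <oo) u i < +oo.
Proof.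
move=> u0 Moo uM; apply: le_lt_trans Moo; apply: lime_le.
  by apply: is_cvg_nneseries => *; exact: u0.
by apply: nearW.
Qed.

(** Caratheodory's argument. The part of [X] off the half-plane is cut into slabs accumulating at
    the line; slabs of equal parity are separated, so the lengths of all slabs have a finite sum and
    the slabs near the line contribute a vanishing tail. *)
Lemma caratheodory_halfplane (f : R * R -> R) a : lip1 f ->
  (@hausdorff1 R).-caratheodory [set x | (a <= f x)%R].
Proof.
move=> lf; apply: le_caratheodory_measurable => X.
change (hausdorff1 (X `&` [set x | (a <= f x)%R]) +
  hausdorff1 (X `&` ~` [set x | (a <= f x)%R]) <= hausdorff1 X).
set E := [set x | (a <= f x)%R].
have [->|HX] := eqVneq (hausdorff1 X) +oo; first by rewrite leey.
have HXoo : hausdorff1 X < +oo by rewrite ltey.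
(* Levels increasing to [a]; [B n] is at positive distance from the half-plane, and [S n] are the
   slabs between consecutive levels. *)
pose c (n : nat) : R := (a - n.+1%:R^-1)%R.
have cS n : (c n < c n.+1)%R.
  by rewrite ltrD2l ltrN2 ltf_pV2 ?posrE ?ltr0n// ltr_nat.
have cle m n : (m <= n)%N -> (c m <= c n)%R.
  by move=> mn; rewrite lerD2l lerN2 lef_pV2 ?posrE ?ltr0n// ler_nat.
have ca n : (c n < a)%R by rewrite ltrBlDr ltrDl invr_gt0.
pose B n := X `&` [set x | (f x <= c n)%R].
pose S n := X `&` [set x | (c n.+1 < f x <= c n.+2)%R].
(* Between two slabs of the same parity a whole slab is left out, so [hausdorff1_sep] applies at
   each step; [e] is the parity. *)
have SX e m : \sum_(0 <= i < m) hausdorff1 (S (i.*2 + e)%N) <= hausdorff1 (B (m.*2 + e)%N).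
  elim: m => [|m IH]; first by rewrite big_nil hausdorff1_ge0.
  rewrite big_nat_recr//=; apply: le_trans.
    by apply: leeD2r; exact: IH.
  apply: (le_trans (hausdorff1_sep lf (cS (m.*2 + e)%N) _ _)).
  - by move=> x [].
  - by move=> x [_ /= /andP[/ltW]].
  - apply: le_hausdorff1 => x; rewrite doubleS !addSn => -[|] [Xx /= H]; split => //=.
      by apply: le_trans H (cle _ _ _); rewrite -addn2 leq_addr.
    by case/andP: H.
have SXX e m : \sum_(0 <= i < m) hausdorff1 (S (i.*2 + e)%N) <= hausdorff1 X.
  by apply: (le_trans (SX e m)); apply: le_hausdorff1 => x [].
have tot : \sum_(i <oo) hausdorff1 (S i) < +oo.
  apply: (@nneseries_bounded_lt _ (hausdorff1 X + hausdorff1 X)).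
  - by move=> n; exact: hausdorff1_ge0.
  - by rewrite lte_add_pinfty.
  - move=> n; apply: (@le_trans _ _ (\sum_(0 <= i < n.*2) hausdorff1 (S i))).
      apply: lee_sum_nneg_natr => [*|]; first exact: hausdorff1_ge0.
      by rewrite -addnn leq_addr.
    apply: (@le_trans _ _ (\sum_(0 <= i < n) hausdorff1 (S (i.*2 + 0)%N)
        + \sum_(0 <= i < n) hausdorff1 (S (i.*2 + 1)%N))); last first.
      by apply: leeD; exact: SXX.
    rewrite -big_split/=; elim: n => [|n IH]; first by rewrite !big_nil.
    rewrite doubleS !big_nat_recr//= addn0 addn1.
    by rewrite -addeA leeD2r.
have step n : hausdorff1 (X `&` E) + hausdorff1 (B n) <= hausdorff1 X.
  rewrite addeC; apply: (le_trans (hausdorff1_sep lf (ca n) _ _)).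
  - by move=> x [].
  - by move=> x [].
  - by apply: le_hausdorff1 => x [[]|[]].
have XBS n : X `&` ~` E `<=` B n.+1 `|` \bigcup_m S (m + n)%N.
  move=> x [Xx /= /negP]; rewrite -ltNge => fa.
  have [fc|fc] := leP (f x) (c n.+1); first by left.
  right.
  have exm : exists m, (f x <= c m)%R.
    have [m] := ltr_add_invr fa => Hm; exists m.
    by rewrite lerBrDr ltW.
  have := ex_minnP exm; case=> m fm mmin.
  have nm : (n.+2 <= m)%N.
    rewrite ltnNge; apply/negP => mn; move: fc; rewrite ltNge => /negP; apply.
    exact: le_trans fm (cle _ _ mn).
  exists (m - n.+2)%N => //; split => //=.
  have -> : ((m - n.+2 + n).+2 = m)%N by lia.
  rewrite fm andbT ltNge; apply/negP => /mmin.
  by clear -nm; lia.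
have tail n : hausdorff1 (X `&` ~` E) <=
    hausdorff1 (B n.+1) + \sum_(n <= i <oo) hausdorff1 (S i).
  apply: (le_trans (le_hausdorff1 (XBS n))).
  apply: le_trans (outer_measureU2 _ _ _) _; apply: leeD2l.
  apply: le_trans (hausdorff1_sigma_subadditive _) _.
  rewrite -(@nneseries_addn _ (fun i => hausdorff1 (S i)) n)//.
  by move=> *; exact: hausdorff1_ge0.
have tcvg : \sum_(n <= i <oo) hausdorff1 (S i) @[n --> \oo] --> 0.
  by apply: nneseries_tail_cvg => // *; exact: hausdorff1_ge0.
have le n : hausdorff1 (X `&` E) + hausdorff1 (X `&` ~` E) <=
    hausdorff1 X + \sum_(n <= i <oo) hausdorff1 (S i).
  apply: (le_trans (leeD2l _ (tail n))); rewrite addeA leeD2r//; exact: step.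
have : hausdorff1 X + \sum_(n <= i <oo) hausdorff1 (S i) @[n --> \oo] --> hausdorff1 X + 0.
  by apply: cvgeD => //; [rewrite fin_num_adde_defl//|exact: cvg_cst].
rewrite adde0 => cX; rewrite -(cvg_lim _ cX)//.
apply: lime_ge; first by apply/cvg_ex; eexists; exact: cX.
by apply: nearW.
Qed.

Lemma caratheodory_open (f : R * R -> R) (B : set R) : lip1 f -> measurable B ->
  (@hausdorff1 R).-caratheodory (f @^-1` B).
Proof.
move=> lf mB.
have : measurable_fun setT (f : caratheodory_type (@hausdorff1 R) -> R).
  apply: (measurability _ (RGenCInfty.measurableE R)) => //.
  move=> _ [_ [a ->] <-]; rewrite setTI.
  rewrite (_ : _ @^-1` _ = [set x | (a <= f x)%R]); first exact: caratheodory_halfplane.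
  by apply/seteqP; split => x /=; rewrite in_itv/= andbT.
by move=> /(_ measurableT B mB); rewrite setTI.
Qed.

(** Coordinate half-planes generate the Borel sets of the plane. In this form the inclusion of
    sigma-algebras can be used directly to push arc integrals forward to the Borel plane. *)
Lemma measurable_id_cara : measurable_fun [set: caratheodory_type (@hausdorff1 R)]
  (id : caratheodory_type (@hausdorff1 R) -> measurableTypeR R * measurableTypeR R).
Proof.
apply/measurable_fun_pairP; split.
  by move=> _ B mB; rewrite setTI; exact: (caratheodory_open lip1_fst).
by move=> _ B mB; rewrite setTI; exact: (caratheodory_open lip1_snd).
Qed.

Lemma borel_caratheodory (A : set (measurableTypeR R * measurableTypeR R)) :
  measurable A -> (@hausdorff1 R).-caratheodory A.
Proof. by move=> mA; have := measurable_id_cara measurableT mA; rewrite setTI. Qed.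

(** A 1-Lipschitz map does not increase length: the image of a covering set lies in an interval no
    longer than its diameter. All lower bounds for length come from here. *)
Lemma le_hausdorff1_proj (f : R * R -> R) A (B : set R) : lip1 f -> measurable B ->
  B `<=` f @` A -> lebesgue_measure B <= hausdorff1 A.
Proof.
move=> lf mB BA; apply: le_trans (hausdorff1_pre_le A ltr01).
apply: le_ereal_inf_tmp => _ [F [dF AF] <-].
(* The closed interval hull of the image. Covers of mesh 1 are used, so that all diameters are
   finite and [fine] loses nothing. *)
pose J i : set (measurableTypeR R) := if pselect (F i !=set0) then `[inf (f @` F i), sup (f @` F i)]%classic else set0.
have bF i x y : F i x -> F i y -> (f x - f y <= fine (ediam (F i)))%R.
  move=> Fx Fy; rewrite -lee_fin fineK; last first.
    rewrite ge0_fin_numE ?ediam_ge0//; exact: le_lt_trans (dF i) (ltry _).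
  apply: le_trans (ediam_ub Fx Fy); rewrite lee_fin.
  exact: le_trans (ler_norm _) (lf _ _).
have hub i x : F i x -> ubound (f @` F i) (f x + fine (ediam (F i)))%R.
  by move=> Fx _ [y Fy <-]; rewrite -lerBlDl bF.
have hlb i x : F i x -> lbound (f @` F i) (f x - fine (ediam (F i)))%R.
  by move=> Fx _ [y Fy <-]; rewrite lerBlDl -lerBlDr bF.
have mJ i : measurable (J i) by rewrite /J; case: pselect => ?; [exact: measurable_itv|exact: measurable0].
have lJ i : lebesgue_measure (J i) <= ediam (F i).
  rewrite /J; case: pselect => [[x Fx]|?] /=; last by rewrite measure0 ediam_ge0.
  rewrite lebesgue_measure_itv/=; case: ifPn => _; last exact: ediam_ge0.
  rewrite -EFinD -[leRHS]fineK; last first.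
    rewrite ge0_fin_numE ?ediam_ge0//; exact: le_lt_trans (dF i) (ltry _).
  rewrite lee_fin lerBlDr; apply: ge_sup; first by exists (f x), x.
  move=> _ [y Fy <-]; rewrite addrC -lerBlDr; apply: lb_le_inf; first by exists (f x), x.
  by move=> _ [z Fz <-]; rewrite lerBlDl -lerBlDr bF.
apply: (@le_trans _ _ (\sum_(i <oo) lebesgue_measure (J i))); last first.
  by apply: lee_nneseries => //; move=> *; exact: measure_ge0.
apply: measure_sigma_subadditive => //.
move=> _ /BA[x Ax <-]; have [i _ Fx] := AF _ Ax; exists i => //.
rewrite /J; case: pselect => [?|[]]; last by exists x.
rewrite /= in_itv/=; apply/andP; split.
  apply: ge_inf; last by exists x.
  by exists (f x - fine (ediam (F i)))%R; exact: hlb.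
apply: ub_le_sup; last by exists x.
by exists (f x + fine (ediam (F i)))%R; exact: hub.
Qed.

End hausdorff.

(** * Borel sets of the plane *)

Section plane_borel.
Context {R : realType}.
Notation plane := (measurableTypeR R * measurableTypeR R)%type.
Implicit Types (U : set (R * R)) (f g : R * R -> R) (p x : R * R) (h : R).

Definition box p h : set (R * R) :=
  [set x | `|x.1 - p.1| < h /\ `|x.2 - p.2| < h].

Definition cbox p h : set (R * R) :=
  [set x | `|x.1 - p.1| <= h /\ `|x.2 - p.2| <= h].

Lemma ball_box p h : ball p h = box p h.
Proof.
rewrite predeqE => x; split => -[H1 H2].
  by split; rewrite distrC.
by split; rewrite /= /ball/= distrC.
Qed.

Lemma nbhs_boxP p U : nbhs p U <-> exists2 h, 0 < h & box p h `<=` U.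
Proof.
split=> [/nbhs_ballP[h h0 hU]|[h h0 hU]].
  by exists h => //; rewrite -ball_box.
by apply/nbhs_ballP; exists h => //; rewrite ball_box.
Qed.

Lemma openP_box U : open U <-> forall p, U p -> exists2 h, 0 < h & box p h `<=` U.
Proof.
rewrite openE; split => [oU p Up|oU p Up].
  by apply/nbhs_boxP; exact: oU.
by apply/nbhs_boxP; exact: oU.
Qed.

Lemma boxxx p h : 0 < h -> box p h p.
Proof. by move=> h0; split; rewrite subrr normr0. Qed.

Lemma open_box p h : open (box p h).
Proof.
apply/openP_box => x [x1 x2].
exists (Num.min (h - `|x.1 - p.1|) (h - `|x.2 - p.2|)).
  by rewrite lt_min !subr_gt0 x1 x2.
move=> y [] /=; rewrite !lt_min => /andP[y1 _] /andP[_ y2]; split.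
  rewrite (_ : _ - _ = (y.1 - x.1) + (x.1 - p.1)); last by ring.
  by apply: le_lt_trans (ler_normD _ _) _; rewrite -ltrBrDr.
rewrite (_ : _ - _ = (y.2 - x.2) + (x.2 - p.2)); last by ring.
by apply: le_lt_trans (ler_normD _ _) _; rewrite -ltrBrDr.
Qed.

Lemma cbox_prod p h :
  cbox p h = `[p.1 - h, p.1 + h]%classic `*` `[p.2 - h, p.2 + h]%classic.
Proof. by rewrite predeqE => x /=; rewrite !in_itv/= -!ler_distl. Qed.

Lemma compact_cbox p h : compact (cbox p h).
Proof. by rewrite cbox_prod; apply: compact_setX; exact: segment_compact. Qed.

Lemma closed_bounded_compact U h : closed U -> U `<=` cbox 0 h -> compact U.
Proof. move=> cU Uh; have := @subclosed_compact _ U (cbox 0 h) cU; apply => //.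
exact: compact_cbox. Qed.

Lemma measurable_box p h : measurable (box p h : set plane).
Proof.
rewrite (_ : box p h = `]p.1 - h, p.1 + h[%classic `*` `]p.2 - h, p.2 + h[%classic).
  exact: measurableX.
by rewrite predeqE => x /=; rewrite !in_itv/= -!ltr_distl.
Qed.

Lemma rat_near (a h : R) : 0 < h -> exists q : rat, `|a - ratr q| < h.
Proof.
move=> h0; have : a - h < a + h by rewrite ltrD2l gtrN.
move=> /rat_in_itvoo[q]; rewrite in_itv/= => /andP[q1 q2].
by exists q; rewrite distrC ltr_distl q1 q2.
Qed.

Definition ratbox (q : rat * rat * rat) : set (R * R) :=
  box (ratr q.1.1, ratr q.1.2) (ratr q.2).

(** A half-side within [h / 9] of [h / 3] and a centre within [h / 9] of [p] in each coordinate
    leave room on both sides. The rational squares thus form a countable base. *)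
Lemma ratbox_sub p h : 0 < h -> exists q, ratbox q p /\ ratbox q `<=` box p h.
Proof.
move=> h0.
have [e e1] : exists e : rat, `|h / 3 - ratr e| < h / 9 by apply: rat_near; rewrite divr_gt0.
have [a a1] : exists e : rat, `|p.1 - ratr e| < h / 9 by apply: rat_near; rewrite divr_gt0.
have [b b1] : exists e : rat, `|p.2 - ratr e| < h / 9 by apply: rat_near; rewrite divr_gt0.
exists (a, b, e); move: e1 a1 b1; rewrite /ratbox/= !ltr_norml => e1 a1 b1.
split; first by split; rewrite /= ltr_norml; lra.
by move=> x [] /=; rewrite !ltr_norml => x1 x2; split; rewrite ltr_norml; lra.
Qed.

(** The sigma-algebra here is the product one, generated by measurable rectangles; an open set
    belongs to it as a countable union of rational squares. *)
Lemma open_plane_measurable U : open U -> measurable (U : set plane).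
Proof.
move=> /openP_box oU.
pose F q : set plane := if pselect (ratbox q `<=` U) then ratbox q else set0.
rewrite (_ : U = \bigcup_q F q).
  apply: countable_bigcupT_measurable => // q; rewrite /F; case: pselect => ?; last exact: measurable0.
  exact: measurable_box.
apply/seteqP; split => [x /oU[h h0 hU]|x [q _]].
  have [q [qx qh]] := ratbox_sub x h0; exists q => //.
  by rewrite /F; case: pselect => [?|[]] //=; exact: subset_trans hU.
by rewrite /F; case: pselect => // H /H.
Qed.

Lemma closed_plane_measurable U : closed U -> measurable (U : set plane).
Proof.
move=> cU; rewrite -(setCK U); apply: measurableC.
by apply: open_plane_measurable; exact: closed_openC.
Qed.

Lemma continuous_plane_measurable_within U f : open U ->
  (forall x, U x -> {for x, continuous f}) ->
  measurable_fun (U : set plane) (f : plane -> R).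
Proof.
move=> oU cf; apply: (measurability _ (RGenOpens.measurableE R)) => //.
move=> _ [_ [a [b ->]] <-]; apply: open_plane_measurable.
rewrite openE => x [Ux /= fx]; rewrite /interior.
apply: filterI; first exact: open_nbhs_nbhs.
have : nbhs (f x) `]a, b[%classic by apply: open_nbhs_nbhs; split => //; exact: interval_open.
exact: cf.
Qed.

Lemma continuous_plane_measurable f : continuous f ->
  measurable_fun setT (f : plane -> R).
Proof.
by move=> cf; have := @continuous_plane_measurable_within [set: R * R] f openT (fun x _ => cf x).
Qed.

Lemma continuous_fst_plane : continuous (fst : R * R -> R).
Proof. by move=> x; exact: cvg_fst. Qed.

Lemma continuous_snd_plane : continuous (snd : R * R -> R).
Proof. by move=> x; exact: cvg_snd. Qed.

Lemma continuous_enormB p : continuous (fun x => enorm (x - p)).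
Proof.
move=> x; rewrite /enorm.
apply: (@continuous_comp _ _ _ (fun x => (x - p).1 ^+ 2 + (x - p).2 ^+ 2) Num.sqrt); last exact: sqrt_continuous.
by apply: cvgD; apply: cvgM; apply: cvgB; do ?exact: cvg_cst;
  do ?exact: cvg_fst; exact: cvg_snd.
Qed.

End plane_borel.

(** * Functions of class C^n on open sets *)

Section calculus.
Context {R : realType}.
Implicit Types (U V : set (R * R)) (f g : R * R -> R) (p x v : R * R) (h : R -> R).

Lemma is_derive_e1 f x l :
  is_derive x (1, 0) f l <-> is_derive x.1 1 (fun t => f (t, x.2)) l.
Proof.
have E : (fun h : R => h^-1 *: ((f \o shift x) (h *: (1, 0)) - f x)) =
    (fun h : R => h^-1 *: (((fun t => f (t, x.2)) \o shift x.1) (h *: (1 : R)) - f (x.1, x.2))).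
  apply/funext => h /=; rewrite -surjective_pairing.
  congr (_ *: (f _ - f _)); apply: injective_projections => //=.
  by rewrite /GRing.scale/= mulr0 add0r.
split=> -[d e].
  split; first by rewrite /derivable -E.
  by rewrite -e /derive -E.
split; first by rewrite /derivable E.
by rewrite -e /derive E.
Qed.

Lemma is_derive_e2 f x l :
  is_derive x (0, 1) f l <-> is_derive x.2 1 (fun t => f (x.1, t)) l.
Proof.
have E : (fun h : R => h^-1 *: ((f \o shift x) (h *: (0, 1)) - f x)) =
    (fun h : R => h^-1 *: (((fun t => f (x.1, t)) \o shift x.2) (h *: (1 : R)) - f (x.1, x.2))).
  apply/funext => h /=; rewrite -surjective_pairing.
  congr (_ *: (f _ - f _)); apply: injective_projections => //=.
  by rewrite /GRing.scale/= mulr0 add0r.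
split=> -[d e].
  split; first by rewrite /derivable -E.
  by rewrite -e /derive -E.
split; first by rewrite /derivable E.
by rewrite -e /derive E.
Qed.

Lemma is_derive_d1 f x l : is_derive x (1, 0) f l -> d1 f x = l.
Proof. by case. Qed.

Lemma is_derive_d2 f x l : is_derive x (0, 1) f l -> d2 f x = l.
Proof. by case. Qed.

Lemma is_derive_near f g x v l : v != 0 -> is_derive x v f l ->
  (\near x, f x = g x) -> is_derive x v g l.
Proof.
move=> v0 [d e] fg; have gf : \near x, g x = f x by apply: filterS fg.
split; first exact: near_eq_derivable fg d.
by rewrite (near_eq_derive _ gf).
Qed.

Lemma e1_neq0 : ((1, 0) : R * R) != 0.
Proof. by apply/eqP => -[] /eqP; rewrite oner_eq0. Qed.

Lemma e2_neq0 : ((0, 1) : R * R) != 0.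
Proof. by apply/eqP => -[] /eqP; rewrite oner_eq0. Qed.

Lemma near_open U x : open U -> U x -> \near x, U x.
Proof. by move=> oU Ux; exact: open_nbhs_nbhs. Qed.

(** The localization of [Ck]. The operators [d1] and [d2] are total, so nothing is asserted about
    their values off [U]. *)
Fixpoint CkU U (n : nat) f : Prop :=
  (forall x, U x -> {for x, continuous f}) /\
  if n is m.+1 then
    [/\ forall x, U x -> derivable f x (1, 0) /\ derivable f x (0, 1),
        CkU U m (d1 f) & CkU U m (d2 f)]
  else True.

Lemma CkU_setT n f : Ck n f <-> CkU setT n f.
Proof.
elim: n f => [|n IH] f /=.
  by split => -[H _]; split => // x; have := H x; [|exact].
split => -[H [d c1 c2]]; split.
- by move=> x _; exact: H.
- by split => //; [exact/IH|exact/IH].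
- by move=> x; exact: H.
- by split; [move=> x; exact: d|exact/IH|exact/IH].
Qed.

Lemma CkU_cont U n f : CkU U n f -> forall x, U x -> {for x, continuous f}.
Proof. by case: n => [|n] []. Qed.

Lemma CkU_d1 U n f : CkU U n.+1 f -> CkU U n (d1 f).
Proof. by move=> [_ []]. Qed.

Lemma CkU_d2 U n f : CkU U n.+1 f -> CkU U n (d2 f).
Proof. by move=> [_ []]. Qed.

Lemma CkU_is_d1 U n f x : CkU U n.+1 f -> U x -> is_derive x (1, 0) f (d1 f x).
Proof. by move=> [_ [d _ _]] Ux; apply: derivableP; exact: (d x Ux).1. Qed.

Lemma CkU_is_d2 U n f x : CkU U n.+1 f -> U x -> is_derive x (0, 1) f (d2 f x).
Proof. by move=> [_ [d _ _]] Ux; apply: derivableP; exact: (d x Ux).2. Qed.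

Lemma CkU_S U n f : CkU U n.+1 f -> CkU U n f.
Proof.
elim: n f => [|n IH] f; first by move=> [].
move=> [c [d h1 h2]]; split; first exact: c.
by split; [exact: d|apply: IH; exact: h1|apply: IH; exact: h2].
Qed.

Lemma CkU_sub U V n f : U `<=` V -> CkU V n f -> CkU U n f.
Proof.
move=> UV; elim: n f => [|n IH] f /= [c d]; split => //; try by move=> x /UV; exact: c.
by case: d => d h1 h2; split; [move=> x /UV; exact: d|exact: IH|exact: IH].
Qed.

(** Near each point [f] may coincide with a different model [g]; derivatives depend only on germs,
    so the models transfer their regularity. Functions extended by zero and singular sources are
    handled this way. *)
Lemma CkU_local U n f : open U ->
  (forall x, U x -> exists V g, [/\ open V, V x, CkU V n g & forall y, V y -> f y = g y]) ->
  CkU U n f.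
Proof.
move=> oU; elim: n f => [|n IH] f H.
  split => // x Ux; have [V [g [oV Vx [cg _] fg]]] := H x Ux.
  have E : \near x, g x = f x.
    by have := near_open oV Vx; apply: filterS => y /fg ->.
  have gfx : f x = g x by exact: fg.
  rewrite /prop_for/continuous_at gfx; apply: cvg_trans (cg x Vx).
  exact: near_eq_cvg.
have dH x v V g : v != 0 -> open V -> V x -> (forall y, V y -> f y = g y) ->
    derivable g x v -> is_derive x v f ('D_v g x).
  move=> v0 oV Vx fg /derivableP dg; apply: is_derive_near v0 dg _.
  by have := near_open oV Vx; apply: filterS => y /fg ->.
split.
  move=> x Ux; have [V [g [oV Vx [cg _] fg]]] := H x Ux.
  have E : \near x, g x = f x.
    by have := near_open oV Vx; apply: filterS => y /fg ->.
  have gfx : f x = g x by exact: fg.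
  rewrite /prop_for/continuous_at gfx; apply: cvg_trans (cg x Vx).
  exact: near_eq_cvg.
split.
- move=> x Ux; have [V [g [oV Vx [_ [dg _ _]] fg]]] := H x Ux.
  by split; [have [] := dH x _ V g e1_neq0 oV Vx fg (dg x Vx).1|
    have [] := dH x _ V g e2_neq0 oV Vx fg (dg x Vx).2].
- apply: IH => x Ux; have [V [g [oV Vx [_ [dg g1 _]] fg]]] := H x Ux.
  exists V, (d1 g); split => // y Vy.
  by have [] := dH y _ V g e1_neq0 oV Vy fg (dg y Vy).1.
- apply: IH => x Ux; have [V [g [oV Vx [_ [dg _ g1]] fg]]] := H x Ux.
  exists V, (d2 g); split => // y Vy.
  by have [] := dH y _ V g e2_neq0 oV Vy fg (dg y Vy).2.
Qed.

Lemma CkU_eq U n f g : open U -> (forall y, U y -> f y = g y) -> CkU U n g -> CkU U n f.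
Proof. by move=> oU fg cg; apply: CkU_local => // x Ux; exists U, g. Qed.

Lemma d_eq U f g x : open U -> (forall y, U y -> f y = g y) -> U x ->
  d1 f x = d1 g x /\ d2 f x = d2 g x.
Proof.
move=> oU fg Ux.
have E : \near x, f x = g x by have := near_open oU Ux; apply: filterS => y /fg.
by rewrite /d1 /d2 (near_eq_derive _ E) (near_eq_derive _ E).
Qed.

Lemma d_cst (c : R) x : d1 (fun=> c) x = 0 /\ d2 (fun=> c) x = 0.
Proof. by rewrite /d1 /d2 !derive_cst. Qed.

Lemma CkU_cst U n (c : R) : CkU U n (fun=> c).
Proof.
elim: n c => [|n IH] c; first by split => // x _; exact: cvg_cst.
split; first by move=> x _; exact: cvg_cst.
have E1 : d1 (fun=> c) = (fun=> 0) by apply/funext => x; exact: (d_cst c x).1.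
have E2 : d2 (fun=> c) = (fun=> 0) by apply/funext => x; exact: (d_cst c x).2.
by split; rewrite ?E1 ?E2 => // x _; split; exact: derivable_cst.
Qed.

Lemma CkU_fst U n : CkU U n fst.
Proof.
have E1 : d1 (fst : R * R -> R) = (fun=> 1).
  apply: funext => x; apply: is_derive_d1; apply/is_derive_e1; exact: is_derive_id.
have E2 : d2 (fst : R * R -> R) = (fun=> 0).
  apply: funext => x; apply: is_derive_d2; apply/is_derive_e2; exact: is_derive_cst.
case: n => [|n]; (split; first by move=> x _; exact: cvg_fst); first exact: Logic.I.
split; rewrite ?E1 ?E2; do ?exact: CkU_cst.
move=> x _; split.
  by have [] : is_derive x (1, 0) fst (1 : R) by apply/is_derive_e1; exact: is_derive_id.
by have [] : is_derive x (0, 1) fst (0 : R) by apply/is_derive_e2; exact: is_derive_cst.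
Qed.

Lemma CkU_snd U n : CkU U n snd.
Proof.
have E1 : d1 (snd : R * R -> R) = (fun=> 0).
  apply: funext => x; apply: is_derive_d1; apply/is_derive_e1; exact: is_derive_cst.
have E2 : d2 (snd : R * R -> R) = (fun=> 1).
  apply: funext => x; apply: is_derive_d2; apply/is_derive_e2; exact: is_derive_id.
case: n => [|n]; (split; first by move=> x _; exact: cvg_snd); first exact: Logic.I.
split; rewrite ?E1 ?E2; do ?exact: CkU_cst.
move=> x _; split.
  by have [] : is_derive x (1, 0) snd (0 : R) by apply/is_derive_e1; exact: is_derive_cst.
by have [] : is_derive x (0, 1) snd (1 : R) by apply/is_derive_e2; exact: is_derive_id.
Qed.

Lemma is_deriveD_fun f g x v a b : is_derive x v f a -> is_derive x v g b ->
  is_derive x v (fun y => f y + g y) (a + b).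
Proof. by move=> df dg; exact: is_deriveD. Qed.

Lemma is_deriveM_fun f g x v a b : is_derive x v f a -> is_derive x v g b ->
  is_derive x v (fun y => f y * g y) (a * g x + f x * b).
Proof.
move=> df dg; have dM : is_derive x v (f * g) (f x *: b + g x *: a) by exact: is_deriveM.
apply: (is_derive_eq dM).
by rewrite addrC /GRing.scale/= [g x * a]mulrC.
Qed.

Lemma CkU_add U n f g : open U -> CkU U n f -> CkU U n g -> CkU U n (fun y => f y + g y).
Proof.
move=> oU; elim: n f g => [|n IH] f g cf cg.
  by split => // x Ux; apply: cvgD; [exact: cf.1|exact: cg.1].
have D1 y : U y -> is_derive y (1, 0) (fun y => f y + g y) (d1 f y + d1 g y).
  by move=> Uy; apply: is_deriveD_fun; [exact: (CkU_is_d1 cf)|exact: (CkU_is_d1 cg)].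
have D2 y : U y -> is_derive y (0, 1) (fun y => f y + g y) (d2 f y + d2 g y).
  by move=> Uy; apply: is_deriveD_fun; [exact: (CkU_is_d2 cf)|exact: (CkU_is_d2 cg)].
split; first by move=> x Ux; apply: cvgD; [exact: cf.1|exact: cg.1].
split.
- by move=> x Ux; split; [case: (D1 x Ux)|case: (D2 x Ux)].
- apply: (CkU_eq oU (g := fun y => d1 f y + d1 g y)); first by move=> y /D1 /is_derive_d1.
  by apply: IH; exact: CkU_d1.
- apply: (CkU_eq oU (g := fun y => d2 f y + d2 g y)); first by move=> y /D2 /is_derive_d2.
  by apply: IH; exact: CkU_d2.
Qed.

Lemma CkU_mul U n f g : open U -> CkU U n f -> CkU U n g -> CkU U n (fun y => f y * g y).
Proof.
move=> oU; elim: n f g => [|n IH] f g cf cg.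
  by split => // x Ux; apply: cvgM; [exact: cf.1|exact: cg.1].
have D1 y : U y -> is_derive y (1, 0) (fun y => f y * g y) (d1 f y * g y + f y * d1 g y).
  by move=> Uy; apply: is_deriveM_fun; [exact: (CkU_is_d1 cf)|exact: (CkU_is_d1 cg)].
have D2 y : U y -> is_derive y (0, 1) (fun y => f y * g y) (d2 f y * g y + f y * d2 g y).
  by move=> Uy; apply: is_deriveM_fun; [exact: (CkU_is_d2 cf)|exact: (CkU_is_d2 cg)].
split; first by move=> x Ux; apply: cvgM; [exact: cf.1|exact: cg.1].
split.
- by move=> x Ux; split; [case: (D1 x Ux)|case: (D2 x Ux)].
- apply: (CkU_eq oU (g := fun y => d1 f y * g y + f y * d1 g y)); first by move=> y /D1 /is_derive_d1.
  by apply: CkU_add => //; apply: IH; do ?[exact: CkU_d1|exact: CkU_S].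
- apply: (CkU_eq oU (g := fun y => d2 f y * g y + f y * d2 g y)); first by move=> y /D2 /is_derive_d2.
  by apply: CkU_add => //; apply: IH; do ?[exact: CkU_d2|exact: CkU_S].
Qed.

Lemma CkU_scale U n f (c : R) : open U -> CkU U n f -> CkU U n (fun y => c * f y).
Proof. by move=> oU cf; apply: CkU_mul => //; exact: CkU_cst. Qed.

Lemma CkU_opp U n f : open U -> CkU U n f -> CkU U n (fun y => - f y).
Proof.
move=> oU cf; apply: (CkU_eq oU (g := fun y => -1 * f y)); last exact: CkU_scale.
by move=> y _; rewrite mulN1r.
Qed.

Lemma CkU_sub_fun U n f g : open U -> CkU U n f -> CkU U n g -> CkU U n (fun y => f y - g y).
Proof. by move=> oU cf cg; apply: CkU_add => //; exact: CkU_opp. Qed.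

Lemma CkU_sum U n (I : Type) (s : seq I) (F : I -> R * R -> R) : open U ->
  (forall i, CkU U n (F i)) -> CkU U n (fun y => \sum_(i <- s) F i y).
Proof.
move=> oU HF; elim: s => [|i s IH].
  by apply: (CkU_eq oU (g := fun=> 0)); [move=> y _; rewrite big_nil|exact: CkU_cst].
apply: (CkU_eq oU (g := fun y => F i y + \sum_(j <- s) F j y)); first by move=> y _; rewrite big_cons.
exact: CkU_add.
Qed.

Lemma is_derive_comp_e1 (h : R -> R) f x a b : is_derive (f x) 1 h a ->
  is_derive x (1, 0) f b -> is_derive x (1, 0) (fun y => h (f y)) (b * a).
Proof.
rewrite {1}(surjective_pairing x) => dh /is_derive_e1 df; apply/is_derive_e1.
by rewrite mulrC; exact: is_derive1_comp.
Qed.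

Lemma is_derive_comp_e2 (h : R -> R) f x a b : is_derive (f x) 1 h a ->
  is_derive x (0, 1) f b -> is_derive x (0, 1) (fun y => h (f y)) (b * a).
Proof.
rewrite {1}(surjective_pairing x) => dh /is_derive_e2 df; apply/is_derive_e2.
by rewrite mulrC; exact: is_derive1_comp.
Qed.

(** The outer function comes with the sequence [hs] of its successive derivatives, and the induction
    shifts the sequence; no formula for higher derivatives of a composition is needed. *)
Lemma CkU_comp U (I : set R) n (hs : nat -> R -> R) f : open U ->
  (forall i t, I t -> is_derive t 1 (hs i) (hs i.+1 t)) ->
  CkU U n f -> (forall x, U x -> I (f x)) -> CkU U n (fun y => hs 0%N (f y)).
Proof.
move=> oU + cf fI; elim: n hs cf => [|n IH] hs cf dhs.
  split => // x Ux; apply: continuous_comp; first exact: cf.1.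
  apply: differentiable_continuous; apply/derivable1_diffP.
  by have [] := dhs 0%N _ (fI x Ux).
have D1 y : U y -> is_derive y (1, 0) (fun y => hs 0%N (f y)) (d1 f y * hs 1%N (f y)).
  by move=> Uy; apply: is_derive_comp_e1; [exact/dhs/fI|exact: (CkU_is_d1 cf)].
have D2 y : U y -> is_derive y (0, 1) (fun y => hs 0%N (f y)) (d2 f y * hs 1%N (f y)).
  by move=> Uy; apply: is_derive_comp_e2; [exact/dhs/fI|exact: (CkU_is_d2 cf)].
have cI : CkU U n (fun y => hs 1%N (f y)).
  by apply: (IH (fun i => hs i.+1)) => //; exact: CkU_S.
split.
  move=> x Ux; apply: continuous_comp; first exact: cf.1.
  apply: differentiable_continuous; apply/derivable1_diffP.
  by have [] := dhs 0%N _ (fI x Ux).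
split.
- by move=> x Ux; split; [case: (D1 x Ux)|case: (D2 x Ux)].
- apply: (CkU_eq oU (g := fun y => d1 f y * hs 1%N (f y))); first by move=> y /D1 /is_derive_d1.
  by apply: CkU_mul => //; exact: CkU_d1.
- apply: (CkU_eq oU (g := fun y => d2 f y * hs 1%N (f y))); first by move=> y /D2 /is_derive_d2.
  by apply: CkU_mul => //; exact: CkU_d2.
Qed.

End calculus.

(** * One-variable calculus: minima, slopes and Taylor remainders *)

Section one_variable.
Context {R : realType}.
Implicit Types (f g : R -> R) (a b c t l r : R).

Lemma is_derive_eps g c l : is_derive c 1 g l -> forall e, 0 < e ->
  exists2 d, 0 < d & forall h, `|h| < d -> `|g (c + h) - g c - l * h| <= e * `|h|.
Proof.
move=> [dg <-] e e0.
have : (h^-1 *: ((g \o shift c) (h *: (1 : R)) - g c)) @[h --> 0^'] --> 'D_1 g c by exact: dg.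
move=> /cvgrPdist_le/(_ e e0); rewrite near_withinE => /nbhs_ballP[d d0 H].
exists d => // h hd; have [->|h0] := eqVneq h 0.
  by rewrite addr0 subrr mulr0 subr0 normr0 mulr0.
have := H h; rewrite /ball/= sub0r normrN => /(_ hd h0).
rewrite -(ler_pM2r (x := `|h|)) ?normr_gt0// -normrM.
rewrite /GRing.scale/= mulr1 mulrBl [h + c]addrC mulrAC mulVf// mul1r distrC.
by [].
Qed.

Lemma is_derive_cont g c l : is_derive c 1 g l -> {for c, continuous g}.
Proof.
by move=> [d _]; apply: differentiable_continuous; exact/derivable1_diffP.
Qed.

Lemma mvt_is_derive g dg a b : a < b -> (forall t, a <= t <= b -> is_derive t 1 g (dg t)) ->
  exists2 c, a < c < b & g b - g a = dg c * (b - a).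
Proof.
move=> ab H; have [||c cab ->] := @MVT R g dg a b ab.
- move=> x; rewrite in_itv/= => /andP[x1 x2]; apply: H; by rewrite !ltW.
- apply: continuous_in_subspaceT => x; rewrite inE/= in_itv/= => xab.
  exact: is_derive_cont (H x xab).
- by exists c => //; rewrite in_itv/= in cab.
Qed.

Lemma ge0_is_derive_le g dg a b : a <= b -> (forall t, a <= t <= b -> is_derive t 1 g (dg t)) ->
  (forall t, a < t < b -> 0 <= dg t) -> g a <= g b.
Proof.
rewrite le_eqVlt => /predU1P[->//|ab] H d0; rewrite -subr_ge0.
have [c cab ->] := mvt_is_derive ab H; apply: mulr_ge0; first exact: d0.
by rewrite subr_ge0 ltW.
Qed.

Lemma is_derive_id1 c : is_derive c 1 (fun t : R => t) 1.
Proof. exact: is_derive_id. Qed.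

Lemma is_derive_cst1 c (k : R) : is_derive c 1 (fun t : R => k) 0.
Proof. exact: is_derive_cst. Qed.

Lemma is_deriveD1 f g c a b : is_derive c 1 f a -> is_derive c 1 g b ->
  is_derive c 1 (fun y => f y + g y) (a + b).
Proof. by move=> df dg; exact: is_deriveD. Qed.

Lemma is_deriveN1 f c a : is_derive c 1 f a ->
  is_derive c 1 (fun y : R => - f y : R) (- a).
Proof. by move=> df; exact: is_deriveN. Qed.

Lemma is_deriveB1 f g c a b : is_derive c 1 f a -> is_derive c 1 g b ->
  is_derive c 1 (fun y => f y - g y) (a - b).
Proof. by move=> df dg; exact: is_deriveB. Qed.

Lemma is_deriveM1 f g c a b : is_derive c 1 f a -> is_derive c 1 g b ->
  is_derive c 1 (fun y => f y * g y) (a * g c + f c * b).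
Proof.
move=> df dg.
have dM : is_derive c 1 (f * g) (f c *: b + g c *: a) by exact: is_deriveM.
by apply: (is_derive_eq dM); rewrite addrC /GRing.scale/= [g c * a]mulrC.
Qed.

Lemma is_deriveZ1 (k : R) f c a : is_derive c 1 f a ->
  is_derive c 1 (fun y => k * f y) (k * a).
Proof. by move=> df; exact: is_deriveZ. Qed.

Lemma is_derive_comp1 (h : R -> R) f c a b : is_derive (f c) 1 h a ->
  is_derive c 1 f b -> is_derive c 1 (fun y => h (f y)) (a * b).
Proof. by move=> dh df; exact: is_derive1_comp. Qed.

Lemma is_deriveX1 n c : is_derive c 1 (fun t : R => t ^+ n) (n%:R * c ^+ n.-1).
Proof.
elim: n => [|n IH]; first by rewrite mul0r; exact: is_derive_cst1.
have := is_deriveM1 (is_derive_id1 c) IH; rewrite mul1r => H.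
rewrite (_ : (fun t => t ^+ n.+1) = (fun y => y * y ^+ n)); last first.
  by apply/funext => y; rewrite exprS.
apply: (is_derive_eq H) => /=.
case: n {H IH} => [|n] /=; first by rewrite expr0 mul0r mulr0 addr0 mul1r.
by rewrite mulrCA -exprS -[in RHS]natr1 mulrDl mul1r addrC.
Qed.

Lemma is_derive_shift1 f c s l : is_derive (s + c) 1 f l ->
  is_derive c 1 (fun t => f (s + t)) l.
Proof.
move=> df; have := is_derive_comp1 df (is_deriveD1 (is_derive_cst1 c s) (is_derive_id1 c)).
by rewrite add0r mulr1.
Qed.

Lemma is_derive_reflect1 f c s l : is_derive (s - c) 1 f l ->
  is_derive c 1 (fun t => f (s - t)) (- l).
Proof.
move=> df; have := @is_derive_comp1 f (fun t => s - t) c l _ df (is_deriveB1 (is_derive_cst1 c s) (is_derive_id1 c)).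
by rewrite sub0r mulrN1.
Qed.

(** The slope vanishes at the minimum; were [l] negative, it would be negative just to the right,
    and the mean value theorem would produce a smaller value. *)
Lemma second_derive_min g g1 c l r : 0 < r ->
  (forall t, `|t - c| < r -> is_derive t 1 g (g1 t)) -> is_derive c 1 g1 l ->
  (forall t, `|t - c| < r -> g c <= g t) -> 0 <= l.
Proof.
move=> r0 dg dg1 gmin; rewrite leNgt; apply/negP => l0.
have g1c : g1 c = 0.
  have cr : c - r <= c + r by lra.
  have dgc : forall t, t \in `]c - r, c + r[ -> derivable g t 1.
    move=> t; rewrite in_itv/= -ltr_distl => /dg[]//.
  have [_ <-] : is_derive c 1 g 0.
    apply: (derive1_at_min cr dgc).
      by rewrite in_itv/= ltrBlDr !ltrDl r0.
    by move=> t; rewrite in_itv/= -ltr_distl; exact: gmin.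
  have cc : `|c - c| < r by rewrite subrr normr0.
  by have [_ ->] := dg c cc.
have l2 : 0 < - l / 2 by lra.
have [d d0 H] := is_derive_eps dg1 l2.
pose h := Num.min (d / 2) (r / 2).
have h0 : 0 < h by rewrite lt_min !divr_gt0.
have hd : h <= d / 2 by rewrite ge_min lexx.
have hr : h <= r / 2 by rewrite ge_min lexx orbT.
have [t tch E] : exists2 t, c < t < c + h & g (c + h) - g c = g1 t * (c + h - c).
  apply: mvt_is_derive; first by lra.
  by move=> t tt; apply: dg; rewrite ltr_norml; lra.
have : g c <= g (c + h) by apply: gmin; rewrite ltr_norml; lra.
rewrite -subr_ge0 E addrAC subrr add0r pmulr_lge0// => g1t.
have := H (t - c); rewrite g1c subr0 addrCA subrr addr0.
rewrite (ger0_norm (x := t - c)); last by lra.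
move=> /(_ ltac:(lra)); rewrite ler_norml => /andP[_].
have : 0 < t - c by lra.
nra.
Qed.

Lemma is_derive_slope_le g c l K r : 0 < r -> is_derive c 1 g l ->
  (forall h, 0 < h < r -> g (c + h) - g c <= K * h) -> l <= K.
Proof.
move=> r0 dg H; rewrite leNgt; apply/negP => Kl.
have e0 : 0 < (l - K) / 2 by lra.
have [d d0 Hd] := is_derive_eps dg e0.
pose h := Num.min (d / 2) (r / 2).
have h0 : 0 < h by rewrite lt_min !divr_gt0.
have hd : h <= d / 2 by rewrite ge_min lexx.
have hr : h <= r / 2 by rewrite ge_min lexx orbT.
have := Hd h; rewrite (ger0_norm (ltW h0)) => /(_ ltac:(lra)).
rewrite ler_norml => /andP[H1 _].
have := H h ltac:(lra).
nra.
Qed.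

Lemma is_derive_taylor_sum (n : nat) (a : nat -> R) (s : R) :
  is_derive s 1 (fun y : R => \sum_(0 <= m < n) a m * y ^+ m.+1 / m.+1`!%:R)
    (\sum_(0 <= m < n) a m * s ^+ m / m`!%:R).
Proof.
elim: n => [|n IHn].
  rewrite (_ : (fun y => _) = (fun=> 0)); last by apply/funext => y; rewrite big_nil.
  by rewrite big_nil; exact: is_derive_cst1.
rewrite (_ : (fun y : R => _) = (fun y => \sum_(0 <= m < n) a m * y ^+ m.+1 / m.+1`!%:R
    + a n / n.+1`!%:R * y ^+ n.+1)); last first.
  by apply/funext => y; rewrite big_nat_recr//= mulrAC.
rewrite big_nat_recr//=; apply: is_deriveD1 => //.
apply: (is_derive_eq (is_deriveZ1 _ (is_deriveX1 n.+1 s))) => /=.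
rewrite factS natrM; field.
by rewrite pnatr_eq0 -lt0n fact_gt0 nat1r pnatr_eq0.
Qed.

(** Induction on the order: the remainder [rho] has for derivative the remainder of the shifted
    family, and the derivative of [G] is the bound given by induction. Hence [G + rho] and [G - rho]
    are nondecreasing and vanish at 0. *)
Lemma taylor_bound_ge0 n (F : nat -> R -> R) (r B : R) :
  (forall m t, 0 <= t <= r -> is_derive t 1 (F m) (F m.+1 t)) ->
  (forall t, 0 <= t <= r -> `|F n t| <= B) ->
  forall t, 0 <= t <= r ->
  `|F 0%N t - \sum_(0 <= m < n) F m 0 * t ^+ m / m`!%:R| <= B * t ^+ n / n`!%:R.
Proof.
elim: n F => [|n IH] F dF FB t tr.
  by rewrite big_nil subr0 expr0 mulr1 divr1; exact: FB.
have IHt s : 0 <= s <= r -> `|F 1%N s - \sum_(0 <= m < n) F m.+1 0 * s ^+ m / m`!%:R|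
    <= B * s ^+ n / n`!%:R.
  by apply: (IH (fun m => F m.+1)).
pose rho s := F 0%N s - \sum_(0 <= m < n.+1) F m 0 * s ^+ m / m`!%:R.
pose rho1 s := F 1%N s - \sum_(0 <= m < n) F m.+1 0 * s ^+ m / m`!%:R.
have drho s : 0 <= s <= r -> is_derive s 1 rho (rho1 s).
  move=> sr; apply: is_deriveB1; first exact: dF.
  rewrite (_ : (fun y => _) = (fun y => F 0%N 0 + \sum_(0 <= m < n) F m.+1 0 * y ^+ m.+1 / m.+1`!%:R)); last first.
    by apply/funext => y; rewrite big_nat_recl//= expr0 mulr1 divr1.
  have dS := is_derive_taylor_sum n (fun m => F m.+1 0) s.
  by have := is_deriveD1 (is_derive_cst1 s (F 0%N 0)) dS; rewrite add0r.
have rho0 : rho 0 = 0.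
  rewrite /rho big_nat_recl//= expr0 mulr1 divr1 big1 ?addr0 ?subrr//.
  by move=> m _; rewrite exprS mul0r mulr0 mul0r.
pose G s := B * s ^+ n.+1 / n.+1`!%:R.
have dG (s : R) : is_derive s 1 G (B * s ^+ n / n`!%:R).
  rewrite /G (_ : (fun s : R => _) = fun s => B / n.+1`!%:R * s ^+ n.+1); last first.
    by apply/funext => y; rewrite mulrAC.
  apply: (is_derive_eq (is_deriveZ1 _ (is_deriveX1 n.+1 s))) => /=.
  rewrite factS natrM; field.
  by rewrite pnatr_eq0 -lt0n fact_gt0 nat1r pnatr_eq0.
have G0 : G 0 = 0 by rewrite /G exprS mul0r mulr0 mul0r.
rewrite ler_norml; apply/andP; split.
  have : G 0 + rho 0 <= G t + rho t.
    apply: (@ge0_is_derive_le (fun s => G s + rho s) (fun s => B * s ^+ n / n`!%:R + rho1 s)) => //.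
    - by case/andP: tr.
    - move=> s st; apply: is_deriveD1 => //; apply: drho.
      by case/andP: st => -> /le_trans; apply; case/andP: tr.
    - move=> s st; have : 0 <= s <= r by case/andP: tr st; lra.
      by move=> /IHt; rewrite ler_norml => /andP[+ _]; rewrite -/(rho1 s); lra.
  by rewrite G0 rho0 addr0 -lerBlDl sub0r.
have : G 0 - rho 0 <= G t - rho t.
  apply: (@ge0_is_derive_le (fun s => G s - rho s) (fun s => B * s ^+ n / n`!%:R - rho1 s)) => //.
  - by case/andP: tr.
  - move=> s st; apply: is_deriveB1 => //; apply: drho.
    by case/andP: st => -> /le_trans; apply; case/andP: tr.
  - move=> s st; have : 0 <= s <= r by case/andP: tr st; lra.
    by move=> /IHt; rewrite ler_norml => /andP[_]; rewrite -/(rho1 s); lra.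
by rewrite G0 rho0 subr0 subr_ge0.
Qed.

Lemma taylor_bound n (F : nat -> R -> R) (r B : R) :
  (forall m t, `|t| <= r -> is_derive t 1 (F m) (F m.+1 t)) ->
  (forall t, `|t| <= r -> `|F n t| <= B) ->
  forall t, `|t| <= r ->
  `|F 0%N t - \sum_(0 <= m < n) F m 0 * t ^+ m / m`!%:R| <= B * `|t| ^+ n / n`!%:R.
Proof.
move=> dF FB t tr; have [t0|t0] := leP 0 t.
  rewrite (ger0_norm t0); apply: (@taylor_bound_ge0 n F r B).
  - by move=> m s /andP[s0 sr]; apply: dF; rewrite ger0_norm.
  - by move=> s /andP[s0 sr]; apply: FB; rewrite ger0_norm.
  - by rewrite t0 (le_trans (ler_norm _) tr).
(* The derivatives of the reflected function; the signs [(-1)^m] cancel those of [(- t)^m]. *)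
pose G m s := (-1) ^+ m * F m (- s).
have : `|G 0%N (- t) - \sum_(0 <= m < n) G m 0 * (- t) ^+ m / m`!%:R| <= B * (- t) ^+ n / n`!%:R.
  apply: (@taylor_bound_ge0 n G r B).
  - move=> m s sr; rewrite /G.
    have H : is_derive (0 - s) 1 (F m) (F m.+1 (- s)).
      by rewrite sub0r; apply: dF; rewrite normrN ger0_norm//; case/andP: sr.
    have := is_deriveZ1 ((-1) ^+ m) (is_derive_reflect1 H).
    rewrite (_ : (fun y => _ * F m (0 - y)) = (fun s => (-1) ^+ m * F m (- s))); last first.
      by apply/funext => y; rewrite sub0r.
    by rewrite exprS mulN1r mulNr mulrN.
  - move=> s /andP[s0 sr]; rewrite /G normrM normrX normrN1 expr1n mul1r.
    by apply: FB; rewrite normrN ger0_norm.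
  - by rewrite oppr_ge0 (ltW t0)/= -(ltr0_norm t0).
rewrite (ltr0_norm t0); congr (`|_ - _| <= _).
  by rewrite /G expr0 mul1r opprK.
apply: eq_bigr => m _; rewrite /G oppr0; congr (_ / _).
by rewrite [in LHS](exprNn t) mulrACA -expr2 sqrr_sign mul1r.
Qed.

End one_variable.

(** * Interior estimates and Taylor expansions for the Helmholtz equation *)

Section helmholtz.
Context {R : realType}.
Implicit Types (U V : set (R * R)) (w : R * R -> R) (p x : R * R) (f : nat -> nat -> R * R -> R).

Lemma double_difference (wa wb wc wd X Y A B h : R) : h != 0 ->
  wa - wb - (wc - wd) = X * h -> X = B * h -> wa - wc - (wb - wd) = Y * h ->
  Y = A * h -> A = B.
Proof.
move=> h0 E1 EX E2 EY; have hn : h * h != 0 by rewrite mulf_neq0.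
by apply: (mulIf hn); rewrite !mulrA -EX -EY -E1 -E2; ring.
Qed.

Lemma dist_half (a b c e : R) : `|a - c| <= e / 2 -> `|b - c| <= e / 2 -> `|a - b| <= e.
Proof. by rewrite !ler_norml; lra. Qed.

(** The second difference over a square of side [h], evaluated by the mean value theorem in both
    orders, equates the two mixed derivatives at two points within [h] of [x]; continuity at [x]
    concludes. *)
Lemma schwarz U w x : open U -> CkU U 2 w -> U x -> d1 (d2 w) x = d2 (d1 w) x.
Proof.
move=> oU cw Ux; have [h0 h00 hU] := (openP_box U).1 oU x Ux.
have cA := CkU_cont (CkU_d1 (CkU_d2 cw)) Ux.
have cB := CkU_cont (CkU_d2 (CkU_d1 cw)) Ux.
have key (h : R) : 0 < h -> h < h0 -> exists y z, [/\ box x h y, box x h z &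
    d1 (d2 w) y = d2 (d1 w) z].
  move=> hh0 hh.
  have inU a b : x.1 <= a <= x.1 + h -> x.2 <= b <= x.2 + h -> U (a, b).
    move=> /andP[a1 a2] /andP[b1 b2]; apply: hU; split; rewrite ltr_norml /=; lra.
  have [c c1 E1] : exists2 c, x.1 < c < x.1 + h &
      (w (x.1 + h, x.2 + h) - w (x.1 + h, x.2)) - (w (x.1, x.2 + h) - w (x.1, x.2))
      = (d1 w (c, x.2 + h) - d1 w (c, x.2)) * h.
    have [||c c1 E] := @mvt_is_derive _ (fun t => w (t, x.2 + h) - w (t, x.2))
      (fun t => d1 w (t, x.2 + h) - d1 w (t, x.2)) x.1 (x.1 + h); first by lra.
      move=> t t1; apply: is_deriveB1.
        by apply/(@is_derive_e1 _ w (t, x.2 + h)); apply: (CkU_is_d1 cw); apply: inU => //; lra.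
      by apply/(@is_derive_e1 _ w (t, x.2)); apply: (CkU_is_d1 cw); apply: inU => //; lra.
    exists c; first exact: c1.
    rewrite (_ : (d1 w (c, x.2 + h) - d1 w (c, x.2)) * h = (d1 w (c, x.2 + h) - d1 w (c, x.2)) * (x.1 + h - x.1)); last by congr (_ * _); rewrite addrAC subrr add0r.
    by rewrite -E; ring.
  have [e e1 E2] : exists2 e, x.2 < e < x.2 + h &
      d1 w (c, x.2 + h) - d1 w (c, x.2) = d2 (d1 w) (c, e) * h.
    have [||e e1 E] := @mvt_is_derive _ (fun t => d1 w (c, t))
      (fun t => d2 (d1 w) (c, t)) x.2 (x.2 + h); first by lra.
      move=> t t1; apply/(@is_derive_e2 _ (d1 w) (c, t)).
      by apply: (CkU_is_d2 (CkU_d1 cw)); apply: inU => //; lra.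
    exists e; first exact: e1.
    by rewrite E; congr (_ * _); rewrite addrAC subrr add0r.
  have [b b1 E3] : exists2 b, x.2 < b < x.2 + h &
      (w (x.1 + h, x.2 + h) - w (x.1, x.2 + h)) - (w (x.1 + h, x.2) - w (x.1, x.2))
      = (d2 w (x.1 + h, b) - d2 w (x.1, b)) * h.
    have [||b b1 E] := @mvt_is_derive _ (fun t => w (x.1 + h, t) - w (x.1, t))
      (fun t => d2 w (x.1 + h, t) - d2 w (x.1, t)) x.2 (x.2 + h); first by lra.
      move=> t t1; apply: is_deriveB1.
        by apply/(@is_derive_e2 _ w (x.1 + h, t)); apply: (CkU_is_d2 cw); apply: inU => //; lra.
      by apply/(@is_derive_e2 _ w (x.1, t)); apply: (CkU_is_d2 cw); apply: inU => //; lra.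
    exists b; first exact: b1.
    rewrite (_ : (d2 w (x.1 + h, b) - d2 w (x.1, b)) * h = (d2 w (x.1 + h, b) - d2 w (x.1, b)) * (x.2 + h - x.2)); last by congr (_ * _); rewrite addrAC subrr add0r.
    by rewrite -E; ring.
  have [a a1 E4] : exists2 a, x.1 < a < x.1 + h &
      d2 w (x.1 + h, b) - d2 w (x.1, b) = d1 (d2 w) (a, b) * h.
    have [||a a1 E] := @mvt_is_derive _ (fun t => d2 w (t, b))
      (fun t => d1 (d2 w) (t, b)) x.1 (x.1 + h); first by lra.
      move=> t t1; apply/(@is_derive_e1 _ (d2 w) (t, b)).
      by apply: (CkU_is_d1 (CkU_d2 cw)); apply: inU => //; lra.
    exists a; first exact: a1.
    by rewrite E; congr (_ * _); rewrite addrAC subrr add0r.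
  exists (a, b), (c, e); split.
  - by split; rewrite ltr_norml/=; lra.
  - by split; rewrite ltr_norml/=; lra.
  - exact: (double_difference (lt0r_neq0 hh0) E1 E2 E3 E4).
apply/eqP; rewrite -subr_eq0 -normr_le0; apply/ler_addgt0Pr => e e0; rewrite add0r.
have e2 : 0 < e / 2 by lra.
move/cvgrPdist_le: cA => /(_ _ e2) /nbhs_boxP[hA hA0 HA].
move/cvgrPdist_le: cB => /(_ _ e2) /nbhs_boxP[hB hB0 HB].
pose h := Num.min (h0 / 2) (Num.min hA hB).
have hpos : 0 < h by rewrite !lt_min hA0 hB0 divr_gt0.
have h1 : h < h0.
  by apply: (@le_lt_trans _ _ (h0 / 2)); [rewrite ge_min lexx|lra].
have [y [z [by_ bz yz]]] := key h hpos h1.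
have lA : h <= hA by rewrite !ge_min lexx orbT.
have lB : h <= hB by rewrite !ge_min lexx !orbT.
have bA : box x hA y by case: by_ => y1 y2; split; exact: lt_le_trans lA.
have bB : box x hB z by case: bz => y1 y2; split; exact: lt_le_trans lB.
have Hy := HA y bA; rewrite yz in Hy; exact: (dist_half Hy (HB z bB)).
Qed.

(** [f i j] stands for the derivative of order [(i, j)] of a solution. Carrying the whole array
    makes every derivative a solution again, by a shift of the indices. *)
Definition helm U (k : R) f := forall i j x, U x ->
  [/\ {for x, continuous (f i j)},
      is_derive x (1, 0) (f i j) (f i.+1 j x),
      is_derive x (0, 1) (f i j) (f i j.+1 x) &
      f i.+2 j x + f i j.+2 x + k ^+ 2 * f i j x = 0].

Definition dfam w : nat -> nat -> R * R -> R := fun i j => iter i d1 (iter j d2 w).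

Definition smoothU U w := forall n, CkU U n w.

Lemma smoothU_d1 U w : smoothU U w -> smoothU U (d1 w).
Proof. by move=> sw n; apply: CkU_d1; exact: sw. Qed.

Lemma smoothU_d2 U w : smoothU U w -> smoothU U (d2 w).
Proof. by move=> sw n; apply: CkU_d2; exact: sw. Qed.

Lemma smoothU_dfam U w i j : smoothU U w -> smoothU U (dfam w i j).
Proof.
move=> sw; rewrite /dfam; have : smoothU U (iter j d2 w).
  by elim: j => [//|j IH] /=; exact: smoothU_d2.
by move: (iter j d2 w) => v sv; elim: i => [//|i IH] /=; exact: smoothU_d1.
Qed.

(** In [dfam] the operators [d1] are outermost, so an extra [d2] has to be commuted through them. *)
Lemma d2_dfam U w i j x : open U -> smoothU U w -> U x ->
  d2 (dfam w i j) x = dfam w i j.+1 x.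
Proof.
move=> oU sw; elim: i x => [//|i IH] x Ux.
have -> : dfam w i.+1 j = d1 (dfam w i j) by [].
rewrite -(schwarz oU _ Ux); last exact: smoothU_dfam.
have -> : dfam w i.+1 j.+1 = d1 (dfam w i j.+1) by [].
exact: (d_eq oU IH Ux).1.
Qed.

Lemma helm_dfam U k w : open U -> smoothU U w ->
  (forall x, U x -> d1 (d1 w) x + d2 (d2 w) x + k ^+ 2 * w x = 0) ->
  helm U k (dfam w).
Proof.
move=> oU sw Hw.
have S i j := smoothU_dfam i j sw.
have eq0j j x : U x -> dfam w 2 j x + dfam w 0 j.+2 x + k ^+ 2 * dfam w 0 j x = 0.
  elim: j x => [|j IH] x Ux; first exact: Hw.
  have := (d_eq oU (g := fun=> 0) IH Ux).2; rewrite (d_cst 0 x).2 => <-.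
  apply/esym; apply: is_derive_d2; apply: is_deriveD_fun; first apply: is_deriveD_fun.
  - by rewrite -(d2_dfam _ _ oU sw Ux); apply: (CkU_is_d2 (S 2%N j 1%N) Ux).
  - exact: (CkU_is_d2 (S 0%N j.+2 1%N) Ux).
  - have := is_deriveM_fun (is_derive_cst (k ^+ 2) x (0, 1)) (CkU_is_d2 (S 0%N j 1%N) Ux).
    by rewrite mul0r add0r.
move=> i j x Ux; split.
- exact: (@CkU_cont _ U 0%N _ (S i j 0%N) x Ux).
- exact: (CkU_is_d1 (S i j 1%N) Ux).
- by rewrite -(d2_dfam _ _ oU sw Ux); exact: (CkU_is_d2 (S i j 1%N) Ux).
- elim: i x Ux => [|i IH] x Ux; first exact: eq0j.
  have := (d_eq oU (g := fun=> 0) IH Ux).1; rewrite (d_cst 0 x).1 => <-.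
  apply/esym; apply: is_derive_d1; apply: is_deriveD_fun; first apply: is_deriveD_fun.
  - exact: (CkU_is_d1 (S i.+2 j 1%N) Ux).
  - exact: (CkU_is_d1 (S i j.+2 1%N) Ux).
  - have := is_deriveM_fun (is_derive_cst (k ^+ 2) x (1, 0)) (CkU_is_d1 (S i j 1%N) Ux).
    by rewrite mul0r add0r.
Qed.

Lemma helm_shift U k f a b : helm U k f -> helm U k (fun i j => f (i + a)%N (j + b)%N).
Proof. by move=> H i j x Ux; exact: H. Qed.

Definition swp x : R * R := (x.2, x.1).

Lemma swpK : involutive swp.
Proof. by case. Qed.

Lemma continuous_pair_at (T : topologicalType) (g h : T -> R) (x : T) :
  {for x, continuous g} -> {for x, continuous h} ->
  {for x, continuous (fun y => (g y, h y))}.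
Proof. by move=> cg ch; exact: (cvg_pair cg ch). Qed.

Lemma continuous_swp : continuous swp.
Proof. by move=> x; apply: continuous_pair_at; [exact: cvg_snd|exact: cvg_fst]. Qed.

Lemma helm_swap U k f : helm U k f -> helm (swp @^-1` U) k (fun i j => f j i \o swp).
Proof.
move=> H i j x Ux; have [c a b e] := H j i _ Ux; split.
- by apply: continuous_comp => //; exact: continuous_swp.
- by apply/is_derive_e1; move/is_derive_e2: b.
- by apply/is_derive_e2; move/is_derive_e1: a.
- by rewrite /= addrAC -[RHS]e /= [f j.+2 i _ + _]addrC addrAC.
Qed.

Lemma helm_opp U k f : helm U k f -> helm U k (fun i j x => - f i j x).
Proof.
move=> H i j x Ux; have [c a b e] := H i j x Ux; split.
- exact: cvgN.
- exact: is_deriveN.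
- exact: is_deriveN.
- by rewrite mulrN -!opprD e oppr0.
Qed.

Lemma cbox_swp p h x : cbox p h x <-> cbox (swp p) h (swp x).
Proof. by split => -[]. Qed.

(** Gradient estimate by comparison. The odd part [phi] of the solution across the horizontal line
    through [p] vanishes on that line; the barrier [psi] dominates it on the edge of the upper half
    of the square, and [psi - phi] has negative Laplacian, hence no interior minimum. The slope of
    [psi] on the line then bounds that of [phi]. *)
Lemma helm_grad2_ub U k f p (d B : R) : 0 < d -> 0 < B -> cbox p d `<=` U ->
  helm U k f -> (forall x, cbox p d x -> `|f 0%N 0%N x| <= B) ->
  f 0%N 1%N p <= (2 / d + (k ^+ 2 + 1) * d / 2) * B.
Proof.
move=> d0 B0 dU hf fB.
pose w := f 0%N 0%N.
pose F := (k ^+ 2 + 1) * B.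
have F0 : 0 < F by rewrite mulr_gt0// ltr_wpDl// sqr_ge0.
(* The term in [B] is harmonic and at least [B] on the sides [a = - d], [a = d] and [b = d]; the
   other term has Laplacian [- F]. *)
pose psi a b : R := B / d ^+ 2 * (a ^+ 2 + b * (2 * d - b)) + F / 2 * (b * (d - b)).
pose phi a b : R := 2^-1 * (w (p.1 + a, p.2 + b) - w (p.1 + a, p.2 - b)).
pose chi (x : R * R) : R := psi x.1 x.2 - phi x.1 x.2.
have inP a b : - d <= a <= d -> - d <= b <= d -> cbox p d (p.1 + a, p.2 + b).
  by move=> a1 b1; split; rewrite /= addrAC subrr add0r ler_norml.
have inN a b : - d <= a <= d -> - d <= b <= d -> cbox p d (p.1 + a, p.2 - b).
  by move=> a1 b1; apply: inP => //; lra.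
pose T : set (R * R) := `[-d, d]%classic `*` `[0, d]%classic.
have cT : compact T by apply: compact_setX; exact: segment_compact.
have T0 : T !=set0 by exists (0, 0); split; rewrite /= in_itv/=; lra.
have cpsi : continuous (fun x : R * R => psi x.1 x.2).
  move=> x; apply: cvgD.
    apply: cvgM; first exact: cvg_cst.
    apply: cvgD; first by apply: cvgM; exact: cvg_fst.
    by apply: cvgM; [exact: cvg_snd|apply: cvgB; [exact: cvg_cst|exact: cvg_snd]].
  apply: cvgM; first exact: cvg_cst.
  by apply: cvgM; [exact: cvg_snd|apply: cvgB; [exact: cvg_cst|exact: cvg_snd]].
have cw x : cbox p d x -> {for x, continuous w} by move=> /dU Ux; have [] := hf 0%N 0%N x Ux.
have cchi : {within T, continuous chi}.
  apply: continuous_in_subspaceT => x; rewrite inE => -[/=]; rewrite !in_itv/= => x1 x2.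
  have x2' : - d <= x.2 <= d by lra.
  apply: cvgB; first exact: cpsi.
  apply: cvgM; first exact: cvg_cst.
  apply: cvgB.
    apply: (@continuous_comp _ _ _ (fun x : R * R => (p.1 + x.1, p.2 + x.2)) w).
      by apply: continuous_pair_at; apply: cvgD; do ?[exact: cvg_cst|exact: cvg_fst|exact: cvg_snd].
    by apply: cw; exact: inP.
  apply: (@continuous_comp _ _ _ (fun x : R * R => (p.1 + x.1, p.2 - x.2)) w).
    apply: continuous_pair_at; first by apply: cvgD; do ?[exact: cvg_cst|exact: cvg_fst|exact: cvg_snd].
    by apply: cvgB; do ?[exact: cvg_cst|exact: cvg_fst|exact: cvg_snd].
  by apply: cw; exact: inN.
have [[a b]] := compact_EVT_min T0 cT cchi.
rewrite inE => -[/=]; rewrite !in_itv/= => ad bd Hmin.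
have phiB a' b' : - d <= a' <= d -> - d <= b' <= d -> `|phi a' b'| <= B.
  move=> h1 h2; have := fB _ (inP a' b' h1 h2); have := fB _ (inN a' b' h1 h2).
  by rewrite /phi -/w !ler_norml; lra.
have d2p : 0 < d ^+ 2 by rewrite exprn_gt0.
have chi_ge0 : 0 <= chi (a, b).
  have [b0|b0] := eqVneq b 0.
    rewrite /chi/= /phi b0 addr0 subr0 subrr mulr0 subr0 /psi !mul0r mulr0 !addr0.
    by rewrite mulr_ge0 ?sqr_ge0// divr_ge0// ltW.
  have phab : phi a b <= B.
    by apply: le_trans (ler_norm _) _; apply: phiB => //; lra.
  have geB : d ^+ 2 <= a ^+ 2 + b * (2 * d - b) -> 0 <= chi (a, b).
    move=> H; have H2 : B <= B / d ^+ 2 * (a ^+ 2 + b * (2 * d - b)).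
      by rewrite mulrAC ler_pdivlMr// ler_pM2l.
    have H3 : 0 <= F / 2 * (b * (d - b)).
      by apply: mulr_ge0; [lra|apply: mulr_ge0; lra].
    by rewrite /chi/= /psi; lra.
  have [b1|b1] := eqVneq b d; first by apply: geB; rewrite b1; nra.
  have [a0|a0] := eqVneq (a ^+ 2) (d ^+ 2); first by apply: geB; rewrite a0; nra.
  have a1 : - d < a < d.
    have adn : a != d by apply: contra_neq a0 => ->.
    have and_ : a != - d by apply: contra_neq a0 => ->; rewrite sqrrN.
    by rewrite !lt_neqAle eq_sym and_ adn.
  have b2 : 0 < b < d by rewrite !lt_neqAle eq_sym b0 b1.
  exfalso.
  have [r [r0 rs]] : exists r : R, 0 < r /\ forall t, t < r ->
      [/\ t < a + d, t < d - a, t < b & t < d - b].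
    exists (Num.min (Num.min (a + d) (d - a)) (Num.min b (d - b))); split.
      by rewrite !lt_min; lra.
    by move=> t; rewrite !lt_min => /andP[/andP[-> ->] /andP[-> ->]].
  have bb : - d <= b <= d by lra.
  have Dw i j s t : - d <= s <= d -> - d <= t <= d ->
      is_derive s 1 (fun s => f i j (p.1 + s, p.2 + t)) (f i.+1 j (p.1 + s, p.2 + t)) /\
      is_derive t 1 (fun t => f i j (p.1 + s, p.2 + t)) (f i j.+1 (p.1 + s, p.2 + t)).
    move=> h1 h2; have [_ e1 e2 _] := hf i j _ (dU _ (inP _ _ h1 h2)); split.
      by apply: (@is_derive_shift1 _ (fun s => f i j (s, p.2 + t))); move/is_derive_e1: e1.
    by apply: (@is_derive_shift1 _ (fun t => f i j (p.1 + s, t))); move/is_derive_e2: e2.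
  have Dwn i j s t : - d <= s <= d -> - d <= t <= d ->
      is_derive t 1 (fun t => f i j (p.1 + s, p.2 - t)) (- f i j.+1 (p.1 + s, p.2 - t)).
    move=> h1 h2; have [_ _ e2 _] := hf i j _ (dU _ (inN _ _ h1 h2)).
    by apply: (@is_derive_reflect1 _ (fun t => f i j (p.1 + s, t))); move/is_derive_e2: e2.
  (* [l1] and [l2] are the second derivatives of [chi] at a minimum, hence nonnegative. Their sum is
     [- F + k^2 phi], at most [- B] because of the [+ 1] in [F]. *)
  pose l1 : R := 2 * (B / d ^+ 2) - 2^-1 * (f 2%N 0%N (p.1 + a, p.2 + b) - f 2%N 0%N (p.1 + a, p.2 - b)).
  have L1 : 0 <= l1.
    pose g1 (s : R) : R := 2 * (B / d ^+ 2) * s - 2^-1 * (f 1%N 0%N (p.1 + s, p.2 + b) - f 1%N 0%N (p.1 + s, p.2 - b)).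
    apply: (@second_derive_min _ (fun s : R => chi (s, b)) g1 a l1 r r0).
    - move=> t ta; have tr := rs _ ta; move: ta tr => _; rewrite !ltr_norml => -[] t1 t2 t3 t4.
      have td : - d <= t <= d by lra.
      rewrite /chi/=; apply: is_deriveB1.
        apply: (is_derive_eq (is_deriveD1 (is_deriveZ1 (B / d ^+ 2) (is_deriveD1 (is_deriveX1 2 t)
           (is_derive_cst1 t (b * (2 * d - b))))) (is_derive_cst1 t (F / 2 * (b * (d - b)))))).
        by rewrite /= expr1 !addr0 mulrCA mulrA.
      apply: is_deriveZ1; apply: is_deriveB1; first exact: (Dw 0%N 0%N _ _ td bb).1.
      by apply: (Dw 0%N 0%N t (- b) td _).1; lra.
    - apply: is_deriveB1.
        by have := is_deriveZ1 (2 * (B / d ^+ 2)) (is_derive_id1 a); rewrite mulr1.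
      apply: is_deriveZ1; apply: is_deriveB1; first exact: (Dw 1%N 0%N _ _ ad bb).1.
      by apply: (Dw 1%N 0%N a (- b) ad _).1; lra.
    - move=> t ta; have tr := rs _ ta; move: ta tr => _; rewrite !ltr_norml => -[] t1 t2 t3 t4.
      by apply: Hmin; rewrite inE; split; rewrite /= in_itv/=; lra.
  pose l2 : R := - 2 * (B / d ^+ 2) - F - 2^-1 * (f 0%N 2%N (p.1 + a, p.2 + b) - f 0%N 2%N (p.1 + a, p.2 - b)).
  have L2 : 0 <= l2.
    pose g1 (s : R) : R := B / d ^+ 2 * (2 * d - 2 * s) + F / 2 * (d - 2 * s)
      - 2^-1 * (f 0%N 1%N (p.1 + a, p.2 + s) - - f 0%N 1%N (p.1 + a, p.2 - s)).
    apply: (@second_derive_min _ (fun s : R => chi (a, s)) g1 b l2 r r0).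
    - move=> t ta; have tr := rs _ ta; move: ta tr => _; rewrite !ltr_norml => -[] t1 t2 t3 t4.
      have td : - d <= t <= d by lra.
      rewrite /chi/=; apply: is_deriveB1.
        have D1 := is_deriveD1 (is_derive_cst1 t (a ^+ 2)) (is_deriveM1 (is_derive_id1 t)
          (is_deriveB1 (is_derive_cst1 t (2 * d)) (is_derive_id1 t))).
        have D2 := is_deriveM1 (is_derive_id1 t) (is_deriveB1 (is_derive_cst1 t d) (is_derive_id1 t)).
        apply: (is_derive_eq (is_deriveD1 (is_deriveZ1 (B / d ^+ 2) D1) (is_deriveZ1 (F / 2) D2))).
        by ring.
      apply: is_deriveZ1; apply: is_deriveB1; first exact: (Dw 0%N 0%N _ _ ad td).2.
      exact: (Dwn 0%N 0%N a t ad td).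
    - have D1 := is_deriveB1 (is_derive_cst1 b (2 * d)) (is_deriveZ1 2 (is_derive_id1 b)).
      have D2 := is_deriveB1 (is_derive_cst1 b d) (is_deriveZ1 2 (is_derive_id1 b)).
      have D3 := is_deriveB1 (Dw 0%N 1%N _ _ ad bb).2 (is_deriveN1 (Dwn 0%N 1%N a b ad bb)).
      apply: (is_derive_eq (is_deriveB1 (is_deriveD1 (is_deriveZ1 (B / d ^+ 2) D1)
         (is_deriveZ1 (F / 2) D2)) (is_deriveZ1 2^-1 D3))).
      by rewrite /l2; field; rewrite gt_eqF.
    - move=> t ta; have tr := rs _ ta; move: ta tr => _; rewrite !ltr_norml => -[] t1 t2 t3 t4.
      by apply: Hmin; rewrite inE; split; rewrite /= in_itv/=; lra.
  have [_ _ _ E1] := hf 0%N 0%N _ (dU _ (inP a b ad bb)).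
  have [_ _ _ E2] := hf 0%N 0%N _ (dU _ (inN a b ad bb)).
  have := fB _ (inP a b ad bb); have := fB _ (inN a b ad bb); rewrite !ler_norml => /andP[B1 B2] /andP[B3 B4].
  have k0 : 0 <= k ^+ 2 by rewrite sqr_ge0.
  have : 2^-1 * (k ^+ 2 * (f 0%N 0%N (p.1 + a, p.2 + b) - f 0%N 0%N (p.1 + a, p.2 - b))) <= k ^+ 2 * B.
    by rewrite mulrCA ler_wpM2l//; lra.
  move: L1 L2; rewrite /l1 /l2 /F; lra.
have key t : 0 < t < d -> w (p.1, p.2 + t) - w (p.1, p.2 - t) <= 2 * (2 * B / d + F * d / 2) * t.
  move=> td; have : 0 <= chi (0, t).
    apply: le_trans chi_ge0 _; apply: Hmin; rewrite inE; split; rewrite /= in_itv/=; lra.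
  rewrite /chi/= /phi addr0 /psi expr0n/= add0r.
  have e1 : B / d ^+ 2 * (t * (2 * d - t)) <= 2 * B / d * t.
    rewrite (_ : 2 * B / d * t = B / d ^+ 2 * (t * (2 * d))); last by field; rewrite gt_eqF.
    by rewrite ler_pM2l ?divr_gt0// ler_pM2l; lra.
  have e2 : F / 2 * (t * (d - t)) <= F * d / 2 * t.
    rewrite (_ : F * d / 2 * t = F / 2 * (t * d)); last by ring.
    by rewrite ler_pM2l ?divr_gt0// ler_pM2l; lra.
  lra.
have pd : cbox p d p by split; rewrite subrr normr0 ltW.
have [_ _ e2 _] := hf 0%N 0%N p (dU _ pd).
move/is_derive_e2 : e2 => e2.
have D0 : is_derive (0 : R) 1 (fun t : R => w (p.1, p.2 + t) - w (p.1, p.2 - t)) (f 0%N 1%N p - - f 0%N 1%N p).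
  apply: is_deriveB1.
    by apply: (@is_derive_shift1 _ (fun t => w (p.1, t))); rewrite addr0.
  by apply: (@is_derive_reflect1 _ (fun t => w (p.1, t))); rewrite subr0.
have : f 0%N 1%N p - - f 0%N 1%N p <= 2 * (2 * B / d + F * d / 2).
  apply: (is_derive_slope_le d0 D0) => h hd.
  by rewrite !add0r addr0 subr0 subrr subr0; exact: key.
have -> : (2 / d + (k ^+ 2 + 1) * d / 2) * B = 2 * B / d + F * d / 2 by rewrite /F; ring.
lra.
Qed.

Lemma helm_grad2 U k f p (d B : R) : 0 < d <= 1 -> 0 < B -> cbox p d `<=` U ->
  helm U k f -> (forall x, cbox p d x -> `|f 0%N 0%N x| <= B) ->
  `|f 0%N 1%N p| <= (k ^+ 2 + 3) / d * B.
Proof.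
move=> /andP[d0 d1] B0 dU hf fB.
have H1 := helm_grad2_ub d0 B0 dU hf fB.
have H2 := helm_grad2_ub d0 B0 dU (helm_opp hf) _.
have {}H2 : - f 0%N 1%N p <= (2 / d + (k ^+ 2 + 1) * d / 2) * B.
  by apply: H2 => x xd; rewrite normrN; exact: fB.
have E : (2 / d + (k ^+ 2 + 1) * d / 2) * B <= (k ^+ 2 + 3) / d * B.
  rewrite ler_pM2r// (_ : (_ + 3) / d = 2 / d + (k ^+ 2 + 1) * d^-1); last by ring.
  rewrite lerD2l -mulrA ler_pM2l; last by rewrite ltr_wpDl// sqr_ge0.
  apply: (@le_trans _ _ 1); first by lra.
  by rewrite invr_ge1 ?unitf_gt0.
by rewrite ler_norml; apply/andP; split; lra.
Qed.

Lemma helm_grad1 U k f p (d B : R) : 0 < d <= 1 -> 0 < B -> cbox p d `<=` U ->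
  helm U k f -> (forall x, cbox p d x -> `|f 0%N 0%N x| <= B) ->
  `|f 1%N 0%N p| <= (k ^+ 2 + 3) / d * B.
Proof.
move=> d0 B0 dU hf fB; rewrite -(swpK p).
apply: (@helm_grad2 (swp @^-1` U) k (fun i j => f j i \o swp) (swp p) d B) => //.
- by move=> x /cbox_swp; rewrite swpK => /dU.
- exact: helm_swap.
- by move=> x /cbox_swp; rewrite swpK => /fB.
Qed.

Lemma cbox_add p x (s d : R) : cbox p s x -> cbox x d `<=` cbox p (s + d).
Proof.
move=> [x1 x2] y [y1 y2]; split.
  rewrite (_ : y.1 - p.1 = (x.1 - p.1) + (y.1 - x.1)); last by ring.
  by apply: (le_trans (ler_normD _ _)); exact: lerD.
rewrite (_ : y.2 - p.2 = (x.2 - p.2) + (y.2 - x.2)); last by ring.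
by apply: (le_trans (ler_normD _ _)); exact: lerD.
Qed.

(** Each derivative costs a factor [(k^2 + 3) / d] and a margin [d], so [n] of them fit when [n d]
    fits; the step [d] is chosen later as a function of [n]. *)
Lemma helm_bound U k f p (h d B : R) : 0 < d <= 1 -> 0 < B -> cbox p h `<=` U ->
  helm U k f -> (forall x, cbox p h x -> `|f 0%N 0%N x| <= B) ->
  forall n s x, n%:R * d + s <= h -> cbox p s x ->
  `|f n 0%N x| <= ((k ^+ 2 + 3) / d) ^+ n * B.
Proof.
move=> d01 B0 hU hf fB.
have A0 : 0 < (k ^+ 2 + 3) / d.
  by rewrite divr_gt0//; [rewrite ltr_wpDl// sqr_ge0|case/andP: d01].
elim=> [|n IH] s x nh xs.
  rewrite expr0 mul1r; apply: fB; case: xs => x1 x2; split.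
    by apply: le_trans x1 _; lra.
  by apply: le_trans x2 _; lra.
rewrite exprS -mulrA.
apply: (@helm_grad1 U k (fun i j => f (i + n)%N (j + 0)%N) x d (_ ^+ n * B)) => //.
- by rewrite mulr_gt0// exprn_gt0.
- apply: subset_trans hU => y /(cbox_add xs) [y1 y2].
  have : s + d <= h.
    apply: le_trans nh; rewrite addrC lerD2r -[leLHS]mul1r ler_pM2r; last by case/andP: d01.
    by rewrite ler1n.
  by move=> sh; split; [exact: le_trans y1 sh|exact: le_trans y2 sh].
- exact: helm_shift.
- move=> y /(cbox_add xs) yy; rewrite add0n; apply: (IH (s + d)) => //.
  by apply: le_trans nh; rewrite -natr1; lra.
Qed.

(** The left side is one term of the exponential series at [n]. It turns the factor [n^n] of the
    iterated gradient estimate into a geometric one. *)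
Lemma exp_ge_pow (n : nat) : n%:R ^+ n / n`!%:R <= expR 1 ^+ n :> R.
Proof.
rewrite -expRM_natl mulr1.
case: n => [|n]; first by rewrite expr0 divr1 expR0.
by apply: le_trans (expR_ge1Dxn n (ler0n _ _)); rewrite lerDr.
Qed.

Lemma cvg_geometric_bound (u : R^nat) (l B : R) :
  (forall n, `|l - u n| <= B * 2^-1 ^+ n) -> u @ \oo --> l.
Proof.
move=> H; apply/cvgrPdist_le => e e0.
have : geometric B (2^-1 : R) @ \oo --> (0 : R).
  by apply: cvg_geometric; rewrite ger0_norm ?invr_ge0// invf_lt1// ltr1n.
move=> /cvgrPdist_le/(_ e e0); apply: filterS => n; rewrite sub0r normrN => Hn.
by apply: le_trans (H n) _; apply: le_trans Hn; exact: ler_norm.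
Qed.

(** The constant for which [2 (k^2 + 3) e |t| / h <= 1/2] when [|t|] is at most [h] times it. *)
Definition taylor_radius (k : R) : R := (4 * (k ^+ 2 + 3) * expR 1)^-1.

Lemma taylor_radius_gt0 k : 0 < taylor_radius k.
Proof. by rewrite invr_gt0 !mulr_gt0 ?expR_gt0// ltr_wpDl// sqr_ge0. Qed.

Lemma taylor_radius_le k : taylor_radius k <= 2^-1.
Proof.
rewrite lef_pV2 ?posrE ?mulr_gt0 ?expR_gt0//; last by rewrite ltr_wpDl// sqr_ge0.
have : 1 <= expR 1 :> R by rewrite -expR0 ler_expR.
have := sqr_ge0 k; nra.
Qed.

Lemma compact_bounded_fun (A : set (R * R)) (w : R * R -> R) : compact A ->
  (forall x, A x -> {for x, continuous w}) ->
  exists2 B, 0 < B & forall x, A x -> `|w x| <= B.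
Proof.
move=> cA cw; have [A0|/set0P A0] := eqVneq A set0.
  by exists 1 => // x; rewrite A0.
have [|c _ Hc] := @compact_EVT_max _ R (fun x => `|w x|) A A0 cA.
  apply: continuous_in_subspaceT => x; rewrite inE => Ax.
  by apply: cvg_norm; exact: cw.
exists (`|w c| + 1); first by rewrite ltr_wpDl.
by move=> x Ax; apply: (@le_trans _ _ `|w c|); [apply: Hc; rewrite inE|rewrite lerDl].
Qed.

(** With margin [d = h / (2 n)] the derivative of order [n] is at most [(2 (k^2 + 3) n / h)^n B],
    and the remainder at most [B 2^-n]. The radius of convergence is uniform over all solutions,
    which is what allows continuation for all sources simultaneously. *)
Lemma helm_taylor1 U k f p (h t : R) : 0 < h <= 1 -> cbox p h `<=` U -> helm U k f ->
  `|t| <= taylor_radius k * h ->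
  series (fun m => f m 0%N p * t ^+ m / m`!%:R) @ \oo --> f 0%N 0%N (p.1 + t, p.2).
Proof.
move=> /andP[h0 h1] hU hf tr.
have cf x : cbox p h x -> {for x, continuous (f 0%N 0%N)}.
  by move=> /hU Ux; have [] := hf 0%N 0%N x Ux.
have [B B0 HB] := compact_bounded_fun (@compact_cbox R p h) cf.
have rh : taylor_radius k * h <= h / 2.
  by rewrite mulrC ler_pM2l// taylor_radius_le.
have A0 : 0 < k ^+ 2 + 3 by rewrite ltr_wpDl// sqr_ge0.
have inb s : `|s| <= taylor_radius k * h -> cbox p (h / 2) (p.1 + s, p.2).
  move=> sh; split; rewrite /= ?subrr ?normr0; last by lra.
  by rewrite addrAC subrr add0r; exact: le_trans rh.
apply: (@cvg_geometric_bound _ _ B) => n.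
have dF m (s : R) : `|s| <= taylor_radius k * h ->
    is_derive s 1 (fun s : R => f m 0%N (p.1 + s, p.2)) (f m.+1 0%N (p.1 + s, p.2)).
  move=> sh; have Us : U (p.1 + s, p.2).
    apply: hU; have [s1 s2] := inb s sh; split; [apply: le_trans s1 _|apply: le_trans s2 _]; lra.
  have [_ /is_derive_e1 H _ _] := hf m 0%N _ Us.
  exact: (@is_derive_shift1 _ (fun s => f m 0%N (s, p.2))).
(* Order 0 is separate, since [d] has [n] in its denominator. *)
have bF (s : R) : `|s| <= taylor_radius k * h ->
    `|f n 0%N (p.1 + s, p.2)| <= (2 * (k ^+ 2 + 3) * n%:R / h) ^+ n * B.
  move=> sh; case: n => [|n].
    rewrite expr0 mul1r; apply: HB; have [s1 s2] := inb s sh.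
    split; [apply: le_trans s1 _|apply: le_trans s2 _]; lra.
  have n0 : 0 < n.+1%:R :> R by rewrite ltr0n.
  have d01 : 0 < h / (2 * n.+1%:R) <= 1.
    rewrite divr_gt0 ?mulr_gt0//= ler_pdivrMr ?mulr_gt0// mul1r.
    apply: le_trans h1 _; have : 1 <= n.+1%:R :> R by rewrite ler1n.
    lra.
  have := helm_bound d01 B0 hU hf HB (n := n.+1) (s := h / 2) _ (inb s sh).
  rewrite (_ : (k ^+ 2 + 3) / (h / (2 * n.+1%:R)) = 2 * (k ^+ 2 + 3) * n.+1%:R / h); last first.
    by field; rewrite gt_eqF//= gt_eqF// ltr_wpDl.
  apply; rewrite (_ : n.+1%:R * _ = h / 2); first by lra.
  by field; rewrite gt_eqF// ltr_wpDl.
have := @taylor_bound _ n (fun m s => f m 0%N (p.1 + s, p.2)) _ _ dF bF t tr.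
rewrite /= addr0 -surjective_pairing /series /= => /le_trans; apply.
rewrite [leLHS](_ : _ = B * ((2 * (k ^+ 2 + 3) * `|t| / h) ^+ n * (n%:R ^+ n / n`!%:R))); last first.
  rewrite !exprMn; ring.
rewrite ler_pM2l//.
apply: (@le_trans _ _ ((2 * (k ^+ 2 + 3) * `|t| / h) ^+ n * expR 1 ^+ n)).
  apply: ler_wpM2l; last exact: exp_ge_pow.
  by rewrite exprn_ge0// divr_ge0 ?(ltW h0)// !mulr_ge0// ltW.
rewrite -exprMn; apply: lerXn2r; rewrite ?nnegrE//.
  by rewrite mulr_ge0 ?expR_ge0// divr_ge0 ?(ltW h0)// !mulr_ge0// ltW.
move: tr; rewrite /taylor_radius.
have e0 : 0 < expR 1 :> R by rewrite expR_gt0.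
rewrite mulrC ler_pdivlMr ?mulr_gt0// => tr.
rewrite mulrAC ler_pdivrMr//.
by lra.
Qed.

Lemma helm_taylor2 U k f p (h t : R) : 0 < h <= 1 -> cbox p h `<=` U -> helm U k f ->
  `|t| <= taylor_radius k * h ->
  series (fun m => f 0%N m p * t ^+ m / m`!%:R) @ \oo --> f 0%N 0%N (p.1, p.2 + t).
Proof.
move=> h01 hU hf tr.
have := @helm_taylor1 (swp @^-1` U) k (fun i j => f j i \o swp) (swp p) h t h01 _ (helm_swap hf) tr.
rewrite /= swpK; apply.
by move=> x /cbox_swp; rewrite swpK => /hU.
Qed.

End helmholtz.

(** * A smooth step *)

Section flat.
Context {R : realType}.
Implicit Types (q : {poly R}) (t x : R).

(** A quadratic error term identifies the derivative without computing limits; used for flat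
    functions at 0 and for sums of power series. *)
Lemma is_derive_quad (g : R -> R) (c l C r : R) : 0 < r ->
  (forall h, `|h| < r -> `|g (c + h) - g c - l * h| <= C * h ^+ 2) -> is_derive c 1 g l.
Proof.
move=> r0 H.
have lim : (h^-1 *: ((g \o shift c) (h *: (1 : R)) - g c)) @[h --> 0^'] --> l.
  apply/cvgrPdist_le => e e0; rewrite near_withinE; apply/nbhs_ballP.
  exists (Num.min r (e / (`|C| + 1))).
    by rewrite /= lt_min r0 divr_gt0// ltr_wpDl.
  move=> h; rewrite /ball/= sub0r normrN lt_min => /andP[hr he] h0.
  rewrite /GRing.scale/= mulr1 [h + c]addrC.
  rewrite -(ler_pM2r (x := `|h|)) ?normr_gt0// -normrM mulrBl mulrAC mulVf// mul1r distrC.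
  apply: (le_trans (H h hr)); rewrite -real_normK ?num_real// expr2 mulrA ler_wpM2r//.
  apply: (@le_trans _ _ ((`|C| + 1) * `|h|)).
    by apply: ler_wpM2r => //; apply: (le_trans (ler_norm _)); rewrite lerDl.
  by rewrite mulrC -ler_pdivlMr ?ltW// ltr_wpDl.
split; first by apply/cvg_ex; exists l.
exact: cvg_lim.
Qed.

Lemma is_derive1_near (f g : R -> R) (c l : R) : is_derive c 1 f l ->
  (\near c, f c = g c) -> is_derive c 1 g l.
Proof.
move=> [d e] fg; have gf : \near c, g c = f c by apply: filterS fg.
split; first exact: near_eq_derivable fg d.
by rewrite (near_eq_derive _ gf).
Qed.

Lemma is_derive_inv (c : R) : c != 0 -> is_derive c 1 (fun t : R => t^-1) (- c^-2).
Proof.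
move=> c0; have H : is_derive c 1 (fun t : R => t) (1 : R) by exact: is_derive_id.
have H2 : is_derive c 1 (fun t : R => t^-1) (- c^-2 *: (1 : R)) by exact: is_deriveV.
by rewrite /GRing.scale/= mulr1 in H2.
Qed.

Lemma is_derive_horner_fun q (c : R) : is_derive c 1 (fun t : R => q.[t]) (q^`()).[c].
Proof.
elim/poly_ind: q => [|q a IH].
  rewrite (_ : (fun t : R => _) = (fun=> 0)); last by apply/funext => t; rewrite horner0.
  by rewrite linear0 horner0; exact: is_derive_cst1.
rewrite (_ : (fun t : R => _) = (fun t => q.[t] * t + a)); last by apply/funext => t; rewrite !hornerE.
apply: (is_derive_eq (is_deriveD1 (is_deriveM1 IH (is_derive_id1 c)) (is_derive_cst1 c a))).
by rewrite derivD derivM derivX derivC !hornerE; ring.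
Qed.

(** Functions [q(1/t) e^(-1/t)] on [t > 0]: a class closed under differentiation, with [q] replaced
    by [X^2 (q - q')], which gives all derivatives of the classical flat function at once. *)
Definition flat q t : R := if 0 < t then q.[t^-1] * expR (- t^-1) else 0.

Definition flat_next q : {poly R} := 'X^2 * (q - q^`()).

Lemma flat_le0 q t : t <= 0 -> flat q t = 0.
Proof. by rewrite /flat leNgt => /negbTE ->. Qed.

Lemma poly_bound q : exists2 C, 0 <= C & forall x, 1 <= x -> `|q.[x]| <= C * x ^+ size q.
Proof.
exists (\sum_(i < size q) `|q`_i|); first by apply: sumr_ge0.
move=> x x1; rewrite horner_coef mulr_suml; apply: (le_trans (ler_norm_sum _ _ _)).
apply: ler_sum => i _; rewrite normrM normrX (ger0_norm (x := x)) ?(le_trans ler01)//.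
by apply: ler_wpM2l => //; apply: ler_weXn2l => //; exact: ltnW.
Qed.

(** One term of the exponential series gives [e^(-1/t) <= N! t^N]; two powers more than the size of
    [q] leave [t^2], so the derivative at 0 is 0. *)
Lemma flat_small q : exists2 C, 0 <= C & forall t, t <= 1 -> `|flat q t| <= C * t ^+ 2.
Proof.
have [C C0 HC] := poly_bound q.
set N := (size q).+2.
exists (C * N`!%:R); first by rewrite mulr_ge0.
move=> t t1; rewrite /flat; case: ifPn => [t0|_]; last first.
  by rewrite normr0 mulr_ge0 ?sqr_ge0// mulr_ge0.
have x1 : 1 <= t^-1 by rewrite invf_ge1.
rewrite normrM (ger0_norm (expR_ge0 _)) expRN.
apply: (@le_trans _ _ (C * t^-1 ^+ size q * (N`!%:R * t ^+ N))).
  apply: ler_pM => //; first exact: HC.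
  rewrite invf_ple ?posrE ?expR_gt0//; last by rewrite mulr_gt0 ?ltr0n ?fact_gt0 ?exprn_gt0.
  rewrite invfM mulrC -exprVn.
  have x0 : 0 <= t^-1 by rewrite invr_ge0 ltW.
  by apply: (le_trans _ (expR_ge1Dxn (size q).+1 x0)); rewrite lerDr.
rewrite mulrACA -[leRHS]mulrA -[leLHS]mulrA; apply: ler_wpM2l => //.
rewrite (_ : t^-1 ^+ size q * t ^+ N = t ^+ 2)//.
by rewrite /N -addn2 exprD mulrA -exprMn mulVf ?gt_eqF// expr1n mul1r.
Qed.

Lemma is_derive_flat q t : is_derive t 1 (flat q) (flat (flat_next q) t).
Proof.
have [t0|t0|t0] := ltgtP t 0.
- rewrite flat_le0 ?ltW//.
  have D0 : is_derive t 1 (fun _ : R => 0 : R) 0 by exact: is_derive_cst1.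
  apply: (is_derive1_near D0).
  have : \near t, t < 0 by exact: lt_nbhsl.
  by apply: filterS => s s0; rewrite flat_le0// ltW.
- have e : flat (flat_next q) t = (q^`()).[t^-1] * (- t^-2) * expR (- t^-1) +
      q.[t^-1] * (expR (- t^-1) * - (- t^-2)).
    rewrite /flat t0 /flat_next !hornerE /= -!exprVn; ring.
  rewrite e; apply: (@is_derive1_near (fun s => q.[s^-1] * expR (- s^-1))).
    have tn : t != 0 by rewrite gt_eqF.
    apply: is_deriveM1.
      exact: (is_derive_comp1 (is_derive_horner_fun q t^-1) (is_derive_inv tn)).
    exact: (@is_derive_comp1 _ expR (fun t => - t^-1) _ _ _ (is_derive_expR (- t^-1)) (is_deriveN1 (is_derive_inv tn))).
  have : \near t, 0 < t by exact: lt_nbhsr.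
  by apply: filterS => s s0; rewrite /flat s0.
- rewrite t0 flat_le0//; have [C C0 HC] := flat_small q.
  apply: (@is_derive_quad _ _ _ C 1) => // h h1.
  rewrite add0r (flat_le0 _ (lexx 0)) mul0r !subr0; apply: HC.
  by apply: le_trans (ler_norm _) (ltW h1).
Qed.

Definition flatn (i : nat) : R -> R := flat (iter i flat_next 1).

Lemma is_derive_flatn i t : is_derive t 1 (flatn i) (flatn i.+1 t).
Proof. exact: is_derive_flat. Qed.

Lemma flat0E t : 0 < t -> flatn 0 t = expR (- t^-1).
Proof. by rewrite /flatn /flat /= => ->; rewrite hornerC mul1r. Qed.

Lemma flat0_gt0 t : 0 < t -> 0 < flatn 0 t.
Proof. by move=> t0; rewrite flat0E// expR_gt0. Qed.

Lemma flat0_ge0 t : 0 <= flatn 0 t.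
Proof. by rewrite /flatn /flat /=; case: ifP => // _; rewrite hornerC mul1r expR_ge0. Qed.

Lemma flat1E t : 0 < t -> flatn 1 t = t^-2 * expR (- t^-1).
Proof.
move=> t0; rewrite /flatn /flat t0 /= /flat_next derivC subr0 mulr1 hornerXn.
by rewrite -exprVn.
Qed.

Lemma flat1_ge0 t : 0 <= flatn 1 t.
Proof.
have [t0|t0] := ltP 0 t; last by rewrite /flatn flat_le0.
by rewrite flat1E// mulr_ge0 ?expR_ge0// invr_ge0 sqr_ge0.
Qed.

(** The polynomial factor is [y^4 - 2 y^3] with [y = 1/t >= 2]. This convexity enters the sign of
    the regularized source. *)
Lemma flat2_ge0 t : t <= 2^-1 -> 0 <= flatn 2 t.
Proof.
move=> t1; have [t0|t0] := ltP 0 t; last by rewrite /flatn flat_le0.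
rewrite /flatn /flat t0 /= /flat_next derivC subr0 mulr1 derivXn !hornerE /=.
apply: mulr_ge0; last exact: expR_ge0.
have : 2 <= t^-1 by rewrite -(invrK 2) lef_pV2 ?posrE// invr_gt0.
move: (t^-1) => y y2.
by rewrite mulr_ge0 ?sqr_ge0//; nra.
Qed.

Definition sstep t : R := flatn 0 t / (flatn 0 t + flatn 0 (1 - t)).

Lemma sstep_den t : 0 < flatn 0 t + flatn 0 (1 - t).
Proof.
have [t0|t0] := ltP 0 t.
  by rewrite ltr_wpDr ?flat0_ge0 ?flat0_gt0.
by rewrite ltr_wpDl ?flat0_ge0 ?flat0_gt0//; lra.
Qed.

Lemma sstep_ge0 t : 0 <= sstep t.
Proof. by rewrite divr_ge0 ?flat0_ge0// ltW// sstep_den. Qed.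

Lemma sstep_le1 t : sstep t <= 1.
Proof. by rewrite ler_pdivrMr ?sstep_den// mul1r lerDl flat0_ge0. Qed.

Lemma sstep0 t : t <= 0 -> sstep t = 0.
Proof. by move=> t0; rewrite /sstep /flatn (flat_le0 _ t0) mul0r. Qed.

Lemma sstep1 t : 1 <= t -> sstep t = 1.
Proof.
move=> t1; have E : flatn 0 (1 - t) = 0 by rewrite /flatn flat_le0// subr_le0.
rewrite /sstep E addr0 divff//.
by rewrite gt_eqF// flat0_gt0// (lt_le_trans ltr01).
Qed.

Lemma sstep_mono s t : s <= t -> sstep s <= sstep t.
Proof.
move=> st; rewrite /sstep.
have mono a b : a <= b -> flatn 0 a <= flatn 0 b.
  move=> ab; apply: (@ge0_is_derive_le _ _ (flatn 1)) => // *.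
    exact: is_derive_flatn.
  exact: flat1_ge0.
have h1 := mono _ _ st.
have h2 : flatn 0 (1 - t) <= flatn 0 (1 - s) by apply: mono; lra.
rewrite ler_pdivrMr ?sstep_den// mulrAC ler_pdivlMr ?sstep_den//.
have := flat0_ge0 s; have := flat0_ge0 (1 - t); nra.
Qed.

Definition sstepd t : R :=
  flatn 1 t * (flatn 0 t + flatn 0 (1 - t))^-1 +
  flatn 0 t * ((- (flatn 0 t + flatn 0 (1 - t))^-2) * (flatn 1 t + - flatn 1 (1 - t))).

Lemma is_derive_sstep t : is_derive t 1 sstep (sstepd t).
Proof.
apply: is_deriveM1; first exact: is_derive_flatn.
have dn : flatn 0 t + flatn 0 (1 - t) != 0 by rewrite gt_eqF// sstep_den.
apply: (@is_derive_comp1 _ (fun t => t^-1) (fun y => flatn 0 y + flatn 0 (1 - y)) _ _ _ (is_derive_inv dn)).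
apply: is_deriveD1; first exact: is_derive_flatn.
by apply: is_derive_reflect1; exact: is_derive_flatn.
Qed.

Lemma sstepd_cont : continuous sstepd.
Proof.
have cf i : continuous (flatn i) by move=> t; exact: is_derive_cont (is_derive_flatn i t).
have cr i : continuous (fun t => flatn i (1 - t)).
  move=> t; apply: (@continuous_comp _ _ _ (fun t : R => 1 - t) (flatn i)); last exact: cf.
  by apply: cvgB; [exact: cvg_cst|exact: cvg_id].
have dn t : flatn 0 t + flatn 0 (1 - t) != 0 by rewrite gt_eqF// sstep_den.
move=> t; apply: cvgD.
  by apply: cvgM; [exact: cf|apply: cvgV => //; apply: cvgD; [exact: cf|exact: cr]].
apply: cvgM; first exact: cf.
apply: cvgM.
  apply: cvgN; apply: cvgV; first by rewrite expf_neq0.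
  by apply: cvgM; apply: cvgD; do ?[exact: cf|exact: cr].
by apply: cvgD; [exact: cf|apply: cvgN; exact: cr].
Qed.

Lemma sstepd_eq0 t : (t < 0) || (1 < t) -> sstepd t = 0.
Proof.
move=> t01; apply: (@etrans _ _ ('D_1 sstep t)); first by case: (is_derive_sstep t).
case/orP: t01 => t01.
  have E : \near t, sstep t = 0.
    have : \near t, t < 0 by exact: lt_nbhsl.
    by apply: filterS => s s0; rewrite sstep0// ltW.
  by rewrite (near_eq_derive _ (g := fun _ : R => 0 : R) E) derive_cst.
have E : \near t, sstep t = 1.
  have : \near t, 1 < t by exact: lt_nbhsr.
  by apply: filterS => s s0; rewrite sstep1// ltW.
by rewrite (near_eq_derive _ (g := fun _ : R => 1 : R) E) derive_cst.
Qed.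

Lemma sstepd_ge0 (t : R) : 0 <= sstepd t.
Proof.
have dt := is_derive_sstep t; rewrite -[sstepd t](@derive_val _ _ _ _ _ _ _ dt).
have D : derivable (sstep : R -> R) t 1 by case: dt.
rewrite /derive; apply: limr_ge => //; near=> h.
have h0 : h != 0 by near: h; exact: nbhs_dnbhs_neq.
rewrite /= [h *: 1]mulr1; have [hn|hp|/eqP] := ltgtP h 0; last by rewrite (negbTE h0).
- rewrite -[_ *: _]/(_ * _) nmulr_rge0 ?invr_lt0// subr_le0; apply: sstep_mono; lra.
- rewrite -[_ *: _]/(_ * _) pmulr_rge0 ?invr_gt0// subr_ge0; apply: sstep_mono; lra.
Unshelve. all: by end_near. Qed.

Lemma sstepd_bound : exists2 C, 0 < C & forall t, `|sstepd t| <= C.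
Proof.
have [|c _ Hc] := @EVT_max R (fun x => `|sstepd x|) 0 1 ler01.
  apply: continuous_subspaceT => x.
  by apply: cvg_norm; exact: sstepd_cont.
exists (`|sstepd c| + 1); first by rewrite ltr_wpDl.
move=> t; have [t01|] := boolP (t \in `[0, 1]).
  by apply: le_trans (Hc t t01) _; rewrite lerDl.
rewrite in_itv/= negb_and -!ltNge => /sstepd_eq0 ->.
by rewrite normr0 ltW// ltr_wpDl.
Qed.

(** Successive derivatives of the inverse, in the form that [CkU_comp] expects; [ln_fam] puts the
    logarithm in front of them. *)
Definition inv_fam (i : nat) t : R := (-1) ^+ i * i`!%:R * t^-1 ^+ i.+1.

Lemma is_derive_inv_fam i t : t != 0 -> is_derive t 1 (inv_fam i) (inv_fam i.+1 t).
Proof.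
move=> t0; apply: (is_derive_eq (is_deriveZ1 _ (@is_derive_comp1 _ (fun t => t ^+ i.+1) (fun t => t^-1) _ _ _ (is_deriveX1 i.+1 t^-1) (is_derive_inv t0)))).
by rewrite /inv_fam /= factS natrM -exprVn !exprS; ring.
Qed.

Definition ln_fam (i : nat) : R -> R := if i is j.+1 then inv_fam j else @ln R.

Lemma is_derive_ln_fam i t : 0 < t -> is_derive t 1 (ln_fam i) (ln_fam i.+1 t).
Proof.
move=> t0; case: i => [|i] /=; last by apply: is_derive_inv_fam; rewrite gt_eqF.
by rewrite /inv_fam expr0 fact0 !mul1r expr1; exact: is_derive1_ln.
Qed.

End flat.

Section smooth_compositions.
Context {R : realType}.
Implicit Types (U : set (R * R)) (u v : R * R -> R) (c : R).

Lemma smoothU_inv U u : open U -> smoothU U u -> (forall x, U x -> u x != 0) ->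
  smoothU U (fun x => (u x)^-1).
Proof.
move=> oU su u0 n; apply: (CkU_eq oU (g := fun x => inv_fam 0 (u x))).
  by move=> x _; rewrite /inv_fam expr0 fact0 !mul1r expr1.
apply: (@CkU_comp _ U [set t | t != 0] n inv_fam u oU) => //.
by move=> i t; exact: is_derive_inv_fam.
Qed.

Lemma smoothU_ln U u : open U -> smoothU U u -> (forall x, U x -> 0 < u x) ->
  smoothU U (fun x => ln (u x)).
Proof.
move=> oU su u0 n; apply: (@CkU_comp _ U [set t | 0 < t] n ln_fam u oU) => //.
by move=> i t; exact: is_derive_ln_fam.
Qed.

Lemma smoothU_flat U u : open U -> smoothU U u -> smoothU U (fun x => flatn 0 (u x)).
Proof.
move=> oU su n; apply: (@CkU_comp _ U setT n flatn u oU) => //.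
by move=> i t _; exact: is_derive_flatn.
Qed.

Lemma smoothU_add U u v : open U -> smoothU U u -> smoothU U v -> smoothU U (fun x => u x + v x).
Proof. by move=> oU su sv n; exact: CkU_add. Qed.

Lemma smoothU_sub U u v : open U -> smoothU U u -> smoothU U v -> smoothU U (fun x => u x - v x).
Proof. by move=> oU su sv n; exact: CkU_sub_fun. Qed.

Lemma smoothU_mul U u v : open U -> smoothU U u -> smoothU U v -> smoothU U (fun x => u x * v x).
Proof. by move=> oU su sv n; exact: CkU_mul. Qed.

Lemma smoothU_cst U c : smoothU U (fun=> c).
Proof. by move=> n; exact: CkU_cst. Qed.

Lemma smoothU_sstep U u : open U -> smoothU U u -> smoothU U (fun x => sstep (u x)).
Proof.
move=> oU su; apply: smoothU_mul => //; first exact: smoothU_flat.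
apply: smoothU_inv => //; last by move=> x _; rewrite gt_eqF// sstep_den.
apply: smoothU_add => //; first exact: smoothU_flat.
by apply: smoothU_flat => //; apply: smoothU_sub => //; exact: smoothU_cst.
Qed.

End smooth_compositions.

(** * Bessel functions *)

Section power_series.
Context {R : realType}.
Implicit Types (c : R^nat) (x s : R).

(** A growth condition that makes the series entire and survives termwise differentiation with the
    same [A]. *)
Definition expbounded c := exists M A : R, 0 <= M /\ 0 <= A /\ forall n, `|c n| <= M * A ^+ n / n`!%:R.

Definition psum c x : R := limn (pseries c x).

Lemma expbounded_cvg c x : expbounded c -> cvgn (pseries c x).
Proof.
move=> [M [A [M0 [A0 H]]]]; apply: normed_cvg.
have mx : 0 <= A * `|x| by rewrite mulr_ge0.
apply: (@series_le_cvg _ _ (fun n => M * (exp_coeff (A * `|x|) n))).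
- by move=> n /=.
- by move=> n; rewrite mulr_ge0// /exp_coeff/= divr_ge0// exprn_ge0.
- move=> n /=; rewrite normrM normrX /exp_coeff/=.
  apply: (@le_trans _ _ (M * A ^+ n / n`!%:R * `|x| ^+ n)).
    by rewrite ler_wpM2r// exprn_ge0.
  by rewrite exprMn le_eqVlt; apply/orP; left; apply/eqP; ring.
- rewrite (_ : series _ = M *: series (exp_coeff (A * `|x|))).
    by apply: is_cvgZr; exact: is_cvg_series_exp_coeff.
  by apply/funext => n; rewrite /series /= -mulr_sumr.
Qed.

Lemma expbounded_diffs c : expbounded c -> expbounded (pseries_diffs c).
Proof.
move=> [M [A [M0 [A0 H]]]]; exists (M * A), A; split; first exact: mulr_ge0.
split => // n; rewrite /pseries_diffs normrM ger0_norm//.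
apply: (@le_trans _ _ (n.+1%:R * (M * A ^+ n.+1 / n.+1`!%:R))); first exact: ler_wpM2l.
rewrite factS natrM le_eqVlt; apply/orP; left; apply/eqP; rewrite exprS; field.
by rewrite pnatr_eq0 -lt0n fact_gt0 nat1r pnatr_eq0.
Qed.

Lemma is_derive_psum c x : expbounded c -> is_derive x 1 (psum c) (psum (pseries_diffs c) x).
Proof.
move=> ec; apply: (@pseries_snd_diffs _ c (`|x| + 1)).
- exact: expbounded_cvg.
- exact/expbounded_cvg/expbounded_diffs.
- exact/expbounded_cvg/expbounded_diffs/expbounded_diffs.
- by rewrite [ltRHS]ger0_norm ?addr_ge0// ltrDl.
Qed.

Definition psumn c (i : nat) : R -> R := psum (iter i (@pseries_diffs R) c).

Lemma is_derive_psumn c i x : expbounded c -> is_derive x 1 (psumn c i) (psumn c i.+1 x).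
Proof.
move=> ec; apply: is_derive_psum; elim: i => [//|i IH] /=; exact: expbounded_diffs.
Qed.

Lemma psum_scale c (a : R) x : expbounded c -> psum (fun n => a * c n) x = a * psum c x.
Proof.
move=> /(@expbounded_cvg _ x) cc; rewrite /psum; apply: cvg_lim => //.
rewrite (_ : pseries _ x = (fun n => a * pseries c x n)); first by apply: cvgMr.
by apply/funext => n; rewrite /pseries /series/= mulr_sumr; apply: eq_bigr => i _; rewrite mulrA.
Qed.

Lemma psum_add c e x : expbounded c -> expbounded e ->
  psum (fun n => c n + e n) x = psum c x + psum e x.
Proof.
move=> /(@expbounded_cvg _ x) cc /(@expbounded_cvg _ x) ce; rewrite /psum; apply: cvg_lim => //.
rewrite (_ : pseries _ x = (fun n => pseries c x n + pseries e x n)); first exact: cvgD.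
by apply/funext => n; rewrite /pseries /series/= -big_split/=; apply: eq_bigr => i _; rewrite mulrDl.
Qed.

(** Multiplication by [x] restores the index lowered by differentiation: the Euler operator is
    diagonal on coefficients, which turns the Bessel equation into an identity between
    coefficients. *)
Lemma psum_mulX c x : expbounded c -> x * psum (pseries_diffs c) x = psum (fun n => n%:R * c n) x.
Proof.
move=> ec; have := @expbounded_cvg _ x (expbounded_diffs ec) => cd.
apply/esym; rewrite /psum; apply: cvg_lim => //; rewrite -cvg_shiftS.
rewrite (_ : (fun n => _) = (fun n => x * pseries (pseries_diffs c) x n)); first exact: cvgMr.
apply/funext => n; rewrite /pseries /series/= big_nat_recl//= mul0r mul0r add0r mulr_sumr.
by apply: eq_bigr => i _; rewrite /pseries_diffs exprS; ring.
Qed.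

Lemma expbounded_scale_nat c : expbounded c -> expbounded (fun n => n%:R * c n).
Proof.
move=> [M [A [M0 [A0 H]]]]; exists M, (2 * A); split => //; split; first exact: mulr_ge0.
move=> n; rewrite normrM ger0_norm//.
apply: (@le_trans _ _ (n%:R * (M * A ^+ n / n`!%:R))); first exact: ler_wpM2l.
rewrite exprMn !mulrA ler_wpM2r ?invr_ge0// ler_wpM2r ?exprn_ge0// mulrC ler_wpM2l//.
by rewrite -natrX ler_nat ltnW// ltn_expl.
Qed.

End power_series.

Section bessel.
Context {R : realType}.
Context (a : R).
Context (a0 : 0 < a).
Implicit Types (s x : R).

(** With [a = k^2 / 4] these are the coefficients of [J_0(k r)] as a series in [s = r^2]; in this
    variable there is no square root at the source. [S_coef] is the second series in [Y_0]. *)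
Definition J_coef (m : nat) : R := (-1) ^+ m * a ^+ m / m`!%:R ^+ 2.
Definition S_coef (m : nat) : R := (-1) ^+ m * harmonic_number m * a ^+ m / m`!%:R ^+ 2.

Lemma natr_fact_neq0 (m : nat) : m`!%:R != 0 :> R.
Proof. by rewrite pnatr_eq0 -lt0n fact_gt0. Qed.

Lemma harmonic_number_ge0 m : 0 <= harmonic_number m :> R.
Proof. by apply: sumr_ge0 => i _; rewrite invr_ge0. Qed.

(** Crude, but one of the two factorials in [S_coef] absorbs it. *)
Lemma harmonic_number_le m : harmonic_number m <= m`!%:R :> R.
Proof.
apply: (@le_trans _ _ m%:R); last first.
  by rewrite ler_nat; case: m => // m; rewrite factS leq_pmulr// fact_gt0.
rewrite /harmonic_number; elim: m => [|m IH]; first by rewrite big_geq.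
rewrite big_nat_recr//=; apply: (@le_trans _ _ (m%:R + 1)); last by rewrite natr1.
by apply: lerD => //; rewrite invf_le1 ?ltr0n// ler1n.
Qed.

Lemma harmonic_numberS m : harmonic_number m.+1 = harmonic_number m + m.+1%:R^-1 :> R.
Proof. by rewrite /harmonic_number big_nat_recr. Qed.

Lemma expbounded_J : expbounded J_coef.
Proof.
exists 1, a; split => //; split; first exact: ltW.
move=> n; rewrite mul1r /J_coef !normrM normrX normrN1 expr1n mul1r normrX.
rewrite (gtr0_norm a0) normfV normrX ger0_norm// expr2 invfM mulrA.
rewrite ler_piMr//; first by rewrite divr_ge0// exprn_ge0// ltW.
by rewrite invf_le1 ?ltr0n ?fact_gt0// ler1n fact_gt0.
Qed.

Lemma expbounded_S : expbounded S_coef.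
Proof.
exists 1, a; split => //; split; first exact: ltW.
move=> n; rewrite mul1r /S_coef !normrM normrX normrN1 expr1n mul1r normrX.
rewrite (gtr0_norm a0) normfV normrX !ger0_norm ?harmonic_number_ge0// expr2 invfM mulrA.
rewrite (_ : _ * _ * _ * _ = a ^+ n / n`!%:R * (harmonic_number n / n`!%:R)); last by ring.
rewrite ler_piMr//; first by rewrite divr_ge0// exprn_ge0// ltW.
by rewrite ler_pdivrMr ?ltr0n ?fact_gt0// mul1r harmonic_number_le.
Qed.

Definition Jn := psumn J_coef.
Definition Sn := psumn S_coef.

Lemma is_derive_Jn i s : is_derive s 1 (Jn i) (Jn i.+1 s).
Proof. exact: is_derive_psumn expbounded_J. Qed.

Lemma is_derive_Sn i s : is_derive s 1 (Sn i) (Sn i.+1 s).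
Proof. exact: is_derive_psumn expbounded_S. Qed.

(* The Bessel equation for J(s), s = r^2, in the form (s J')' = - a J. *)
Lemma is_derive_sJ s : is_derive s 1 (fun s => s * Jn 1 s) (- a * Jn 0 s).
Proof.
rewrite (_ : (fun s => _) = psum (fun n => n%:R * J_coef n)); last first.
  by apply/funext => y; rewrite -psum_mulX//; exact: expbounded_J.
apply: (is_derive_eq (is_derive_psum s (expbounded_scale_nat expbounded_J))).
rewrite /Jn /psumn/= -psum_scale; last exact: expbounded_J.
congr (psum _ s); apply/funext => n; rewrite /pseries_diffs /J_coef factS natrM !exprS.
by field; rewrite natr_fact_neq0 nat1r pnatr_eq0.
Qed.

(** The extra [Jn 1] comes from the increment [1 / (m + 1)] of the harmonic numbers; it cancels the
    cross term produced by differentiating the logarithm times [J_0]. *)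
Lemma is_derive_sS s : is_derive s 1 (fun s => s * Sn 1 s) (- a * Sn 0 s + Jn 1 s).
Proof.
rewrite (_ : (fun s => _) = psum (fun n => n%:R * S_coef n)); last first.
  by apply/funext => y; rewrite -psum_mulX//; exact: expbounded_S.
apply: (is_derive_eq (is_derive_psum s (expbounded_scale_nat expbounded_S))).
rewrite /Sn /Jn /psumn/= -psum_scale; last exact: expbounded_S.
rewrite -psum_add; last 2 first.
- move: expbounded_S => [M [A [M0 [A0 H]]]]; exists (a * M), A.
  split; first by rewrite mulr_ge0// ltW.
  by split => // n; rewrite normrM normrN (gtr0_norm a0) -!mulrA ler_pM2l// mulrA.
- exact: expbounded_diffs expbounded_J.
congr (psum _ s); apply/funext => n.
rewrite /pseries_diffs /S_coef /J_coef harmonic_numberS factS natrM !exprS.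
by field; rewrite natr_fact_neq0 nat1r pnatr_eq0.
Qed.

Lemma psum0 (c : R^nat) : psum c 0 = c 0%N.
Proof.
rewrite /psum; apply: cvg_lim => //; rewrite -cvg_shiftS.
rewrite (_ : (fun n => _) = (fun=> c 0%N)); first exact: cvg_cst.
apply/funext => n; rewrite /pseries /series/= big_nat_recl//= expr0 mulr1 big1 ?addr0//.
by move=> i _; rewrite exprS mul0r mulr0.
Qed.

Lemma Jn0 : Jn 0 0 = 1.
Proof. by rewrite /Jn /psumn /= psum0 /J_coef !expr0 fact0 expr1n !mul1r invr1. Qed.

Lemma Jn1_lt0 : Jn 1 0 < 0.
Proof.
rewrite /Jn /psumn /= psum0 /pseries_diffs /J_coef !expr1 (_ : 1`! = 1)%N//.
by rewrite expr1n !mul1r mulN1r divr1 oppr_lt0.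
Qed.

End bessel.

Section fundamental_solution.
Context {R : realType}.
Context (k : R).
Context (k0 : 0 < k).

Definition bessel_a : R := k ^+ 2 / 4.

Lemma bessel_a_gt0 : 0 < bessel_a.
Proof. by rewrite divr_gt0// exprn_gt0. Qed.

Definition log_cst : R := ln (k / 2) + euler_gamma.

(* -Y_0(k r)/4 as a function of s = r^2, the logarithm of s being replaced by m. *)
Definition Gfun (m s : R) : R :=
  - (2 * pi)^-1 * ((m / 2 + log_cst) * Jn bessel_a 0 s - Sn bessel_a 0 s).

Lemma bessel_J0E (r : R) : bessel_J0 (k * r) = Jn bessel_a 0 (r ^+ 2).
Proof.
rewrite /bessel_J0 /Jn /psumn /psum /=; congr (limn _); rewrite /pseries.
apply/funext => n; rewrite /series /=; apply: eq_bigr => i _.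
rewrite -mul2n exprM (_ : (k * r / 2) ^+ 2 = bessel_a * r ^+ 2); last by rewrite /bessel_a; field.
by rewrite exprMn /J_coef; ring.
Qed.

Lemma enorm_sqr (x : R * R) : enorm x ^+ 2 = x.1 ^+ 2 + x.2 ^+ 2.
Proof. by rewrite /enorm sqr_sqrtr// addr_ge0 ?sqr_ge0. Qed.

(** The real part of [i/4 (J + i Y)] is [- Y / 4]. The logarithm of [k r / 2] is split into
    [ln(r^2) / 2] and a constant, so that the whole singularity sits in the first argument of
    [Gfun]. *)
Lemma Re_incident (z x : R * R) : x != z ->
  complex.Re (incident_field k z x)
    = Gfun (ln (enorm (x - z) ^+ 2)) (enorm (x - z) ^+ 2).
Proof.
move=> xz.
have e0 : 0 < enorm (x - z).
  rewrite lt_neqAle eq_sym enorm_ge0 andbT; apply: contra xz => /eqP e.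
  have := enorm_sqr (x - z); rewrite e expr0n/= => /esym/eqP.
  rewrite paddr_eq0 ?sqr_ge0// !sqrf_eq0 /= => /andP[/eqP h1 /eqP h2].
  by apply/eqP; apply: injective_projections; apply/eqP; rewrite -subr_eq0; apply/eqP.
have -> : complex.Re (incident_field k z x) = - bessel_Y0 (k * enorm (x - z)) / 4.
  rewrite /incident_field /hankel0; move: (bessel_J0 _) (bessel_Y0 _) => J Y.
  rewrite (_ : 4 = (4 : R)%:C%C :> R[i]); last by rewrite rmorph_nat.
  rewrite -fmorphV /= mulrC. 
  rewrite /GRing.mul/= -[LHS]/(J * (0 * 4^-1 - 1 * 0) - (0 * 0 + 1 * 4^-1) * Y : R).
  by rewrite -[RHS]/(- Y / 4 : R); field.
rewrite /bessel_Y0 bessel_J0E /Gfun.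
have -> : ln (k * enorm (x - z) / 2) = ln (enorm (x - z) ^+ 2) / 2 + ln (k / 2).
  have e2 : ln (enorm (x - z) ^+ 2) = ln (enorm (x - z)) + ln (enorm (x - z)).
    by rewrite expr2 lnM ?posrE.
  have e1 : ln (k * enorm (x - z) / 2) = ln (enorm (x - z)) + ln (k / 2).
    rewrite (_ : k * enorm (x - z) / 2 = enorm (x - z) * (k / 2)); last by ring.
    by rewrite lnM// posrE divr_gt0.
  by rewrite e1 e2; field.
rewrite /log_cst -addrA.
have -> : limn (series (fun m => (-1) ^+ m * harmonic_number m / m`!%:R ^+ 2
    * (k * enorm (x - z) / 2) ^+ m.*2)) = Sn bessel_a 0 (enorm (x - z) ^+ 2).
  rewrite /Sn /psumn /psum /=; congr (limn _); rewrite /pseries.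
  apply/funext => n; rewrite /series /=; apply: eq_bigr => i _.
  rewrite -mul2n exprM (_ : (k * enorm (x - z) / 2) ^+ 2 = bessel_a * enorm (x - z) ^+ 2);
    last by rewrite /bessel_a; field.
  by rewrite exprMn /S_coef; ring.
by rewrite invfM; move: (pi^-1) => P; field.
Qed.

End fundamental_solution.

(** * The regularized point source *)

Section regularized.
Context {R : realType}.
Context (k : R).
Context (k0 : 0 < k).
Implicit Types (x z : R * R) (s t : R).

Definition qq x : R := x.1 ^+ 2 + x.2 ^+ 2.

Lemma qq_ge0 x : 0 <= qq x.
Proof. by rewrite addr_ge0 ?sqr_ge0. Qed.

Lemma is_derive_unique1 (f : R -> R) (c a b : R) : is_derive c 1 f a -> is_derive c 1 f b -> a = b.
Proof. by move=> [_ <-] [_ <-]. Qed.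

Lemma laplacian_radial (h h1 h2 : R -> R) x :
  (forall s, 0 <= s -> is_derive s 1 h (h1 s)) ->
  (forall s, 0 <= s -> is_derive s 1 h1 (h2 s)) ->
  d1 (d1 (fun y => h (qq y))) x + d2 (d2 (fun y => h (qq y))) x
    = 4 * (h1 (qq x) + qq x * h2 (qq x)).
Proof.
move=> dh dh1.
have dq1 (y : R * R) : is_derive y (1, 0) qq (2 * y.1).
  apply/is_derive_e1; rewrite /qq/=.
  apply: (is_derive_eq (is_deriveD1 (is_deriveX1 2 y.1) (is_derive_cst1 y.1 (y.2 ^+ 2)))).
  by rewrite addr0 expr1.
have dq2 (y : R * R) : is_derive y (0, 1) qq (2 * y.2).
  apply/is_derive_e2; rewrite /qq/=.
  apply: (is_derive_eq (is_deriveD1 (is_derive_cst1 y.2 (y.1 ^+ 2)) (is_deriveX1 2 y.2))).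
  by rewrite add0r expr1.
have E1 : d1 (fun y => h (qq y)) = fun y => 2 * y.1 * h1 (qq y).
  apply/funext => y; apply: is_derive_d1.
  exact: (is_derive_comp_e1 (dh _ (qq_ge0 y)) (dq1 y)).
have E2 : d2 (fun y => h (qq y)) = fun y => 2 * y.2 * h1 (qq y).
  apply/funext => y; apply: is_derive_d2.
  exact: (is_derive_comp_e2 (dh _ (qq_ge0 y)) (dq2 y)).
rewrite E1 E2.
have F1 : d1 (fun y : R * R => 2 * y.1 * h1 (qq y)) x = 2 * h1 (qq x) + 2 * x.1 * (2 * x.1 * h2 (qq x)).
  apply: is_derive_d1; apply: is_deriveM_fun.
    apply/is_derive_e1 => /=; apply: (is_derive_eq (is_deriveZ1 2 (is_derive_id1 x.1))).
    by rewrite mulr1.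
  exact: (is_derive_comp_e1 (dh1 _ (qq_ge0 x)) (dq1 x)).
have F2 : d2 (fun y : R * R => 2 * y.2 * h1 (qq y)) x = 2 * h1 (qq x) + 2 * x.2 * (2 * x.2 * h2 (qq x)).
  apply: is_derive_d2; apply: is_deriveM_fun.
    apply/is_derive_e2 => /=; apply: (is_derive_eq (is_deriveZ1 2 (is_derive_id1 x.2))).
    by rewrite mulr1.
  exact: (is_derive_comp_e2 (dh1 _ (qq_ge0 x)) (dq2 x)).
by rewrite F1 F2 {3 6}/qq; ring.
Qed.

Context (al : R).
Context (al0 : 0 < al).

(** A smooth positive substitute for [s], equal to it for [s >= al]. Replacing [ln s] by
    [ln (ureg s)] makes the point source smooth and leaves it unchanged at distance at least
    [sqrt al]; [freg] is the resulting right-hand side, a smeared point mass. *)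
Definition ureg s : R := s + flatn 0 (al - s).
Definition ureg1 s : R := 1 - flatn 1 (al - s).
Definition Mreg s : R := ln (ureg s).
Definition M1reg s : R := ureg1 s / ureg s.
Definition M2reg s : R := flatn 2 (al - s) * (ureg s)^-1 + ureg1 s * (- (ureg s)^-2 * ureg1 s).
Definition Greg s : R := Gfun k (Mreg s) s.
Definition greg x : R := Greg (qq x).
(** What the Helmholtz operator leaves once the Bessel equations have been used, for a general
    substitute [M] of the logarithm. For [M = ln s] both [M' + s M''] and [s M' - 1] vanish. *)
Definition Freg s : R :=
  - (2 * pi)^-1 * (2 * (M1reg s + s * M2reg s) * Jn (bessel_a k) 0 s
     + 4 * (s * M1reg s - 1) * Jn (bessel_a k) 1 s).
Definition freg x : R := Freg (qq x).

Lemma ureg_gt0 s : 0 <= s -> 0 < ureg s.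
Proof.
move=> s0; rewrite /ureg; have [sal|sal] := ltP s al.
  by rewrite ltr_wpDl// flat0_gt0// subr_gt0.
by rewrite ltr_wpDr ?flat0_ge0// (lt_le_trans al0).
Qed.

Lemma is_derive_ureg s : is_derive s 1 ureg (ureg1 s).
Proof.
exact: (is_deriveD1 (is_derive_id1 s) (is_derive_reflect1 (is_derive_flatn 0 (al - s)))).
Qed.

Lemma is_derive_ureg1 s : is_derive s 1 ureg1 (flatn 2 (al - s)).
Proof.
apply: (is_derive_eq (is_deriveB1 (is_derive_cst1 s 1) (is_derive_reflect1 (is_derive_flatn 1 (al - s))))).
by rewrite sub0r opprK.
Qed.

Lemma is_derive_Mreg s : 0 <= s -> is_derive s 1 Mreg (M1reg s).
Proof.
move=> s0; apply: (is_derive_eq (is_derive_comp1 (is_derive1_ln (ureg_gt0 s0)) (is_derive_ureg s))).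
by rewrite mulrC.
Qed.

Lemma is_derive_M1reg s : 0 <= s -> is_derive s 1 M1reg (M2reg s).
Proof.
move=> s0; apply: is_deriveM1; first exact: is_derive_ureg1.
have u0 : ureg s != 0 by rewrite gt_eqF// ureg_gt0.
exact: (is_derive_comp1 (is_derive_inv u0) (is_derive_ureg s)).
Qed.

Let a0 := bessel_a_gt0 k0.

Definition G1reg s : R := - (2 * pi)^-1 *
  ((M1reg s / 2) * Jn (bessel_a k) 0 s + (Mreg s / 2 + log_cst k) * Jn (bessel_a k) 1 s
   - Sn (bessel_a k) 1 s).
Definition G2reg s : R := - (2 * pi)^-1 *
  ((M2reg s / 2) * Jn (bessel_a k) 0 s + (M1reg s / 2) * Jn (bessel_a k) 1 s
   + ((M1reg s / 2) * Jn (bessel_a k) 1 s + (Mreg s / 2 + log_cst k) * Jn (bessel_a k) 2 s)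
   - Sn (bessel_a k) 2 s).

Lemma is_derive_half (f : R -> R) (c a : R) : is_derive c 1 f a ->
  is_derive c 1 (fun t => f t / 2) (a / 2).
Proof.
move=> df; rewrite mulrC (_ : (fun t => _) = (fun t => 2^-1 * f t)).
  exact: is_deriveZ1.
by apply/funext => t; rewrite mulrC.
Qed.

Lemma is_derive_Mc s : 0 <= s -> is_derive s 1 (fun t => Mreg t / 2 + log_cst k) (M1reg s / 2).
Proof.
move=> s0; have := is_deriveD1 (is_derive_half (is_derive_Mreg s0)) (is_derive_cst1 s (log_cst k)).
by rewrite addr0.
Qed.

Lemma is_derive_Greg s : 0 <= s -> is_derive s 1 Greg (G1reg s).
Proof.
move=> s0; apply: is_deriveZ1; apply: is_deriveB1; last exact: is_derive_Sn.
by apply: is_deriveM1; [exact: is_derive_Mc|exact: is_derive_Jn].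
Qed.

Lemma is_derive_G1reg s : 0 <= s -> is_derive s 1 G1reg (G2reg s).
Proof.
move=> s0; apply: is_deriveZ1; apply: is_deriveB1; last exact: is_derive_Sn.
apply: is_deriveD1; apply: is_deriveM1; do ?exact: is_derive_Jn.
  by apply: is_derive_half; exact: is_derive_M1reg.
exact: is_derive_Mc.
Qed.

(** In the variable [s] the Laplacian is [4 (h' + s h'')]; the terms [s J''] and [s S''] are
    eliminated by the Bessel equations, and only derivatives of the substitute logarithm remain. *)
Lemma helmholtz_greg x : d1 (d1 greg) x + d2 (d2 greg) x + k ^+ 2 * greg x = freg x.
Proof.
have -> := laplacian_radial x is_derive_Greg is_derive_G1reg.
have s0 := qq_ge0 x; rewrite /freg /greg; move: (qq x) s0 => s s0.
have eJ : Jn (bessel_a k) 1 s + s * Jn (bessel_a k) 2 s = - bessel_a k * Jn (bessel_a k) 0 s.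
  apply: (is_derive_unique1 _ (is_derive_sJ a0 s)).
  have := is_deriveM1 (is_derive_id1 s) (is_derive_Jn a0 1 s).
  by rewrite mul1r.
have eS : Sn (bessel_a k) 1 s + s * Sn (bessel_a k) 2 s
    = - bessel_a k * Sn (bessel_a k) 0 s + Jn (bessel_a k) 1 s.
  apply: (is_derive_unique1 _ (is_derive_sS a0 s)).
  have := is_deriveM1 (is_derive_id1 s) (is_derive_Sn a0 1 s).
  by rewrite mul1r.
have ek : k ^+ 2 = 4 * bessel_a k by rewrite /bessel_a; field.
rewrite ek /Greg /Gfun /G1reg /G2reg /Freg; move: (bessel_a k) eJ eS => a eJ eS.
have eJ' : s * Jn a 2 s = - a * Jn a 0 s - Jn a 1 s by rewrite -eJ; ring.
have eS' : s * Sn a 2 s = - a * Sn a 0 s + Jn a 1 s - Sn a 1 s by rewrite -eS; ring.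
set ka := - _^-1.
rewrite [X in 4 * X](_ : _ = ka * ((M1reg s / 2) * Jn a 0 s + (Mreg s / 2 + log_cst k) * Jn a 1 s
   - Sn a 1 s + (s * M2reg s / 2) * Jn a 0 s + s * M1reg s * Jn a 1 s +
   (Mreg s / 2 + log_cst k) * (s * Jn a 2 s) - s * Sn a 2 s)); last by field.
by rewrite eJ' eS'; field.
Qed.

Lemma smooth_fst : smoothU setT (fst : R * R -> R).
Proof. by move=> n; exact: CkU_fst. Qed.

Lemma smooth_snd : smoothU setT (snd : R * R -> R).
Proof. by move=> n; exact: CkU_snd. Qed.

Lemma smooth_qq : smoothU setT qq.
Proof.
have oT := @openT (R * R)%type.
by apply: smoothU_add => //; apply: (smoothU_mul oT (u := _) (v := _)); do ?exact: smooth_fst; exact: smooth_snd.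
Qed.

Lemma smooth_greg : smoothU setT greg.
Proof.
have oT := @openT (R * R)%type.
have sq := smooth_qq.
have su : smoothU setT (fun x => ureg (qq x)).
  apply: smoothU_add => //; apply: smoothU_flat => //.
  by apply: smoothU_sub => //; exact: smoothU_cst.
have sM : smoothU setT (fun x => Mreg (qq x)).
  by apply: (smoothU_ln oT su) => x _; exact/ureg_gt0/qq_ge0.
have sJ : smoothU setT (fun x => Jn (bessel_a k) 0 (qq x)).
  move=> n; apply: (@CkU_comp _ setT setT n (Jn (bessel_a k)) qq oT) => //.
  by move=> i t _; exact: is_derive_Jn.
have sS : smoothU setT (fun x => Sn (bessel_a k) 0 (qq x)).
  move=> n; apply: (@CkU_comp _ setT setT n (Sn (bessel_a k)) qq oT) => //.
  by move=> i t _; exact: is_derive_Sn.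
apply: smoothU_mul => //; first exact: smoothU_cst.
apply: smoothU_sub => //; apply: smoothU_mul => //.
apply: smoothU_add => //; last exact: smoothU_cst.
by apply: smoothU_mul => //; exact: smoothU_cst.
Qed.

Lemma continuous_freg : continuous freg.
Proof.
have S := smooth_greg.
rewrite (_ : freg = fun x => d1 (d1 greg) x + d2 (d2 greg) x + k ^+ 2 * greg x); last first.
  by apply/funext => x; rewrite helmholtz_greg.
move=> x; apply: cvgD.
  apply: cvgD; first exact: (CkU_cont (smoothU_d1 (smoothU_d1 S) 0%N) Logic.I).
  exact: (CkU_cont (smoothU_d2 (smoothU_d2 S) 0%N) Logic.I).
by apply: cvgMr; exact: (CkU_cont (S 0%N) Logic.I).
Qed.

Lemma greg_out x : al <= qq x -> greg x = Gfun k (ln (qq x)) (qq x).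
Proof.
move=> alx; rewrite /greg /Greg /Mreg /ureg.
have F : flatn 0 (al - qq x) = 0 by rewrite /flatn flat_le0// subr_le0.
by rewrite F addr0.
Qed.

Lemma freg_out x : al <= qq x -> freg x = 0.
Proof.
move=> alx; rewrite /freg /Freg /M1reg /M2reg /ureg /ureg1.
have F i : flatn i (al - qq x) = 0 by rewrite /flatn flat_le0// subr_le0.
have q0 : qq x != 0 by rewrite gt_eqF// (lt_le_trans al0).
by rewrite !F addr0; move: (_^-1) => P; field.
Qed.

(** Conditions that fix every sign in [Freg]: convexity of the flat function, monotonicity of
    [ureg], and the signs of [J] and [J'] near 0. *)
Definition small_al := [/\ al <= 2^-1, forall t, t <= al -> flatn 1 t <= 1 &
  forall s, 0 <= s <= al -> 0 < Jn (bessel_a k) 0 s /\ Jn (bessel_a k) 1 s < 0].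

(** In the bracket, [(s M')' >= 0] multiplies a positive [J], and [s M' - 1 <= 0] multiplies a
    negative [J']. A constant sign lets the source act as an approximate identity without control of
    its absolute value. *)
Lemma freg_le0 x : small_al -> freg x <= 0.
Proof.
move=> [al2 f1 HJ]; have [alx|alx] := leP al (qq x); first by rewrite freg_out.
have s0 := qq_ge0 x; rewrite /freg /Freg; move: (qq x) s0 alx => s s0 sal.
have := HJ s; rewrite s0 (ltW sal) => /(_ isT)[J0 J1].
have u0 := ureg_gt0 s0.
have ts : al - s <= al by rewrite gerBl.
have u1 : 0 <= ureg1 s by rewrite subr_ge0 f1.
have f2 : 0 <= flatn 2 (al - s) by apply: flat2_ge0; exact: le_trans al2.
have f1p := flat1_ge0 (al - s).
have f0p := flat0_ge0 (al - s).
(* The sign is read off after putting everything over [ureg^2], since [ureg - s ureg1] is the sum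
   [flatn 0 + s flatn 1] at [al - s]. *)
have SS : 0 <= M1reg s + s * M2reg s.
  rewrite (_ : _ + _ = (ureg1 s * (flatn 0 (al - s) + s * flatn 1 (al - s))
     + s * flatn 2 (al - s) * ureg s) / ureg s ^+ 2); last first.
    rewrite /M1reg /M2reg; have un : ureg s != 0 by rewrite gt_eqF.
    have -> : flatn 0 (al - s) + s * flatn 1 (al - s) = ureg s - s * ureg1 s.
      by rewrite /ureg /ureg1; ring.
    by field.
  apply: divr_ge0; last exact: sqr_ge0.
  apply: addr_ge0; first by apply: mulr_ge0 => //; apply: addr_ge0 => //; exact: mulr_ge0.
  by apply: mulr_ge0; [exact: mulr_ge0|exact: ltW].
have S1 : s * M1reg s - 1 <= 0.
  rewrite subr_le0 /M1reg mulrA ler_pdivrMr// mul1r /ureg /ureg1 mulrBr mulr1.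
  by rewrite lerD2l; apply: (@le_trans _ _ 0) => //; rewrite oppr_le0 mulr_ge0.
rewrite mulNr oppr_le0; apply: mulr_ge0; first by rewrite invr_ge0 mulr_ge0// pi_ge0.
apply: addr_ge0; first by rewrite mulr_ge0 ?(ltW J0)// mulr_ge0.
by apply: mulr_le0; [rewrite pmulr_rle0|exact: ltW].
Qed.

Lemma freg0 : small_al -> freg 0 < 0.
Proof.
move=> [al2 f1 HJ]; rewrite /freg /qq/= expr0n/= addr0 /Freg !mul0r addr0 sub0r.
have := HJ 0; rewrite lexx (ltW al0) => /(_ isT)[J0 J1].
rewrite mulNr oppr_lt0 mulr_gt0//; first by rewrite invr_gt0 mulr_gt0// pi_gt0.
rewrite ltr_wpDl//.
  rewrite mulr_ge0 ?(ltW J0)// mulr_ge0//.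
  by rewrite /M1reg divr_ge0// ?subr_ge0 ?f1 ?subr0// ltW// ureg_gt0.
by rewrite mulrN1 mulNr oppr_gt0 pmulr_rlt0.
Qed.

End regularized.

Section small_exists.
Context {R : realType}.
Implicit Types (k al : R).

Lemma small_al_exists k : 0 < k -> exists2 al0, 0 < al0 & forall al, 0 < al <= al0 -> small_al k al.
Proof.
move=> k0; have a0 := bessel_a_gt0 k0.
have c0 := is_derive_cont (is_derive_Jn a0 0 0).
have c1 := is_derive_cont (is_derive_Jn a0 1 0).
have h0 : 0 < Jn (bessel_a k) 0 0 by rewrite Jn0.
have h1 := Jn1_lt0 a0.
have n0 : \forall s \near 0, 0 < Jn (bessel_a k) 0 s 
  by move/cvgrPdist_lt: c0 => /(_ _ h0); apply: filterS => s; rewrite ltr_norml; lra.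
have n1 : \forall s \near 0, Jn (bessel_a k) 1 s < 0.
  have h1' : 0 < - Jn (bessel_a k) 1 0 by rewrite oppr_gt0.
  by move/cvgrPdist_lt: c1 => /(_ _ h1'); apply: filterS => s; rewrite ltr_norml; lra.
have n01 : nbhs (0 : R) (fun s => 0 < Jn (bessel_a k) 0 s /\ Jn (bessel_a k) 1 s < 0).
  exact: filterI.
move/nbhs_ballP: n01 => [d d0 Hd].
have [C C0 HC] := @flat_small R (iter 1 flat_next 1).
(* The entry [(C + 1)^-1] turns the bound [C t^2] for [flatn 1] into the bound 1; [d / 2] keeps [s]
   where [J] and [J'] have their signs. *)
exists (Num.min (2^-1) (Num.min (d / 2) (C + 1)^-1)).
  by rewrite !lt_min invr_gt0 ltr0n/= divr_gt0//= invr_gt0 ltr_wpDl.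
move=> al; rewrite !le_min => /andP[al0 /and3P[al2 ald alC]]; split => //.
  move=> t tal; have [t0|t0] := leP t 0; first by rewrite /flatn flat_le0.
  apply: le_trans (ler_norm _) _.
  have t1 : t <= 1 by lra.
  apply: (le_trans (HC t t1)).
  have tC : t <= (C + 1)^-1 by exact: le_trans alC.
  have : t * (C + 1) <= 1 by rewrite -ler_pdivlMr ?mul1r// ltr_wpDl.
  nra.
move=> s /andP[s0 sal]; apply: Hd; rewrite /ball/= sub0r normrN ger0_norm//.
have d0' : 0 < d := d0.
by apply: le_lt_trans (le_trans sal ald) _; lra.
Qed.

End small_exists.

(** * Real analytic functions of two variables *)

Section analytic.
Context {R : realType}.
Implicit Types (f : R * R -> R) (a : nat -> nat -> R) (h p : R * R) (r s t x rho : R).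

Lemma norm_lim_le (u : R^nat) (l B : R) : u @ \oo --> l -> (forall n, `|u n| <= B) -> `|l| <= B.
Proof.
move=> ul uB; have nc : `|u n| @[n --> \oo] --> `|l| by exact: cvg_norm.
rewrite -(cvg_lim _ nc)//; apply: limr_le; first by apply/cvg_ex; eexists; exact: nc.
exact: nearW.
Qed.

(** The homogeneous part of degree [n]; [ablk] majorizes it on the square of half-side [rho]. *)
Definition blk a (n : nat) h : R :=
  \sum_(0 <= i < n.+1) a i (n - i)%N * h.1 ^+ i * h.2 ^+ (n - i).

Definition ablk a (n : nat) (rho : R) : R :=
  \sum_(0 <= i < n.+1) `|a i (n - i)%N| * rho ^+ n.

Lemma pow_pair (h : R * R) (rho : R) (n i : nat) : `|h.1| <= rho -> `|h.2| <= rho -> (i <= n)%N ->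
  `|h.1| ^+ i * `|h.2| ^+ (n - i) <= rho ^+ n.
Proof.
move=> h1 h2 i_n; have r0 : 0 <= rho by exact: le_trans h1.
rewrite -{2}(subnKC i_n) exprD; apply: ler_pM; rewrite ?exprn_ge0//.
  by apply: lerXn2r => //; rewrite nnegrE.
by apply: lerXn2r => //; rewrite nnegrE.
Qed.

Lemma blk_le_ablk a n h rho : `|h.1| <= rho -> `|h.2| <= rho ->
  \sum_(0 <= i < n.+1) `|a i (n - i)%N * h.1 ^+ i * h.2 ^+ (n - i)| <= ablk a n rho.
Proof.
move=> h1 h2; rewrite /ablk big_nat [leRHS]big_nat; apply: ler_sum => i /andP[_ i_n].
rewrite !normrM !normrX -mulrA; apply: ler_wpM2l => //.
exact: pow_pair.
Qed.

Lemma norm_blk_le a n h rho : `|h.1| <= rho -> `|h.2| <= rho -> `|blk a n h| <= ablk a n rho.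
Proof.
by move=> h1 h2; apply: le_trans (ler_norm_sum _ _ _) _; exact: blk_le_ablk.
Qed.

Lemma ablk_scale a n s rho : s != 0 -> ablk a n rho = ablk a n s * (rho / s) ^+ n.
Proof.
move=> s0; rewrite /ablk mulr_suml; apply: eq_bigr => i _.
by rewrite -mulrA -exprMn mulrCA mulfV// mulr1.
Qed.

(** Absolute convergence at the single diagonal point [(r/4, r/4)], of norm less than [r], bounds
    all homogeneous parts on a square. *)
Lemma analytic2_bound f p : analytic2_at f p -> exists a s M, [/\ 0 < s, 0 <= M,
  forall n, ablk a n s <= M &
  forall h, `|h.1| <= s -> `|h.2| <= s -> series (fun n => blk a n h) @ \oo --> f (p + h)].
Proof.
move=> [a [r [r0 H]]]; have s0 : 0 < r / 4 by lra.
have small h : `|h.1| <= r / 4 -> `|h.2| <= r / 4 -> enorm h < r.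
  by move=> h1 h2; apply: le_lt_trans (enorm_le_abs h) _; lra.
have nr : `|r / 4| <= r / 4 by rewrite ger0_norm// ltW.
have [cA _] := H (r / 4, r / 4) (small (r / 4, r / 4) nr nr).
have [M [Mr HM]] := cvg_series_bounded cA.
exists a, (r / 4), (`|M| + 1); split => //.
- move=> n; have Mlt : M < `|M| + 1 by apply: le_lt_trans (ler_norm M) _; rewrite ltrDl.
  have HMn := HM _ Mlt n Logic.I; rewrite /= in HMn; apply: le_trans HMn.
  rewrite ger0_norm; last by apply: sumr_ge0.
  rewrite /ablk; apply: ler_sum_nat => i /andP[_ i_n].
  rewrite !normrM !normrX (ger0_norm (ltW s0)) -mulrA; apply: ler_wpM2l => //.
  by rewrite -exprD subnKC.
- by move=> h h1 h2; have [_] := H h (small h h1 h2).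
Qed.

(** Second-order remainder of a power with the explicit loss [i^2]; the factor [rho^2] on the left
    avoids negative exponents. *)
Lemma pow_quad x t rho (i : nat) : 0 < rho -> `|x| <= rho -> `|x + t| <= rho ->
  rho ^+ 2 * `|(x + t) ^+ i - x ^+ i - i%:R * x ^+ i.-1 * t| <= i%:R ^+ 2 * t ^+ 2 * rho ^+ i.
Proof.
move=> r0 xr xtr; elim: i => [|i IH].
  by rewrite !expr0 subrr mul0r mul0r subrr normr0 mulr0 expr0n !mul0r.
have E : (x + t) ^+ i.+1 - x ^+ i.+1 - i.+1%:R * x ^+ i.+1.-1 * t =
    (x + t) * ((x + t) ^+ i - x ^+ i - i%:R * x ^+ i.-1 * t) + i%:R * x ^+ i.-1 * t ^+ 2.
  case: i {IH} => [|i] /=; first by rewrite !expr0 !expr1; ring.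
  by rewrite -[i.+2%:R]natr1 !exprS; ring.
rewrite E; apply: (@le_trans _ _ (rho * (i%:R ^+ 2 * t ^+ 2 * rho ^+ i) + i%:R * rho ^+ i.+1 * t ^+ 2)).
  apply: (@le_trans _ _ (rho ^+ 2 * (rho * `|(x + t) ^+ i - x ^+ i - i%:R * x ^+ i.-1 * t|
     + i%:R * `|x| ^+ i.-1 * t ^+ 2))).
    apply: ler_wpM2l; first exact: sqr_ge0.
    apply: (le_trans (ler_normD _ _)); apply: lerD; first by rewrite normrM ler_wpM2r.
    have Et : `|t ^+ 2| = t ^+ 2 by rewrite ger0_norm ?sqr_ge0.
    by rewrite normrM Et normrM normrX ger0_norm.
  rewrite mulrDr; apply: lerD.
    by rewrite mulrCA ler_wpM2l// ltW.
  case: i {IH E} => [|i]; first by rewrite !mul0r mulr0.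
  rewrite /= mulrA ler_wpM2r ?sqr_ge0// mulrCA ler_wpM2l//.
  rewrite [leRHS](_ : _ = rho ^+ 2 * rho ^+ i); last by rewrite -exprD.
  by rewrite ler_wpM2l ?sqr_ge0//; apply: lerXn2r => //; rewrite nnegrE// ltW.
rewrite [leLHS](_ : _ = (i%:R ^+ 2 + i%:R) * (t ^+ 2 * rho ^+ i.+1)); last by rewrite (exprS rho i); ring.
rewrite [leRHS](_ : _ = i.+1%:R ^+ 2 * (t ^+ 2 * rho ^+ i.+1)); last by ring.
apply: ler_wpM2r; first by rewrite mulr_ge0 ?sqr_ge0// exprn_ge0// ltW.
by rewrite -natr1 sqrrD1; have := ler0n R i; lra.
Qed.

Lemma sqr_le_pow2 (n : nat) : (n ^ 2 <= 2 * 2 ^ n)%N.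
Proof.
have H m : (2 * m + 5 <= 2 * 2 ^ m.+2)%N.
  by elim: m => [//|m IH]; rewrite expnS; lia.
case: n => [//|[//|n]]; elim: n => [//|n IH].
have := H n; have -> : (n.+3 ^ 2 = n.+2 ^ 2 + (2 * n + 5))%N by rewrite -!mulnn; lia.
rewrite [(2 ^ n.+3)%N]expnS; lia.
Qed.

(** Reducing the radius by 4 pays for the quadratic loss of termwise differentiation and still
    leaves a geometric series. *)
Lemma ratio_bound (n : nat) : (n%:R ^+ 2 * (4^-1) ^+ n <= 2 * 2^-1 ^+ n :> R).
Proof.
have -> : 4^-1 = 2^-1 * 2^-1 :> R by rewrite -invfM; congr (_^-1); ring.
rewrite exprMn mulrA ler_wpM2r ?exprn_ge0// exprVn ler_pdivrMr ?exprn_gt0//.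
by rewrite -!natrX -natrM ler_nat sqr_le_pow2.
Qed.

Definition dcoef a (i j : nat) : R := i.+1%:R * a i.+1 j.

(* Summed over n, this differentiates a double power series termwise. *)
Lemma blk_quad a n h t rho : 0 < rho -> `|h.1| <= rho -> `|h.1 + t| <= rho -> `|h.2| <= rho ->
  rho ^+ 2 * `|blk a n.+1 (h.1 + t, h.2) - blk a n.+1 h - blk (dcoef a) n h * t|
    <= n.+1%:R ^+ 2 * t ^+ 2 * ablk a n.+1 rho.
Proof.
move=> r0 h1 h1t h2.
have -> : blk (dcoef a) n h * t = \sum_(0 <= i < n.+2) a i (n.+1 - i)%N * (i%:R * h.1 ^+ i.-1 * t) * h.2 ^+ (n.+1 - i).
  rewrite [RHS]big_nat_recl//= !mul0r mulr0 mul0r add0r /blk mulr_suml.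
  by apply: eq_bigr => i _; rewrite /dcoef subSS; ring.
rewrite /blk -!sumrB; apply: (@le_trans _ _ (\sum_(0 <= i < n.+2) `|a i (n.+1 - i)%N| *
   (rho ^+ 2 * `|(h.1 + t) ^+ i - h.1 ^+ i - i%:R * h.1 ^+ i.-1 * t|) * `|h.2| ^+ (n.+1 - i))).
  apply: (@le_trans _ _ (rho ^+ 2 * \sum_(0 <= i < n.+2) `|a i (n.+1 - i)%N| *
   `|(h.1 + t) ^+ i - h.1 ^+ i - i%:R * h.1 ^+ i.-1 * t| * `|h.2| ^+ (n.+1 - i))); last first.
    by rewrite mulr_sumr; apply: ler_sum => i _; rewrite le_eqVlt; apply/orP; left; apply/eqP; ring.
  apply: ler_wpM2l; first exact: sqr_ge0.
  apply: (le_trans (ler_norm_sum _ _ _)); apply: ler_sum => i _.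
  by rewrite -normrX -!normrM /= le_eqVlt; apply/orP; left; apply/eqP; congr (`|_|); ring.
rewrite /ablk mulr_sumr big_nat [leRHS]big_nat; apply: ler_sum => i /andP[_ i_n].
apply: (@le_trans _ _ (`|a i (n.+1 - i)%N| * (i%:R ^+ 2 * t ^+ 2 * rho ^+ i) * rho ^+ (n.+1 - i))).
  apply: ler_pM => //.
  - by rewrite mulr_ge0// mulr_ge0// sqr_ge0.
  - by apply: ler_wpM2l => //; exact: pow_quad.
  - by apply: lerXn2r => //; rewrite nnegrE// ltW.
rewrite [leLHS](_ : _ = i%:R ^+ 2 * (t ^+ 2 * (`|a i (n.+1 - i)%N| * rho ^+ n.+1))); last first.
  have E : rho ^+ n.+1 = rho ^+ i * rho ^+ (n.+1 - i) by rewrite -exprD subnKC.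
  by rewrite E; ring.
rewrite -[leRHS]mulrA; apply: ler_wpM2r.
  by rewrite mulr_ge0 ?sqr_ge0// mulr_ge0// exprn_ge0// ltW.
by apply: lerXn2r; rewrite ?nnegrE// ler_nat.
Qed.

Lemma ablk_dcoef a n rho : 0 < rho -> ablk (dcoef a) n rho <= n.+1%:R / rho * ablk a n.+1 rho.
Proof.
move=> r0; rewrite /ablk [X in _ <= _ * X]big_nat_recl//= mulrDr.
apply: (@le_trans _ _ (n.+1%:R / rho * \sum_(0 <= i < n.+1) `|a i.+1 (n.+1 - i.+1)%N| * rho ^+ n.+1)); last first.
  by rewrite lerDr mulr_ge0// ?divr_ge0// ?(ltW r0)// mulr_ge0// exprn_ge0// ltW.
rewrite mulr_sumr big_nat [leRHS]big_nat; apply: ler_sum => i /andP[_ i_n].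
rewrite /dcoef normrM ger0_norm// subSS exprS.
rewrite [leRHS](_ : _ = n.+1%:R * `|a i.+1 (n - i)%N| * rho ^+ n); last first.
  by field; rewrite gt_eqF.
by apply: ler_wpM2r; [rewrite exprn_ge0// ltW|apply: ler_wpM2r => //; rewrite ler_nat].
Qed.

Lemma sum_half_le N : \sum_(0 <= n < N) 2^-1 ^+ n <= 2 :> R.
Proof.
suff -> : \sum_(0 <= n < N) 2^-1 ^+ n = 2 - 2 * 2^-1 ^+ N :> R by rewrite gerBl mulr_ge0.
elim: N => [|N IH]; first by rewrite big_geq// expr0; ring.
by rewrite big_nat_recr//= IH exprS; field.
Qed.

(** Termwise differentiation on the square of half-side [rho = s / 4]: the sum of the quadratic
    errors of all blocks converges, so [is_derive_quad] identifies the derivative. *)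
Lemma analytic2_d1 f p : analytic2_at f p ->
  [/\ {for p, continuous f}, derivable f p (1, 0) & analytic2_at (d1 f) p].
Proof.
move=> /analytic2_bound[a [s [M [s0 M0 HM Hf]]]].
pose rho := s / 4; have rho0 : 0 < rho by rewrite /rho; lra.
have rs : rho / s = 4^-1 by rewrite /rho; field; rewrite gt_eqF.
have sn : s != 0 by rewrite gt_eqF.
have abM n x : 0 <= x -> ablk a n x <= M * (x / s) ^+ n.
  by move=> x0; rewrite (ablk_scale a n x sn) ler_wpM2r// exprn_ge0// divr_ge0// ltW.
have dab n : ablk (dcoef a) n rho <= 2 * M / rho * 2^-1 ^+ n.
  apply: (le_trans (ablk_dcoef a n rho0)).
  apply: (@le_trans _ _ (n.+1%:R / rho * (M * 4^-1 ^+ n.+1))).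
    by apply: ler_wpM2l; [rewrite divr_ge0// ltW|rewrite -rs abM// ltW].
  rewrite [leLHS](_ : _ = M / rho * (n.+1%:R * 4^-1 ^+ n.+1)); last by field; rewrite gt_eqF.
  rewrite [leRHS](_ : _ = M / rho * (2 * 2^-1 ^+ n)); last by field; rewrite gt_eqF.
  apply: ler_wpM2l; first by rewrite divr_ge0// ltW.
  apply: (@le_trans _ _ (2 * 2^-1 ^+ n.+1)); last first.
    by rewrite exprS ler_wpM2l// ler_piMl ?exprn_ge0// invf_le1// ler1n.
  apply: le_trans (ratio_bound n.+1); apply: ler_wpM2r; first by rewrite exprn_ge0.
  by rewrite ler_eXnr// ler1n.
have cvd h : `|h.1| <= rho -> `|h.2| <= rho ->
    cvgn (series (fun n => \sum_(0 <= i < n.+1) `|dcoef a i (n - i)%N * h.1 ^+ i * h.2 ^+ (n - i)|)).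
  move=> h1 h2; apply: (@series_le_cvg _ _ (geometric (2 * M / rho) 2^-1)).
  - by move=> n; apply: sumr_ge0.
  - by move=> n; rewrite /geometric/= mulr_ge0// ?exprn_ge0// divr_ge0// ?mulr_ge0// ltW.
  - by move=> n; apply: (le_trans (blk_le_ablk _ n h1 h2)); exact: dab.
  - by apply: is_cvg_geometric_series; rewrite ger0_norm// invf_lt1// ltr1n.
have cvb h : `|h.1| <= rho -> `|h.2| <= rho -> cvgn (series (blk (dcoef a) ^~ h)).
  move=> h1 h2; apply: normed_cvg; apply: (series_le_cvg _ _ _ (cvd h h1 h2)).
  - by move=> n /=.
  - by move=> n; apply: sumr_ge0.
  - by move=> n; exact: ler_norm_sum.
have dF h : `|h.1| < rho / 2 -> `|h.2| < rho / 2 ->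
    is_derive (p + h) (1, 0) f (limn (series (blk (dcoef a) ^~ h))).
  move=> h1 h2; apply/is_derive_e1.
  have h1r : `|h.1| <= rho by lra.
  have h2r : `|h.2| <= rho by lra.
  have rles : rho <= s by rewrite /rho; lra.
  apply: (@is_derive_quad _ _ _ _ (4 * M / rho ^+ 2) (rho / 2)); first by lra.
  move=> t tr /=.
  have h1t : `|h.1 + t| <= rho by apply: (le_trans (ler_normD _ _)); lra.
  have -> : ((p.1 + h.1 + t, p.2 + h.2) = p + (h.1 + t, h.2)) by apply: injective_projections => //=; rewrite addrA.
  rewrite -[(p.1 + h.1, p.2 + h.2)]/(p + h).
  have c1 : series (fun n => blk a n (h.1 + t, h.2)) @ \oo --> f (p + (h.1 + t, h.2)).
    by apply: Hf => /=; exact: le_trans rles.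
  have c2 : series (fun n => blk a n h) @ \oo --> f (p + h).
    by apply: Hf => /=; exact: le_trans rles.
  have c3 := cvb h h1r h2r.
  (* Block [n] of the derivative comes from block [n + 1] of the series, so [N + 1] terms of the
     latter are compared with [N] terms of the former. *)
  have c123 : (fun N => series (fun n => blk a n (h.1 + t, h.2)) N.+1 - series (fun n => blk a n h) N.+1
      - series (blk (dcoef a) ^~ h) N * t) @ \oo -->
      f (p + (h.1 + t, h.2)) - f (p + h) - limn (series (blk (dcoef a) ^~ h)) * t.
    apply: cvgB; first apply: cvgB.
    - by move: c1; rewrite -cvg_shiftS.
    - by move: c2; rewrite -cvg_shiftS.
    - by apply: cvgMl; exact: c3.
  apply: (norm_lim_le c123) => N.
  rewrite /series /= !(big_nat_recl N)//= /blk !big_nat1 /= !expr0 !mulr1.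
  rewrite (_ : _ - _ = \sum_(0 <= n < N) (blk a n.+1 (h.1 + t, h.2) - blk a n.+1 h - blk (dcoef a) n h * t)); last first.
    by rewrite !sumrB -mulr_suml /blk; ring.
  apply: (le_trans (ler_norm_sum _ _ _)).
  apply: (@le_trans _ _ (\sum_(0 <= n < N) 2 * M / rho ^+ 2 * t ^+ 2 * 2^-1 ^+ n)).
    apply: ler_sum => n _.
    rewrite [leRHS](_ : _ = (t ^+ 2 * (2 * M * 2^-1 ^+ n)) / rho ^+ 2); last by field; rewrite gt_eqF.
    rewrite ler_pdivlMr ?exprn_gt0// mulrC.
    apply: (le_trans (blk_quad a n rho0 h1r h1t h2r)).
    rewrite mulrAC mulrC; apply: ler_wpM2l; first exact: sqr_ge0.
    apply: (@le_trans _ _ (n.+1%:R ^+ 2 * (M * 4^-1 ^+ n.+1))).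
      by apply: ler_wpM2l; [exact: sqr_ge0|rewrite -rs abM// ltW].
    rewrite mulrCA [leRHS](_ : _ = M * (2 * 2^-1 ^+ n)); last by ring.
    apply: ler_wpM2l => //; apply: (le_trans (ratio_bound n.+1)).
    by rewrite exprS ler_wpM2l// ler_piMl ?exprn_ge0// invf_le1// ler1n.
  rewrite -mulr_sumr [leRHS](_ : _ = 2 * M / rho ^+ 2 * t ^+ 2 * 2); last by ring.
  apply: ler_wpM2l; last exact: sum_half_le.
  by rewrite mulr_ge0 ?sqr_ge0// divr_ge0 ?sqr_ge0// mulr_ge0.
split.
- apply/cvgrPdist_le => e e0; apply/nbhs_boxP.
  (* On the square of half-side [d] the blocks of positive degree sum to at most [2 M d / s], which
     the second entry makes smaller than [e]. *)
  pose d := Num.min (s / 2) (e * s / (2 * (M + 1))).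
  have M1 : 0 < M + 1 by lra.
  have d0 : 0 < d by rewrite lt_min; apply/andP; split; [lra|rewrite divr_gt0// ?mulr_gt0//; lra].
  exists d => // y [y1 y2]; rewrite distrC.
  have dl1 : d <= s / 2 by rewrite ge_min lexx.
  have dl2 : d <= e * s / (2 * (M + 1)) by rewrite ge_min lexx orbT.
  pose h := y - p; have hy : y = p + h by rewrite addrC subrK.
  have h1 : `|h.1| <= d by exact: ltW.
  have h2 : `|h.2| <= d by exact: ltW.
  have ds : d <= s by lra.
  have c1 := Hf h (le_trans h1 ds) (le_trans h2 ds).
  have c0 : series (fun n => blk a n 0) @ \oo --> f p.
    by have := Hf 0; rewrite addr0; apply; rewrite /= normr0 ltW.
  have a00 : f p = a 0%N 0%N.
    rewrite -(cvg_lim _ c0)//; apply: cvg_lim => //; rewrite -cvg_shiftS.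
    rewrite (_ : (fun n => _) = (fun=> a 0%N 0%N)); first exact: cvg_cst.
    apply/funext => n; rewrite /series /= big_nat_recl//= big1 ?addr0.
      by rewrite /blk big_nat1 !expr0 !mulr1.
    move=> i _; rewrite /blk big_nat big1// => j /andP[_ jn].
    have [->|j0] := eqVneq j 0%N; first by rewrite subn0 [_ ^+ i.+1]exprS mul0r mulr0.
    by case: j j0 jn => // j _ _; rewrite [_ ^+ j.+1]exprS mul0r mulr0 mul0r.
  have c2 : (fun n => series (fun n => blk a n h) n.+1 - f p) @ \oo --> f (p + h) - f p.
    by apply: cvgB; [move: c1; rewrite -cvg_shiftS|exact: cvg_cst].
  rewrite hy; apply: (norm_lim_le c2) => N; rewrite /series /= big_nat_recl//= {1}/blk big_nat1 /= !expr0 !mulr1 -a00.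
  rewrite addrAC subrr add0r; apply: (le_trans (ler_norm_sum _ _ _)).
  apply: (@le_trans _ _ (\sum_(0 <= n < N) M * (d / s) * 2^-1 ^+ n)).
    apply: ler_sum => n _; apply: (le_trans (norm_blk_le _ _ h1 h2)).
    apply: (le_trans (abM _ _ (ltW d0))).
    rewrite -mulrA; apply: ler_wpM2l => //; rewrite exprS; apply: ler_wpM2l.
      by rewrite divr_ge0// ltW.
    apply: lerXn2r; rewrite ?nnegrE//; first by rewrite divr_ge0// ltW.
    by rewrite ler_pdivrMr//; lra.
  rewrite -mulr_sumr; apply: (@le_trans _ _ (M * (d / s) * 2)).
    apply: ler_wpM2l; last exact: sum_half_le.
    by rewrite mulr_ge0// divr_ge0// ltW.
  rewrite mulrA mulrAC ler_pdivrMr//.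
  have : d * (2 * (M + 1)) <= e * s by rewrite -ler_pdivlMr// mulr_gt0.
  nra.
- by have [] := dF 0 _ _; rewrite ?addr0 //= normr0; lra.
- exists (dcoef a), (rho / 2); split; first by lra.
  move=> h hr.
  have h1 : `|h.1| < rho / 2 by exact: le_lt_trans (abs1_le_enorm h) hr.
  have h2 : `|h.2| < rho / 2 by exact: le_lt_trans (abs2_le_enorm h) hr.
  have h1r : `|h.1| <= rho by lra.
  have h2r : `|h.2| <= rho by lra.
  split; first exact: cvd.
  by rewrite (is_derive_d1 (dF h h1 h2)); exact: cvb.
Qed.

Lemma analytic2_swap f p : analytic2_at f p -> analytic2_at (f \o swp) (swp p).
Proof.
move=> [a [r [r0 H]]]; exists (fun i j => a j i), r; split => // h hr.
have sr : enorm (swp h) < r by rewrite /enorm addrC.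
have [c1 c2] := H (swp h) sr; split.
  rewrite (_ : (fun n => _) = (fun n : nat => \sum_(0 <= i < n.+1)
      `|a i (n - i)%N * (swp h).1 ^+ i * (swp h).2 ^+ (n - i)|))//.
  apply/funext => n.
  rewrite [LHS]big_nat_rev/= add0n big_nat [RHS]big_nat; apply: eq_bigr => i /andP[_ i_n].
  by rewrite subSS subKn//; congr (`|_|); ring.
rewrite /= (_ : swp (swp p + h) = p + swp h); last by case: (p) => ? ?; case: (h).
rewrite (_ : (fun n => _) = (fun n : nat => \sum_(0 <= i < n.+1)
    a i (n - i)%N * (swp h).1 ^+ i * (swp h).2 ^+ (n - i)))//.
apply/funext => n.
rewrite [LHS]big_nat_rev/= add0n big_nat [RHS]big_nat; apply: eq_bigr => i /andP[_ i_n].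
by rewrite subSS subKn//; ring.
Qed.

Lemma d1_line f (x : R * R) : d1 f x = 'D_1 (fun t => f (t, x.2)) x.1.
Proof.
have E : (fun h : R => h^-1 *: ((f \o shift x) (h *: (1, 0)) - f x)) =
    (fun h : R => h^-1 *: (((fun t => f (t, x.2)) \o shift x.1) (h *: (1 : R)) - f (x.1, x.2))).
  apply/funext => h /=; rewrite -surjective_pairing.
  congr (_ *: (f _ - f _)); apply: injective_projections => //=.
  by rewrite /GRing.scale/= mulr0 add0r.
by rewrite /d1 /derive E.
Qed.

Lemma d2_line f (x : R * R) : d2 f x = 'D_1 (fun t => f (x.1, t)) x.2.
Proof.
have E : (fun h : R => h^-1 *: ((f \o shift x) (h *: (0, 1)) - f x)) =
    (fun h : R => h^-1 *: (((fun t => f (x.1, t)) \o shift x.2) (h *: (1 : R)) - f (x.1, x.2))).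
  apply/funext => h /=; rewrite -surjective_pairing.
  congr (_ *: (f _ - f _)); apply: injective_projections => //=.
  by rewrite /GRing.scale/= mulr0 add0r.
by rewrite /d2 /derive E.
Qed.

Lemma d2_swap f (x : R * R) : d1 (f \o swp) (swp x) = d2 f x.
Proof. by rewrite d1_line d2_line. Qed.

Lemma derivable_swap f (x : R * R) : derivable (f \o swp) (swp x) (1, 0) -> derivable f x (0, 1).
Proof.
move=> /derivableP/is_derive_e1 H.
by have [] : is_derive x (0, 1) f ('D_(1, 0) (f \o swp) (swp x)) by apply/is_derive_e2; exact: H.
Qed.

Lemma analytic2_d2 f p : analytic2_at f p ->
  derivable f p (0, 1) /\ analytic2_at (d2 f) p.
Proof.
move=> /analytic2_swap/analytic2_d1[_ d a]; split; first exact: derivable_swap.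
move: (analytic2_swap a); rewrite swpK (_ : _ \o _ = d2 f)//.
by apply/funext => x; rewrite /= d2_swap.
Qed.

(** Both partial derivatives stay analytic, so the induction on the order never leaves the class. *)
Lemma analytic2_smoothU (U : set (R * R)) f : (forall x : R * R, U x -> analytic2_at f x) -> smoothU U f.
Proof.
move=> + n; elim: n f => [|n IH] f H.
  by split => // x Ux; have [] := analytic2_d1 (H x Ux).
split; first by move=> x Ux; have [] := analytic2_d1 (H x Ux).
split.
- by move=> x Ux; split; [have [] := analytic2_d1 (H x Ux)|have [] := analytic2_d2 (H x Ux)].
- by apply: IH => x Ux; have [] := analytic2_d1 (H x Ux).
- by apply: IH => x Ux; have [] := analytic2_d2 (H x Ux).
Qed.

End analytic.

(** * Integration in the plane *)

HB.instance Definition _ (R : realType) := Measure.on (@leb2 R).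

Section tonelli.
Context {R : realType}.
Local Notation mu := (@lebesgue_measure R).
Local Notation plane := (measurableTypeR R * measurableTypeR R)%type.

Local Open Scope ereal_scope.

Lemma leb2_tonelli1 (f : plane -> \bar R) : measurable_fun setT f -> (forall x, 0 <= f x) ->
  \int[leb2]_x f x = \int[mu]_x \int[mu]_y f (x, y).
Proof. by move=> mf f0; rewrite fubini_tonelli1. Qed.

Lemma leb2_tonelli2 (f : plane -> \bar R) : measurable_fun setT f -> (forall x, 0 <= f x) ->
  \int[leb2]_x f x = \int[mu]_y \int[mu]_x f (x, y).
Proof. by move=> mf f0; rewrite fubini_tonelli2. Qed.

Lemma measurable_inner (f : plane -> \bar R) : measurable_fun setT f -> (forall x, 0 <= f x) ->
  measurable_fun setT (fun x => \int[mu]_y f (x, y)).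
Proof. by move=> mf f0; exact: measurable_fun_fubini_tonelli_F. Qed.

Lemma measurable_swp : measurable_fun setT (swp : plane -> plane).
Proof. by apply/measurable_fun_pairP; split; [exact: measurable_snd|exact: measurable_fst]. Qed.

Lemma leb2_swp (f : plane -> \bar R) : measurable_fun setT f -> (forall x, 0 <= f x) ->
  \int[leb2]_x f (swp x) = \int[leb2]_x f x.
Proof.
move=> mf f0; rewrite leb2_tonelli1; last 2 first.
- by apply: measurableT_comp => //; exact: measurable_swp.
- by move=> x; exact: f0.
by rewrite [RHS]leb2_tonelli2.
Qed.

Lemma leb2_setX (A B : set (measurableTypeR R)) : measurable A -> measurable B ->
  leb2 (A `*` B) = mu A * mu B.
Proof. by move=> mA mB; rewrite /leb2 product_measure1E. Qed.

End tonelli.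

(** * Square estimates along a segment *)

Section one_variable.
Context {R : realType}.
Local Notation mu := (@lebesgue_measure R).
Implicit Types (u v : R -> R) (a b s c : R).

Lemma ftc2 u v a b : a <= b -> continuous v ->
  (forall t : R, is_derive t (1 : R) u (v t)) ->
  (\int[mu]_(t in `[a, b]) (v t)%:E = (u b - u a)%:E)%E.
Proof.
rewrite le_eqVlt => /orP[/eqP->|ab] cv uv.
  by rewrite set_itv1 integral_set1 subrr.
rewrite (@continuous_FTC2 _ v u)//.
- by apply: continuous_subspaceT.
- by split=> [t _||]; [exact: ex_derive|apply: cvg_at_right_filter|apply: cvg_at_left_filter];
    apply: is_derive_cont; exact: uv.
- by move=> t _; rewrite derive1E; apply: derive_val.
Qed.

Lemma integrable_itv v a b : continuous v -> mu.-integrable `[a, b] (EFin \o v).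
Proof.
move=> cv; apply: continuous_compact_integrable; first exact: segment_compact.
exact: continuous_subspaceT.
Qed.

(** Cauchy-Schwarz from one square: with [m] the mean slope, [m^2 (s - c)] is the integral of
    [2 m v - m^2], which is at most [v^2] pointwise. *)
Lemma diff_sq_le u v a b s c : continuous v ->
  (forall t : R, is_derive t (1 : R) u (v t)) -> a <= s <= b -> a <= c <= b ->
  (((u s - u c) ^+ 2)%:E <= (b - a)%:E * \int[mu]_(t in `[a, b]) ((v t) ^+ 2)%:E)%E.
Proof.
move=> cv uv.
wlog cs : s c / c <= s.
  move=> H sab cab; have [cs|/ltW sc] := leP c s; first exact: H.
  by rewrite -sqrrN opprB; exact: H.
move=> /andP[_ sb] /andP[ac _].
have cv2 : continuous (fun t => v t ^+ 2).
  by move=> t; rewrite /continuous_at/=; under eq_fun do rewrite expr2; rewrite expr2; apply: cvgM; exact: cv.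
have I0 : (0 <= \int[mu]_(t in `[a, b]) ((v t) ^+ 2)%:E)%E.
  by apply: integral_ge0 => t _; rewrite lee_fin sqr_ge0.
have cs' := cs; move: cs; rewrite le_eqVlt => /orP[/eqP<-|cs].
  rewrite subrr expr0n/= mule_ge0// lee_fin subr_ge0.
  by rewrite (le_trans ac)// (le_trans cs').
pose m := (u s - u c) / (s - c).
have sc0 : 0 < s - c by rewrite subr_gt0.
have H : ((m ^+ 2 * (s - c))%:E <= \int[mu]_(t in `[c, s]) ((v t) ^+ 2)%:E)%E.
  have <- : (\int[mu]_(t in `[c, s]) (2 * m * v t - m ^+ 2)%:E = (m ^+ 2 * (s - c))%:E)%E.
    have uw (t : R) : is_derive t (1 : R) (fun t : R => 2 * m * u t - m ^+ 2 * t) (2 * m * v t - m ^+ 2).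
      apply: is_derive_eq (is_deriveB1 (is_deriveZ1 (2 * m) (uv t))
        (is_deriveZ1 (m ^+ 2) (is_derive_id1 t))) _.
      by rewrite mulr1.
    rewrite (ftc2 (ltW cs) _ uw); last first.
      by move=> t; apply: cvgB; [apply: cvgMr; exact: cv|exact: cvg_cst].
    congr EFin; rewrite /m; field; lra.
  apply: le_integral; first exact: measurable_itv.
  - apply: (@integrable_itv (fun t => 2 * m * v t - m ^+ 2)).
    by move=> t; apply: cvgB; [apply: cvgMr; exact: cv|exact: cvg_cst].
  - exact: (@integrable_itv (fun t => v t ^+ 2)).
  - by move=> t _; rewrite lee_fin; have := sqr_ge0 (v t - m); nra.
have -> : (u s - u c) ^+ 2 = (s - c) * (m ^+ 2 * (s - c)).
  by rewrite /m; field; lra.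
rewrite EFinM; apply: lee_pmul => //.
- by rewrite lee_fin ltW.
- by rewrite lee_fin mulr_ge0 ?sqr_ge0// ltW.
- by rewrite lee_fin; lra.
- apply: le_trans H _; apply: ge0_subset_integral => //.
  + by apply: measurable_funTS; apply/measurable_EFinP; exact: continuous_measurable_fun.
  + by move=> t _; rewrite lee_fin sqr_ge0.
  + by move=> t /=; rewrite !in_itv/= => /andP[? ?]; apply/andP; split; lra.
Qed.

Lemma sq_le_point u v a b s c : continuous v ->
  (forall t : R, is_derive t (1 : R) u (v t)) -> a <= s <= b -> a <= c <= b ->
  (((u s) ^+ 2)%:E <= (2 * (u c) ^+ 2)%:E
    + (2 * (b - a))%:E * \int[mu]_(t in `[a, b]) ((v t) ^+ 2)%:E)%E.
Proof.
move=> cv uv sab cab.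
apply: (@le_trans _ _ ((2 * (u c) ^+ 2)%:E + 2%:E * ((u s - u c) ^+ 2)%:E)%E).
  by rewrite -EFinM -EFinD lee_fin; have := sqr_ge0 (u s - 2 * u c); nra.
rewrite leeD2l// [(2 * (b - a))%:E]EFinM -muleA; apply: lee_wpmul2l => //.
exact: diff_sq_le.
Qed.

End one_variable.

Section compact_support.
Context {R : realType}.
Local Notation mu := (@lebesgue_measure R).
Local Notation plane := (measurableTypeR R * measurableTypeR R)%type.
Implicit Types (A f : R * R -> R) (L : R).

Lemma cbox_closed p (h : R) : closed (cbox p h).
Proof. by apply: compact_closed; [exact: norm_hausdorff|exact: compact_cbox]. Qed.

Lemma leb2_cbox p (h : R) : (leb2 (cbox p h) < +oo)%E.
Proof.
rewrite cbox_prod leb2_setX//.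
by rewrite !lebesgue_measure_itv/=; do 2 case: ifP => _ //; rewrite ?mule0 ?mul0e// -!EFinB -EFinM ltry.
Qed.

Lemma leb2_bounded_set (U : set (R * R)) (h : R) : measurable (U : set plane) -> U `<=` cbox 0 h ->
  (leb2 U < +oo)%E.
Proof.
move=> mU Uh; apply: le_lt_trans (leb2_cbox 0 h); apply: le_measure => //; rewrite inE//.
by apply: closed_plane_measurable; exact: cbox_closed.
Qed.

Lemma integrable_csupp f L : continuous f -> (forall x, ~ cbox 0 L x -> f x = 0) ->
  leb2.-integrable setT (EFin \o f : plane -> \bar R).
Proof.
move=> cf f0.
have mC : measurable (cbox 0 L : set plane) by apply: closed_plane_measurable; exact: cbox_closed.
have : leb2.-integrable (cbox 0 L) (EFin \o f : plane -> \bar R).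
  apply: measurable_bounded_integrable => //; first exact: leb2_cbox.
    by apply: measurable_funTS; exact: continuous_plane_measurable.
  have [B B0 HB] := compact_bounded_fun (@compact_cbox R 0 L) (fun x _ => cf x).
  by exists B; split; [exact: num_real|move=> M BM x Cx; exact: le_trans (HB x Cx) (ltW BM)].
move/(integrable_mkcond _ mC); apply: eq_integrable => // x _.
rewrite patchE; case: ifPn => //; rewrite notin_setE => /f0 /= ->//.
Qed.

Lemma int_ftc0 (u v : R -> R) (L : R) : continuous v ->
  (forall t : R, is_derive t (1 : R) u (v t)) ->
  (forall t, L < `|t| -> u t = 0 /\ v t = 0) ->
  (\int[mu]_t (v t)%:E = 0)%E.
Proof.
move=> cv uv u0; pose M : R := `|L| + 1.
have HL : L < M by rewrite /M; have := ler_norm L; lra.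
have M0 : 0 < M by rewrite /M; have := normr_ge0 L; lra.
have -> : (\int[mu]_t (v t)%:E = \int[mu]_(t in `[(- M)%R, M]) (v t)%:E)%E.
  rewrite [RHS]integral_mkcond; apply: eq_integral => t _; rewrite patchE.
  case: ifPn => //; rewrite notin_setE/= in_itv/= => tM.
  suff /u0[_ ->] : L < `|t| by [].
  apply: lt_le_trans HL _; rewrite leNgt; apply/negP; rewrite ltr_norml => /andP[? ?].
  by apply: tM; apply/andP; split; exact: ltW.
rewrite (ftc2 _ cv uv); last lra.
have [-> _] : u M = 0 /\ v M = 0 by apply: u0; rewrite gtr0_norm.
have [-> _] : u (- M) = 0 /\ v (- M) = 0 by apply: u0; rewrite normrN gtr0_norm.
by rewrite subrr.
Qed.

Lemma int_d1_eq0 A f L : continuous f ->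
  (forall x : R * R, is_derive x (1, 0) A (f x)) ->
  (forall x, ~ cbox 0 L x -> A x = 0 /\ f x = 0) ->
  (\int[leb2]_x (f x)%:E = 0)%E.
Proof.
move=> cf dA A0.
have cf' : forall y, continuous (fun t => f (t, y)).
  move=> y t; apply: (@continuous_comp _ _ _ (fun t : R => (t, y)) f); last exact: cf.
  by apply: continuous_pair_at; [exact: cvg_id|exact: cvg_cst].
have If : leb2.-integrable setT (EFin \o f : plane -> \bar R).
  by apply: (@integrable_csupp f L) => // x /A0[].
rewrite /leb2 -(integral21_prod_meas1 If); apply: integral0_eq => y _.
apply: (@int_ftc0 (fun t => A (t, y)) (fun t => f (t, y)) L) => //=.
  by move=> t; have /is_derive_e1 := dA (t, y).
move=> t tL; apply: A0 => -[/= + _]; rewrite subr0 => H.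
by move: (lt_le_trans tL H); rewrite ltxx.
Qed.

Lemma int_d2_eq0 A f L : continuous f ->
  (forall x : R * R, is_derive x (0, 1) A (f x)) ->
  (forall x, ~ cbox 0 L x -> A x = 0 /\ f x = 0) ->
  (\int[leb2]_x (f x)%:E = 0)%E.
Proof.
move=> cf dA A0.
have cf' : forall y, continuous (fun t => f (y, t)).
  move=> y t; apply: (@continuous_comp _ _ _ (fun t : R => (y, t)) f); last exact: cf.
  by apply: continuous_pair_at; [exact: cvg_cst|exact: cvg_id].
have If : leb2.-integrable setT (EFin \o f : plane -> \bar R).
  by apply: (@integrable_csupp f L) => // x /A0[].
rewrite /leb2 -(integral12_prod_meas1 If); apply: integral0_eq => y _.
apply: (@int_ftc0 (fun t => A (y, t)) (fun t => f (y, t)) L) => //=.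
  by move=> t; have /is_derive_e2 := dA (y, t).
move=> t tL; apply: A0 => -[_ /=]; rewrite subr0 => H.
by move: (lt_le_trans tL H); rewrite ltxx.
Qed.

End compact_support.

(** * Square-integrable functions on a subset of the plane *)

Section L2_space.
Context {R : realType}.
Local Notation plane := (measurableTypeR R * measurableTypeR R)%type.
Context (U : set (R * R)) (mU : measurable (U : set plane)).
Implicit Types (f g a b : R * R -> R).
Local Notation mfun f := (measurable_fun (U : set plane) (f : plane -> R)).

Lemma measurable_sqr f : mfun f ->
  measurable_fun (U : set plane) (fun x : plane => ((f x) ^+ 2)%:E).
Proof. by move=> mf; apply/measurable_EFinP; exact: measurable_funX. Qed.

Lemma L2_sqr_integrable f : L2 U f -> leb2.-integrable U (fun x : plane => ((f x) ^+ 2)%:E).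
Proof.
move=> [mf foo]; apply/integrableP; split; first exact: measurable_sqr.
by under eq_integral do rewrite gee0_abs ?lee_fin ?sqr_ge0//.
Qed.

Lemma L2_dom f g h : mfun f -> (forall x, U x -> (f x) ^+ 2 <= 2 * (g x) ^+ 2 + 2 * (h x) ^+ 2) ->
  L2 U g -> L2 U h -> L2 U f.
Proof.
move=> mf fgh Lg Lh; split => //.
have : leb2.-integrable U (fun x : plane => 2%:E * ((g x) ^+ 2)%:E + 2%:E * ((h x) ^+ 2)%:E)%E.
  by apply: integrableD => //; apply: integrableZl => //; exact: L2_sqr_integrable.
move/integrableP => [_]; apply: le_lt_trans; apply: ge0_le_integral => //.
- by move=> x _; rewrite lee_fin sqr_ge0.
- exact: measurable_sqr.
- apply: measurableT_comp => //; apply: emeasurable_funD; apply: measurable_funeM; apply: measurable_sqr.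
  + by case: Lg.
  + by case: Lh.
- move=> x Ux; rewrite gee0_abs; first by rewrite -!EFinM -EFinD lee_fin fgh.
  by rewrite -!EFinM -EFinD lee_fin addr_ge0// mulr_ge0// sqr_ge0.
Qed.

Lemma L2_add f g : L2 U f -> L2 U g -> L2 U (fun x => f x + g x).
Proof.
move=> Lf Lg; apply: (@L2_dom _ f g) => //.
  by apply: measurable_funD; [case: Lf|case: Lg].
by move=> x _; have := sqr_ge0 (f x - g x); nra.
Qed.

Lemma L2_bmul f h (B : R) : mfun h -> (forall x, U x -> `|h x| <= B) -> L2 U f ->
  L2 U (fun x => h x * f x).
Proof.
move=> mh hB Lf; have mf := Lf.1; split; first exact: measurable_funM.
have : leb2.-integrable U (fun x : plane => (B ^+ 2)%:E * ((f x) ^+ 2)%:E)%E.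
  by apply: integrableZl => //; exact: L2_sqr_integrable.
move/integrableP => [_]; apply: le_lt_trans; apply: ge0_le_integral => //.
- by move=> x _; rewrite lee_fin sqr_ge0.
- by apply: measurable_sqr; exact: measurable_funM.
- by apply: measurableT_comp => //; apply: measurable_funeM; exact: measurable_sqr.
- move=> x Ux; rewrite -EFinM gee0_abs lee_fin; last exact: mulr_ge0 (sqr_ge0 _) (sqr_ge0 _).
  have B0 : 0 <= B by exact: le_trans (normr_ge0 _) (hB _ Ux).
  by rewrite exprMn ler_wpM2r ?sqr_ge0// -real_normK ?num_real// lerXn2r ?nnegrE// hB.
Qed.

Lemma L2_scale f (c : R) : L2 U f -> L2 U (fun x => c * f x).
Proof. by move=> Lf; apply: (@L2_bmul f (fun=> c) `|c|). Qed.

Lemma L2_sub f g : L2 U f -> L2 U g -> L2 U (fun x => f x - g x).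
Proof.
move=> Lf Lg; have -> : (fun x => f x - g x) = (fun x => f x + (-1) * g x).
  by apply/funext => x; rewrite mulN1r.
by apply: L2_add => //; exact: L2_scale.
Qed.

Lemma L2_bounded f (B : R) : (leb2 U < +oo)%E -> mfun f -> (forall x, U x -> `|f x| <= B) -> L2 U f.
Proof.
move=> Uoo mf fB.
have L1 : L2 U (fun=> 1).
  split => //; under eq_integral do rewrite expr1n.
  by rewrite integral_cst// mul1e.
have -> : f = (fun x => f x * 1) by apply/funext => x; rewrite mulr1.
exact: (L2_bmul mf fB).
Qed.

Lemma L2_mul_integrable f g : L2 U f -> L2 U g ->
  leb2.-integrable U (EFin \o (fun x => f x * g x) : plane -> \bar R).
Proof.
move=> Lf Lg; have mf := Lf.1; have mg := Lg.1.
have I : leb2.-integrable U (fun x : plane => ((f x) ^+ 2)%:E + ((g x) ^+ 2)%:E)%E.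
  by apply: integrableD => //; exact: L2_sqr_integrable.
apply: le_integrable I => //.
  by apply/measurable_EFinP; exact: measurable_funM.
move=> x _; rewrite /= lee_fin [leRHS]ger0_norm ?addr_ge0 ?sqr_ge0// ler_norml.
have := sqr_ge0 (f x - g x); have := sqr_ge0 (f x + g x).
have := sqr_ge0 (f x); have := sqr_ge0 (g x); nra.
Qed.

Lemma L2_sqr_fin f : L2 U f ->
  (\int[leb2]_(x in U) ((f x) ^+ 2)%:E = (\int[leb2]_(x in U) ((f x) ^+ 2))%:E)%E.
Proof. by move=> Lf; rewrite fineK//; apply: integrable_fin_num => //; exact: L2_sqr_integrable. Qed.

(** Young's inequality with a free weight replaces Cauchy-Schwarz, so square roots of integrals
    never appear. *)
Lemma L2_inner_le f g (t : R) : 0 < t -> L2 U f -> L2 U g ->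
  `|\int[leb2]_(x in U) (f x * g x)| <=
  t^-1 * \int[leb2]_(x in U) ((f x) ^+ 2) + t * \int[leb2]_(x in U) ((g x) ^+ 2).
Proof.
move=> t0 Lf Lg; have Ifg := L2_mul_integrable Lf Lg.
have If := L2_sqr_integrable Lf; have Ig := L2_sqr_integrable Lg.
apply: le_trans (le_normr_Rintegral mU Ifg) _.
rewrite -RintegralZl// -RintegralZl// -RintegralD//; last 2 first.
- by apply: (@eq_integrable _ _ _ _ _ _ (fun x : plane => t^-1%:E * ((f x) ^+ 2)%:E)%E) => //; apply: integrableZl.
- by apply: (@eq_integrable _ _ _ _ _ _ (fun x : plane => t%:E * ((g x) ^+ 2)%:E)%E) => //; apply: integrableZl.
apply: le_Rintegral => //.
- by have := integrable_norm Ifg; apply: eq_integrable.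
- apply: (@eq_integrable _ _ _ _ _ _ (fun x : plane => t^-1%:E * ((f x) ^+ 2)%:E + t%:E * ((g x) ^+ 2)%:E)%E) => //.
  by apply: integrableD => //; apply: integrableZl.
- move=> x _; rewrite ler_norml.
  pose s := Num.sqrt t; have s0 : 0 < s by rewrite sqrtr_gt0.
  have -> : t = s ^+ 2 by rewrite sqr_sqrtr// ltW.
  have P := sqr_ge0 (s^-1 * f x - s * g x); have Q := sqr_ge0 (s^-1 * f x + s * g x).
  have e1 : s^-1 * f x * (s * g x) = f x * g x by field; lra.
  have e2 : (s ^+ 2)^-1 * f x ^+ 2 = (s^-1 * f x) ^+ 2 by rewrite exprMn exprVn.
  have e3 : s ^+ 2 * g x ^+ 2 = (s * g x) ^+ 2 by rewrite exprMn.
  rewrite e2 e3 -e1; set X := s^-1 * f x in P Q *; set Y := s * g x in P Q *.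
  have := sqr_ge0 X; have := sqr_ge0 Y; nra.
Qed.

Definition L2_cvg (a_ : nat -> R * R -> R) a :=
  (\int[leb2]_(x in U) ((a_ n x - a x) ^+ 2)%:E)%E @[n --> \oo] --> 0%E.

Lemma cvg_L2_inner (a_ : nat -> R * R -> R) a b : (forall n, L2 U (a_ n)) -> L2 U a -> L2 U b ->
  L2_cvg a_ a ->
  (\int[leb2]_(x in U) (a_ n x * b x)) @[n --> \oo] --> \int[leb2]_(x in U) (a x * b x).
Proof.
move=> La_ La Lb aa; apply/cvgrPdist_le => e e0.
pose B := \int[leb2]_(x in U) ((b x) ^+ 2).
have B0 : 0 <= B by apply: Rintegral_ge0 => x _; exact: sqr_ge0.
(* The weight makes the fixed factor contribute at most [e / 2]; the convergent factor, although
   divided by [t], eventually contributes at most [e / 2]. *)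
pose t := e / (2 * (B + 1)).
have t0 : 0 < t by rewrite divr_gt0//; lra.
have tB : t * B <= e / 2.
  rewrite /t mulrAC ler_pdivrMr; last lra.
  by have := e0; nra.
have := aa; move/fine_cvgP => [_ /cvgrPdist_le/(_ (t * (e / 2)))].
have te : 0 < t * (e / 2) by rewrite mulr_gt0//; lra.
move=> /(_ te); apply: filterS => n /=; rewrite sub0r normrN => Hn.
rewrite distrC -RintegralB//; [|exact: L2_mul_integrable..].
have -> : \int[leb2]_(x in U) (a_ n x * b x - a x * b x) = \int[leb2]_(x in U) ((a_ n x - a x) * b x).
  by apply: eq_Rintegral => x _; rewrite mulrBl.
apply: le_trans (L2_inner_le t0 (L2_sub (La_ n) La) Lb) _.
have : t^-1 * \int[leb2]_(x in U) ((a_ n x - a x) ^+ 2) <= e / 2.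
  rewrite mulrC ler_pdivrMr// mulrC; apply: le_trans Hn; exact: ler_norm.
by rewrite -/B; lra.
Qed.

End L2_space.

Section open_sets.
Context {R : realType}.
Implicit Types u v : R * R -> R.

Lemma open_lt_fun u v : continuous u -> continuous v -> open [set x | u x < v x].
Proof.
move=> cu cv; have c : continuous (fun x => v x - u x).
  by move=> x; apply: cvgB; [exact: cv|exact: cu].
have -> : [set x | u x < v x] = (fun x => v x - u x) @^-1` [set y | 0 < y].
  by apply/seteqP; split => x /=; rewrite subr_gt0.
by move/continuousP : c; apply; exact: open_gt.
Qed.

Lemma continuous_comp_fst (h : R -> R) : continuous h -> continuous (fun x : R * R => h x.1).
Proof. by move=> ch x; apply: (@continuous_comp _ _ _ fst h); [exact: continuous_fst_plane|exact: ch]. Qed.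

Lemma lip_continuous (h : R -> R) (L : R) : (forall s t, `|h s - h t| <= L * `|s - t|) -> continuous h.
Proof.
move=> hL t; apply/cvgrPdist_le => e e0; have L0 : 0 < `|L| + 1 by have := normr_ge0 L; lra.
have /cvgrPdist_lt/(_ (e / (`|L| + 1))) : (fun s : R => s) @ t --> t by exact: cvg_id.
move=> /(_ (divr_gt0 e0 L0)); apply: filterS => s; rewrite ltr_pdivlMr// => H.
apply: le_trans (hL t s) _; have := ler_norm L; have := normr_ge0 (t - s).
by move: H; set X := `|t - s|; nra.
Qed.

End open_sets.

Section pushforward_comparison.
Local Open Scope ereal_scope.
Context d1 d2 d3 (X : measurableType d1) (Y : measurableType d2) (Z : measurableType d3)
  (R : realType).

(** Wraps the pushforward as a measure structure, hiding the measurability proof so that later goals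
    can be rewritten along an equality of set functions. *)
Lemma pushforward_measure (phi : X -> Y) (mphi : measurable_fun setT phi)
    (m : {measure set X -> \bar R}) :
  exists n : {measure set Y -> \bar R}, (n : set Y -> \bar R) = pushforward m phi.
Proof.
unshelve refine (ex_intro _ (pushforward m phi : {measure set Y -> \bar R}) _).
- exact: mphi.
- by [].
Qed.

End pushforward_comparison.

Section pushforward_comparison2.
Local Open Scope ereal_scope.
Context d1 d2 d3 (X : measurableType d1) (Y : measurableType d2) (Z : measurableType d3)
  (R : realType).

Lemma pushforward_integral_le (phi : X -> Y) (psi : Z -> Y) (m : {measure set X -> \bar R})
    (n : {measure set Z -> \bar R}) (S : set Y) (f : Y -> \bar R) :
  measurable_fun setT phi -> measurable_fun setT psi ->
  (forall A, measurable A -> m (phi @^-1` A) <= n (psi @^-1` A)) -> measurable S ->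
  measurable_fun setT f -> (forall y, 0 <= f y) ->
  \int[m]_(x in phi @^-1` S) f (phi x) <= \int[n]_(z in psi @^-1` S) f (psi z).
Proof.
move=> mphi mpsi mn mS mf f0.
have [m' m'E] := pushforward_measure mphi m; have [n' n'E] := pushforward_measure mpsi n.
have -> : \int[m]_(x in phi @^-1` S) f (phi x) = \int[m']_(y in S) f y.
  by rewrite m'E (ge0_integral_pushforward mphi)//; exact: measurable_funTS.
have -> : \int[n]_(x in psi @^-1` S) f (psi x) = \int[n']_(y in S) f y.
  by rewrite n'E (ge0_integral_pushforward mpsi)//; exact: measurable_funTS.
apply: ge0_le_measure_integral => // A mA.
by rewrite m'E n'E; exact: mn.
Qed.

End pushforward_comparison2.

(** * Arc integrals over graphs *)

Section graph_integral.
Context {R : realType}.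
Local Notation mu := (@lebesgue_measure R).
Local Notation plane := (measurableTypeR R * measurableTypeR R)%type.
Local Notation cara := (caratheodory_type (@hausdorff1 R)).
Local Open Scope ereal_scope.

Definition arc_length_measure : {measure set cara -> \bar R} :=
  Measure.clone _ _ _ (OuterMeasure.sort (@hausdorff1 R : {outer_measure set (R * R)%type -> \bar R})
    : set cara -> \bar R) _.

Lemma measurable_cara_fun (B : set (R * R)) (f : R * R -> \bar R) :
  measurable (B : set plane) -> measurable_fun (B : set plane) (f : plane -> \bar R) ->
  measurable (B : set cara) /\ measurable_fun (B : set cara) (f : cara -> \bar R).
Proof.
move=> mB mf; have mB' : measurable (B : set cara) by exact: borel_caratheodory.
split=> // _ Y mY; exact: borel_caratheodory (mf mB Y mY).
Qed.

(** The projection is 1-Lipschitz, so a piece of a graph is at least as long as its shadow; both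
    integrals are compared as pushforwards to the Borel plane. Smallness in [L^2] of the boundary
    curve thus yields smallness along each graph chart. *)
Lemma graph_integral_le (prj : R * R -> R) (gm : R -> R * R) (B : set (R * R)) (I : set R)
    (f : R * R -> R) : lip1 prj -> measurable_fun setT (prj : plane -> measurableTypeR R) ->
  measurable_fun setT (gm : measurableTypeR R -> plane) ->
  (forall t, prj (gm t) = t) -> measurable (B : set plane) -> measurable (I : set (measurableTypeR R)) ->
  (forall t, I t -> B (gm t)) -> measurable_fun setT (f : plane -> R) -> (forall x, (0 <= f x)%R) ->
  \int[mu]_(t in I) (f (gm t))%:E <= arc_integral B (fun x => (f x)%:E).
Proof.
move=> lp mp mg pg mB mI IB mf f0.
have mfE : measurable_fun setT (fun x : plane => (f x)%:E) by apply/measurable_EFinP.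
pose S : set plane := B `&` prj @^-1` I.
have mS : measurable S.
  by apply: measurableI => //; rewrite -[X in measurable X]setTI; exact: mp.
have -> : \int[mu]_(t in I) (f (gm t))%:E =
    \int[mu]_(t in (gm : measurableTypeR R -> plane) @^-1` S) (f (gm t))%:E.
  congr (integral _ _ _); apply/seteqP; split => t /=; rewrite /S/= pg; last by case.
  by move=> It; split => //; exact: IB.
have := @pushforward_integral_le _ _ _ _ _ _ R _ _ mu
  arc_length_measure _ _ mg (@measurable_id_cara R) _ mS mfE.
move=> H; refine (le_trans (H _ _) _).
- move=> A mA; apply: (le_hausdorff1_proj lp).
    by rewrite -[X in measurable X]setTI; exact: mg.
  by move=> t At; exists (gm t).
- by move=> y; rewrite lee_fin.
rewrite /arc_integral; have [mB' mf'] := measurable_cara_fun mB (measurable_funTS mfE).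
apply: ge0_subset_integral => //.
- exact: borel_caratheodory.
- by move=> x _; rewrite lee_fin.
- by move=> x [].
Qed.

End graph_integral.

(** * Strips along graphs *)

Section strips.
Context {R : realType}.
Local Notation mu := (@lebesgue_measure R).
Local Notation plane := (measurableTypeR R * measurableTypeR R)%type.
Implicit Types (l gm : R -> R) (a b tau : R) (psi : R * R -> R).

Definition strip a b l tau : set (R * R) :=
  [set x | a < x.1 < b /\ l x.1 < x.2 < l x.1 + tau].

Lemma open_strip a b l tau : continuous l -> open (strip a b l tau).
Proof.
move=> cl; have cl' := continuous_comp_fst cl.
have -> : strip a b l tau = [set x | a < x.1] `&` [set x | x.1 < b] `&`
    ([set x | l x.1 < x.2] `&` [set x | x.2 < l x.1 + tau]).
  by apply/seteqP; split=> x /=; [case=> /andP[-> ->] /andP[-> ->]|case=> -[? ?] [? ?]; split; apply/andP].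
apply: openI; apply: openI; apply: open_lt_fun => //;
  try exact: continuous_fst_plane; try exact: continuous_snd_plane; try exact: cst_continuous.
by move=> x; apply: cvgD; [exact: cl'|exact: cvg_cst].
Qed.

Lemma measurable_strip a b l tau : continuous l -> measurable (strip a b l tau : set plane).
Proof. by move=> cl; apply: open_plane_measurable; exact: open_strip. Qed.

Lemma continuous_section1 (f : R * R -> R) (t : R) : continuous f -> continuous (fun y => f (t, y)).
Proof.
move=> cf y; apply: (@continuous_comp _ _ _ (fun y : R => (t, y)) f); last exact: cf.
by apply: continuous_pair_at; [exact: cvg_cst|exact: cvg_id].
Qed.

Local Open Scope ereal_scope.

Lemma measurable_strip_fun a b l tau (f : R * R -> R) : continuous l -> continuous f ->
  measurable_fun setT ((fun x : plane => (f x)%:E) \_ (strip a b l tau)).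
Proof.
move=> cl cf; apply/(measurable_restrictT _ _).1; first exact: measurable_strip.
by apply: measurable_funTS; apply/measurable_EFinP; exact: continuous_plane_measurable.
Qed.

Lemma strip_section a b l tau (f : R * R -> R) (t : R) : continuous l -> continuous f ->
  \int[mu]_y ((fun x : plane => (f x)%:E) \_ (strip a b l tau)) (t, y) =
  if t \in `]a, b[ then \int[mu]_(y in `[l t, (l t + tau)%R]) (f (t, y))%:E else 0.
Proof.
move=> cl cf; case: ifPn => [tab|tab]; last first.
  apply: integral0_eq => y _; rewrite patchE ifF//; apply/negbTE; rewrite notin_setE => -[/= + _].
  by move: tab; rewrite in_itv/= => /negP.
rewrite integral_itv_bndoo; last first.
  by apply: measurable_funTS; apply/measurable_EFinP; apply: continuous_measurable_fun; exact: continuous_section1.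
rewrite [RHS]integral_mkcond; apply: eq_integral => y _; rewrite !patchE.
have -> // : ((t, y) \in strip a b l tau) = (y \in `]l t, (l t + tau)%R[%classic).
move: tab; rewrite in_itv/= => tab.
apply/idP/idP => /set_mem /= H; apply/mem_set => /=; last first.
  by move: H; rewrite in_itv /strip/= tab.
by case: H => _; rewrite in_itv.
Qed.

Lemma strip_tonelli a b l tau (f : R * R -> R) : continuous l -> continuous f -> (forall x, (0 <= f x)%R) ->
  \int[leb2]_(x in strip a b l tau) (f x)%:E =
  \int[mu]_(t in `]a, b[) \int[mu]_(y in `[l t, (l t + tau)%R]) (f (t, y))%:E.
Proof.
move=> cl cf f0; rewrite integral_mkcond leb2_tonelli1; last 2 first.
- exact: measurable_strip_fun.
- by move=> x; rewrite patchE; case: ifP => // _; rewrite lee_fin.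
rewrite [RHS]integral_mkcond; apply: eq_integral => t _; rewrite strip_section// patchE.
by rewrite mem_setE.
Qed.

Lemma measurable_strip_inner a b l tau (f : R * R -> R) : continuous l -> continuous f -> (forall x, (0 <= f x)%R) ->
  measurable_fun `]a, b[ (fun t : measurableTypeR R => \int[mu]_(y in `[l t, (l t + tau)%R]) (f (t, y))%:E).
Proof.
move=> cl cf f0.
have := @measurable_inner R _ (measurable_strip_fun a b tau cl cf).
have f0' x : 0 <= ((fun x : plane => (f x)%:E) \_ (strip a b l tau)) x.
  by rewrite patchE; case: ifP => // _; rewrite lee_fin.
move=> /(_ f0') H; apply: eq_measurable_fun (measurable_funTS H) => t.
by rewrite inE/= => tab; rewrite strip_section// tab.
Qed.

(** On each vertical section [sq_le_point] compares the value with the one on the graph [gm];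
    integrating over a section of length [tau] gives a factor [tau] for the graph term and [tau^2]
    for the gradient term. *)
Lemma strip_le a b l gm tau psi : (0 < tau)%R -> continuous l -> continuous gm ->
  (forall t, (l t <= gm t <= l t + tau)%R) -> Ck 1 psi ->
  \int[leb2]_(x in strip a b l tau) ((psi x) ^+ 2)%:E <=
  (2 * tau)%:E * \int[mu]_(t in `]a, b[) ((psi (t, gm t)) ^+ 2)%:E +
  (2 * tau ^+ 2)%:E * \int[leb2]_(x in strip a b l tau) ((d2 psi x) ^+ 2)%:E.
Proof.
move=> tau0 cl cg lg /CkU_setT psi1.
have cpsi : continuous psi by move=> x; exact: (CkU_cont psi1).
have cd2 : continuous (d2 psi) by move=> x; exact: (CkU_cont (CkU_d2 psi1)).
have csq (h : R * R -> R) : continuous h -> continuous (fun x => h x ^+ 2)%R.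
  by move=> ch x; rewrite /continuous_at; apply: cvgM; exact: ch.
have c1 : continuous (fun t => psi (t, gm t)).
  move=> t; apply: (@continuous_comp _ _ _ (fun t : R => (t, gm t)) psi); last exact: cpsi.
  by apply: continuous_pair_at; [exact: cvg_id|exact: cg].
have m1 : measurable_fun `]a, b[ (fun t : measurableTypeR R => ((psi (t, gm t)) ^+ 2)%:E).
  apply: measurable_funTS; apply/measurable_EFinP; apply: measurable_funX.
  exact: continuous_measurable_fun.
have s0 (h : R * R -> R) x : (0 <= h x ^+ 2)%R by exact: sqr_ge0.
rewrite !strip_tonelli//; [|exact: csq..].
have I0 t : 0 <= \int[mu]_(y in `[l t, (l t + tau)%R]) ((d2 psi (t, y)) ^+ 2)%:E.
  by apply: integral_ge0 => y _; rewrite lee_fin sqr_ge0.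
have mi := @measurable_strip_inner a b l tau (fun x => d2 psi x ^+ 2)%R cl (csq _ cd2) (s0 (d2 psi)).
have k1 : 0 <= (2 * tau)%:E by rewrite lee_fin mulr_ge0// ltW.
have k2 : 0 <= (2 * tau ^+ 2)%:E by rewrite lee_fin mulr_ge0// sqr_ge0.
have g1 (t : R) : 0 <= ((psi (t, gm t)) ^+ 2)%:E by rewrite lee_fin sqr_ge0.
have <- : \int[mu]_(t in `]a, b[) ((2 * tau)%:E * ((psi (t, gm t)) ^+ 2)%:E) =
    (2 * tau)%:E * \int[mu]_(t in `]a, b[) ((psi (t, gm t)) ^+ 2)%:E.
  by apply: ge0_integralZl.
have <- : \int[mu]_(t in `]a, b[) ((2 * tau ^+ 2)%:E * \int[mu]_(y in `[l t, (l t + tau)%R]) ((d2 psi (t, y)) ^+ 2)%:E) =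
    (2 * tau ^+ 2)%:E * \int[mu]_(t in `]a, b[) \int[mu]_(y in `[l t, (l t + tau)%R]) ((d2 psi (t, y)) ^+ 2)%:E.
  by apply: ge0_integralZl.
rewrite -ge0_integralD//; [|by move=> t _; exact: mule_ge0|exact: measurable_funeM
  |by move=> t _; exact: mule_ge0|exact: measurable_funeM].
apply: ge0_le_integral => //.
- by move=> t _; apply: integral_ge0 => y _; rewrite lee_fin sqr_ge0.
- exact: (@measurable_strip_inner a b l tau (fun x => psi x ^+ 2)%R cl (csq _ cpsi) (s0 psi)).
- by apply: emeasurable_funD; exact: measurable_funeM.
move=> t _.
have -> : (2 * tau)%:E * ((psi (t, gm t)) ^+ 2)%:E +
    (2 * tau ^+ 2)%:E * \int[mu]_(y in `[l t, (l t + tau)%R]) ((d2 psi (t, y)) ^+ 2)%:E =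
  \int[mu]_(y in `[l t, (l t + tau)%R]) ((2 * (psi (t, gm t)) ^+ 2)%:E +
    (2 * (l t + tau - l t))%:E * \int[mu]_(y in `[l t, (l t + tau)%R]) ((d2 psi (t, y)) ^+ 2)%:E).
  have mI : mu `[l t, (l t + tau)%R] = tau%:E.
    by rewrite lebesgue_measure_itv/= lte_fin ltrDl tau0 -EFinB addrC addKr.
  rewrite (_ : (l t + tau - l t)%R = tau); last by rewrite addrC addKr.
  rewrite integral_cst//; set X := (X in _ = _ * X); have -> : X = tau%:E by exact: mI.
  rewrite ge0_muleDl; [|by rewrite lee_fin mulr_ge0// sqr_ge0|exact: mule_ge0].
  set J := (X in _ + _ * X); rewrite [in RHS]muleAC -!EFinM.
  by congr (_%:E + _%:E * _); ring.
apply: ge0_le_integral => //.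
- by move=> y _; rewrite lee_fin sqr_ge0.
- apply: measurable_funTS; apply/measurable_EFinP; apply: continuous_measurable_fun.
  exact: (@continuous_section1 (fun x => psi x ^+ 2)%R t (csq _ cpsi)).
move=> y /=; rewrite in_itv/= => yl.
apply: (@sq_le_point _ (fun y => psi (t, y)) (fun y => d2 psi (t, y))) => //.
- exact: continuous_section1.
- by move=> s; have := CkU_is_d2 psi1 (I : setT (t, s)) => /is_derive_e2.
Qed.

End strips.

(** * Boundary charts as graphs over a coordinate axis *)

Section charts.
Context {R : realType}.
Implicit Types (A : set (R * R)) (p x : R * R) (F : R * R -> R).

(** The domain lies on one side of a Lipschitz graph in a rectangle. The graph function is defined
    on the whole line, and stays within [e / 2] of the centre so that a strip of thickness [e / 2]
    fits in the rectangle; [up] tells the side. *)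
Definition vchart A p (d e L : R) (gm : R -> R) (up : bool) : Prop :=
  [/\ 0 < d, 0 < e, forall s t, `|gm s - gm t| <= L * `|s - t|,
      forall t, `|gm t - p.2| < e / 2 &
      forall x, `|x.1 - p.1| < d -> `|x.2 - p.2| < e ->
        (A x <-> if up then gm x.1 < x.2 else x.2 < gm x.1)].

Definition clamp (a b t : R) : R := Num.max a (Num.min b t).

Lemma clamp_in a b t : a <= b -> a <= clamp a b t <= b.
Proof.
move=> ab; rewrite /clamp; apply/andP; split; first by rewrite le_max lexx.
by rewrite ge_max ab ge_min lexx.
Qed.

Lemma clamp_id a b t : a <= t <= b -> clamp a b t = t.
Proof.
move=> /andP[at_ tb]; rewrite /clamp; have -> : Num.min b t = t by apply/min_idPr.
by apply/max_idPr.
Qed.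

Lemma clamp_lip a b s t : `|clamp a b s - clamp a b t| <= `|s - t|.
Proof.
have lip (x y c : R) : `|Num.max c x - Num.max c y| <= `|x - y| /\
    `|Num.min c x - Num.min c y| <= `|x - y|.
  have := ler_norm (x - y); have := ler_norm (- (x - y)); rewrite normrN => H1 H2.
  by split; case: (leP c x) => ?; case: (leP c y) => ?; rewrite ?subrr ?normr0 ?normr_ge0//;
    rewrite ler_norml; lra.
exact: le_trans (lip _ _ _).1 (lip _ _ _).2.
Qed.

Lemma strictly_increasing_pos (h dh : R -> R) (a b m : R) : a < b ->
  (forall t, a <= t <= b -> is_derive t (1 : R) h (dh t)) -> (forall t, a <= t <= b -> m <= dh t) ->
  m * (b - a) <= h b - h a.
Proof.
move=> ab dhh dm; have [c /andP[ac cb] ->] := mvt_is_derive ab dhh.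
by rewrite ler_wpM2r ?subr_ge0 ?dm ?(ltW ab) ?(ltW ac) ?(ltW cb).
Qed.

Lemma mvt_abs (h dh : R -> R) (s t M : R) :
  (forall u, Num.min s t <= u <= Num.max s t -> is_derive u (1 : R) h (dh u) /\ `|dh u| <= M) ->
  `|h s - h t| <= M * `|s - t|.
Proof.
wlog st : s t / s <= t.
  move=> H; case/orP: (le_total s t) => [st|ts]; first exact: (H _ _ st).
  rewrite distrC (distrC s) => Hd; apply: (H _ _ ts) => u; rewrite minC maxC; exact: Hd.
have -> : Num.min s t = s by apply/min_idPl.
have -> : Num.max s t = t by apply/max_idPr.
move=> Hd; move: st; rewrite le_eqVlt => /orP[/eqP->|st]; first by rewrite !subrr normr0 mulr0.
have [c /andP[sc ct] e] := mvt_is_derive st (fun u hu => (Hd u hu).1).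
rewrite distrC e normrM distrC ler_wpM2r//.
by have [] := Hd c; rewrite ?(ltW sc) ?(ltW ct).
Qed.

(** Implicit function by monotonicity: on a small square [F] increases vertically at rate at least
    [m] and varies horizontally at rate at most [M], so each vertical line carries one zero and the
    zeros form a graph of slope at most [M / m]. [clamp] extends it to the whole line. *)
Lemma implicit_chart_up A p (h : R) F F1 F2 : 0 < h ->
  (forall x, box p h x -> is_derive x (1, 0) F (F1 x) /\ is_derive x (0, 1) F (F2 x)) ->
  {for p, continuous F1} -> {for p, continuous F2} -> F p = 0 -> 0 < F2 p ->
  (forall x, box p h x -> (A x <-> 0 < F x)) ->
  exists d e L gm, vchart A p d e L gm true.
Proof.
move=> h0 dF c1 c2 Fp F2p AF.
pose m := F2 p / 2; pose M := `|F1 p| + 1.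
have m0 : 0 < m by rewrite /m; lra.
have M0 : 0 < M by rewrite /M; have := normr_ge0 (F1 p); lra.
have [e [e0 eh He]] : exists e, [/\ 0 < e, e < h & forall x, cbox p e x -> m <= F2 x /\ `|F1 x| <= M].
  have N1 : nbhs p [set x | `|F1 p - F1 x| < 1] by move/cvgrPdist_lt : c1; apply.
  have N2 : nbhs p [set x | `|F2 p - F2 x| < m] by move/cvgrPdist_lt : c2; apply.
  have N12 : nbhs p ([set x | `|F1 p - F1 x| < 1] `&` [set x | `|F2 p - F2 x| < m]) by exact: filterI.
  move/nbhs_boxP : N12 => [r r0 Hr].
  exists (Num.min r h / 2); split.
  - by rewrite divr_gt0// lt_min r0.
  - by have : Num.min r h <= h by [rewrite ge_min lexx orbT]; lra.
  - have rm : Num.min r h / 2 < r.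
      by have : Num.min r h <= r by [rewrite ge_min lexx]; lra.
    move=> x [x1 x2]; have [/= H1 H2] := Hr x (conj (le_lt_trans x1 rm) (le_lt_trans x2 rm)).
    split; last first.
      by rewrite /M -[F1 x](subrK (F1 p)) addrC (le_trans (ler_normD _ _))// lerD2l distrC ltW.
    by move: H2; rewrite ltr_norml /m => /andP[? ?]; lra.
have dF1 x : cbox p e x -> is_derive x.1 (1 : R) (fun t : R => F (t, x.2)) (F1 x).
  by move=> [x1 x2]; apply/is_derive_e1; apply: (dF x _).1; split; lra.
have dF2 x : cbox p e x -> is_derive x.2 (1 : R) (fun t : R => F (x.1, t)) (F2 x).
  by move=> [x1 x2]; apply/is_derive_e2; apply: (dF x _).2; split; lra.
have Fmono t y z : `|t - p.1| <= e -> `|y - p.2| <= e -> `|z - p.2| <= e -> y < z ->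
    m * (z - y) <= F (t, z) - F (t, y).
  move=> te ye ze yz.
  apply: (@strictly_increasing_pos (fun s => F (t, s)) (fun s => F2 (t, s))) => // s /andP[ys sz].
  - apply: (dF2 (t, s)); split => //=; move: ye ze; rewrite !ler_norml; lra.
  - apply: (He (t, s) _).1; split => //=; move: ye ze; rewrite !ler_norml; lra.
have Flip s t y : `|s - p.1| <= e -> `|t - p.1| <= e -> `|y - p.2| <= e ->
    `|F (s, y) - F (t, y)| <= M * `|s - t|.
  move=> se te ye; apply: (@mvt_abs (fun s => F (s, y)) (fun s => F1 (s, y))) => u /andP[u1 u2].
  have C : cbox p e (u, y).
    split => //=; move: se te u1 u2; rewrite !ler_norml ge_min le_max.
    by move=> /andP[? ?] /andP[? ?] /orP[] ? /orP[] ?; lra.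
  by split; [exact: (dF1 (u, y))|exact: (He _ C).2].
pose e' := e / 4; have e'E : e' = e / 4 by []; have e'0 : 0 < e' by rewrite /e'; lra.
(* Narrow enough that the horizontal variation [M d] cannot undo the vertical gain [m e'], which
   forces a sign change between [p.2 - e'] and [p.2 + e']. *)
pose d := Num.min e (m * e' / (2 * M)).
have d0 : 0 < d by rewrite lt_min e0 divr_gt0 ?mulr_gt0.
have de : d <= e by rewrite ge_min lexx.
have dM : M * d < m * e'.
  have : d <= m * e' / (2 * M) by rewrite ge_min lexx orbT.
  rewrite ler_pdivlMr; last by rewrite mulr_gt0.
  by have : 0 < m * e' by [rewrite mulr_gt0]; lra.
have pe y : `|y| <= e' -> `|p.2 + y - p.2| <= e by rewrite addrC addKr /e'; move=> ?; lra.
have root t : `|t - p.1| <= d -> {y | `|y - p.2| <= e' & F (t, y) = 0}.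
  move=> td; apply: cid2.
  have te : `|t - p.1| <= e by exact: le_trans de.
  have F0 : `|F (t, p.2)| <= M * d.
    have -> : F (t, p.2) = F (t, p.2) - F (p.1, p.2) by rewrite -surjective_pairing Fp subr0.
    apply: le_trans (Flip _ _ _ te _ _) _; rewrite ?subrr ?normr0 ?(ltW e0)//.
    by rewrite ler_pM2l.
  have b0 : `|p.2 - p.2| <= e by rewrite subrr normr0 ltW.
  have b1 : `|p.2 + e' - p.2| <= e by apply: pe; rewrite gtr0_norm.
  have b2 : `|p.2 - e' - p.2| <= e by apply: pe; rewrite normrN gtr0_norm.
  have up : 0 < F (t, p.2 + e').
    have := Fmono t p.2 (p.2 + e') te b0 b1; rewrite ltrDl => /(_ e'0).
    by move: F0; rewrite ler_norml => /andP[? ?]; rewrite addrC addKr; lra.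
  have dn : F (t, p.2 - e') < 0.
    have := Fmono t (p.2 - e') p.2 te b2 b0; rewrite gtrBl => /(_ e'0).
    by move: F0; rewrite ler_norml => /andP[? ?]; rewrite opprB addrC subrK; lra.
  have [|||y yI Fy] := @IVT R (fun y => F (t, y)) (p.2 - e') (p.2 + e') 0.
  - lra.
  - apply: continuous_in_subspaceT => y; rewrite inE/= in_itv/= => /andP[? ?].
    apply: is_derive_cont; apply: (dF2 (t, y)); split => //=; rewrite ler_norml; lra.
  - by rewrite ge_min le_max (ltW dn) (ltW up) orbT.
  exists y => //; move: yI; rewrite in_itv/= ler_norml; lra.
pose gm t := if pselect (`|t - p.1| <= d) is left td then s2val (root t td) else p.2.
have gmP t : `|t - p.1| <= d -> `|gm t - p.2| <= e' /\ F (t, gm t) = 0.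
  by move=> td; rewrite /gm; case: pselect => [td'|//]; case: (root t td').
have cl t : `|clamp (p.1 - d) (p.1 + d) t - p.1| <= d.
  have /andP[? ?] := @clamp_in (p.1 - d) (p.1 + d) t ltac:(lra).
  by rewrite ler_norml; lra.
have e'e : e' <= e by rewrite /e'; lra.
exists d, e, (M / m), (fun t => gm (clamp (p.1 - d) (p.1 + d) t)); split => //.
- move=> s t; have := clamp_lip (p.1 - d) (p.1 + d) s t.
  move: (cl s) (cl t); set s' := clamp _ _ s; set t' := clamp _ _ t => sd td st.
  have [s1 s2] := gmP _ sd; have [t1 t2] := gmP _ td.
  have s1e := le_trans s1 e'e; have t1e := le_trans t1 e'e.
  have sde := le_trans sd de; have tde := le_trans td de.
  suff H : m * `|gm s' - gm t'| <= M * `|s' - t'|.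
    rewrite mulrAC ler_pdivlMr// mulrC; apply: le_trans H _; by rewrite ler_pM2l.
  have K := Flip s' t' (gm s') sde tde s1e; rewrite s2 sub0r normrN in K.
  apply: le_trans K.
  have [lt|lt|->] := ltgtP (gm s') (gm t'); last by rewrite subrr normr0 mulr0.
  + have := Fmono _ _ _ tde s1e t1e lt; rewrite t2 sub0r => H.
    by rewrite (ltr0_norm (_ : gm s' - gm t' < 0)) ?subr_lt0// opprB (le_trans H)// -normrN ler_norm.
  + have := Fmono _ _ _ tde t1e s1e lt; rewrite t2 subr0 => H.
    by rewrite gtr0_norm ?subr_gt0// (le_trans H)// ler_norm.
- by move=> t; apply: le_lt_trans (gmP _ (cl t)).1 _; rewrite /e'; lra.
- move=> x xd xe.
  have -> : clamp (p.1 - d) (p.1 + d) x.1 = x.1.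
    by apply: clamp_id; move: xd; rewrite ltr_norml; lra.
  have [g1 g2] := gmP x.1 (ltW xd); have g1e := le_trans g1 e'e.
  have xde := le_trans (ltW xd) de.
  rewrite (AF x); last by split; [exact: lt_trans xd (le_lt_trans de eh)|exact: lt_trans xe eh].
  rewrite [x in F x]surjective_pairing.
  have [lt|lt|xg] := ltgtP x.2 (gm x.1); last by rewrite xg g2 ltxx.
  + have := Fmono _ _ _ xde (ltW xe) g1e lt; rewrite g2 sub0r => H.
    by have : 0 < m * (gm x.1 - x.2) by [rewrite mulr_gt0 ?subr_gt0]; split => //; lra.
  + have := Fmono _ _ _ xde g1e (ltW xe) lt; rewrite g2 subr0 => H.
    by have : 0 < m * (x.2 - gm x.1) by [rewrite mulr_gt0 ?subr_gt0]; split => //; lra.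
Qed.

Definition flip2 x : R * R := (x.1, - x.2).

Lemma vchart_flip A p d e L gm : vchart (flip2 @^-1` A) (flip2 p) d e L gm true ->
  vchart A p d e L (fun t => - gm t) false.
Proof.
case=> d0 e0 gL ge H; split => //.
- by move=> s t; rewrite -opprD normrN; exact: gL.
- by move=> t; have := ge t; rewrite /flip2/= opprK -normrN opprD.
- move=> x xd xe; have := H (flip2 x); rewrite /flip2/= opprK opprK -surjective_pairing.
  move=> /(_ xd); rewrite addrC distrC => /(_ xe) ->.
  by rewrite ltrNr.
Qed.

Lemma implicit_chart A p (h : R) F F1 F2 : 0 < h ->
  (forall x, box p h x -> is_derive x (1, 0) F (F1 x) /\ is_derive x (0, 1) F (F2 x)) ->
  {for p, continuous F1} -> {for p, continuous F2} -> F p = 0 -> F2 p != 0 ->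
  (forall x, box p h x -> (A x <-> 0 < F x)) ->
  exists d e L gm up, vchart A p d e L gm up.
Proof.
move=> h0 dF c1 c2 Fp + AF; rewrite neq_lt => /orP[F2p|F2p]; last first.
  have [d [e [L [gm V]]]] := implicit_chart_up h0 dF c1 c2 Fp F2p AF.
  by exists d, e, L, gm, true.
have cfl : {for flip2 p, continuous flip2}.
  apply: continuous_pair_at; first exact: continuous_fst_plane.
  by apply: cvgN; exact: continuous_snd_plane.
have fK x : flip2 (flip2 x) = x by rewrite /flip2/= opprK -surjective_pairing.
have bf x : box (flip2 p) h x -> box p h (flip2 x).
  by case=> /= ? ?; split => //=; rewrite -opprD normrN -[p.2]opprK.
have cc (G : R * R -> R) : {for p, continuous G} -> {for flip2 p, continuous (G \o flip2)}.
  by move=> cG; apply: continuous_comp => //; rewrite fK.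
have [||||||d [e [L [gm V]]]] := @implicit_chart_up (flip2 @^-1` A) (flip2 p) h (F \o flip2)
  (F1 \o flip2) (fun x => - (F2 (flip2 x))) h0.
- move=> x /bf bx; have [D1 D2] := dF _ bx; split.
    by apply/is_derive_e1; move/is_derive_e1 : D1.
  apply/is_derive_e2; move/is_derive_e2 : D2 => /= D2.
  apply: is_derive_eq (@is_derive_comp1 _ (fun t => F (x.1, t)) (fun t : R => - t) x.2 _ _ D2
    (is_deriveN1 (is_derive_id1 x.2))) _.
  by rewrite mulrN1.
- exact: cc.
- by apply: cvgN; exact: (cc F2).
- by rewrite /= fK.
- by rewrite fK oppr_gt0.
- by move=> x /bf bx; exact: AF.
exists d, e, L, (fun t => - gm t), false; exact: vchart_flip.
Qed.

(** The given chart lives in a rotated frame, while length and area are computed along the axes. The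
    boundary is the zero set of [F], whose gradient does not vanish, so it is a graph over one of
    the two axes. *)
Lemma C2_boundary_chart A p : C2_boundary A -> bd A p ->
  (exists d e L gm up, vchart A p d e L gm up) \/
  (exists d e L gm up, vchart (swp @^-1` A) (swp p) d e L gm up).
Proof.
move=> CA bp; have [r [a [b [g [r0 ab [g1 g2 g3] Ag]]]]] := CA _ bp.
pose F (x : R * R) := (- b * (x - p).1 + a * (x - p).2) - g (a * (x - p).1 + b * (x - p).2).
have Dg t : is_derive t (1 : R) g (derive1 g t) by rewrite derive1E; apply: DeriveDef => //; exact: g1.
have cg' : continuous (derive1 g) by move=> t; apply: differentiable_continuous; apply/derivable1_diffP; exact: g2.
pose F1 (x : R * R) := - b - derive1 g (a * (x - p).1 + b * (x - p).2) * a.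
pose F2 (x : R * R) := a - derive1 g (a * (x - p).1 + b * (x - p).2) * b.
have lin (u v c w : R) : is_derive w (1 : R) (fun t : R => u * (t - c) + v) u.
  apply: is_derive_eq (is_deriveD1 (is_deriveZ1 u (is_deriveB1 (is_derive_id1 w) (is_derive_cst1 w c)))
    (is_derive_cst1 w v)) _.
  by rewrite subr0 mulr1 addr0.
have lin' (u v c w : R) : is_derive w (1 : R) (fun t : R => v + u * (t - c)) u.
  by have := lin u v c w; under eq_fun do rewrite addrC.
have dF x : is_derive x (1, 0) F (F1 x) /\ is_derive x (0, 1) F (F2 x).
  split; [apply/is_derive_e1|apply/is_derive_e2].
  - exact: is_derive_eq (is_deriveB1 (lin (- b) (a * (x.2 - p.2)) p.1 x.1)
      (@is_derive_comp1 _ g _ x.1 _ _ (Dg _) (lin a (b * (x.2 - p.2)) p.1 x.1))) _.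
  - exact: is_derive_eq (is_deriveB1 (lin' a (- b * (x.1 - p.1)) p.2 x.2)
      (@is_derive_comp1 _ g _ x.2 _ _ (Dg _) (lin' b (a * (x.1 - p.1)) p.2 x.2))) _.
have cF' : continuous (fun x : R * R => derive1 g (a * (x - p).1 + b * (x - p).2)).
  move=> x; apply: (@continuous_comp _ _ _ (fun x : R * R => a * (x - p).1 + b * (x - p).2) (derive1 g)); last exact: cg'.
  by apply: cvgD; apply: cvgMr; apply: cvgB;
    [exact: continuous_fst_plane|exact: cvg_cst|exact: continuous_snd_plane|exact: cvg_cst].
have c1 : continuous F1 by move=> x; apply: cvgB; [exact: cvg_cst|apply: cvgMl; exact: cF'].
have c2 : continuous F2 by move=> x; apply: cvgB; [exact: cvg_cst|apply: cvgMl; exact: cF'].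
have cF : continuous F.
  move=> x; apply: cvgB; first by apply: cvgD; apply: cvgMr; apply: cvgB;
    [exact: continuous_fst_plane|exact: cvg_cst|exact: continuous_snd_plane|exact: cvg_cst].
  apply: (@continuous_comp _ _ _ (fun x : R * R => a * (x - p).1 + b * (x - p).2) g); last first.
    by apply: differentiable_continuous; apply/derivable1_diffP; exact: g1.
  by apply: cvgD; apply: cvgMr; apply: cvgB;
    [exact: continuous_fst_plane|exact: cvg_cst|exact: continuous_snd_plane|exact: cvg_cst].
have h0 : 0 < r / 2 by lra.
have AF x : box p (r / 2) x -> (A x <-> 0 < F x).
  move=> [x1 x2]; rewrite subr_gt0; apply: Ag.
  by apply: le_lt_trans (enorm_le_abs _) _; rewrite /=; lra.
have bx0 : nbhs p (box p (r / 2)) by apply: near_open; [exact: open_box|exact: boxxx].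
have Fp : F p = 0.
  case: bp => [clA nA]; apply/eqP; rewrite eq_le; apply/andP; split; rewrite leNgt; apply/negP => Fp.
  - apply: nA; rewrite /interior; apply: filterS (filterI bx0 (cvgr_gt _ (cF p) 0 Fp)).
    by move=> x [/AF ? ?]; tauto.
  - have [x [Ax [bx Fx]]] := clA _ (filterI bx0 (cvgr_lt _ (cF p) 0 Fp)).
    by move/(AF _ bx) : Ax; rewrite ltNge (ltW Fx).
have [b1|b2] := eqVneq (F2 p) 0; last first.
  by left; exact: (@implicit_chart A p (r / 2) F F1 F2 h0 (fun x _ => dF x) (c1 p) (c2 p) Fp b2 AF).
(* Rotating the gradient back gives component 1 along the normal axis of the frame, so both partial
   derivatives cannot vanish. *)
right; have F1p : F1 p != 0.
  apply/eqP => b0; move: b0 b1; rewrite /F1 /F2 => e1 e2.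
  set G := derive1 g _ in e1 e2.
  have : a * (a - G * b) - b * (- b - G * a) = 1 by rewrite -ab; ring.
  by rewrite e1 e2 !mulr0 subrr => /eqP; rewrite eq_sym oner_eq0.
have cs (G : R * R -> R) : continuous G -> {for swp p, continuous (G \o swp)}.
  by move=> cG; apply: continuous_comp; [exact: continuous_swp|exact: cG].
apply: (@implicit_chart _ (swp p) (r / 2) (F \o swp) (F2 \o swp) (F1 \o swp)) => //.
- move=> x _; have [D1 D2] := dF (swp x); split.
  + by apply/is_derive_e1; move/is_derive_e2 : D2.
  + by apply/is_derive_e2; move/is_derive_e1 : D1.
- exact: cs.
- exact: cs.
- by move=> x [x1 x2]; apply: AF.
Qed.

End charts.

Section strip_limit.
Context {R : realType}.
Local Notation mu := (@lebesgue_measure R).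
Local Notation plane := (measurableTypeR R * measurableTypeR R)%type.
Implicit Types (S D U : set (R * R)) (f g h : R * R -> R).

Lemma cvge0_small (u : nat -> \bar R) (e : R) : u @ \oo --> 0%E -> 0 < e ->
  \forall n \near \oo, (u n <= e%:E)%E.
Proof.
move/fine_cvgP => [fu /cvgrPdist_le H] e0; near=> n.
have un : u n \is a fin_num by near: n.
rewrite -(fineK un) lee_fin; apply: le_trans (ler_norm _) _.
by rewrite -[X in `|X|](opprK) normrN -[X in `|X|]add0r; near: n; exact: H.
Unshelve. all: by end_near. Qed.

Lemma squeeze_cvge0 (u v : nat -> \bar R) : (forall n, 0 <= u n <= v n)%E ->
  v @ \oo --> 0%E -> u @ \oo --> 0%E.
Proof. by move=> uv v0; apply: (squeeze_cvge _ (cvg_cst 0%E) v0); apply: nearW. Qed.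

Lemma L2_subset S U f : measurable (S : set plane) -> measurable (U : set plane) -> S `<=` U ->
  L2 U f -> L2 S f.
Proof.
move=> mS mU SU [mf foo]; split; first exact: measurable_funS mf.
apply: le_lt_trans foo; apply: ge0_subset_integral => //; first exact: measurable_sqr.
by move=> x _; rewrite lee_fin sqr_ge0.
Qed.

Lemma int_sqr_le S f g : measurable (S : set plane) ->
  measurable_fun (S : set plane) (f : plane -> R) -> measurable_fun (S : set plane) (g : plane -> R) ->
  (\int[leb2]_(x in S) ((f x) ^+ 2)%:E <= 2%:E * \int[leb2]_(x in S) ((g x - f x) ^+ 2)%:E
     + 2%:E * \int[leb2]_(x in S) ((g x) ^+ 2)%:E)%E.
Proof.
move=> mS mf mg; have mB := measurable_funB mg mf.
rewrite -!ge0_integralZl//; try exact: measurable_sqr; try by move=> x _; rewrite lee_fin sqr_ge0.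
rewrite -ge0_integralD//; try (by move=> x _; rewrite -EFinM lee_fin mulr_ge0// sqr_ge0);
  try (by apply: measurable_funeM; exact: measurable_sqr).
apply: ge0_le_integral => //.
- by move=> x _; rewrite lee_fin sqr_ge0.
- exact: measurable_sqr.
- by apply: emeasurable_funD; apply: measurable_funeM; exact: measurable_sqr.
- by move=> x _; rewrite -!EFinM -EFinD lee_fin; have := sqr_ge0 (f x - 2 * g x); nra.
Qed.

Lemma le_integral_sqr S U f : measurable (S : set plane) -> measurable (U : set plane) -> S `<=` U ->
  measurable_fun (U : set plane) (f : plane -> R) ->
  (\int[leb2]_(x in S) ((f x) ^+ 2)%:E <= \int[leb2]_(x in U) ((f x) ^+ 2)%:E)%E.
Proof.
move=> mS mU SU mf; apply: ge0_subset_integral => //; first exact: measurable_sqr.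
by move=> x _; rewrite lee_fin sqr_ge0.
Qed.

Lemma smooth_continuous f : smooth f -> continuous f.
Proof. by move=> sf; case: (sf 0%N). Qed.

Lemma smoothP f : smooth f <-> smoothU setT f.
Proof. by split=> sf n; apply/CkU_setT. Qed.

Lemma smooth_d1 f : smooth f -> smooth (d1 f).
Proof. by move/smoothP/smoothU_d1/smoothP. Qed.

Lemma smooth_d2 f : smooth f -> smooth (d2 f).
Proof. by move/smoothP/smoothU_d2/smoothP. Qed.

Lemma H1_cvg_parts D (psi : nat -> R * R -> R) f h1 h2 : measurable (D : set plane) ->
  L2 D f -> L2 D h1 -> L2 D h2 -> (forall n, smooth (psi n)) -> H1_cvg D psi f h1 h2 ->
  [/\ L2_cvg D psi f, L2_cvg D (d1 \o psi) h1 & L2_cvg D (d2 \o psi) h2].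
Proof.
move=> mD [mf _] [mh1 _] [mh2 _] sp H.
have mc (u : R * R -> R) : continuous u -> measurable_fun (D : set plane) (u : plane -> R).
  by move=> cu; apply: measurable_funTS; exact: continuous_plane_measurable.
have m0 n : measurable_fun (D : set plane) (fun x : plane => psi n x - f x).
  by apply: measurable_funB => //; apply: mc; exact: smooth_continuous.
have m1 n : measurable_fun (D : set plane) (fun x : plane => d1 (psi n) x - h1 x).
  by apply: measurable_funB => //; apply: mc; apply: smooth_continuous; exact: smooth_d1.
have m2 n : measurable_fun (D : set plane) (fun x : plane => d2 (psi n) x - h2 x).
  by apply: measurable_funB => //; apply: mc; apply: smooth_continuous; exact: smooth_d2.
have mt n : measurable_fun (D : set plane) (fun x : plane => ((psi n x - f x) ^+ 2
    + (d1 (psi n) x - h1 x) ^+ 2 + (d2 (psi n) x - h2 x) ^+ 2)%:E).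
  by apply/measurable_EFinP; apply: measurable_funD; [apply: measurable_funD|]; exact: measurable_funX.
have s0 (a : R) : 0 <= a ^+ 2 by exact: sqr_ge0.
have key (u : nat -> R * R -> R) : (forall n, measurable_fun (D : set plane) (u n : plane -> R)) ->
    (forall n x, u n x ^+ 2 <= (psi n x - f x) ^+ 2 + (d1 (psi n) x - h1 x) ^+ 2 + (d2 (psi n) x - h2 x) ^+ 2) ->
    (\int[leb2]_(x in D) ((u n x) ^+ 2)%:E)%E @[n --> \oo] --> 0%E.
  move=> mu_ ule; apply: squeeze_cvge0 H => n; apply/andP; split.
    by apply: integral_ge0 => x _; rewrite lee_fin.
  apply: ge0_le_integral => //.
  - by move=> x _; rewrite lee_fin.
  - by apply: measurable_sqr; exact: mu_.
  - by move=> x _; rewrite lee_fin.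
split.
- apply: (key (fun n x => psi n x - f x)) => // n x.
  by have := s0 (d1 (psi n) x - h1 x); have := s0 (d2 (psi n) x - h2 x); lra.
- apply: (key (fun n x => d1 (psi n) x - h1 x)) => // n x.
  by have := s0 (psi n x - f x); have := s0 (d2 (psi n) x - h2 x); lra.
- apply: (key (fun n x => d2 (psi n) x - h2 x)) => // n x.
  by have := s0 (psi n x - f x); have := s0 (d1 (psi n) x - h1 x); lra.
Qed.

(** Passage to the limit in [strip_le] when the values on the graph tend to 0. The constant 8 is the
    product of three factors 2, one for each splitting of a square. *)
Lemma strip_L2_le (a b tau : R) (l gm : R -> R) (psi : nat -> R * R -> R) f h : 0 < tau ->
  continuous l -> continuous gm -> (forall t, l t <= gm t <= l t + tau) ->
  L2 (strip a b l tau) f -> L2 (strip a b l tau) h -> (forall n, Ck 1 (psi n)) ->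
  L2_cvg (strip a b l tau) psi f -> L2_cvg (strip a b l tau) (d2 \o psi) h ->
  (\int[mu]_(t in `]a, b[) ((psi n (t, gm t)) ^+ 2)%:E)%E @[n --> \oo] --> 0%E ->
  \int[leb2]_(x in strip a b l tau) ((f x) ^+ 2) <=
  8 * tau ^+ 2 * \int[leb2]_(x in strip a b l tau) ((h x) ^+ 2).
Proof.
move=> tau0 cl cg lg Lf Lh psi1 c1 c2 c3; set S := strip a b l tau.
have mS : measurable (S : set plane) by exact: measurable_strip.
apply/ler_addgt0Pr => e e0.
pose e' : R := e / (2 + 4 * tau + 8 * tau ^+ 2).
have t2 : 0 <= tau ^+ 2 by exact: sqr_ge0.
have den : 0 < 2 + 4 * tau + 8 * tau ^+ 2 by nra.
have e'0 : 0 < e' by rewrite divr_gt0.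
have eE : e = 2 * e' + 4 * tau * e' + 8 * tau ^+ 2 * e' by rewrite /e'; field; lra.
near \oo => n.
have A : (\int[leb2]_(x in S) ((psi n x - f x) ^+ 2)%:E <= e'%:E)%E.
  by near: n; exact: cvge0_small c1 e'0.
have B : (\int[leb2]_(x in S) ((d2 (psi n) x - h x) ^+ 2)%:E <= e'%:E)%E.
  by near: n; exact: cvge0_small c2 e'0.
have C : (\int[mu]_(t in `]a, b[) ((psi n (t, gm t)) ^+ 2)%:E <= e'%:E)%E.
  by near: n; exact: cvge0_small c3 e'0.
have /CkU_setT pc := psi1 n.
have mp : measurable_fun (S : set plane) (psi n : plane -> R).
  by apply: measurable_funTS; apply: continuous_plane_measurable => x; exact: (CkU_cont pc).
have mp2 : measurable_fun (S : set plane) (d2 (psi n) : plane -> R).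
  by apply: measurable_funTS; apply: continuous_plane_measurable => x; exact: (CkU_cont (CkU_d2 pc)).
rewrite -lee_fin EFinD EFinM -!L2_sqr_fin//.
have D1 := int_sqr_le mS Lf.1 mp; have D2 := strip_le a b tau0 cl cg lg (psi1 n).
have D3 : (\int[leb2]_(x in S) ((d2 (psi n) x) ^+ 2)%:E <= 2%:E * e'%:E +
    2%:E * \int[leb2]_(x in S) ((h x) ^+ 2)%:E)%E.
  have := int_sqr_le mS mp2 Lh.1.
  have -> : (\int[leb2]_(x in S) ((h x - d2 (psi n) x) ^+ 2)%:E =
     \int[leb2]_(x in S) ((d2 (psi n) x - h x) ^+ 2)%:E)%E.
    by apply: eq_integral => x _; rewrite -sqrrN opprB.
  by move/le_trans; apply; apply: leeD => //; exact: lee_wpmul2l.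
apply: le_trans D1 _; rewrite -/S in D2.
have k1 : (0 <= (2 * tau)%:E)%E by rewrite lee_fin; lra.
have k2 : (0 <= (2 * tau ^+ 2)%:E)%E by rewrite lee_fin; lra.
apply: (@le_trans _ _ (2%:E * e'%:E + 2%:E * ((2 * tau)%:E * e'%:E +
  (2 * tau ^+ 2)%:E * (2%:E * e'%:E + 2%:E * \int[leb2]_(x in S) ((h x) ^+ 2)%:E)))%E).
  apply: leeD; first exact: lee_wpmul2l.
  apply: lee_wpmul2l => //; apply: le_trans D2 _.
  by apply: leeD; exact: lee_wpmul2l.
rewrite L2_sqr_fin//= lee_fin eE.
by set X := \int[_]_(_ in _) _; nra.
Unshelve. all: by end_near. Qed.

End strip_limit.

Section oriented.
Context {R : realType}.
Local Notation mu := (@lebesgue_measure R).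
Local Notation plane := (measurableTypeR R * measurableTypeR R)%type.
Implicit Types (S D U : set (R * R)) (f g h : R * R -> R).

(** A chart is a graph over one axis or the other; [o = true] exchanges the coordinates, so that
    every strip argument is written for vertical strips alone. *)
Definition ori (o : bool) (x : R * R) : R * R := if o then swp x else x.

Lemma oriK o : involutive (ori o). Proof. by case: o => x; rewrite /ori// swpK. Qed.

Lemma measurable_ori o : measurable_fun setT (ori o : plane -> plane).
Proof. by case: o; [exact: measurable_swp|exact: measurable_id]. Qed.

Lemma measurable_ori_pre o S : measurable (S : set plane) -> measurable (ori o @^-1` S : set plane).
Proof. by move=> mS; rewrite -[X in measurable X]setTI; exact: measurable_ori. Qed.

Lemma integral_ori o S (f : R * R -> \bar R) : measurable (S : set plane) ->
  measurable_fun (S : set plane) (f : plane -> \bar R) -> (forall x, 0 <= f x)%E ->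
  (\int[leb2]_(x in ori o @^-1` S) f (ori o x) = \int[leb2]_(x in S) f x)%E.
Proof.
case: o => // mS mf f0; rewrite integral_mkcond [RHS]integral_mkcond.
rewrite -(@leb2_swp _ (f \_ S)).
- by apply: eq_integral => x _; rewrite !patchE.
- exact/(measurable_restrictT _ _).1.
- by move=> x; rewrite patchE; case: ifP.
Qed.

Lemma L2_ori o S f : measurable (S : set plane) -> L2 S f -> L2 (ori o @^-1` S) (f \o ori o).
Proof.
move=> mS [mf foo]; split; last first.
  have := @integral_ori o S (fun x => ((f x) ^+ 2)%:E) mS (measurable_sqr mf).
  by move=> /= -> // x; rewrite lee_fin sqr_ge0.
apply: (measurable_comp mS) => //; first by move=> x [y Sy <-].
by apply: measurable_funTS; exact: measurable_ori.
Qed.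

Lemma continuous_ori o : continuous (ori o).
Proof. by case: o; [exact: continuous_swp|move=> x; exact: cvg_id]. Qed.

Lemma continuous_ori_comp o f : continuous f -> continuous (f \o ori o).
Proof. by move=> cf x; apply: continuous_comp; [exact: continuous_ori|exact: cf]. Qed.

Lemma d_swp f x : d1 (f \o swp) x = d2 f (swp x) /\ d2 (f \o swp) x = d1 f (swp x).
Proof.
rewrite /d1 /d2 /derive; split; congr (lim (_ @ _)); apply/funext => t /=;
  by congr (_ *: (f _ - _)); rewrite /swp; congr pair.
Qed.

Lemma smooth_swp f : smooth f -> smooth (f \o swp).
Proof.
move=> sf n; elim: n f sf => [|n IH] f sf /=.
  by split => //; apply: (@continuous_ori_comp true); exact: smooth_continuous.
split; first by apply: (@continuous_ori_comp true); exact: smooth_continuous.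
have E1 : d1 (f \o swp) = d2 f \o swp by apply/funext => x; case: (d_swp f x).
have E2 : d2 (f \o swp) = d1 f \o swp by apply/funext => x; case: (d_swp f x).
split; [|by rewrite E1; apply: IH; exact: smooth_d2|by rewrite E2; apply: IH; exact: smooth_d1].
move=> x; have := (sf 1%N).2 => -[/(_ (swp x))[D1 D2] _ _]; split.
- have /is_derive_e2 H := DeriveDef D2 erefl.
  have D : is_derive x (1, 0) (f \o swp) ('D_((0, 1) : R * R) f (swp x)) by apply/is_derive_e1; exact: H.
  exact: ex_derive.
- have /is_derive_e1 H := DeriveDef D1 erefl.
  have D : is_derive x (0, 1) (f \o swp) ('D_((1, 0) : R * R) f (swp x)) by apply/is_derive_e2; exact: H.
  exact: ex_derive.
Qed.

End oriented.

Section chart_geometry.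
Context {R : realType}.
Local Notation plane := (measurableTypeR R * measurableTypeR R)%type.
Implicit Types (D U B : set (R * R)) (p x : R * R).

Lemma bdE D x : open D -> bd D x <-> closure D x /\ ~ D x.
Proof. by move=> oD; rewrite /bd (interior_id D).1. Qed.

Lemma closed_bd D : open D -> closed (bd D).
Proof.
move=> oD; have -> : bd D = closure D `&` ~` D.
  by apply/seteqP; split => x; rewrite bdE.
by apply: closedI; [exact: closed_closure|exact: open_closedC].
Qed.

Lemma ori_box o p (h : R) x : box (ori o p) h (ori o x) <-> box p h x.
Proof. by case: o => //; rewrite /ori /box /swp/=; split => -[]. Qed.

Lemma ori_cvg_closure o D x : closure (ori o @^-1` D) x -> closure D (ori o x).
Proof.
move=> cl B nB; have : nbhs x (ori o @^-1` B) by exact: (@continuous_ori R o x).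
by move/cl => [y [Dy By]]; exists (ori o y).
Qed.

Lemma vchart_bd A p (d e L : R) gm up t : open A -> vchart A p d e L gm up -> `|t - p.1| < d ->
  bd A (t, gm t).
Proof.
move=> oA [d0 e0 _ ge H] td; have gt := ge t.
rewrite bdE//; split; last first.
  move/(H (t, gm t)) => /= -/(_ td) K.
  by have /K : `|gm t - p.2| < e by [lra]; case: up {H K} => /=; rewrite ltxx.
move=> B /nbhs_boxP[r r0 rB].
pose s := Num.min r e / 4; have s0 : 0 < s by rewrite divr_gt0// lt_min r0.
have sr : s < r by rewrite /s; have : Num.min r e <= r by [rewrite ge_min lexx]; lra.
have se : s < e / 2 by rewrite /s; have : Num.min r e <= e by [rewrite ge_min lexx orbT]; lra.
pose y := if up then gm t + s else gm t - s.
have yg : `|y - gm t| = s.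
  by rewrite /y; case: (up); rewrite addrC addKr ?normrN gtr0_norm.
exists (t, y); split; last by apply: rB; split => /=; rewrite ?subrr ?normr0// yg.
apply/(H (t, y)) => //=.
  rewrite -(subrK (gm t) y) -addrA; apply: le_lt_trans (ler_normD _ _) _; rewrite yg; lra.
by rewrite /y; case: (up); rewrite ?ltrDl// gtrBl.
Qed.

Lemma chart_bd o D p (d e L : R) gm up t : open D ->
  vchart (ori o @^-1` D) (ori o p) d e L gm up -> `|t - (ori o p).1| < d ->
  bd D (ori o (t, gm t)).
Proof.
move=> oD V td; have oD' : open (ori o @^-1` D).
  by move/continuousP : (@continuous_ori R o); apply.
have /bdE [//|cl nD] := vchart_bd oD' V td; apply/bdE => //; split => //.
exact: ori_cvg_closure.
Qed.

(** Intersected with [D] this is the collar of width [s]. Measured from the complement it is a union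
    of open squares, hence open. *)
Definition near_compl D (s : R) : set (R * R) := [set x | exists2 y, ~ D y & box y s x].

Lemma open_near_compl D s : open (near_compl D s).
Proof.
have -> : near_compl D s = \bigcup_(y in ~` D) box y s.
  by apply/seteqP; split => x; [case=> y ? ?; exists y|case=> y ? ?; exists y].
by apply: bigcup_open => y _; exact: open_box.
Qed.

Definition chart_low (gm : R -> R) (up : bool) (tau t : R) : R := if up then gm t else gm t - tau.

Definition chart_strip o p (d : R) gm up (tau : R) : set (R * R) :=
  ori o @^-1` strip ((ori o p).1 - d) ((ori o p).1 + d) (chart_low gm up tau) tau.

Lemma continuous_chart_low gm up tau : continuous gm -> continuous (chart_low gm up tau).
Proof. by move=> cg t; rewrite /chart_low; case: up; [exact: cg|apply: cvgB; [exact: cg|exact: cvg_cst]]. Qed.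

Lemma chart_strip_sub o D p (d e L : R) gm up (tau : R) :
  vchart (ori o @^-1` D) (ori o p) d e L gm up -> 0 < tau <= e / 2 ->
  chart_strip o p d gm up tau `<=` D.
Proof.
case=> d0 e0 _ ge H /andP[t0 te] x; rewrite /chart_strip/= /strip/=.
have := oriK o x; move: (ori o x) => y yx [y1 y2]; rewrite -yx.
apply/(H y).
- by rewrite ltr_norml; lra.
- have := ge y.1; rewrite !ltr_norml; move: y2; rewrite /chart_low; case: up {H}; lra.
- by move: y2; rewrite /chart_low; case: up {H}; lra.
Qed.

(** A point of [D] within [s] of the complement is less than [(1 + |L|) s] from the graph along the
    second axis: [s] for the displacement and [|L| s] for the variation of the graph. One more [s]
    is spare. *)
Lemma near_compl_strip o D p (d e L : R) gm up (s : R) x :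
  vchart (ori o @^-1` D) (ori o p) d e L gm up -> 0 < s -> s <= d / 2 -> s <= e / 2 ->
  D x -> box p (Num.min (d / 2) (e / 2)) x -> near_compl D s x ->
  chart_strip o p d gm up ((2 + `|L|) * s) x.
Proof.
case=> d0 e0 gL ge H s0 sd se Dx bx [y nDy bxy].
have Dx' : (ori o @^-1` D) (ori o x) by rewrite /= oriK.
have nDy' : ~ (ori o @^-1` D) (ori o y) by rewrite /= oriK.
rewrite /chart_strip/=; move/(ori_box o) : bx; move/(ori_box o) : bxy.
move: (ori o x) (ori o y) (ori o p) H ge Dx' nDy' => {Dx nDy}{}x {}y {}p H ge Dx nDy.
move=> [/= xy1 xy2] [/= x1 x2].
have [xd1 xe1] : `|x.1 - p.1| < d / 2 /\ `|x.2 - p.2| < e / 2.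
  by move: x1 x2; rewrite !lt_min => /andP[? _] /andP[].
have yd : `|y.1 - p.1| < d.
  by rewrite -(subrKA x.1) (le_lt_trans (ler_normD _ _))// (distrC y.1); lra.
have ye : `|y.2 - p.2| < e.
  by rewrite -(subrKA x.2) (le_lt_trans (ler_normD _ _))// (distrC y.2); lra.
have xd : `|x.1 - p.1| < d by lra.
have xe : `|x.2 - p.2| < e by lra.
have /H := Dx => /(_ xd xe) Gx.
have Gy : ~ (if up then gm y.1 < y.2 else y.2 < gm y.1) by move=> G; apply: nDy; apply/H.
have lg : `|gm x.1 - gm y.1| <= `|L| * s.
  apply: le_trans (gL _ _) _; apply: (@le_trans _ _ (`|L| * `|x.1 - y.1|)).
    by rewrite ler_wpM2r// ler_norm.
  by rewrite ler_wpM2l// ltW.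
move: lg xy2 xd; rewrite ler_norml !ltr_norml /strip/= => lg xy2 xd.
split; first lra.
set K := `|L| * s in lg *; have KE : (2 + `|L|) * s = 2 * s + K by rewrite /K; ring.
rewrite KE /chart_low; move: Gx Gy; case: up {H} => Gx /negP; rewrite -leNgt => Gy; lra.
Qed.

Lemma measurable_chart_strip o p d gm up tau : continuous gm ->
  measurable (chart_strip o p d gm up tau : set plane).
Proof.
by move=> cg; apply: measurable_ori_pre; apply: measurable_strip; exact: continuous_chart_low.
Qed.

Lemma leb2_chart_strip o p d gm up tau : continuous gm -> 0 < d -> 0 < tau ->
  leb2 (chart_strip o p d gm up tau) = (2 * d * tau)%:E.
Proof.
move=> cg d0 t0; have cl : continuous (chart_low gm up tau) by exact: continuous_chart_low.
set S := strip ((ori o p).1 - d) ((ori o p).1 + d) (chart_low gm up tau) tau.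
have mS : measurable (S : set plane) by exact: measurable_strip.
have -> : leb2 (chart_strip o p d gm up tau) = (\int[leb2]_(x in chart_strip o p d gm up tau) 1)%E.
  by rewrite integral_cst ?mul1e//; exact: measurable_chart_strip.
rewrite (@integral_ori _ o S (fun=> 1%E))// (@strip_tonelli _ _ _ _ _ (fun=> 1))//; last exact: cst_continuous.
transitivity (\int[lebesgue_measure]_(t in `]((ori o p).1 - d)%R, ((ori o p).1 + d)%R[) tau%:E)%E.
  apply: eq_integral => t _; rewrite integral_cst// mul1e.
  have mI : lebesgue_measure `[chart_low gm up tau t, (chart_low gm up tau t + tau)%R] = tau%:E :> \bar R.
    by rewrite lebesgue_measure_itv/= lte_fin ltrDl t0 -EFinB addrC addKr.
  exact: mI.
rewrite integral_cst//.
have mJ : lebesgue_measure `]((ori o p).1 - d)%R, ((ori o p).1 + d)%R[ = (2 * d)%:E :> \bar R.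
  rewrite lebesgue_measure_itv/= lte_fin -EFinB ifT; last lra.
  by congr EFin; ring.
set X := (X in (_ * X)%E); have -> : X = (2 * d)%:E by exact: mJ.
by rewrite -EFinM; congr EFin; ring.
Qed.

End chart_geometry.

(** * Functions of zero trace near the boundary *)

Section zero_trace.
Context {R : realType}.
Local Notation mu := (@lebesgue_measure R).
Local Notation plane := (measurableTypeR R * measurableTypeR R)%type.
Implicit Types (D U B : set (R * R)) (p x : R * R) (V f g h : R * R -> R).

Lemma H1_cvg_arc D (psi : nat -> R * R -> R) :
  arc_integral (bd D) (fun x => ((psi n x - 0) ^+ 2)%:E) @[n --> \oo] --> 0%E ->
  arc_integral (bd D) (fun x => ((psi n x) ^+ 2)%:E) @[n --> \oo] --> 0%E.
Proof. by under eq_fun do under eq_fun do rewrite subr0. Qed.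

(** The smooth approximations of [V] tend to 0 in [L^2] of the boundary curve, hence on its graph
    charts by [graph_integral_le]; [strip_L2_le] then applies with the derivative across the
    strip. *)
Lemma chart_strip_le o D p (d e L : R) gm up (tau : R) V h1 h2 :
  open D -> L2 D V -> L2 D h1 -> L2 D h2 -> has_trace D V h1 h2 (fun=> 0) ->
  vchart (ori o @^-1` D) (ori o p) d e L gm up -> 0 < tau <= e / 2 ->
  \int[leb2]_(x in chart_strip o p d gm up tau) ((V x) ^+ 2) <=
  8 * tau ^+ 2 * \int[leb2]_(x in chart_strip o p d gm up tau) (((if o then h1 else h2) x) ^+ 2).
Proof.
move=> oD LV L1 L2' [psi [sp H1c tr]] VC tte; have [d0 e0 gL ge _] := VC.
set T := chart_strip o p d gm up tau; set h := (if o then h1 else h2).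
have cg : continuous gm by exact: lip_continuous gL.
have cl : continuous (chart_low gm up tau) by exact: continuous_chart_low.
have mD : measurable (D : set plane) by exact: open_plane_measurable.
have TD : T `<=` D by exact: chart_strip_sub VC tte.
have mT : measurable (T : set plane) by exact: measurable_chart_strip.
have [cV c1 c2] := H1_cvg_parts mD LV L1 L2' sp H1c.
set a := (ori o p).1 - d; set b := (ori o p).1 + d; set l := chart_low gm up tau.
pose S := strip a b l tau.
have ST : S = ori o @^-1` T by apply/seteqP; split => x; rewrite /T /chart_strip/= oriK.
have Lh : L2 T h by apply: (L2_subset mT mD TD); rewrite /h; case: (o).
have mch (u : R * R -> R) : continuous u -> measurable_fun (D : set plane) (u : plane -> R).
  by move=> cu; apply: measurable_funTS; exact: continuous_plane_measurable.
have trans (u : R * R -> R) : L2 T u ->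
    \int[leb2]_(x in S) ((u (ori o x)) ^+ 2) = \int[leb2]_(x in T) ((u x) ^+ 2).
  move=> [mu_ _]; congr fine; rewrite ST (@integral_ori _ o T (fun x => ((u x) ^+ 2)%:E))//.
    exact: measurable_sqr.
  by move=> x; rewrite lee_fin sqr_ge0.
have LVT : L2 T V by exact: L2_subset LV.
rewrite -(trans V)// -(trans h)//.
have cvgS (u : nat -> R * R -> R) (v : R * R -> R) : (forall n, measurable_fun (D : set plane) (u n : plane -> R)) ->
    measurable_fun (D : set plane) (v : plane -> R) -> L2_cvg D u v ->
    L2_cvg S (fun n x => u n (ori o x)) (v \o ori o).
  move=> mu_ mv; apply: squeeze_cvge0 => n.
  have mB := measurable_funB (mu_ n) mv.
  apply/andP; split; first by apply: integral_ge0 => x _; rewrite lee_fin sqr_ge0.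
  rewrite ST (@integral_ori _ o T (fun x => ((u n x - v x) ^+ 2)%:E))//.
  - exact: le_integral_sqr.
  - by apply: measurable_sqr; exact: measurable_funS mB.
  - by move=> x; rewrite lee_fin sqr_ge0.
have sd2 n : d2 (psi n \o ori o) = (if o then d1 (psi n) else d2 (psi n)) \o ori o.
  by case: (o) => //; apply/funext => x; case: (d_swp (psi n) x).
have mpsi n : measurable_fun (D : set plane) (psi n : plane -> R).
  by apply: mch; exact: smooth_continuous.
have spo n : smooth (psi n \o ori o) by case: (o); [exact: (smooth_swp (sp n))|exact: sp].
apply: (@strip_L2_le R a b tau l gm (fun n => psi n \o ori o) (V \o ori o) (h \o ori o)) => //.
- by case/andP: tte.
- by move=> t; rewrite /l /chart_low; case/andP: tte => t0 _; case: (up); lra.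
- by rewrite -/S ST; exact: L2_ori.
- by rewrite -/S ST; exact: L2_ori.
- by move=> n; exact: spo.
- by apply: cvgS => //; case: LV.
- have -> : d2 \o (fun n => psi n \o ori o) = (fun n => (if o then d1 (psi n) else d2 (psi n)) \o ori o).
    by apply/funext => n; exact: sd2.
  apply: (cvgS (fun n => if o then d1 (psi n) else d2 (psi n)) h).
  + by move=> n; apply: mch; apply: smooth_continuous; case: (o); [exact: smooth_d1|exact: smooth_d2].
  + by rewrite /h; case: (o); [case: L1|case: L2'].
  + by rewrite /h; case: (o).
- apply: squeeze_cvge0 (H1_cvg_arc tr) => n; apply/andP; split.
    by apply: integral_ge0 => t _; rewrite lee_fin sqr_ge0.
  apply: (@graph_integral_le R (if o then snd else fst) (fun t => ori o (t, gm t)) (bd D) `]a, b[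
    (fun x => (psi n x) ^+ 2)).
  + by case: (o); [exact: lip1_snd|exact: lip1_fst].
  + by case: (o); [exact: measurable_snd|exact: measurable_fst].
  + apply: measurableT_comp; first exact: measurable_ori.
    apply/measurable_fun_pairP; split; first exact: measurable_id.
    exact: continuous_measurable_fun.
  + by move=> t; case: (o).
  + by apply: closed_plane_measurable; exact: closed_bd.
  + exact: measurable_itv.
  + move=> t /=; rewrite in_itv/= => tab; apply: (chart_bd oD VC).
    by rewrite ltr_norml; move: tab; rewrite /a /b; lra.
  + by apply: measurable_funX; apply: continuous_plane_measurable; exact: smooth_continuous.
  + by move=> x; exact: sqr_ge0.
Qed.

(** Square integral [o(s^2)] on the collar of width [s]. The gradients of the cutoffs are of size
    [1 / s], so this rate is what makes their product with [V] tend to 0 in [L^2]. *)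
Definition collar_small D V B := forall eps : R, 0 < eps -> exists2 s0 : R, 0 < s0 & forall s, 0 < s < s0 ->
  (\int[leb2]_(x in D `&` B `&` near_compl D s) ((V x) ^+ 2)%:E <= (eps * s ^+ 2)%:E)%E.

(** The strip estimate gives [s^2] times the gradient integral over a strip whose area tends to 0;
    absolute continuity of that integral supplies the factor [eps]. *)
Lemma collar_small_chart o D p (d e L : R) gm up V h1 h2 :
  open D -> L2 D V -> L2 D h1 -> L2 D h2 -> has_trace D V h1 h2 (fun=> 0) ->
  vchart (ori o @^-1` D) (ori o p) d e L gm up ->
  collar_small D V (box p (Num.min (d / 2) (e / 2))).
Proof.
move=> oD LV L1 L2' tr VC eps eps0; have [d0 e0 gL ge _] := VC.
have cg : continuous gm by exact: lip_continuous gL.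
have mD : measurable (D : set plane) by exact: open_plane_measurable.
pose h := if o then h1 else h2.
have Lh : L2 D h by rewrite /h; case: (o).
have Ih : leb2.-integrable setT (EFin \o ((fun x => (h x) ^+ 2) \_ D) : plane -> \bar R).
  have := L2_sqr_integrable Lh => /(integrable_mkcond _ mD).
  by rewrite restrict_EFin.
pose K := 2 + `|L|; have K0 : 0 < K by rewrite /K; have := normr_ge0 L; lra.
have k0 : 0 < eps / (8 * K ^+ 2) by rewrite divr_gt0// mulr_gt0// exprn_gt0.
have [del [del0 Hdel]] := integral_normr_continuous Ih k0.
pose s0 := Num.min (Num.min (d / 2) (e / 2)) (Num.min (e / 2 / K) (del / (2 * d) / K)).
exists s0.
  by rewrite !lt_min !divr_gt0// mulr_gt0.
move=> s /andP[sp]; rewrite !lt_min => /andP[/andP[sd se] /andP[seK sdel]].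
pose tau := K * s; have t0 : 0 < tau by rewrite mulr_gt0.
have te : 0 < tau <= e / 2 by rewrite t0/= /tau [K * s]mulrC -ler_pdivlMr// ltW.
have TD := chart_strip_sub VC te; set T := chart_strip o p d gm up tau in TD.
have mT : measurable (T : set plane) by exact: measurable_chart_strip.
have sub : D `&` box p (Num.min (d / 2) (e / 2)) `&` near_compl D s `<=` T.
  by move=> x [[Dx bx] nx]; apply: (near_compl_strip VC); rewrite ?ltW.
have mN : measurable (D `&` box p (Num.min (d / 2) (e / 2)) `&` near_compl D s : set plane).
  by apply: open_plane_measurable; apply: openI; [apply: openI => //; exact: open_box|exact: open_near_compl].
have LVT : L2 T V by exact: L2_subset LV.
apply: le_trans (le_integral_sqr mN mT sub LVT.1) _.
rewrite L2_sqr_fin// lee_fin.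
apply: le_trans (chart_strip_le oD LV L1 L2' tr VC te) _; rewrite -/T -/h.
have : \int[leb2]_(x in T) ((h x) ^+ 2) < eps / (8 * K ^+ 2).
  have -> : \int[leb2]_(x in T) ((h x) ^+ 2) = \int[leb2]_(x in T) `|((fun x => (h x) ^+ 2) \_ D) x|.
    apply: eq_Rintegral => x /set_mem Tx; rewrite patchE mem_set ?ger0_norm ?sqr_ge0//.
    exact: TD.
  apply: Hdel => //; suff : (leb2 T < del%:E)%E by [].
  rewrite /T leb2_chart_strip// lte_fin /tau.
  by move: sdel; rewrite !ltr_pdivlMr ?mulr_gt0//; lra.
rewrite ltr_pdivlMr; last by rewrite mulr_gt0// exprn_gt0.
move=> H; rewrite /tau exprMn; have := sqr_ge0 s; move: H; set X := \int[_]_(_ in _) _.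
by have := sqr_ge0 K; nra.
Qed.

Lemma collar_smallU D V B B' : open D -> open B -> open B' ->
  measurable_fun (D : set plane) (V : plane -> R) ->
  collar_small D V B -> collar_small D V B' -> collar_small D V (B `|` B').
Proof.
move=> oD oB oB' mV H H' eps eps0; have e20 : 0 < eps / 2 by lra.
have [s0 s00 Hs] := H _ e20; have [s1 s10 Hs'] := H' _ e20.
exists (Num.min s0 s1); first by rewrite lt_min s00.
move=> s; rewrite lt_min => /and3P[sp ss0 ss1].
have := Hs s; rewrite sp ss0 => /(_ isT) K; have := Hs' s; rewrite sp ss1 => /(_ isT) K'.
have mo (C : set (R * R)) : open C -> measurable (D `&` C `&` near_compl D s : set plane).
  by move=> oC; apply: open_plane_measurable; apply: openI; [exact: openI|exact: open_near_compl].
rewrite setIUr setIUl.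
have -> : (eps * s ^+ 2)%:E = ((eps / 2 * s ^+ 2)%:E + (eps / 2 * s ^+ 2)%:E)%E.
  by rewrite -EFinD; congr EFin; field.
apply: le_trans (leeD K K').
have sub (C : set (R * R)) : D `&` C `&` near_compl D s `<=` D by move=> x [[]].
have mD : measurable (D : set plane) by exact: open_plane_measurable.
set X := D `&` B `&` _; set Y := D `&` B' `&` _.
have mX : measurable (X : set plane) by exact: mo.
have mY : measurable (Y : set plane) by exact: mo.
have XD : X `<=` D by exact: sub.
have YD : Y `<=` D by exact: sub.
rewrite -(setDUK (@subsetUl _ X Y)) ge0_integral_setU//.
- rewrite leeD2l//; apply: le_integral_sqr => //.
  + by apply: measurableD => //; exact: measurableU.
  + by move=> x [[]].
  + exact: measurable_funS mD YD mV.
- by apply: measurableD => //; exact: measurableU.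
- by rewrite setDUK//; apply: measurable_sqr; apply: (measurable_funS mD _ mV) => x [/XD|/YD].
- by move=> x _; rewrite lee_fin sqr_ge0.
- by apply/disj_setPS => x [? []].
Qed.

End zero_trace.

Section collar.
Context {R : realType}.
Local Notation plane := (measurableTypeR R * measurableTypeR R)%type.
Implicit Types (D U B : set (R * R)) (p q x y : R * R) (V f g h : R * R -> R).

Lemma bounded_cbox D : bounded_set D -> exists2 M, 0 < M & D `<=` cbox 0 M.
Proof.
case=> M [_ HM]; exists (`|M| + 1); first by have := normr_ge0 M; lra.
have Mlt : M < `|M| + 1 by have := ler_norm M; lra.
move=> x Dx; have /= := HM _ Mlt x Dx; rewrite prod_normE ge_max => /andP[? ?].
by split; rewrite subr0.
Qed.

Lemma closure_cbox D (M : R) : D `<=` cbox 0 M -> closure D `<=` cbox 0 M.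
Proof. by move=> DM; rewrite [X in _ `<=` X](closure_id _).1; [exact: closureS|exact: cbox_closed]. Qed.

Lemma compact_bd D : open D -> bounded_set D -> compact (bd D).
Proof.
move=> oD /bounded_cbox[M _ DM]; apply: (@closed_bounded_compact _ _ M); first exact: closed_bd.
by move=> x [cx _]; exact: closure_cbox cx.
Qed.

Lemma bd_on_segment D x y : open D -> D x -> ~ D y ->
  exists2 s : R, 0 <= s <= 1 & bd D (x.1 + s * (y.1 - x.1), x.2 + s * (y.2 - x.2)).
Proof.
move=> oD Dx nDy.
pose c (t : R) : R * R := (x.1 + t * (y.1 - x.1), x.2 + t * (y.2 - x.2)).
have cc : continuous c.
  move=> t; apply: (@continuous_pair_at _ _ (fun t : R => x.1 + t * (y.1 - x.1))
    (fun t : R => x.2 + t * (y.2 - x.2)) t); (apply: cvgD; [exact: cvg_cst|apply: cvgMl; exact: cvg_id]).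
have c0 : c 0 = x by rewrite /c !mul0r !addr0 -surjective_pairing.
have c1 : c 1 = y by rewrite /c !mul1r addrC subrK addrC subrK -surjective_pairing.
pose A := [set t : R | 0 <= t <= 1 /\ D (c t)].
have A0 : A 0 by split; rewrite ?c0// lexx ler01.
have supA : has_sup A by split; [exists 0|exists 1 => t [/andP[]]].
pose s := sup A.
have s0 : 0 <= s by apply: sup_upper_bound.
have s1 : s <= 1 by apply: ge_sup; [exists 0|move=> t [/andP[]]].
have clD : closure D (c s).
  move=> B nB; have : nbhs s (c @^-1` B) by exact: cc.
  move/nbhs_ballP => [e /= e0 eB].
  have [t At st] := sup_adherent e0 supA; exists (c t); split; first by case: At.
  apply: eB; rewrite /ball/= ltr_norml; have : t <= s by exact: sup_upper_bound.
  by move: st; rewrite -/s; lra.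
have nD : ~ D (c s).
  move=> Ds; have : nbhs s (c @^-1` D) by apply: cc; exact: near_open.
  move/nbhs_ballP => [e /= e0 eB].
  have [s1'|s1'] := eqVneq s 1; first by apply: nDy; rewrite -c1 -s1'.
  have s1lt : s < 1 by rewrite lt_neqAle s1'.
  pose t := Num.min 1 (s + e / 2).
  have st : s < t by rewrite lt_min s1lt/=; lra.
  have : t <= s; last by rewrite leNgt st.
  apply: sup_upper_bound => //; split; first by rewrite ge_min lexx/= andbT; lra.
  apply: eB; rewrite /ball/= ltr0_norm ?subr_lt0// opprB.
  by have : t <= s + e / 2 by [rewrite ge_min lexx orbT]; lra.
by exists s; [rewrite s0 s1|exact/bdE].
Qed.

Lemma segment_bd D x y : open D -> D x -> ~ D y ->
  exists2 q, bd D q & `|x.1 - q.1| <= `|x.1 - y.1| /\ `|x.2 - q.2| <= `|x.2 - y.2|.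
Proof.
move=> oD Dx nDy; have [s /andP[s0 s1] bs] := bd_on_segment oD Dx nDy; eexists; first exact: bs.
have aux (a b : R) : `|a - (a + s * (b - a))| <= `|a - b|.
  have -> : a - (a + s * (b - a)) = s * (a - b) by ring.
  by rewrite normrM ger0_norm// ler_piMl.
by split; exact: aux.
Qed.

Lemma box_sub p q (r s : R) : box p r q -> box q s `<=` box p (r + s).
Proof.
case=> a b x [c d]; split.
- by rewrite -(subrKA q.1) (le_lt_trans (ler_normD _ _))//; lra.
- by rewrite -(subrKA q.2) (le_lt_trans (ler_normD _ _))//; lra.
Qed.

Lemma lebesgue_number (K B : set (R * R)) : compact K -> open B -> K `<=` B ->
  exists2 del : R, 0 < del & forall q s, K q -> 0 < s < del -> box q s `<=` B.
Proof.
move=> cK oB KB; have := cK; move/compact_near_coveringP => /(_ R 0^'+ (fun s q => box q s `<=` B)).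
have H q : K q -> \forall q' \near q & s \near 0^'+, box q' s `<=` B.
  move=> Kq; have /openP_box/(_ q (KB _ Kq))[r r0 rB] := oB.
  exists (box q (r / 2), [set s : R | s < r / 2]).
    split; first by apply: near_open; [exact: open_box|apply: boxxx; lra].
    by apply: nbhs_right_lt; lra.
  case=> q' s [/= bq' sr] x bx; apply: rB.
  have -> : r = r / 2 + r / 2 by field.
  by apply: (box_sub bq'); case: bx => *; split; lra.
move=> /(_ _ H)[del /= del0 Hdel]; exists del => // q s Kq /andP[s0 sd].
by apply: (Hdel s) => //=; rewrite sub0r normrN gtr0_norm.
Qed.

Lemma collar_small0 D V : collar_small D V set0.
Proof.
move=> eps eps0; exists 1 => // s _; rewrite setI0 set0I integral_set0 lee_fin mulr_ge0 ?sqr_ge0//.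
exact: ltW.
Qed.

(** Compactness in filter form: a property of sets that is stable under unions and holds near each
    point of [K] holds for some set covering [K]. *)
Lemma compact_directed (T : topologicalType) (K : set T) (good : set (set T)) : compact K ->
  good set0 -> (forall B B' : set T, good B -> good B' -> good (B `|` B')) ->
  (forall x : T, K x -> exists B : set T, [/\ good B, open B & B x]) -> exists2 B : set T, good B & K `<=` B.
Proof.
move=> cK g0 gU gK.
pose F := filter_from good (fun B : set T => [set B' : set T | good B' /\ B `<=` B']).
have FF : Filter F.
  apply: filter_from_filter; first by exists set0.
  move=> B B' gB gB'; exists (B `|` B'); first exact: gU.
  by move=> C [gC BC]; split; split => // x Bx; apply: BC; [left|right].
have := cK; move/compact_near_coveringP => /(_ _ F (fun (B : set T) (x : T) => B x) FF)[|B gB HB].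
  move=> x Kx; have [B [gB oB Bx]] := gK x Kx.
  exists (B, [set B' : set T | good B' /\ B `<=` B']).
    by split; [exact: open_nbhs_nbhs|exists B].
  by case=> x' B' [/= Bx' [_]]; apply.
by exists B => //; apply: (HB B); split.
Qed.

Lemma C2_oriented_chart D p : C2_boundary D -> bd D p ->
  exists o d e L gm up, vchart (ori o @^-1` D) (ori o p) d e L gm up.
Proof.
move=> cD bp; have [[d [e [L [gm [up V]]]]]|[d [e [L [gm [up V]]]]]] := C2_boundary_chart cD bp.
- by exists false, d, e, L, gm, up.
- by exists true, d, e, L, gm, up.
Qed.

Lemma collar_small_all D V h1 h2 : open D -> bounded_set D -> C2_boundary D ->
  L2 D V -> L2 D h1 -> L2 D h2 -> has_trace D V h1 h2 (fun=> 0) -> collar_small D V setT.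
Proof.
move=> oD bD cD LV L1 L2' tr; have cK := compact_bd oD bD.
have loc p : exists r : R, bd D p -> 0 < r /\ collar_small D V (box p r).
  have [bp|nbp] := pselect (bd D p); last by exists 0.
  have [w [d [e [L [gm [up VC]]]]]] := C2_oriented_chart cD bp.
  exists (Num.min (d / 2) (e / 2)) => _; split; last exact: (collar_small_chart oD LV L1 L2' tr VC).
  by case: VC => d0 e0 _ _ _; rewrite lt_min !divr_gt0.
have [rad Hrad] := choice loc.
have [|||B [oB sB] cov] := compact_directed (good := [set B | open B /\ collar_small D V B]) cK.
- by split; [exact: open0|exact: collar_small0].
- by move=> B B' [? ?] [? ?]; split; [exact: openU|exact: (collar_smallU oD _ _ LV.1)].
- move=> p bp; have [r0 sr] := Hrad p bp; exists (box p (rad p)).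
  by split; [split => //; exact: open_box|exact: open_box|exact: boxxx].
have [del del0 Hdel] := lebesgue_number cK oB cov.
move=> eps eps0; have [s0 s00 Hs] := sB _ eps0.
exists (Num.min del s0); first by rewrite lt_min del0.
move=> s; rewrite lt_min => /and3P[sp sd ss].
have := Hs s; rewrite sp ss => /(_ isT); rewrite setIT.
suff -> : D `&` near_compl D s = D `&` B `&` near_compl D s by [].
apply/seteqP; split => x; last by case=> -[].
case=> Dx nx; split => //; split => //.
(* The segment from [x] to the point of the complement crosses the boundary at a point no farther
   from [x] in either coordinate, and the charts cover a neighbourhood of the boundary. *)
case: nx => y nDy [b1 b2]; have [q bq [q1 q2]] := segment_bd oD Dx nDy.
by apply: (Hdel q s) => //; [rewrite sp|split; lra].
Qed.

End collar.

(** * Cutoffs built on a grid *)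

Section cutoff.
Context {R : realType}.
Implicit Types (D : set (R * R)) (x y : R * R) (s t : R) (n i j : nat).

Lemma is_derive_sum1 n (F F' : nat -> R -> R) t :
  (forall i, is_derive t (1 : R) (F i) (F' i t)) ->
  is_derive t (1 : R) (fun u : R => \sum_(0 <= i < n) F i u) (\sum_(0 <= i < n) F' i t).
Proof.
move=> HF; elim: n => [|n IH].
  by rewrite big_nil; under eq_fun do rewrite big_nil; exact: is_derive_cst1.
rewrite big_nat_recr//=; under eq_fun do rewrite big_nat_recr//=.
exact: is_deriveD1.
Qed.

(** A difference of consecutive steps, so that sums of integer translates telescope: the translates
    form a partition of unity by construction. *)
Definition bump1 t : R := sstep (t + 1) - sstep t.
Definition bump1d t : R := sstepd (t + 1) - sstepd t.

Lemma is_derive_bump1 t : is_derive t (1 : R) bump1 (bump1d t).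
Proof.
apply: is_deriveB1; last exact: is_derive_sstep.
have := @is_derive_shift1 R sstep t 1 _ (is_derive_sstep (1 + t)).
by rewrite /bump1d; under eq_fun do rewrite addrC; rewrite addrC.
Qed.

Lemma bump1_ge0 t : 0 <= bump1 t.
Proof. by rewrite subr_ge0; apply: sstep_mono; lra. Qed.

Lemma bump1_eq0 t : 1 <= `|t| -> bump1 t = 0.
Proof.
rewrite /bump1 ler_normr => /orP[t1|t1].
- by rewrite !sstep1 ?subrr//; lra.
- by rewrite !sstep0 ?subrr//; lra.
Qed.

Lemma bump1_sum n t : \sum_(0 <= i < n) bump1 (t - i%:R) = sstep (t + 1) - sstep (t + 1 - n%:R).
Proof.
elim: n => [|n IH]; first by rewrite big_nil subr0 subrr.
rewrite big_nat_recr//= IH /bump1 -natr1.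
have -> : t + 1 - (n%:R + 1) = t - n%:R by ring.
have -> : t - n%:R + 1 = t + 1 - n%:R by ring.
by rewrite addrA subrK.
Qed.

Let H t : R := if 0 <= t then 1 else 0.

(** At most two integer translates of the unit interval contain [t]. The indicator of [[0, 2)] is
    written with Heaviside steps [H] so that the count telescopes. *)
Lemma unit_sum_le (F : R -> R) (B : R) n t : 0 <= B -> (forall u, `|F u| <= B) ->
  (forall u, (u < 0) || (1 < u) -> F u = 0) ->
  \sum_(0 <= i < n) `|F (t - i%:R)| <= 2 * B.
Proof.
move=> B0 FB F0.
have Fle u : `|F u| <= B * ((H u - H (u - 1)) + (H (u - 1) - H (u - 2))).
  have [u0|u0] := ltP u 0.
    by rewrite F0 ?u0// normr0 /H !ifF ?subrr ?addr0 ?mulr0//; apply/negbTE; rewrite -ltNge; lra.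
  have [u1|u1] := ltP 1 u.
    rewrite F0 ?u1 ?orbT// normr0 mulr_ge0// /H u0.
    by case: ifPn => ?; case: ifPn => ?; lra.
  rewrite addrA subrK /H u0 ifF ?subr0 ?mulr1 ?FB//.
  by apply/negbTE; rewrite -ltNge; lra.
apply: le_trans (ler_sum _ (fun i _ => Fle (t - i%:R))) _.
rewrite -mulr_sumr mulrC ler_wpM2r//.
have tele c m : \sum_(0 <= i < m) (H (t - i%:R - c) - H (t - i%:R - (c + 1))) = H (t - c) - H (t - c - m%:R).
  elim: m => [|m IH]; first by rewrite big_nil !subr0 subrr.
  rewrite big_nat_recr//= IH -natr1.
  have -> : t - c - m%:R = t - m%:R - c by ring.
  have -> : t - c - (m%:R + 1) = t - m%:R - (c + 1) by ring.
  by rewrite addrA subrK.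
have HH u v : H u - H v <= 1 by rewrite /H; case: ifP; case: ifP; lra.
rewrite big_split/=.
have -> : \sum_(0 <= i < n) (H (t - i%:R) - H (t - i%:R - 1)) =
    \sum_(0 <= i < n) (H (t - i%:R - 0) - H (t - i%:R - (0 + 1))).
  by apply: eq_bigr => i _; rewrite subr0 add0r.
have -> : \sum_(0 <= i < n) (H (t - i%:R - 1) - H (t - i%:R - 2)) =
    \sum_(0 <= i < n) (H (t - i%:R - 1) - H (t - i%:R - (1 + 1))) by [].
by rewrite !tele; have := HH (t - 0) (t - 0 - n%:R); have := HH (t - 1) (t - 1 - n%:R); lra.
Qed.

Lemma bump1d_sum : exists2 C : R, 0 < C & forall n t, \sum_(0 <= i < n) `|bump1d (t - i%:R)| <= C.
Proof.
have [B B0 HB] := @sstepd_bound R; exists (4 * B); first by lra.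
move=> n t.
apply: (@le_trans _ _ (\sum_(0 <= i < n) (`|sstepd (t + 1 - i%:R)| + `|sstepd (t - i%:R)|))).
  apply: ler_sum => i _; rewrite /bump1d (_ : t - i%:R + 1 = t + 1 - i%:R); last by ring.
  exact: ler_normB.
rewrite big_split/=.
have := unit_sum_le n (t + 1) (ltW B0) HB (@sstepd_eq0 R).
by have := unit_sum_le n t (ltW B0) HB (@sstepd_eq0 R); lra.
Qed.

(* A partition of unity subordinate to a grid of mesh s covering [-n s, n s]^2, restricted to the
   cells contained in D. *)
Context (D : set (R * R)) (s : R) (n : nat).
Context (s0 : 0 < s) (DM : D `<=` cbox 0 (n%:R * s)).

Let b i t := bump1 (t / s + n%:R - i%:R).
Let db i t := bump1d (t / s + n%:R - i%:R) / s.
Let grid i j : R * R := ((i%:R - n%:R) * s, (j%:R - n%:R) * s).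
Let c i j : R := if `[<cbox (grid i j) s `<=` D>] then 1 else 0.
Let N := (n.*2).+1.

Definition cutoff x : R := \sum_(0 <= i < N) \sum_(0 <= j < N) c i j * (b i x.1 * b j x.2).

Lemma is_derive_b i t : is_derive t (1 : R) (b i) (db i t).
Proof.
have D1 : is_derive t (1 : R) (fun t : R => t / s + n%:R - i%:R) s^-1.
  under eq_fun do rewrite -addrA mulrC.
  apply: is_derive_eq (is_deriveD1 (is_deriveZ1 s^-1 (is_derive_id1 t)) (is_derive_cst1 t (n%:R - i%:R))) _.
  by rewrite addr0 mulr1.
exact: (@is_derive_comp1 _ bump1 (fun t : R => t / s + n%:R - i%:R) t _ _ (is_derive_bump1 _) D1).
Qed.

Lemma b_ge0 i t : 0 <= b i t. Proof. exact: bump1_ge0. Qed.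

Lemma b_sum_le1 t : \sum_(0 <= i < N) b i t <= 1.
Proof.
rewrite bump1_sum; have := sstep_le1 (t / s + n%:R + 1); have := sstep_ge0 (t / s + n%:R + 1 - N%:R); lra.
Qed.

Lemma b_sum1 t : `|t| <= n%:R * s -> \sum_(0 <= i < N) b i t = 1.
Proof.
rewrite ler_norml => /andP[t1 t2]; rewrite bump1_sum.
have k1 : - n%:R <= t / s by rewrite ler_pdivlMr// mulNr.
have k2 : t / s <= n%:R by rewrite ler_pdivrMr.
rewrite sstep1 ?sstep0 ?subr0//; last lra.
by rewrite /N -natr1 -addnn natrD; lra.
Qed.

Lemma b_neq0 i t : b i t != 0 -> `|t - (i%:R - n%:R) * s| < s.
Proof.
move=> bn; rewrite ltNge; apply/negP => H1; move/eqP : bn; apply; apply: bump1_eq0.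
have -> : t / s + n%:R - i%:R = (t - (i%:R - n%:R) * s) / s by field; rewrite gt_eqF.
by rewrite normrM normfV (gtr0_norm s0) ler_pdivlMr// mul1r.
Qed.

Lemma c01 i j : 0 <= c i j <= 1.
Proof. by rewrite /c; case: ifP => _; rewrite lexx ler01. Qed.

Lemma cutoff_ge0 x : 0 <= cutoff x.
Proof.
apply: sumr_ge0 => i _; apply: sumr_ge0 => j _; rewrite mulr_ge0 ?mulr_ge0 ?b_ge0//.
by case/andP: (c01 i j).
Qed.

Lemma cutoff_le1 x : cutoff x <= 1.
Proof.
apply: (@le_trans _ _ (\sum_(0 <= i < N) b i x.1)); last exact: b_sum_le1.
apply: ler_sum => i _; apply: (@le_trans _ _ (\sum_(0 <= j < N) b i x.1 * b j x.2)).
  apply: ler_sum => j _; rewrite ler_piMl ?mulr_ge0 ?b_ge0//; by case/andP: (c01 i j).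
by rewrite -mulr_sumr ler_piMr ?b_ge0// b_sum_le1.
Qed.

(** A bump that is nonzero at [x] has its centre within [s] of [x], so its cell lies in the square
    of half-side [2 s] and is kept; all nonzero terms of the partition of unity are present. *)
Lemma cutoff_eq1 x : D x -> cbox x (2 * s) `<=` D -> cutoff x = 1.
Proof.
move=> Dx xD; have [] := DM Dx; rewrite !subr0 => x1 x2.
rewrite -(b_sum1 x1); apply: eq_bigr => i _.
rewrite -[RHS]mulr1 -(b_sum1 x2) mulr_sumr; apply: eq_bigr => j _.
have [->|bi] := eqVneq (b i x.1) 0; first by rewrite !mul0r mulr0.
have [->|bj] := eqVneq (b j x.2) 0; first by rewrite !mulr0.
rewrite /c ifT ?mul1r//; apply/asboolP => y [y1 y2]; apply: xD.
have := b_neq0 bi; have := b_neq0 bj; move: y1 y2; rewrite /grid/= => y1 y2 k1 k2; split.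
- by rewrite -(subrKA ((i%:R - n%:R) * s)) (le_trans (ler_normD _ _))// (distrC _ x.1); lra.
- by rewrite -(subrKA ((j%:R - n%:R) * s)) (le_trans (ler_normD _ _))// (distrC _ x.2); lra.
Qed.

Lemma smooth_cutoff : smooth cutoff.
Proof.
apply/smoothP => m; apply: CkU_sum; first exact: openT.
move=> i; apply: CkU_sum; first exact: openT.
move=> j; apply: CkU_scale; first exact: openT.
have sb (u : R * R -> R) k : (forall m, CkU setT m u) -> smoothU setT (fun x => b k (u x)).
  move=> su; have aff d : smoothU setT (fun x => u x / s + n%:R - k%:R + d).
    do 3 (apply: smoothU_add; [exact: openT| |exact: smoothU_cst]).
    by apply: smoothU_mul; [exact: openT|exact: su|exact: smoothU_cst].
  apply: smoothU_sub; first exact: openT.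
    by apply: smoothU_sstep; [exact: openT|exact: aff].
  apply: smoothU_sstep; first exact: openT.
  by have := aff 0; under eq_fun do rewrite addr0.
apply: smoothU_mul; first exact: openT.
- by apply: sb => k; exact: CkU_fst.
- by apply: sb => k; exact: CkU_snd.
Qed.

Lemma cutoff_support : exists K, [/\ compact K, K `<=` D & forall x, ~ K x -> cutoff x = 0].
Proof.
pose K := [set x | exists i j, [/\ (i < N)%N, (j < N)%N, cbox (grid i j) s `<=` D & cbox (grid i j) s x]].
have cK : closed K.
  have -> : K = \bigcup_(ij in [set ij : 'I_N * 'I_N | cbox (grid ij.1 ij.2) s `<=` D]) cbox (grid ij.1 ij.2) s.
    apply/seteqP; split => x.
      by case=> i [j [iN jN sD Kx]]; exists (Ordinal iN, Ordinal jN).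
    by case=> -[i j] /= sD Kx; exists i, j; split.
  by apply: closed_bigcup => [|ij _]; [exact: finite_finset|exact: cbox_closed].
exists K; split.
- apply: (closed_bounded_compact cK) => x [i [j [_ _ sD Kx]]]; exact: DM (sD _ Kx).
- by move=> x [i [j [_ _ sD Kx]]]; exact: sD.
move=> x nK; rewrite /cutoff big_nat big1// => i /andP[_ iN].
rewrite big_nat big1// => j /andP[_ jN].
rewrite /c; case: asboolP => sD; last by rewrite mul0r.
have [->|bi] := eqVneq (b i x.1) 0; first by rewrite !mul0r mulr0.
have [->|bj] := eqVneq (b j x.2) 0; first by rewrite !mulr0.
by exfalso; apply: nK; exists i, j; split => //; split; apply: ltW; exact: b_neq0.
Qed.

Lemma cutoff_test : test_fun D cutoff.
Proof. by split; [exact: smooth_cutoff|exact: cutoff_support]. Qed.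

Lemma cutoff_d1 x : d1 cutoff x = \sum_(0 <= i < N) (\sum_(0 <= j < N) c i j * b j x.2) * db i x.1.
Proof.
apply: is_derive_d1; apply/is_derive_e1.
have -> : (fun t : R => cutoff (t, x.2)) =
    (fun t : R => \sum_(0 <= i < N) (\sum_(0 <= j < N) c i j * b j x.2) * b i t).
  apply/funext => t; apply: eq_bigr => i _; rewrite mulr_suml; apply: eq_bigr => j _ /=; ring.
by apply: (@is_derive_sum1 N (fun i t => (\sum_(0 <= j < N) c i j * b j x.2) * b i t)
  (fun i t => (\sum_(0 <= j < N) c i j * b j x.2) * db i t)) => i; apply: is_deriveZ1; exact: is_derive_b.
Qed.

Lemma cutoff_d2 x : d2 cutoff x = \sum_(0 <= j < N) (\sum_(0 <= i < N) c i j * b i x.1) * db j x.2.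
Proof.
apply: is_derive_d2; apply/is_derive_e2.
have -> : (fun t : R => cutoff (x.1, t)) =
    (fun t : R => \sum_(0 <= j < N) (\sum_(0 <= i < N) c i j * b i x.1) * b j t).
  apply/funext => t; rewrite /cutoff exchange_big/=; apply: eq_bigr => j _.
  rewrite mulr_suml; apply: eq_bigr => i _ /=; ring.
by apply: (@is_derive_sum1 N (fun j t => (\sum_(0 <= i < N) c i j * b i x.1) * b j t)
  (fun j t => (\sum_(0 <= i < N) c i j * b i x.1) * db j t)) => i; apply: is_deriveZ1; exact: is_derive_b.
Qed.

Lemma db_sum_le (C : R) (a : nat -> R) t : (forall m u, \sum_(0 <= i < m) `|bump1d (u - i%:R)| <= C) ->
  (forall i, 0 <= a i <= 1) -> `|\sum_(0 <= i < N) a i * db i t| <= C / s.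
Proof.
move=> HC a01; apply: le_trans (ler_norm_sum _ _ _) _.
apply: (@le_trans _ _ ((\sum_(0 <= i < N) `|bump1d (t / s + n%:R - i%:R)|) / s)); last first.
  by rewrite ler_pM2r ?invr_gt0//; exact: HC.
rewrite mulr_suml; apply: ler_sum => i _; rewrite normrM /db normrM normfV (gtr0_norm s0).
have /andP[a0 a1] := a01 i; rewrite (ger0_norm a0) ler_piMl// mulr_ge0// invr_ge0 ltW//.
Qed.

Lemma cb_sum01 (k : nat -> R) t : (forall j, 0 <= k j <= 1) -> 0 <= \sum_(0 <= j < N) k j * b j t <= 1.
Proof.
move=> k01; apply/andP; split.
  by apply: sumr_ge0 => j _; rewrite mulr_ge0 ?b_ge0//; case/andP: (k01 j).
apply: le_trans (b_sum_le1 t); apply: ler_sum => j _.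
by rewrite ler_piMl ?b_ge0//; case/andP: (k01 j).
Qed.

(** In a partial derivative the other variable only contributes coefficients in [[0, 1]], and
    boundedly many bumps have a nonzero derivative at a point: the bound depends neither on the
    number of cells nor on [D]. *)
Lemma cutoff_grad_le (C : R) : (forall m u, \sum_(0 <= i < m) `|bump1d (u - i%:R)| <= C) ->
  forall x, `|d1 cutoff x| <= C / s /\ `|d2 cutoff x| <= C / s.
Proof.
move=> HC x; rewrite cutoff_d1 cutoff_d2; split.
- by apply: (@db_sum_le C (fun i => \sum_(0 <= j < N) c i j * b j x.2)) => // i;
    apply: cb_sum01 => j; exact: c01.
- by apply: (@db_sum_le C (fun j => \sum_(0 <= i < N) c i j * b i x.1)) => // j;
    apply: cb_sum01 => i; exact: c01.
Qed.

(** Width [3 s] is [s] for a neighbourhood of [x] plus the [2 s] that [cutoff_eq1] asks around each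
    of its points. *)
Lemma cutoff_grad0 x : D x -> ~ near_compl D (3 * s) x -> d1 cutoff x = 0 /\ d2 cutoff x = 0.
Proof.
move=> Dx nx.
have bD y : box x (3 * s) y -> D y.
  move=> [y1 y2]; apply: contrapT => nDy; apply: nx; exists y => //.
  by split; rewrite distrC.
have [<- <-] := @d_cst R 1 x.
apply: (@d_eq R (box x s)); [exact: open_box| |exact: boxxx].
have s3 : s < 3 * s by move: s0; lra.
move=> y [y1 y2]; apply: cutoff_eq1; first by apply: bD; split; exact: lt_trans s3.
move=> w [w1 w2]; apply: bD; split.
- by rewrite -(subrKA y.1) (le_lt_trans (ler_normD _ _))//; lra.
- by rewrite -(subrKA y.2) (le_lt_trans (ler_normD _ _))//; lra.
Qed.

End cutoff.

Local Opaque d1 d2 derive.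

(** * Cutoffs and weak forms *)

Section cutoff_sequence.
Context {R : realType}.
Local Notation plane := (measurableTypeR R * measurableTypeR R)%type.
Implicit Types (D : set (R * R)) (x y : R * R) (V f g h : R * R -> R).

Lemma L2_cvg_add D (u v : nat -> R * R -> R) f g : measurable (D : set plane) ->
  (forall n, L2 D (u n)) -> (forall n, L2 D (v n)) -> L2 D f -> L2 D g ->
  L2_cvg D u f -> L2_cvg D v g -> L2_cvg D (fun n x => u n x + v n x) (fun x => f x + g x).
Proof.
move=> mD Lu Lv Lf Lg uf vg.
have := cvgeD (_ : adde_def (2%:E * 0 : \bar R)%E (2%:E * 0)%E)
  (cvgeZl (isT : (2%:E : \bar R) \is a fin_num) uf) (cvgeZl (isT : (2%:E : \bar R) \is a fin_num) vg).
rewrite mule0 adde0 => /(_ _ isT); apply: squeeze_cvge0 => n; apply/andP; split.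
  by apply: integral_ge0 => x _; rewrite lee_fin sqr_ge0.
have m1 := (L2_sub mD (Lu n) Lf).1; have m2 := (L2_sub mD (Lv n) Lg).1.
rewrite -!ge0_integralZl//; try exact: measurable_sqr; try by move=> x _; rewrite lee_fin sqr_ge0.
rewrite -ge0_integralD//; try (by move=> x _; rewrite -EFinM lee_fin mulr_ge0// sqr_ge0);
  try (by apply: measurable_funeM; exact: measurable_sqr).
apply: ge0_le_integral => //.
- by move=> x _; rewrite lee_fin sqr_ge0.
- by apply: measurable_sqr; apply: measurable_funB; apply: measurable_funD;
    [case: (Lu n)|case: (Lv n)|case: Lf|case: Lg].
- by apply: emeasurable_funD; apply: measurable_funeM; exact: measurable_sqr.
- by move=> x _; rewrite -!EFinM -EFinD lee_fin; have := sqr_ge0 (u n x - f x - (v n x - g x)); nra.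
Qed.

Lemma L2_cvg_bmul D (u : nat -> R * R -> R) f h (B : R) : measurable (D : set plane) ->
  (forall n, L2 D (u n)) -> L2 D f -> measurable_fun (D : set plane) (h : plane -> R) ->
  (forall x, D x -> `|h x| <= B) -> L2_cvg D u f ->
  L2_cvg D (fun n x => h x * u n x) (fun x => h x * f x).
Proof.
move=> mD Lu Lf mh hB uf.
have := cvgeZl (isT : ((B ^+ 2)%:E : \bar R) \is a fin_num) uf.
rewrite mule0; apply: squeeze_cvge0 => n; apply/andP; split.
  by apply: integral_ge0 => x _; rewrite lee_fin sqr_ge0.
have m1 := (L2_sub mD (Lu n) Lf).1.
rewrite -ge0_integralZl//; try exact: measurable_sqr; try (by move=> x _; rewrite lee_fin sqr_ge0);
  last by rewrite lee_fin sqr_ge0.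
apply: ge0_le_integral => //.
- by move=> x _; rewrite lee_fin sqr_ge0.
- by apply: measurable_sqr; apply: measurable_funB; apply: measurable_funM => //;
    [case: (Lu n)|case: Lf].
- by apply: measurable_funeM; exact: measurable_sqr.
- move=> x Dx; rewrite -EFinM lee_fin -mulrBr exprMn ler_wpM2r ?sqr_ge0//.
  have B0 : 0 <= B by exact: le_trans (normr_ge0 _) (hB _ Dx).
  by rewrite -real_normK ?num_real// lerXn2r ?nnegrE// hB.
Qed.

(* Cutoffs exhausting D whose gradients are harmless against functions of zero trace. *)
Definition good_cutoffs D (th : nat -> R * R -> R) :=
  [/\ forall m, test_fun D (th m), forall m x, 0 <= th m x <= 1,
      forall x, D x -> \forall m \near \oo, th m x = 1 &
      forall V h1 h2, L2 D V -> L2 D h1 -> L2 D h2 -> has_trace D V h1 h2 (fun=> 0) ->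
        L2_cvg D (fun m x => d1 (th m) x * V x) (fun=> 0) /\
        L2_cvg D (fun m x => d2 (th m) x * V x) (fun=> 0)].

Lemma cvge0_eps (u : nat -> \bar R) : (forall n, 0 <= u n)%E ->
  (forall e : R, 0 < e -> \forall n \near \oo, (u n <= e%:E)%E) -> u @ \oo --> 0%E.
Proof.
move=> u0 H; apply/fine_cvgP; split.
  apply: filterS (H 1 ltr01) => n un; rewrite ge0_fin_numE//.
  by apply: le_lt_trans un _; rewrite ltry.
apply/cvgrPdist_le => e e0; apply: filterS (H e e0) => n un.
rewrite sub0r normrN /= ger0_norm ?fine_ge0// -lee_fin fineK//.
by rewrite ge0_fin_numE// (le_lt_trans un)// ltry.
Qed.

Lemma mesh_small (e : R) : 0 < e -> \forall m \near \oo, (m.+1%:R^-1 : R) < e.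
Proof.
move=> e0; have /cvgrPdist_lt/(_ e e0) := @cvg_harmonic R.
by apply: filterS => m; rewrite sub0r normrN gtr0_norm// invr_gt0.
Qed.

(** With mesh [s = 1 / (m + 1)], the gradient is at most [C / s] and supported in a collar of width
    [3 s], where a function of zero trace has square integral [o(s^2)]. *)
Lemma good_cutoffs_exist D : open D -> bounded_set D -> C2_boundary D ->
  exists th, good_cutoffs D th.
Proof.
move=> oD bD cD; have mD : measurable (D : set plane) by exact: open_plane_measurable.
have [M M0 DM] := bounded_cbox bD; have [C C0 HC] := @bump1d_sum R.
pose s m : R := m.+1%:R^-1; have s0 m : 0 < s m by rewrite invr_gt0.
have nex m : exists n : nat, D `<=` cbox 0 (n%:R * s m).
  exists (Num.bound (M / s m)); apply: subset_trans DM _.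
  have : M / s m < (Num.bound (M / s m))%:R by apply: archi_boundP; rewrite divr_ge0 ?ltW.
  by rewrite ltr_pdivrMr// => H x [x1 x2]; split; [exact: le_trans x1 (ltW H)|exact: le_trans x2 (ltW H)].
have [n Hn] := choice nex.
pose th m := cutoff D (s m) (n m).
have th01 m x : 0 <= th m x <= 1 by rewrite cutoff_ge0 cutoff_le1.
exists th; split => //.
- by move=> m; apply: cutoff_test.
- move=> x Dx; have /openP_box/(_ x Dx)[r r0 rD] := oD.
  have r2 : 0 < r / 2 by lra.
  apply: filterS (mesh_small r2) => m sm; apply: cutoff_eq1 => // y [y1 y2].
  have sm' : s m < r / 2 by exact: sm.
  by apply: rD; split; lra.
move=> V h1 h2 LV L1 L2' tr.
have cs := collar_small_all oD bD cD LV L1 L2' tr.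
have sth m : smooth (th m) by exact: smooth_cutoff.
have key (dd : (R * R -> R) -> R * R -> R) :
    (forall m, continuous (dd (th m))) -> (forall m x, `|dd (th m) x| <= C / s m) ->
    (forall m x, D x -> ~ near_compl D (3 * s m) x -> dd (th m) x = 0) ->
    L2_cvg D (fun m x => dd (th m) x * V x) (fun=> 0).
  move=> cdd ddC dd0; apply: cvge0_eps => [m|e e0].
    by apply: integral_ge0 => x _; rewrite lee_fin sqr_ge0.
  (* [9 C^2] is the product of [(3 s)^2], from the collar, and [(C / s)^2], from the gradient. *)
  have e'0 : 0 < e / (9 * C ^+ 2) by rewrite divr_gt0// mulr_gt0// exprn_gt0.
  have [s1 s10 Hs] := cs _ e'0.
  have s13 : 0 < s1 / 3 by lra.
  apply: filterS (mesh_small s13) => m sm.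
  have := Hs (3 * s m); rewrite mulr_gt0//= -ltr_pdivlMl// mulrC sm setIT => /(_ isT) K.
  set N := D `&` _ in K; have oN : open N by apply: openI => //; exact: open_near_compl.
  have mN : measurable (N : set plane) by exact: open_plane_measurable.
  have ND : N `<=` D by move=> x [].
  have mV : measurable_fun (N : set plane) (V : plane -> R) by exact: measurable_funS mD ND LV.1.
  have mdd : measurable_fun setT (dd (th m) : plane -> R) by exact: continuous_plane_measurable.
  have -> : (\int[leb2]_(x in D) ((dd (th m) x * V x - 0) ^+ 2)%:E =
      \int[leb2]_(x in N) ((dd (th m) x * V x) ^+ 2)%:E)%E.
    rewrite integral_mkcond [RHS]integral_mkcond; apply: eq_integral => x _; rewrite !patchE.
    case: ifPn => [/set_mem Dx|nDx]; last by rewrite ifF//; apply/negbTE; apply: contra nDx => /set_mem[? _]; exact: mem_set.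
    case: ifPn => [_|]; first by rewrite subr0.
    rewrite notin_setE => nN; rewrite dd0//; first by rewrite mul0r subr0 expr0n.
    by move=> nx; apply: nN.
  apply: (@le_trans _ _ (((C / s m) ^+ 2)%:E * \int[leb2]_(x in N) ((V x) ^+ 2)%:E)%E).
    rewrite -ge0_integralZl//; [|exact: measurable_sqr|by move=> x _; rewrite lee_fin sqr_ge0|by rewrite lee_fin sqr_ge0].
    apply: ge0_le_integral => //.
    - by move=> x _; rewrite lee_fin sqr_ge0.
    - by apply: measurable_sqr; apply: measurable_funM => //; exact: measurable_funTS.
    - by apply: measurable_funeM; exact: measurable_sqr.
    - move=> x _; rewrite -EFinM lee_fin exprMn ler_wpM2r ?sqr_ge0//.
      by rewrite -real_normK ?num_real// lerXn2r ?nnegrE ?ddC// divr_ge0// ltW.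
  have k0 : (0 <= ((C / s m) ^+ 2)%:E)%E by rewrite lee_fin sqr_ge0.
  apply: le_trans (lee_wpmul2l k0 K) _; rewrite -EFinM lee_fin le_eqVlt; apply/orP; left.
  by apply/eqP; field; rewrite !gt_eqF.
split; apply: key.
- by move=> m; apply: smooth_continuous; exact: smooth_d1.
- by move=> m x; exact: (cutoff_grad_le D (n m) (s0 m) HC x).1.
- by move=> m x Dx nx; exact: (cutoff_grad0 (s0 m) (Hn m) Dx nx).1.
- by move=> m; apply: smooth_continuous; exact: smooth_d2.
- by move=> m x; exact: (cutoff_grad_le D (n m) (s0 m) HC x).2.
- by move=> m x Dx nx; exact: (cutoff_grad0 (s0 m) (Hn m) Dx nx).2.
Qed.

Lemma L2_cvg_cutoff D th f : measurable (D : set plane) -> good_cutoffs D th -> L2 D f ->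
  L2_cvg D (fun m x => th m x * f x) f.
Proof.
move=> mD [tth th01 th1 _] Lf.
have mth m : measurable_fun (D : set plane) (th m : plane -> R).
  by apply: measurable_funTS; apply: continuous_plane_measurable; apply: smooth_continuous; case: (tth m).
have mf := Lf.1.
have mm m : measurable_fun (D : set plane) (fun x : plane => ((th m x * f x - f x) ^+ 2)%:E).
  by apply: measurable_sqr; apply: measurable_funB => //; exact: measurable_funM.
have := @dominated_convergence _ _ _ (@leb2 R) D mD
  (fun m (x : plane) => ((th m x * f x - f x) ^+ 2)%:E) (fun=> 0%E) (fun x => ((f x) ^+ 2)%:E) mm.
case=> //.
- apply: aeW => x Dx; apply: cvg_near_cst; apply: filterS (th1 x Dx) => m ->.
  by rewrite mul1r subrr expr0n.
- exact: L2_sqr_integrable.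
- apply: aeW => x m _; rewrite /= lee_fin ger0_norm ?sqr_ge0//.
  have -> : th m x * f x - f x = (th m x - 1) * f x by ring.
  rewrite exprMn ler_piMl ?sqr_ge0//; have /andP[] := th01 m x; nra.
- by move=> _ _; rewrite integral0.
Qed.

End cutoff_sequence.

(** * Weak forms tested against functions of zero trace *)

Section weak_forms.
Context {R : realType}.
Local Notation plane := (measurableTypeR R * measurableTypeR R)%type.
Implicit Types (D : set (R * R)) (x y : R * R) (V W f g h phi : R * R -> R).

Definition ip D f g : R := \int[leb2]_(x in D) (f x * g x).

Lemma ipC D f g : ip D f g = ip D g f.
Proof. by apply: eq_Rintegral => x _; rewrite mulrC. Qed.

Lemma ipDl D f g h : measurable (D : set plane) -> L2 D f -> L2 D g -> L2 D h ->
  ip D (fun x => f x + g x) h = ip D f h + ip D g h.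
Proof.
move=> mD Lf Lg Lh; rewrite /ip -RintegralD//; [|exact: L2_mul_integrable..].
by apply: eq_Rintegral => x _; rewrite mulrDl.
Qed.

(** The weak form of [Laplacian W + k^2 W = f]. The gradient of the test function is a separate
    argument, since the test functions of interest have only weak derivatives. *)
Definition weak_eq D (k : R) W g1 g2 f phi f1 f2 : Prop :=
  ip D f1 g1 + ip D f2 g2 = k ^+ 2 * ip D phi W - ip D phi f.

Lemma weak_eq_limit D k W g1 g2 f (u a b : nat -> R * R -> R) V h1 h2 : measurable (D : set plane) ->
  L2 D W -> L2 D g1 -> L2 D g2 -> L2 D f ->
  (forall n, L2 D (u n)) -> (forall n, L2 D (a n)) -> (forall n, L2 D (b n)) ->
  L2 D V -> L2 D h1 -> L2 D h2 -> L2_cvg D u V -> L2_cvg D a h1 -> L2_cvg D b h2 ->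
  (forall n, weak_eq D k W g1 g2 f (u n) (a n) (b n)) -> weak_eq D k W g1 g2 f V h1 h2.
Proof.
move=> mD LW Lg1 Lg2 Lf Lu La Lb LV L1 L2' uV ah bh E.
have C1 : (fun n => ip D (a n) g1 + ip D (b n) g2) @ \oo --> ip D h1 g1 + ip D h2 g2.
  by apply: cvgD; exact: cvg_L2_inner.
have C2 : (fun n => k ^+ 2 * ip D (u n) W - ip D (u n) f) @ \oo --> k ^+ 2 * ip D V W - ip D V f.
  by apply: cvgB; [apply: cvgMr|]; exact: cvg_L2_inner.
have C3 : (fun n => ip D (a n) g1 + ip D (b n) g2) = (fun n => k ^+ 2 * ip D (u n) W - ip D (u n) f).
  by apply/funext => n; exact: E.
rewrite C3 in C1; exact: (cvg_unique (@norm_hausdorff _ R^o) C1 C2).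
Qed.

Lemma test_out phi x (K : set (R * R)) : smooth phi -> closed K -> (forall x, ~ K x -> phi x = 0) -> ~ K x ->
  d1 phi x = 0 /\ d2 phi x = 0.
Proof.
move=> sp cK p0 nK.
have [-> ->] : d1 phi x = d1 (fun=> 0) x /\ d2 phi x = d2 (fun=> 0) x; last exact: d_cst.
by apply: (@d_eq R (~` K)) => //; exact: closed_openC.
Qed.

Lemma compact_closed_plane (K : set (R * R)) : compact K -> closed K.
Proof. by apply: compact_closed; exact: norm_hausdorff. Qed.

Lemma test_mul D phi psi : test_fun D phi -> smooth psi -> test_fun D (fun x => phi x * psi x).
Proof.
move=> [sp [K [cK KD p0]]] spsi; split.
  by apply/smoothP; apply: smoothU_mul; [exact: openT|exact/smoothP|exact/smoothP].
by exists K; split => // x nK; rewrite p0// mul0r.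
Qed.

Lemma bounded_test D phi : test_fun D phi -> exists2 B : R, 0 <= B &
  forall x, [/\ `|phi x| <= B, `|d1 phi x| <= B & `|d2 phi x| <= B].
Proof.
move=> [sp [K [cK KD p0]]]; have kK := compact_closed_plane cK.
have cp (f : R * R -> R) : smooth f -> exists2 B, 0 < B & forall x, K x -> `|f x| <= B.
  by move=> sf; apply: compact_bounded_fun => // x _; exact: smooth_continuous.
have [B0 B00 H0] := cp _ sp; have [B1 B10 H1] := cp _ (smooth_d1 sp); have [B2 B20 H2] := cp _ (smooth_d2 sp).
exists (B0 + B1 + B2); first by rewrite !addr_ge0// ltW.
move=> x; have [Kx|nK] := pselect (K x).
  by split; [apply: le_trans (H0 x Kx) _|apply: le_trans (H1 x Kx) _|apply: le_trans (H2 x Kx) _]; lra.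
have [-> ->] := test_out sp kK p0 nK; rewrite (p0 x nK) normr0; have : 0 <= B0 + B1 + B2 by lra.
by split.
Qed.

Lemma L2_continuous_bounded D f : measurable (D : set plane) -> (leb2 D < +oo)%E -> continuous f ->
  (exists B, forall x, D x -> `|f x| <= B) -> L2 D f.
Proof.
move=> mD Doo cf [B fB]; apply: (@L2_bounded R D mD f B) => //.
by apply: measurable_funTS; exact: continuous_plane_measurable.
Qed.

Lemma L2_bounded_domain D f : open D -> bounded_set D -> continuous f -> L2 D f.
Proof.
move=> oD /bounded_cbox[M M0 DM] cf; have mD : measurable (D : set plane) by exact: open_plane_measurable.
apply: L2_continuous_bounded => //; first exact: leb2_bounded_set DM.
have [B B0 HB] := compact_bounded_fun (@compact_cbox R 0 M) (fun x _ => cf x).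
by exists B => x /DM/HB.
Qed.

Lemma is_d_mul f g x : smooth f -> smooth g ->
  d1 (fun y => f y * g y) x = d1 f x * g x + f x * d1 g x /\
  d2 (fun y => f y * g y) x = d2 f x * g x + f x * d2 g x.
Proof.
move=> /smoothP/(_ 1%N) sf /smoothP/(_ 1%N) sg; split.
- by apply: is_derive_d1; apply: is_deriveM_fun; [exact: (CkU_is_d1 sf)|exact: (CkU_is_d1 sg)].
- by apply: is_derive_d2; apply: is_deriveM_fun; [exact: (CkU_is_d2 sf)|exact: (CkU_is_d2 sg)].
Qed.

(** The smooth approximations attached to a zero trace need not vanish near the boundary; multiplied
    by a cutoff they become test functions. The approximation goes to the limit first, with the
    cutoff fixed, and the cutoff second, its gradient term vanishing by [good_cutoffs]. *)
Lemma weak_eq_zero_trace D th k W g1 g2 f V h1 h2 : open D -> bounded_set D -> good_cutoffs D th ->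
  L2 D W -> L2 D g1 -> L2 D g2 -> L2 D f ->
  (forall phi, test_fun D phi -> weak_eq D k W g1 g2 f phi (d1 phi) (d2 phi)) ->
  L2 D V -> L2 D h1 -> L2 D h2 -> has_trace D V h1 h2 (fun=> 0) ->
  weak_eq D k W g1 g2 f V h1 h2.
Proof.
move=> oD bD gth LW Lg1 Lg2 Lf E LV L1 L2' tr; have [tth th01 th1 thK] := gth.
have mD : measurable (D : set plane) by exact: open_plane_measurable.
have [K1 K2] := thK V h1 h2 LV L1 L2' tr.
have [psi [sp H1c _]] := tr; have [cV c1 c2] := H1_cvg_parts mD LV L1 L2' sp H1c.
have cts (u : R * R -> R) : smooth u -> continuous u by exact: smooth_continuous.
have Lc (u : R * R -> R) : continuous u -> L2 D u by exact: L2_bounded_domain.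
have sth m : smooth (th m) by case: (tth m).
have mc (v : R * R -> R) : continuous v -> measurable_fun (D : set plane) (v : plane -> R).
  by move=> cv; apply: measurable_funTS; exact: continuous_plane_measurable.
have m0 m : measurable_fun (D : set plane) (th m : plane -> R) by apply: mc; apply: cts.
have m1 m : measurable_fun (D : set plane) (d1 (th m) : plane -> R) by apply: mc; apply: cts; exact: smooth_d1.
have m2 m : measurable_fun (D : set plane) (d2 (th m) : plane -> R) by apply: mc; apply: cts; exact: smooth_d2.
have mul_data m (u : R * R -> R) : L2 D u ->
    [/\ L2 D (fun x => th m x * u x), L2 D (fun x => d1 (th m) x * u x) & L2 D (fun x => d2 (th m) x * u x)].
  move=> Lu; have [B B0 HB] := bounded_test (tth m).
  split; [apply: (@L2_bmul _ _ mD u _ B)|apply: (@L2_bmul _ _ mD u _ B)|apply: (@L2_bmul _ _ mD u _ B)] => // x _;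
    by case: (HB x).
(* First limit: [m] is fixed, so the cutoff and its gradient are bounded multipliers. *)
have step m : weak_eq D k W g1 g2 f (fun x => th m x * V x)
    (fun x => d1 (th m) x * V x + th m x * h1 x) (fun x => d2 (th m) x * V x + th m x * h2 x).
  have [B B0 HB] := bounded_test (tth m).
  have B_0 x : D x -> `|th m x| <= B by move=> _; case: (HB x).
  have B_1 x : D x -> `|d1 (th m) x| <= B by move=> _; case: (HB x).
  have B_2 x : D x -> `|d2 (th m) x| <= B by move=> _; case: (HB x).
  have Lp n : L2 D (psi n) by apply: Lc; apply: cts.
  have Lp1 n : L2 D (d1 (psi n)) by apply: Lc; apply: cts; exact: smooth_d1.
  have Lp2 n : L2 D (d2 (psi n)) by apply: Lc; apply: cts; exact: smooth_d2.
  have [A0 A1 A2] := mul_data m V LV.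
  have [A3 _ _] := mul_data m h1 L1; have [A4 _ _] := mul_data m h2 L2'.
  apply: (@weak_eq_limit D k W g1 g2 f (fun n x => th m x * psi n x)
    (fun n x => d1 (th m) x * psi n x + th m x * d1 (psi n) x)
    (fun n x => d2 (th m) x * psi n x + th m x * d2 (psi n) x)) => //.
  - by move=> n; case: (mul_data m (psi n) (Lp n)).
  - move=> n; have [_ ? _] := mul_data m (psi n) (Lp n); have [? _ _] := mul_data m _ (Lp1 n).
    exact: L2_add.
  - move=> n; have [_ _ ?] := mul_data m (psi n) (Lp n); have [? _ _] := mul_data m _ (Lp2 n).
    exact: L2_add.
  - exact: L2_add.
  - exact: L2_add.
  - exact: (L2_cvg_bmul mD Lp LV (m0 m) B_0 cV).
  - apply: (L2_cvg_add (u := fun n x => d1 (th m) x * psi n x) (v := fun n x => th m x * d1 (psi n) x)) => //.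
    + by move=> n; case: (mul_data m (psi n) (Lp n)).
    + by move=> n; case: (mul_data m _ (Lp1 n)).
    + exact: (L2_cvg_bmul mD Lp LV (m1 m) B_1 cV).
    + exact: (L2_cvg_bmul mD Lp1 L1 (m0 m) B_0 c1).
  - apply: (L2_cvg_add (u := fun n x => d2 (th m) x * psi n x) (v := fun n x => th m x * d2 (psi n) x)) => //.
    + by move=> n; case: (mul_data m (psi n) (Lp n)).
    + by move=> n; case: (mul_data m _ (Lp2 n)).
    + exact: (L2_cvg_bmul mD Lp LV (m2 m) B_2 cV).
    + exact: (L2_cvg_bmul mD Lp2 L2' (m0 m) B_0 c2).
  - move=> n; have := E _ (test_mul (tth m) (sp n)).
    have -> : d1 (fun x => th m x * psi n x) = (fun x => d1 (th m) x * psi n x + th m x * d1 (psi n) x).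
      by apply/funext => x; case: (is_d_mul x (sth m) (sp n)).
    have -> // : d2 (fun x => th m x * psi n x) = (fun x => d2 (th m) x * psi n x + th m x * d2 (psi n) x).
    by apply/funext => x; case: (is_d_mul x (sth m) (sp n)).
have L0 : L2 D (fun=> 0) by apply: Lc; exact: cst_continuous.
apply: (weak_eq_limit mD LW Lg1 Lg2 Lf _ _ _ LV L1 L2' _ _ _ step).
- by move=> m; case: (mul_data m V LV).
- by move=> m; apply: L2_add => //; [case: (mul_data m V LV)|case: (mul_data m h1 L1)].
- by move=> m; apply: L2_add => //; [case: (mul_data m V LV)|case: (mul_data m h2 L2')].
- exact: L2_cvg_cutoff.
- have -> : h1 = (fun x => 0 + h1 x) by apply/funext => x; rewrite add0r.
  apply: L2_cvg_add => //; try by move=> m; case: (mul_data m V LV).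
    by move=> m; under eq_fun do rewrite add0r; case: (mul_data m h1 L1).
  by under eq_fun do under eq_fun do rewrite add0r; exact: L2_cvg_cutoff.
- have -> : h2 = (fun x => 0 + h2 x) by apply/funext => x; rewrite add0r.
  apply: L2_cvg_add => //; try by move=> m; case: (mul_data m V LV).
    by move=> m; under eq_fun do rewrite add0r; case: (mul_data m h2 L2').
  by under eq_fun do under eq_fun do rewrite add0r; exact: L2_cvg_cutoff.
Qed.

Lemma green_test D g phi : open D -> smooth g -> test_fun D phi ->
  ip D (d1 phi) (d1 g) + ip D (d2 phi) (d2 g) = - ip D phi (fun x => d1 (d1 g) x + d2 (d2 g) x).
Proof.
move=> oD sg [sp [K [cK KD p0]]]; have kK := compact_closed_plane cK.
have mD : measurable (D : set plane) by exact: open_plane_measurable.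
have [L L0 KL] : exists2 L, 0 < L & K `<=` cbox 0 L by apply: bounded_cbox; exact: compact_bounded.
have out x : ~ cbox 0 L x -> [/\ phi x = 0, d1 phi x = 0 & d2 phi x = 0].
  by move=> nx; have nK : ~ K x by [move=> /KL]; have [] := test_out sp kK p0 nK; rewrite p0.
have outD x : ~ D x -> [/\ phi x = 0, d1 phi x = 0 & d2 phi x = 0].
  by move=> nx; have nK : ~ K x by [move=> /KD]; have [] := test_out sp kK p0 nK; rewrite p0.
have toT (u : R * R -> R) : (forall x, ~ D x -> u x = 0) -> \int[leb2]_(x in D) u x = \int[leb2]_x u x.
  move=> u0; rewrite Rintegral_mkcond; apply: eq_Rintegral => x _; rewrite patchE.
  by case: ifPn => //; rewrite notin_setE => /u0 ->.
have s1 := smooth_d1 sg; have s2 := smooth_d2 sg; have p1 := smooth_d1 sp; have p2 := smooth_d2 sp.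
have s11 := smooth_d1 s1; have s22 := smooth_d2 s2.
have cM (u v : R * R -> R) : smooth u -> smooth v -> continuous (fun x => u x * v x).
  by move=> su sv x; apply: cvgM; exact: smooth_continuous.
have I (u v : R * R -> R) : smooth u -> smooth v -> (forall x, ~ cbox 0 L x -> u x = 0) ->
    leb2.-integrable setT (EFin \o (fun x => u x * v x) : plane -> \bar R).
  by move=> su sv u0; apply: (@integrable_csupp R _ L); [exact: cM|move=> x /u0 ->; rewrite mul0r].
rewrite /ip !toT; last 3 first.
- by move=> x /outD[-> _ _]; rewrite mul0r.
- by move=> x /outD[_ _ ->]; rewrite mul0r.
- by move=> x /outD[_ -> _]; rewrite mul0r.
have J1 : \int[leb2]_x (d1 phi x * d1 g x + phi x * d1 (d1 g) x) = 0.
  have c : continuous (fun x => d1 phi x * d1 g x + phi x * d1 (d1 g) x).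
    by move=> x; apply: cvgD; exact: cM.
  have d (x : R * R) : is_derive x (1, 0) (fun x => phi x * d1 g x) (d1 phi x * d1 g x + phi x * d1 (d1 g) x).
    by apply: is_deriveM_fun; [exact: (CkU_is_d1 ((smoothP _).1 sp 1%N))|exact: (CkU_is_d1 ((smoothP _).1 s1 1%N))].
  have o x : ~ cbox 0 L x -> phi x * d1 g x = 0 /\ d1 phi x * d1 g x + phi x * d1 (d1 g) x = 0.
    by move=> /out[-> e1 e2]; rewrite ?e1 ?e2 !mul0r addr0.
  by rewrite /Rintegral (int_d1_eq0 c d o).
have J2 : \int[leb2]_x (d2 phi x * d2 g x + phi x * d2 (d2 g) x) = 0.
  have c : continuous (fun x => d2 phi x * d2 g x + phi x * d2 (d2 g) x).
    by move=> x; apply: cvgD; exact: cM.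
  have d (x : R * R) : is_derive x (0, 1) (fun x => phi x * d2 g x) (d2 phi x * d2 g x + phi x * d2 (d2 g) x).
    by apply: is_deriveM_fun; [exact: (CkU_is_d2 ((smoothP _).1 sp 1%N))|exact: (CkU_is_d2 ((smoothP _).1 s2 1%N))].
  have o x : ~ cbox 0 L x -> phi x * d2 g x = 0 /\ d2 phi x * d2 g x + phi x * d2 (d2 g) x = 0.
    by move=> /out[-> e1 e2]; rewrite ?e1 ?e2 !mul0r addr0.
  by rewrite /Rintegral (int_d2_eq0 c d o).
have i0 : forall x, ~ cbox 0 L x -> phi x = 0 by move=> x /out[].
have i1 : forall x, ~ cbox 0 L x -> d1 phi x = 0 by move=> x /out[].
have i2 : forall x, ~ cbox 0 L x -> d2 phi x = 0 by move=> x /out[].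
rewrite RintegralD// in J1; [|exact: I|exact: I].
rewrite RintegralD// in J2; [|exact: I|exact: I].
have -> : \int[leb2]_x (phi x * (d1 (d1 g) x + d2 (d2 g) x)) =
    \int[leb2]_x (phi x * d1 (d1 g) x) + \int[leb2]_x (phi x * d2 (d2 g) x).
  rewrite -RintegralD//; [|exact: I|exact: I].
  by apply: eq_Rintegral => x _; rewrite mulrDr.
have ar (a b c d : R) : a + b = 0 -> c + d = 0 -> a + c = - (b + d) by clear; lra.
exact: (ar _ _ _ _ J1 J2).
Qed.

End weak_forms.

Section translation.
Context {R : realType}.
Implicit Types (f : R * R -> R) (x z : R * R).

Lemma is_d_translate f z x : CkU setT 1 f ->
  is_derive x (1, 0) (fun y : R * R => f (y - z)) (d1 f (x - z)) /\
  is_derive x (0, 1) (fun y : R * R => f (y - z)) (d2 f (x - z)).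
Proof.
move=> f1; split; [apply/is_derive_e1|apply/is_derive_e2].
- have /is_derive_e1 := CkU_is_d1 f1 (I : setT (x - z)) => D.
  have -> : (fun t : R => f ((t, x.2) - z)) = (fun t : R => f (- z.1 + t, (x - z).2)).
    by apply/funext => t; rewrite [- z.1 + t]addrC.
  by apply: (@is_derive_shift1 R (fun u : R => f (u, (x - z).2))); rewrite addrC.
- have /is_derive_e2 := CkU_is_d2 f1 (I : setT (x - z)) => D.
  have -> : (fun t : R => f ((x.1, t) - z)) = (fun t : R => f ((x - z).1, - z.2 + t)).
    by apply/funext => t; rewrite [- z.2 + t]addrC.
  by apply: (@is_derive_shift1 R (fun u : R => f ((x - z).1, u))); rewrite addrC.
Qed.

Lemma d_translate f z x : smooth f ->
  d1 (fun y : R * R => f (y - z)) x = d1 f (x - z) /\ d2 (fun y : R * R => f (y - z)) x = d2 f (x - z).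
Proof.
move/smoothP/(_ 1%N) => sf1; have [D1 D2] := is_d_translate z x sf1.
by split; [exact: is_derive_d1|exact: is_derive_d2].
Qed.

Lemma continuous_translate f z : continuous f -> continuous (fun y : R * R => f (y - z)).
Proof.
move=> cf x; apply: (@continuous_comp _ _ _ (fun y : R * R => y - z) f); last exact: cf.
by apply: cvgB; [exact: cvg_id|exact: cvg_cst].
Qed.

Lemma smooth_translate f z : smooth f -> smooth (fun y : R * R => f (y - z)).
Proof.
move=> sf n; elim: n f sf => [|n IH] f sf /=.
  by split => //; apply: continuous_translate; exact: smooth_continuous.
split; first by apply: continuous_translate; exact: smooth_continuous.
have E1 : d1 (fun y : R * R => f (y - z)) = (fun y : R * R => d1 f (y - z)) by apply/funext => x; case: (d_translate z x sf).
have E2 : d2 (fun y : R * R => f (y - z)) = (fun y : R * R => d2 f (y - z)) by apply/funext => x; case: (d_translate z x sf).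
split; [|by rewrite E1; apply: IH; exact: smooth_d1|by rewrite E2; apply: IH; exact: smooth_d2].
move=> x; have /smoothP/(_ 1%N) sf1 := sf; have [D1 D2] := is_d_translate z x sf1.
by split; [exact: (@ex_derive _ _ _ _ _ _ _ D1)|exact: (@ex_derive _ _ _ _ _ _ _ D2)].
Qed.

End translation.

Lemma eq_arc_integral {R : realType} (C : set (R * R)) (f g : R * R -> \bar R) :
  (forall x, C x -> f x = g x) -> arc_integral C f = arc_integral C g.
Proof.
move=> fg; apply: (@eq_integral _ _ _ (@arc_length_measure R) C g f) => x /set_mem; exact: fg.
Qed.

(** * Reciprocity *)

Section point_source.
Context {R : realType}.
Local Notation plane := (measurableTypeR R * measurableTypeR R)%type.
Implicit Types (D : set (R * R)) (x y z : R * R) (V W f g h phi : R * R -> R).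

(* Laplacian V + k^2 V = f weakly, with zero trace. *)
Definition zero_trace_sol D (k : R) V h1 h2 f : Prop :=
  [/\ [/\ L2 D V, L2 D h1 & L2 D h2], L2 D f, has_trace D V h1 h2 (fun=> 0) &
      forall phi, test_fun D phi -> weak_eq D k V h1 h2 f phi (d1 phi) (d2 phi)].

(** Each solution is an admissible test function in the equation of the other; the gradient and
    [k^2] terms are symmetric and cancel. *)
Lemma zero_trace_reciprocity D th k V h1 h2 f W g1 g2 g : open D -> bounded_set D -> good_cutoffs D th ->
  zero_trace_sol D k V h1 h2 f -> zero_trace_sol D k W g1 g2 g -> ip D W f = ip D V g.
Proof.
move=> oD bD gth [[LV L1 L2'] Lf tV eV] [[LW M1 M2] Lg tW eW].
have := weak_eq_zero_trace oD bD gth LV L1 L2' Lf eV LW M1 M2 tW.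
have := weak_eq_zero_trace oD bD gth LW M1 M2 Lg eW LV L1 L2' tV.
rewrite /weak_eq (ipC D h1) (ipC D h2) (ipC D V W).
set a := ip _ g1 _; set b := ip _ g2 _; set c := ip _ W V; set d := ip _ W f; set e := ip _ V g.
by clearbody a b c d e; clear; move=> -> ?; lra.
Qed.

Definition gsrc (k al : R) z x : R := greg k al (x - z).
Definition fsrc (k al : R) z x : R := freg k al (x - z).

Lemma smooth_gsrc k al z : 0 < k -> 0 < al -> smooth (gsrc k al z).
Proof. by move=> k0 al0; apply: smooth_translate; apply/smoothP; exact: smooth_greg. Qed.

Lemma helmholtz_gsrc k al z x : 0 < k -> 0 < al ->
  d1 (d1 (gsrc k al z)) x + d2 (d2 (gsrc k al z)) x = fsrc k al z x - k ^+ 2 * gsrc k al z x.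
Proof.
move=> k0 al0; rewrite /gsrc /fsrc -(helmholtz_greg k0 al0).
have sg : smooth (greg k al) by apply/smoothP; exact: smooth_greg.
have -> : d1 (fun y : R * R => greg k al (y - z)) = (fun y : R * R => d1 (greg k al) (y - z)).
  by apply/funext => y; case: (d_translate z y sg).
have -> : d2 (fun y : R * R => greg k al (y - z)) = (fun y : R * R => d2 (greg k al) (y - z)).
  by apply/funext => y; case: (d_translate z y sg).
have [-> _] := d_translate z x (smooth_d1 sg); have [_ ->] := d_translate z x (smooth_d2 sg).
by rewrite addrK.
Qed.

Lemma gsrc_out k al z x : 0 < k -> 0 < al -> al <= qq (x - z) -> gsrc k al z x = complex.Re (incident_field k z x).
Proof.
move=> k0 al0 aq; have xz : x != z.
  by apply: contraTneq aq => ->; rewrite subrr /qq expr0n/= addr0 -ltNge.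
have e := enorm_sqr (x - z).
by rewrite /gsrc greg_out// Re_incident// e.
Qed.

Lemma continuous_fsrc k al z : 0 < k -> 0 < al -> continuous (fsrc k al z).
Proof. by move=> k0 al0; apply: continuous_translate; exact: continuous_freg. Qed.

Lemma point_source_sol D k z S (al : R) : open D -> bounded_set D -> 0 < k -> 0 < al ->
  (forall x, bd D x -> al <= qq (x - z)) ->
  dirichlet_solution D k S (fun x => - complex.Re (incident_field k z x)) ->
  exists h1 h2, L2 D S /\ zero_trace_sol D k (fun x => S x + gsrc k al z x) h1 h2 (fsrc k al z).
Proof.
move=> oD bD k0 al0 alb [a1 [a2 [[LS La1 La2 _] weakS [psi [sp H1c tr]]]]].
have mD : measurable (D : set plane) by exact: open_plane_measurable.
have sg := smooth_gsrc z k0 al0; set g := gsrc k al z in sg *.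
have Lc (u : R * R -> R) : continuous u -> L2 D u by exact: L2_bounded_domain.
have cts := smooth_continuous.
have Lg : L2 D g by apply: Lc; exact: cts.
have Lg1 : L2 D (d1 g) by apply: Lc; apply: cts; exact: smooth_d1.
have Lg2 : L2 D (d2 g) by apply: Lc; apply: cts; exact: smooth_d2.
exists (fun x => a1 x + d1 g x), (fun x => a2 x + d2 g x); split => //; split.
- by split; exact: L2_add.
- by apply: Lc; exact: continuous_fsrc.
- exists (fun n x => psi n x + g x); split.
  + by move=> n; apply/smoothP; apply: smoothU_add; [exact: openT|exact/smoothP|exact/smoothP].
  + have dadd n x : d1 (fun y => psi n y + g y) x = d1 (psi n) x + d1 g x /\
        d2 (fun y => psi n y + g y) x = d2 (psi n) x + d2 g x.
      have /smoothP/(_ 1%N) c1 := sp n; have /smoothP/(_ 1%N) c2 := sg; split.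
      - by apply: is_derive_d1; apply: is_deriveD_fun; [exact: (CkU_is_d1 c1)|exact: (CkU_is_d1 c2)].
      - by apply: is_derive_d2; apply: is_deriveD_fun; [exact: (CkU_is_d2 c1)|exact: (CkU_is_d2 c2)].
    have E n x : (psi n x + g x - (S x + g x)) ^+ 2 + (d1 (fun y => psi n y + g y) x - (a1 x + d1 g x)) ^+ 2
        + (d2 (fun y => psi n y + g y) x - (a2 x + d2 g x)) ^+ 2 =
        (psi n x - S x) ^+ 2 + (d1 (psi n) x - a1 x) ^+ 2 + (d2 (psi n) x - a2 x) ^+ 2.
      have [-> ->] := dadd n x.
      have ar (a b c : R) : a + c - (b + c) = a - b by clear; ring.
      by congr (_ ^+ 2 + _ ^+ 2 + _ ^+ 2); exact: ar.
    by rewrite /H1_cvg; under eq_fun do under eq_integral do rewrite E.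
  + have E n : arc_integral (bd D) (fun x => ((psi n x + g x - 0) ^+ 2)%:E) =
        arc_integral (bd D) (fun x => ((psi n x - - complex.Re (incident_field k z x)) ^+ 2)%:E).
      apply: eq_arc_integral => x bx.
      by rewrite /g gsrc_out ?alb// subr0 opprK.
    by under eq_fun do rewrite E.
move=> phi tphi; have [Bp _ HB] := bounded_test tphi; have [sphi _] := tphi.
have Lp1 : L2 D (d1 phi) by apply: Lc; apply: cts; exact: smooth_d1.
have Lp2 : L2 D (d2 phi) by apply: Lc; apply: cts; exact: smooth_d2.
have Lp : L2 D phi by apply: Lc; apply: cts.
have W : ip D (d1 phi) a1 + ip D (d2 phi) a2 = k ^+ 2 * ip D phi S.
  rewrite (ipC D phi) -(weakS _ tphi) (ipC D _ a1) (ipC D _ a2) RintegralD//; exact: L2_mul_integrable.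
have Gr := green_test oD sg tphi.
have split_r (u v w : R * R -> R) : L2 D u -> L2 D v -> L2 D w -> ip D w (fun x => u x + v x) = ip D w u + ip D w v.
  by move=> Lu Lv Lw; rewrite ipC ipDl// (ipC D u) (ipC D v).
have Lf : L2 D (fsrc k al z) by apply: Lc; exact: continuous_fsrc.
have E2 : ip D phi (fun x => d1 (d1 g) x + d2 (d2 g) x) = ip D phi (fsrc k al z) - k ^+ 2 * ip D phi g.
  have -> : (fun x => d1 (d1 g) x + d2 (d2 g) x) = (fun x => fsrc k al z x + (- k ^+ 2) * g x).
    by apply/funext => x; rewrite helmholtz_gsrc// mulNr.
  rewrite split_r//; last exact: L2_scale.
  rewrite -[in RHS]mulNr; congr (_ + _).
  have sc (c : R) : ip D phi (fun x => c * g x) = c * ip D phi g.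
    rewrite /ip -RintegralZl//; last exact: L2_mul_integrable.
    by apply: eq_Rintegral => x _; rewrite mulrCA.
  exact: sc.
rewrite /weak_eq !split_r//.
move: W Gr E2; set a := ip D (d1 phi) a1; set b := ip D (d2 phi) a2; set c := ip D phi S.
set d := ip D (d1 phi) (d1 g); set e := ip D (d2 phi) (d2 g); set f := ip D phi (fsrc _ _ _).
set q := ip D phi g; set w := ip D phi (fun x => _).
clearbody a b c d e f q w; clear; move=> W Gr E2; rewrite mulrDr; lra.
Qed.

Lemma qq_far D (K : set (R * R)) : compact K -> open D -> K `<=` D ->
  exists2 al : R, 0 < al & forall z x, K z -> ~ D x -> al <= qq (x - z).
Proof.
move=> cK oD KD; have [del del0 H] := lebesgue_number cK oD KD.
exists ((del / 2) ^+ 2); first by rewrite exprn_gt0//; lra.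
move=> z x Kz nDx; rewrite leNgt; apply/negP => qx; apply: nDx.
have d2 : 0 < del / 2 < del by lra.
apply: (H z (del / 2) Kz d2); move: qx; rewrite /qq /= => qx.
have aux (a b : R) : a ^+ 2 + b ^+ 2 < (del / 2) ^+ 2 -> `|a| < del / 2.
  move=> ab; rewrite -(@ltr_pXn2r _ 2) ?nnegrE ?normr_ge0//; last by case/andP: d2 => /ltW.
  by rewrite real_normK ?num_real//; apply: le_lt_trans ab; rewrite lerDl sqr_ge0.
by split; [apply: aux qx|apply: (aux _ ((x - z).1)); rewrite addrC].
Qed.

End point_source.

Section convolution.
Context {R : realType}.
Local Notation plane := (measurableTypeR R * measurableTypeR R)%type.
Implicit Types (D : set (R * R)) (x y z : R * R) (b F : R * R -> R).

(** [b] is merely square-integrable; the continuity comes from [F], uniformly for [y] in a square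
    containing [D]. *)
Lemma continuous_ip_translate D b F : open D -> bounded_set D -> L2 D b -> continuous F ->
  continuous (fun z => ip D b (fun y => F (y - z))).
Proof.
move=> oD bD Lb cF z0; have mD : measurable (D : set plane) by exact: open_plane_measurable.
have [M M0 DM] := bounded_cbox bD.
have LF z : L2 D (fun y => F (y - z)) by apply: L2_bounded_domain => //; exact: continuous_translate.
have L1 : L2 D (fun=> 1) by apply: L2_bounded_domain => //; exact: cst_continuous.
pose Ib := \int[leb2]_(x in D) `|b x|.
have iab : leb2.-integrable D (EFin \o (fun x => `|b x|) : plane -> \bar R).
  have := integrable_norm (L2_mul_integrable mD Lb L1); apply: eq_integrable => // x _ /=.
  by rewrite mulr1.
have Ib0 : 0 <= Ib by apply: Rintegral_ge0.
apply/cvgrPdist_le => e e0; pose e' : R := e / (Ib + 1); have e'0 : 0 < e' by rewrite divr_gt0//; lra.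
have := @compact_cbox R 0 M; move/compact_near_coveringP => /(_ _ (nbhs z0) (fun z y => `|F (y - z0) - F (y - z)| < e')).
have H y : cbox 0 M y -> \forall y' \near y & z \near z0, `|F (y' - z0) - F (y' - z)| < e'.
  move=> _; have c1 : {for (y, z0), continuous (fun u : (R * R) * (R * R) => F (u.1 - z0) - F (u.1 - u.2))}.
    apply: cvgB.
      apply: (@continuous_comp _ _ _ (fun u : (R * R) * (R * R) => u.1 - z0) F); last exact: cF.
      by apply: cvgB; [exact: cvg_fst|exact: cvg_cst].
    apply: (@continuous_comp _ _ _ (fun u : (R * R) * (R * R) => u.1 - u.2) F); last exact: cF.
    by apply: cvgB; [exact: cvg_fst|exact: cvg_snd].
  move/cvgrPdist_lt : c1 => /(_ e' e'0).
  by apply: filterS => u /=; rewrite subrr sub0r normrN.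
move=> /(_ _ H); apply: filterS => z Hz.
rewrite /ip -RintegralB//; [|exact: L2_mul_integrable..].
have -> : \int[leb2]_(x in D) (b x * F (x - z0) - b x * F (x - z)) = ip D b (fun x => F (x - z0) - F (x - z)).
  by apply: eq_Rintegral => x _; rewrite mulrBr.
have LB := L2_sub mD (LF z0) (LF z).
have I1 := L2_mul_integrable mD Lb LB.
apply: le_trans (le_normr_Rintegral mD I1) _.
apply: (@le_trans _ _ (e' * Ib)).
  rewrite /Ib -RintegralZl//; apply: le_Rintegral => //.
  - by have := integrable_norm I1; apply: eq_integrable.
  - apply: (@eq_integrable _ _ _ _ _ _ (fun x : plane => e'%:E * (`|b x|)%:E)%E) => //.
    exact: integrableZl.
  - by move=> x Dx; rewrite normrM mulrC ler_wpM2r//; apply: ltW; apply: Hz; exact: DM.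
rewrite /e' mulrAC ler_pdivrMr; last lra.
by rewrite ler_pM2l//; lra.
Qed.

End convolution.

(** * Propagation of properties along segments *)

Section propagation.
Context {R : realType}.
Implicit Types (U : set (R * R)) (p q a b x : R * R) (P : set (R * R)).

Definition segment_pt a b (t : R) : R * R := (a.1 + t * (b.1 - a.1), a.2 + t * (b.2 - a.2)).

Lemma continuous_segment_pt a b : continuous (segment_pt a b).
Proof.
move=> t; apply: (@continuous_pair_at _ _ (fun t : R => a.1 + t * (b.1 - a.1))
    (fun t : R => a.2 + t * (b.2 - a.2)) t); (apply: cvgD; [exact: cvg_cst|apply: cvgMl; exact: cvg_id]).
Qed.

(** A property of points that Taylor expansions carry over one horizontal or vertical step, of
    length at most [c] times the half-side of a square contained in [U]. *)
Definition taylor_stable U (c : R) P := forall p (h t : R), 0 < h <= 1 -> cbox p h `<=` U -> `|t| <= c * h -> P p ->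
  P (p.1 + t, p.2) /\ P (p.1, p.2 + t).

(** The segment is followed by a fine staircase, so that one-variable expansions suffice; a Lebesgue
    number keeps a square of fixed size around every stair inside [U]. *)
Lemma taylor_stable_segment U c P a b : open U -> 0 < c <= 2^-1 -> taylor_stable U c P ->
  (forall t, 0 <= t <= 1 -> U (segment_pt a b t)) -> P a -> P b.
Proof.
move=> oU /andP[c0 c1] tP sU Pa.
pose K := segment_pt a b @` `[0, 1]%classic.
have cK : compact K.
  apply: continuous_compact; last exact: segment_compact.
  by apply: continuous_subspaceT; exact: continuous_segment_pt.
have KU : K `<=` U by move=> _ [t /= tI <-]; apply: sU; move: tI; rewrite in_itv.
have [del del0 Hdel] := lebesgue_number cK oU KU.
pose h : R := Num.min 1 (del / 4); have h0 : 0 < h by rewrite lt_min ltr01 divr_gt0.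
have h1 : h <= 1 by rewrite ge_min lexx.
have hd : h <= del / 4 by rewrite ge_min lexx orbT.
have hh : 0 < h <= 1 by rewrite h0 h1.
pose A := `|b.1 - a.1| + `|b.2 - a.2|; have A0 : 0 <= A by rewrite addr_ge0.
(* Number of stairs for which both the horizontal and the vertical part of each are at most
   [c h]. *)
pose N := (Num.bound (A / (c * h))).+1.
have ch0 : 0 < c * h by rewrite mulr_gt0.
have NA : A / N%:R <= c * h.
  rewrite ler_pdivrMr// mulrC -ler_pdivrMr//.
  have : A / (c * h) < (Num.bound (A / (c * h)))%:R by apply: archi_boundP; rewrite divr_ge0// ltW.
  by rewrite /N -natr1; lra.
have chh : c * h <= h / 2 by nra.
have step n : (n <= N)%N -> P (segment_pt a b (n%:R / N%:R)).
  elim: n => [_|n IH nN]; first by rewrite /segment_pt !mul0r !addr0 -surjective_pairing.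
  have := IH (ltnW nN); set p := segment_pt a b _ => Pp.
  have tn : 0 <= n%:R / N%:R :> R by rewrite divr_ge0.
  have tn1 : n%:R / N%:R <= 1 :> R by rewrite ler_pdivrMr// mul1r ler_nat ltnW.
  have Kp : K p by exists (n%:R / N%:R) => //; rewrite /= in_itv/= tn.
  have dsub : 0 < 3 * h < del by lra.
  have pU := Hdel p (3 * h) Kp dsub.
  pose t1 := (b.1 - a.1) / N%:R; pose t2 := (b.2 - a.2) / N%:R.
  have t1c : `|t1| <= c * h.
    apply: le_trans NA; rewrite /t1 normrM normfV normr_nat ler_pM2r ?invr_gt0// /A; have := normr_ge0 (b.2 - a.2); lra.
  have t2c : `|t2| <= c * h.
    apply: le_trans NA; rewrite /t2 normrM normfV normr_nat ler_pM2r ?invr_gt0// /A; have := normr_ge0 (b.1 - a.1); lra.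
  have C1 : cbox p h `<=` U by move=> x [x1 x2]; apply: pU; split; lra.
  have [P1 _] := tP p h t1 hh C1 t1c Pp.
  have C2 : cbox (p.1 + t1, p.2) h `<=` U.
    move=> x [/= x1 x2]; apply: pU; split; last lra.
    have -> : x.1 - p.1 = (x.1 - (p.1 + t1)) + t1 by ring.
    by apply: le_lt_trans (ler_normD _ _) _; lra.
  have [_ P2] := tP _ h t2 hh C2 t2c P1.
  have -> // : segment_pt a b (n.+1%:R / N%:R) = ((p.1 + t1, p.2).1, (p.1 + t1, p.2).2 + t2).
  rewrite /segment_pt /= /p /segment_pt /= /t1 /t2 -natr1.
  by congr pair; ring.
have := step N (leqnn N); have -> : segment_pt a b (N%:R / N%:R) = b; last by [].
rewrite divff ?pnatr_eq0// /segment_pt !mul1r [a.1 + _]addrC subrK [a.2 + _]addrC subrK.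
by rewrite -surjective_pairing.
Qed.

End propagation.

Section approximate_identity.
Context {R : realType}.
Local Notation plane := (measurableTypeR R * measurableTypeR R)%type.
Implicit Types (D : set (R * R)) (x y z : R * R) (u v f g h : R * R -> R).

Lemma qq_box x y (r : R) : 0 < r -> qq (y - x) < r ^+ 2 -> box x r y.
Proof.
move=> r0; have aux (a b : R) : a ^+ 2 + b ^+ 2 < r ^+ 2 -> `|a| < r.
  move=> ab; rewrite -(@ltr_pXn2r _ 2) ?nnegrE ?normr_ge0 ?(ltW r0)//.
  by rewrite real_normK ?num_real//; apply: le_lt_trans ab; rewrite lerDl sqr_ge0.
by rewrite /qq => qx; split; [apply: aux qx|apply: (aux _ (y - x).1); rewrite addrC].
Qed.

Lemma leb2_cboxE x (r : R) : 0 < r -> leb2 (cbox x r) = ((2 * r) ^+ 2)%:E.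
Proof.
move=> r0; rewrite cbox_prod leb2_setX//.
have mI (c : R) : @lebesgue_measure R `[c - r, c + r] = (2 * r)%:E.
  by rewrite lebesgue_measure_itv/= lte_fin ifT; [rewrite -EFinB; congr EFin; ring|lra].
by rewrite !mI -EFinM expr2.
Qed.

Lemma Rintegral_lt0 D f x : open D -> bounded_set D -> continuous f -> (forall y, f y <= 0) -> D x -> f x < 0 ->
  \int[leb2]_(y in D) f y < 0.
Proof.
move=> oD bD cf f0 Dx fx; have mD : measurable (D : set plane) by exact: open_plane_measurable.
have N1 : nbhs x [set y | f y < f x / 2] by apply: (cvgr_lt _ (cf x)); lra.
have : nbhs x ([set y | f y < f x / 2] `&` D) by apply: filterI => //; exact: near_open.
move/nbhs_boxP => [r r0 Hr]; have r2 : 0 < r / 2 by lra.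
have Cr : cbox x (r / 2) `<=` [set y | f y < f x / 2] `&` D by move=> y [y1 y2]; apply: Hr; split; lra.
have mC : measurable (cbox x (r / 2) : set plane) by apply: closed_plane_measurable; exact: cbox_closed.
have L1 : L2 D (fun=> 1) by apply: L2_bounded_domain => //; exact: cst_continuous.
have Lf : L2 D f by apply: L2_bounded_domain.
have If : leb2.-integrable D (EFin \o f : plane -> \bar R).
  by have := L2_mul_integrable mD Lf L1; apply: eq_integrable => // y _ /=; rewrite mulr1.
rewrite -oppr_gt0; have INf : leb2.-integrable D (EFin \o (fun y => - f y) : plane -> \bar R).
  by have := integrableN If; apply: eq_integrable.
have -> : - (\int[leb2]_(y in D) f y) = \int[leb2]_(y in D) (- f y).
  have := RintegralZl (-1) mD If; rewrite mulN1r => <-.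
  by apply: eq_Rintegral => y _; rewrite mulN1r.
rewrite -lte_fin fineK; last by apply: integrable_fin_num.
apply: (@lt_le_trans _ _ ((- f x / 2)%:E * leb2 (cbox x (r / 2)))%E).
  by rewrite leb2_cboxE// -EFinM lte_fin mulr_gt0// ?exprn_gt0; lra.
apply: (@le_trans _ _ (\int[leb2]_(y in cbox x (r / 2)) (- f y)%:E)%E).
  rewrite -integral_cst//; apply: ge0_le_integral => //.
  - by move=> y _; rewrite lee_fin; lra.
  - apply: measurable_funTS; apply/measurable_EFinP; apply: continuous_plane_measurable => y.
    by apply: cvgN; exact: cf.
  - by move=> y /Cr[/= fy _]; rewrite lee_fin; lra.
apply: ge0_subset_integral => //.
- by case/integrableP: INf.
- by move=> y _; rewrite lee_fin oppr_ge0.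
- by move=> y /Cr[].
Qed.

(** The weights have constant sign and shrinking support; division by their mass normalizes them, so
    no limit of the masses has to be computed. Strict negativity at [x] makes the mass nonzero. *)
Lemma approximate_identity D (x : R * R) u (f : nat -> R * R -> R) (al : nat -> R) :
  open D -> bounded_set D -> D x -> L2 D u -> {for x, continuous u} ->
  (forall n, continuous (f n)) -> (forall n y, f n y <= 0) -> (forall n, f n x < 0) ->
  (forall n y, al n <= qq (y - x) -> f n y = 0) -> al @ \oo --> 0 ->
  (fun n => ip D u (f n) / ip D (fun=> 1) (f n)) @ \oo --> u x.
Proof.
move=> oD bD Dx Lu cu cf f0 fx fout al0; have mD : measurable (D : set plane) by exact: open_plane_measurable.
have L1 : L2 D (fun=> 1) by apply: L2_bounded_domain => //; exact: cst_continuous.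
have Lf n : L2 D (f n) by apply: L2_bounded_domain.
have c0 n : ip D (fun=> 1) (f n) < 0.
  rewrite /ip (_ : \int[_]_(_ in _) _ = \int[leb2]_(y in D) f n y).
    exact: Rintegral_lt0 (fx n).
  by apply: eq_Rintegral => y _; rewrite mul1r.
apply/cvgrPdist_le => e e0.
have N1 : nbhs x [set y | `|u x - u y| < e] by move/cvgrPdist_lt : cu; apply.
move/nbhs_boxP : N1 => [r r0 Hr].
have r20 : 0 < r ^+ 2 by rewrite exprn_gt0.
move/cvgrPdist_lt : al0 => /(_ _ r20); apply: filterS => n.
rewrite sub0r normrN => aln; have alr : al n < r ^+ 2 by apply: le_lt_trans (ler_norm _) aln.
have sup y : f n y != 0 -> `|u x - u y| <= e.
  move=> fy; apply: ltW; apply: Hr; apply: qq_box => //.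
  rewrite ltNge; apply/negP => qr; move/eqP : fy; apply; apply: fout; lra.
have Lcu : L2 D (fun y => u x - u y).
  by apply: L2_sub => //; apply: L2_bounded_domain => //; exact: cst_continuous.
have E : u x - ip D u (f n) / ip D (fun=> 1) (f n) = ip D (fun y => u x - u y) (f n) / ip D (fun=> 1) (f n).
  have -> : ip D (fun y => u x - u y) (f n) = u x * ip D (fun=> 1) (f n) - ip D u (f n).
    rewrite /ip -RintegralZl//; last exact: L2_mul_integrable.
    rewrite -RintegralB//; [|have := integrableZl mD (u x) (L2_mul_integrable mD L1 (Lf n)); exact: eq_integrable|exact: L2_mul_integrable].
    by apply: eq_Rintegral => y _; rewrite mul1r mulrBl.
  by rewrite mulrBl mulfK// lt_eqF.
rewrite E normrM normfV (ltr0_norm (c0 n)) ler_pdivrMr ?oppr_gt0//.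
have I1 := L2_mul_integrable mD Lcu (Lf n).
apply: le_trans (le_normr_Rintegral mD I1) _.
have -> : e * - ip D (fun=> 1) (f n) = (- e) * ip D (fun=> 1) (f n) by rewrite mulrN mulNr.
rewrite /ip -RintegralZl//; last exact: L2_mul_integrable.
apply: le_Rintegral => //.
- by have := integrable_norm I1; apply: eq_integrable.
- by have := integrableZl mD (- e) (L2_mul_integrable mD L1 (Lf n)); apply: eq_integrable.
- move=> y _; rewrite mul1r normrM; have [->|/sup ue] := eqVneq (f n y) 0; first by rewrite normr0 !mulr0.
  by rewrite (ler0_norm (f0 n y)) mulrN mulNr lerN2 ler_wnM2r.
Qed.

End approximate_identity.

(** * Measurable dependence of the field on the source *)

Section measurability.
Context {R : realType}.
Local Notation plane := (measurableTypeR R * measurableTypeR R)%type.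
Implicit Types (x y z : R * R).

Lemma convex_disc (r : R) a b t : disc r a -> disc r b -> 0 <= t <= 1 -> disc r (segment_pt a b t).
Proof.
rewrite /disc/= => ar br /andP[t0 t1].
have r0 : 0 < r by exact: le_lt_trans (enorm_ge0 _) ar.
have sq c : enorm c < r -> c.1 ^+ 2 + c.2 ^+ 2 < r ^+ 2.
  by move=> cr; rewrite -enorm_sqr ltrXn2r ?nnegrE ?enorm_ge0// ltW.
have A := sq _ ar; have B := sq _ br.
rewrite -(@ltr_pXn2r _ 2) ?nnegrE ?enorm_ge0 ?(ltW r0)// enorm_sqr /segment_pt/=.
have H1 : (a.1 + t * (b.1 - a.1)) ^+ 2 + (a.2 + t * (b.2 - a.2)) ^+ 2 =
  (1 - t) * (a.1 ^+ 2 + a.2 ^+ 2) + t * (b.1 ^+ 2 + b.2 ^+ 2)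
  - t * (1 - t) * ((a.1 - b.1) ^+ 2 + (a.2 - b.2) ^+ 2) by ring.
rewrite H1; have P : 0 <= t * (1 - t) * ((a.1 - b.1) ^+ 2 + (a.2 - b.2) ^+ 2).
  by rewrite mulr_ge0 ?addr_ge0 ?sqr_ge0// mulr_ge0// subr_ge0.
have [t00|tn0] := eqVneq t 0; first by move: P; rewrite t00 !mul0r; lra.
have tp : 0 < t by rewrite lt_neqAle eq_sym tn0.
move: P; set P := t * (1 - t) * _ => P0; clearbody P; clear -A B tp t1 P0.
set a2 := a.1 ^+ 2 + a.2 ^+ 2 in A *; set b2 := b.1 ^+ 2 + b.2 ^+ 2 in B *; clearbody a2 b2; nra.
Qed.

Lemma measurable_deriv_limit (K : set (R * R)) (u : R * R -> R -> R) (v : R * R -> R) (c r : R) :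
  measurable (K : set plane) -> 0 < r ->
  (forall t, `|t - c| < r -> measurable_fun (K : set plane) (fun z : plane => u z t)) ->
  (forall z, K z -> is_derive c (1 : R) (u z) (v z)) ->
  measurable_fun (K : set plane) (v : plane -> R).
Proof.
move=> mK r0 mu_ du.
have [N _ HN] := mesh_small r0.
have hn n : (n + N).+1%:R^-1 < r by apply: HN; rewrite /= leq_addl.
pose s n : R := (n + N).+1%:R^-1; have s0 n : 0 < s n by rewrite invr_gt0.
apply: (@measurable_fun_cvg _ _ R K (fun n (z : plane) => (u z (c + s n) - u z c) / s n)).
  move=> n; apply: measurable_funM => //; apply: measurable_funB.
    by apply: mu_; rewrite addrC addKr gtr0_norm//; exact: hn.
  by apply: mu_; rewrite subrr normr0.
move=> z Kz; apply/cvgrPdist_le => e e0.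
have [d d0 Hd] := is_derive_eps (du z Kz) e0.
have := mesh_small d0 => -[M _ HM]; exists M => // n /= Mn.
have sd : s n < d by apply: (HM (n + N)%N); rewrite /= (leq_trans Mn)// leq_addr.
have := Hd (s n); rewrite (gtr0_norm (s0 n)) => /(_ sd).
have -> : v z - (u z (c + s n) - u z c) / s n = - ((u z (c + s n) - u z c - v z * s n) / s n).
  by field; rewrite gt_eqF.
by rewrite normrN normrM normfV (gtr0_norm (s0 n)) ler_pdivrMr.
Qed.

Context (k rho : R) (D K : set (R * R)) (S w : R * R -> R * R -> R).
Context (k0 : 0 < k) (oD : open D) (bD : bounded_set D) (cD : C2_boundary D).
Context (cK : compact K) (KD : K `<=` D) (Drho : D `<=` disc rho).
Context (hS : forall z, D z -> dirichlet_solution D k (S z) (fun x => - complex.Re (incident_field k z x))).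
Context (hw : forall z, K z -> analytic_helmholtz (disc rho) k (w z)).
Context (hwS : forall z, K z -> {ae leb2, forall x, D x -> w z x = S z x}).

Let mD : measurable (D : set plane). Proof. exact: open_plane_measurable. Qed.
Let mK : measurable (K : set plane).
Proof. by apply: closed_plane_measurable; exact: compact_closed_plane. Qed.

Lemma open_disc (r : R) : open (disc r).
Proof.
have -> : disc r = [set x : R * R | enorm (x - 0) < r] by apply/seteqP; split => x; rewrite /disc/= subr0.
by apply: open_lt_fun; [exact: continuous_enormB|exact: cst_continuous].
Qed.

Lemma w_smooth z : K z -> smoothU (disc rho) (w z).
Proof. by move=> Kz; apply: analytic2_smoothU => x; case/(hw Kz). Qed.

Lemma w_helm z : K z -> helm (disc rho) k (dfam (w z)).
Proof.
move=> Kz; apply: helm_dfam; [exact: open_disc|exact: w_smooth|].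
by move=> x xr; case: (hw Kz xr).
Qed.

Lemma w_cont z x : K z -> disc rho x -> {for x, continuous (w z)}.
Proof. by move=> Kz xr; exact: CkU_cont (w_smooth Kz 0%N) _ xr. Qed.

Lemma w_meas z : K z -> measurable_fun (D : set plane) (w z : plane -> R).
Proof. by move=> Kz; apply: continuous_plane_measurable_within => // x Dx; apply: w_cont => //; exact: Drho. Qed.

Lemma S_L2 z : D z -> L2 D (S z).
Proof. by move=> Dz; have [g1 [g2 [[]]]] := hS Dz. Qed.

Lemma w_L2 z : K z -> L2 D (w z).
Proof.
move=> Kz; have [mS SS] := S_L2 (KD Kz); split; first exact: w_meas.
rewrite (@ge0_ae_eq_integral _ _ _ leb2 D _ (fun x => ((S z x) ^+ 2)%:E))//.
- by apply: measurable_sqr; exact: w_meas.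
- exact: measurable_sqr.
- by move=> x _; rewrite lee_fin sqr_ge0.
- by move=> x _; rewrite lee_fin sqr_ge0.
- case: (hwS Kz) => N [mN N0 HN]; exists N; split => // x /= nx.
  by apply: HN => /= H; apply: nx => Dx; rewrite H.
Qed.

Lemma w_ip z f : K z -> L2 D f -> ip D (w z) f = ip D (S z) f.
Proof.
move=> Kz Lf; rewrite /ip /Rintegral; congr fine; apply: ae_eq_integral => //.
- by case/integrableP: (L2_mul_integrable mD (w_L2 Kz) Lf).
- by case/integrableP: (L2_mul_integrable mD (S_L2 (KD Kz)) Lf).
- case: (hwS Kz) => N [mN N0 HN]; exists N; split => // x /= nx.
  by apply: HN => /= H; apply: nx => Dx; rewrite H.
Qed.

(** The value at [x] is a limit of averages against regularized sources at [x]. Reciprocity rewrites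
    each average as [h n z], where [z] enters only through the translated kernels [fsrc] and [gsrc],
    hence continuously. *)
Lemma measurable_w_D x : D x -> measurable_fun (K : set plane) (fun z : plane => w z x).
Proof.
move=> Dx; have cK1 : compact (K `|` [set x]) by apply: compactU => //; exact: compact_set1.
have K1D : K `|` [set x] `<=` D by move=> y [/KD|->].
have [al1 al10 Hal1] := qq_far cK1 oD K1D.
have [al2 al20 Hal2] := small_al_exists k0.
pose al : R := Num.min al1 al2; have al0 : 0 < al by rewrite lt_min al10.
pose aln n : R := al / n.+1%:R.
have aln0 n : 0 < aln n by rewrite divr_gt0.
have alnle n : aln n <= al by rewrite ler_pdivrMr// ler_peMr ?ler1n// ltW.
have aln1 n : aln n <= al1 by apply: le_trans (alnle n) _; rewrite ge_min lexx.
have aln2 n : small_al k (aln n) by apply: Hal2; rewrite aln0/=; apply: le_trans (alnle n) _; rewrite ge_min lexx orbT.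
have [th gth] := good_cutoffs_exist oD bD cD.
pose f n := fsrc k (aln n) x.
pose h n z := (ip D (S x) (fsrc k (aln n) z) + ip D (gsrc k (aln n) x) (fsrc k (aln n) z)
  - ip D (f n) (gsrc k (aln n) z)) / ip D (fun=> 1) (f n).
have Lc (u : R * R -> R) : continuous u -> L2 D u by exact: L2_bounded_domain.
have Lf n z : L2 D (fsrc k (aln n) z) by apply: Lc; exact: continuous_fsrc.
have Lg n z : L2 D (gsrc k (aln n) z) by apply: Lc; apply: smooth_continuous; exact: smooth_gsrc.
have rec n z : K z -> ip D (w z) (f n) / ip D (fun=> 1) (f n) = h n z.
  move=> Kz; rewrite w_ip//; last exact: Lf.
  have bal (y : R * R) : (K `|` [set x]) y -> forall b, bd D b -> aln n <= qq (b - y).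
    by move=> Ky b /bdE[//|_ nDb]; apply: le_trans (aln1 n) _; exact: Hal1.
  have [h1 [h2 [LSz Z1]]] := point_source_sol oD bD k0 (aln0 n) (bal z (or_introl Kz)) (hS (KD Kz)).
  have [g1 [g2 [LSx Z2]]] := point_source_sol oD bD k0 (aln0 n) (bal x (or_intror erefl)) (hS Dx).
  have := zero_trace_reciprocity oD bD gth Z2 Z1.
  rewrite !ipDl// (ipC D (gsrc k (aln n) z)) => E.
  rewrite /h; congr (_ / _); rewrite -E /f; by rewrite addrK.
apply: (@measurable_fun_cvg _ _ R K (fun n (z : plane) => h n z)).
  move=> n; apply: measurable_funTS; apply: continuous_plane_measurable => z.
  apply: cvgM; last exact: cvg_cst.
  apply: cvgB; first apply: cvgD.
  - exact: (continuous_ip_translate oD bD (S_L2 Dx) (continuous_freg k0 (aln0 n))).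
  - exact: (continuous_ip_translate oD bD (Lg n x) (continuous_freg k0 (aln0 n))).
  - apply: (continuous_ip_translate oD bD (Lf n x)).
    by apply: smooth_continuous; apply/smoothP; exact: smooth_greg.
move=> z Kz.
have -> : (h ^~ z) = (fun n => ip D (w z) (f n) / ip D (fun=> 1) (f n)).
  by apply/funext => n; rewrite rec.
apply: (approximate_identity (al := aln) oD bD Dx (w_L2 Kz)).
- by apply: w_cont => //; exact: Drho.
- by move=> n; exact: continuous_fsrc.
- by move=> n y; exact: freg_le0.
- by move=> n; rewrite /f /fsrc subrr; exact: freg0.
- by move=> n y; exact: freg_out.
- rewrite -(mulr0 al); apply: cvgMr; exact: cvg_harmonic.
Qed.

(** All derivatives are included, because a Taylor step from [p] uses all of them and has to return
    all of them at the new point. *)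
Definition meas_at x := forall i j, measurable_fun (K : set plane) (fun z : plane => dfam (w z) i j x).

Lemma meas_at_D x : D x -> meas_at x.
Proof.
move=> Dx i j; elim: j i x Dx => [|j IHj] i; [elim: i => [|i IHi]|elim: i => [|i IHi]] => x Dx.
- exact: measurable_w_D.
- have /openP_box/(_ x Dx)[r r0 rD] := oD.
  apply: (@measurable_deriv_limit K (fun z t => dfam (w z) i 0 (t, x.2)) _ x.1 r) => //.
    by move=> t tr; apply: IHi; apply: rD; split => //=; rewrite subrr normr0.
  by move=> z Kz; have [_ + _ _] := w_helm Kz i 0 (Drho Dx) => /is_derive_e1.
- have /openP_box/(_ x Dx)[r r0 rD] := oD.
  apply: (@measurable_deriv_limit K (fun z t => dfam (w z) 0 j (x.1, t)) _ x.2 r) => //.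
    by move=> t tr; apply: IHj; apply: rD; split => //=; rewrite subrr normr0.
  by move=> z Kz; have [_ _ + _] := w_helm Kz 0 j (Drho Dx) => /is_derive_e2.
- have /openP_box/(_ x Dx)[r r0 rD] := oD.
  apply: (@measurable_deriv_limit K (fun z t => dfam (w z) i j.+1 (t, x.2)) _ x.1 r) => //.
    by move=> t tr; apply: IHi; apply: rD; split => //=; rewrite subrr normr0.
  by move=> z Kz; have [_ + _ _] := w_helm Kz i j.+1 (Drho Dx) => /is_derive_e1.
Qed.

Lemma measurable_taylor (a : nat -> plane -> R) (v : plane -> R) (t : R) :
  (forall m, measurable_fun (K : set plane) (a m)) ->
  (forall z, K z -> series (fun m => a m z * t ^+ m / m`!%:R) @ \oo --> v z) ->
  measurable_fun (K : set plane) v.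
Proof.
move=> ma cv; apply: (measurable_fun_cvg _ cv) => n.
rewrite /series /=; apply: measurable_sum => m.
by apply: measurable_funM => //; apply: measurable_funM => //; exact: ma.
Qed.

Lemma meas_at_stable : taylor_stable (disc rho) (taylor_radius k) meas_at.
Proof.
move=> p h t hh pU tc Pp; split=> i j.
- apply: (measurable_taylor (a := fun m z => dfam (w z) (m + i) j p) (t := t)) => [m|z Kz]; first exact: Pp.
  exact: (helm_taylor1 hh pU (helm_shift i j (w_helm Kz)) tc).
- apply: (measurable_taylor (a := fun m z => dfam (w z) i (m + j) p) (t := t)) => [m|z Kz]; first exact: Pp.
  exact: (helm_taylor2 hh pU (helm_shift i j (w_helm Kz)) tc).
Qed.

(* Reciprocity gives the case x in D; Taylor expansions then propagate measurability along segments. *)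
Lemma measurable_w x : D !=set0 -> disc rho x -> measurable_fun (K : set plane) (fun z : plane => w z x).
Proof.
move=> [a Da] xr; suff : meas_at x by move=> /(_ 0 0)%N.
have c01 : 0 < taylor_radius k <= 2^-1 by rewrite taylor_radius_gt0 taylor_radius_le.
apply: (taylor_stable_segment (@open_disc rho) c01 meas_at_stable _ (meas_at_D Da)) => t t01.
by apply: convex_disc => //; exact: Drho.
Qed.

End measurability.

(** * Pointwise boundary values of functions of zero trace *)

Section pointwise_boundary_value.
Context {R : realType}.
Local Notation plane := (measurableTypeR R * measurableTypeR R)%type.
Implicit Types (D : set (R * R)) (p x : R * R) (V f g h : R * R -> R).

Lemma vchart_shrink A p (d d' e L : R) gm up : 0 < d' <= d -> vchart A p d e L gm up -> vchart A p d' e L gm up.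
Proof.
move=> /andP[d'0 d'd] [d0 e0 gL ge H]; split => // x xd xe; apply: H => //; lra.
Qed.

Lemma vchart_center A p (d e L : R) gm up : open A -> bd A p -> vchart A p d e L gm up -> gm p.1 = p.2.
Proof.
move=> oA /bdE[//|clA nA] [d0 e0 gL ge H]; have cg := lip_continuous gL.
have H0 : A p <-> (if up then gm p.1 < p.2 else p.2 < gm p.1) by apply: H; rewrite subrr normr0.
have cgp : {for p, continuous (fun x : R * R => gm x.1 - x.2)}.
  by apply: cvgB; [exact: (continuous_comp_fst cg)|exact: continuous_snd_plane].
have bx : nbhs p [set x : R * R | `|x.1 - p.1| < d /\ `|x.2 - p.2| < e].
  have m0 : 0 < Num.min d e by rewrite lt_min d0.
  have : nbhs p (box p (Num.min d e)) by apply: near_open; [exact: open_box|exact: boxxx].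
  by apply: filterS => x [x1 x2]; split; [apply: lt_le_trans x1 _|apply: lt_le_trans x2 _]; rewrite ge_min lexx ?orbT.
apply/eqP; rewrite eq_le; apply/andP; split; rewrite leNgt; apply/negP => Hlt.
- case: up H H0 => H H0; last by apply: nA; apply/H0.
  have N1 : nbhs p [set x : R * R | 0 < gm x.1 - x.2] by apply: (cvgr_gt _ cgp); rewrite subr_gt0.
  have [x [Ax [[xd xe] /= xg]]] := clA _ (filterI bx N1).
  by have /(_ xd xe)[/(_ Ax) + _] := H x; lra.
- case: up H H0 => H H0; first by apply: nA; apply/H0.
  have N1 : nbhs p [set x : R * R | gm x.1 - x.2 < 0] by apply: (cvgr_lt _ cgp); rewrite subr_lt0.
  have [x [Ax [[xd xe] /= xg]]] := clA _ (filterI bx N1).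
  by have /(_ xd xe)[/(_ Ax) + _] := H x; lra.
Qed.

(** If [u p] were nonzero, [|u|] would exceed some [m] near [p], and the square integral over a
    boundary strip of thickness [tau] would be at least of order [tau], whereas zero trace makes it
    [O(tau^2)]. *)
Lemma zero_trace_boundary_value D V h1 h2 u p : open D -> bounded_set D -> C2_boundary D ->
  L2 D V -> L2 D h1 -> L2 D h2 -> has_trace D V h1 h2 (fun=> 0) -> bd D p ->
  {for p, continuous u} -> {ae leb2, forall x, D x -> u x = V x} -> u p = 0.
Proof.
move=> oD bD cD LV L1 L2' tr bp cu uV; apply: contrapT => /eqP up0.
have mD : measurable (D : set plane) by exact: open_plane_measurable.
have [w [d [e [L [gm [up VC]]]]]] := C2_oriented_chart cD bp.
have [d0 e0 gL ge _] := VC; have cg : continuous gm by exact: lip_continuous gL.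
pose m := `|u p| / 2; have m0 : 0 < m by rewrite divr_gt0// normr_gt0.
have N1 : nbhs p [set x | `|u p - u x| < m] by move/cvgrPdist_lt : cu; apply.
move/nbhs_boxP : N1 => [r r0 Hr].
have um x : box p r x -> m <= `|u x|.
  move=> /Hr /= H; have := ler_normD (u x) (u p - u x); rewrite addrC subrK => K.
  by have mE : m = `|u p| / 2 by []; lra.
have oD' : open (ori w @^-1` D) by move/continuousP : (@continuous_ori R w); apply.
have bp' : bd (ori w @^-1` D) (ori w p).
  have gpd : `|(ori w p).1 - (ori w p).1| < d by rewrite subrr normr0.
  have /bdE[//|clD nD] := bp; apply/bdE => //; split; last by rewrite /= oriK.
  by apply: (@ori_cvg_closure R w (ori w @^-1` D)); rewrite (_ : ori w @^-1` (ori w @^-1` D) = D)//;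
    apply/seteqP; split => x; rewrite /= oriK.
have gmp := vchart_center oD' bp' VC.
(* The chart is narrowed so that the graph varies by at most [r / 2]; the strip then stays in the
   square where [|u|] is at least [m]. *)
pose d' := Num.min d (r / (2 * (`|L| + 1))).
have L10 : 0 < `|L| + 1 by have := normr_ge0 L; lra.
have d'0 : 0 < d' by rewrite lt_min d0 divr_gt0// mulr_gt0.
have d'd : 0 < d' <= d by rewrite d'0 ge_min lexx.
have VC' := vchart_shrink d'd VC.
have Ld' : (`|L| + 1) * d' <= r / 2.
  have : d' <= r / (2 * (`|L| + 1)) by rewrite ge_min lexx orbT.
  rewrite ler_pdivlMr ?mulr_gt0// => H; lra.
pose h := if w then h1 else h2.
have Lh : L2 D h by rewrite /h; case: (w).
pose H := \int[leb2]_(x in D) ((h x) ^+ 2).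
have H0 : 0 <= H by apply: Rintegral_ge0 => x _; exact: sqr_ge0.
have main tau : 0 < tau -> tau <= e / 2 -> tau <= r / 2 -> m ^+ 2 * (2 * d' * tau) <= 8 * tau ^+ 2 * H.
  move=> t0 te tr'; have tte : 0 < tau <= e / 2 by rewrite t0.
  set T := chart_strip w p d' gm up tau.
  have TD : T `<=` D by exact: chart_strip_sub VC' tte.
  have mT : measurable (T : set plane) by exact: measurable_chart_strip.
  have LVT : L2 T V by exact: L2_subset LV.
  have LhT : L2 T h by exact: L2_subset Lh.
  have Tbox x : T x -> box p r x.
    rewrite /T /chart_strip /= -(ori_box w) /strip /=; move: (ori w x) (ori w p) gmp => y q gq [y1 y2].
    have yq : `|y.1 - q.1| < d' by rewrite ltr_norml; lra.
    have := gL y.1 q.1; rewrite gq => Hg.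
    have Hg' : `|gm y.1 - q.2| <= `|L| * d'.
      apply: le_trans Hg _; apply: (@le_trans _ _ (`|L| * `|y.1 - q.1|)); first by rewrite ler_wpM2r// ler_norm.
      by rewrite ler_wpM2l// ltW.
    have d'r : `|L| * d' + d' <= r / 2 by lra.
    have Ldge0 : 0 <= `|L| * d' by rewrite mulr_ge0// ltW.
    split; first by lra.
    move: Hg' y2; rewrite ler_norml ltr_norml /chart_low; case: (up); lra.
  have S1 := chart_strip_le oD LV L1 L2' tr VC' tte; rewrite -/T -/h in S1.
  have S2 : \int[leb2]_(x in T) ((h x) ^+ 2) <= H.
    by rewrite -lee_fin -!L2_sqr_fin//; apply: le_integral_sqr => //; case: Lh.
  apply: (@le_trans _ _ (8 * tau ^+ 2 * \int[leb2]_(x in T) ((h x) ^+ 2))); last first.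
    by rewrite ler_wpM2l// mulr_ge0// sqr_ge0.
  apply: le_trans S1; rewrite -lee_fin -L2_sqr_fin// EFinM -(leb2_chart_strip w p up cg d'0 t0) -/T.
  rewrite -integral_cst//; apply: ae_ge0_le_integral => //.
  - by move=> x _; rewrite lee_fin sqr_ge0.
  - by move=> x _; rewrite lee_fin sqr_ge0.
  - by apply: measurable_sqr; case: LVT.
  - case: uV => N [mN N0 HN]; exists N; split => // x /= nx; apply: HN => /= uVx; apply: nx => Tx.
    rewrite lee_fin -(uVx (TD _ Tx)) -[leRHS]real_normK ?num_real// lerXn2r ?nnegrE ?(ltW m0)//.
    by apply: um; exact: Tbox.
(* The last entry makes [8 t1 H] smaller than [2 m^2 d'], contradicting [main]. *)
pose t1 := Num.min (Num.min (e / 2) (r / 2)) (m ^+ 2 * d' / (8 * (H + 1))).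
have H1 : 0 < H + 1 by lra.
have t10 : 0 < t1.
  rewrite !lt_min (divr_gt0 e0)// (divr_gt0 r0)//= divr_gt0//; last by rewrite mulr_gt0.
  by rewrite mulr_gt0// exprn_gt0.
have t1e : t1 <= e / 2 by rewrite !ge_min lexx.
have t1r : t1 <= r / 2 by rewrite !ge_min lexx ?orbT.
have t1m : t1 * (8 * (H + 1)) <= m ^+ 2 * d' by rewrite -ler_pdivlMr ?mulr_gt0// !ge_min lexx orbT.
have := main t1 t10 t1e t1r.
have md : 0 < m ^+ 2 * d' by rewrite mulr_gt0// exprn_gt0.
have -> : m ^+ 2 * (2 * d' * t1) = 2 * (m ^+ 2 * d') * t1 by ring.
have -> : 8 * t1 ^+ 2 * H = 8 * t1 * H * t1 by ring.
rewrite ler_pM2r//; move: t1m md; set q := m ^+ 2 * d'; clearbody q; clear -H0 t10; nra.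
Qed.

End pointwise_boundary_value.

(** * The Poincare inequality on a tile *)

Section poincare.
Context {R : realType}.
Local Notation mu := (@lebesgue_measure R).
Local Notation plane := (measurableTypeR R * measurableTypeR R)%type.
Implicit Types (a c tau : R) (w F : R * R -> R).

(** Half-open, so that the tiles of a grid are pairwise disjoint and cover a square exactly. *)
Definition tile a c tau : set (R * R) := `[a, a + tau[%classic `*` `[c, c + tau[%classic.

Lemma measurable_tile a c tau : measurable (tile a c tau : set plane).
Proof. by apply: measurableX; exact: measurable_itv. Qed.

Local Open Scope ereal_scope.

Lemma tile_tonelli a c tau F : continuous F -> (forall x, (0 <= F x)%R) ->
  \int[leb2]_(x in tile a c tau) (F x)%:E =
  \int[mu]_(t in `[a, (a + tau)%R[) \int[mu]_(y in `[c, (c + tau)%R]) (F (t, y))%:E.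
Proof.
move=> cF F0; rewrite integral_mkcond leb2_tonelli1; last 2 first.
- apply/(measurable_restrictT _ _).1; first exact: measurable_tile.
  by apply: measurable_funTS; apply/measurable_EFinP; exact: continuous_plane_measurable.
- by move=> x; rewrite patchE; case: ifP => // _; rewrite lee_fin.
rewrite [RHS]integral_mkcond; apply: eq_integral => t _; rewrite patchE.
have mF : measurable_fun setT (fun y : measurableTypeR R => (F (t, y))%:E).
  by apply/measurable_EFinP; apply: continuous_measurable_fun; exact: continuous_section1.
case: ifPn => [/set_mem ta|]; last first.
  rewrite notin_setE => nt; apply: integral0_eq => y _; rewrite patchE ifF//.
  by apply/negbTE; rewrite notin_setE => -[].
rewrite -integral_itv_bndo_bndc; last exact: measurable_funTS.
rewrite [RHS]integral_mkcond; apply: eq_integral => y _; rewrite !patchE.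
have -> // : ((t, y) \in tile a c tau) = (y \in `[c, (c + tau)%R[%classic).
by apply/idP/idP => /set_mem H; apply/mem_set; [case: H|split].
Qed.

Lemma tile_swp a c tau : @swp R @^-1` tile a c tau = tile c a tau.
Proof. by apply/seteqP; split => x; rewrite /tile /swp /= => -[]. Qed.

Lemma tile_tonelli2 a c tau F : continuous F -> (forall x, (0 <= F x)%R) ->
  \int[leb2]_(x in tile a c tau) (F x)%:E =
  \int[mu]_(y in `[c, (c + tau)%R[) \int[mu]_(t in `[a, (a + tau)%R]) (F (t, y))%:E.
Proof.
move=> cF F0; rewrite -(@integral_ori _ true (tile a c tau) (fun x => (F x)%:E)).
- rewrite (_ : ori true @^-1` tile a c tau = tile c a tau); last exact: tile_swp.
  have cs : continuous (F \o swp) by exact: (@continuous_ori_comp R true F cF).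
  exact: (tile_tonelli c a tau cs (fun x => F0 (swp x))).
- exact: measurable_tile.
- by apply: measurable_funTS; apply/measurable_EFinP; exact: continuous_plane_measurable.
- by move=> x; rewrite lee_fin.
Qed.

Lemma leb2_tile a c tau : (0 < tau)%R -> leb2 (tile a c tau) = (tau ^+ 2)%:E.
Proof.
move=> t0; rewrite /tile leb2_setX//.
have mI (b : R) : mu `[b, (b + tau)%R[ = tau%:E.
  by rewrite lebesgue_measure_itv/= lte_fin ltrDl t0 -EFinB addrC addKr.
by rewrite !mI -EFinM expr2.
Qed.

Lemma tile_fst a c tau (P : R -> \bar R) : (0 < tau)%R -> measurable_fun setT P -> (forall t, 0 <= P t) ->
  \int[leb2]_(x in tile a c tau) P x.1 = tau%:E * \int[mu]_(t in `[a, (a + tau)%R[) P t.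
Proof.
move=> t0 mP P0; rewrite integral_mkcond leb2_tonelli1; last 2 first.
- apply/(measurable_restrictT _ _).1; first exact: measurable_tile.
  by apply: measurable_funTS; apply: measurableT_comp.
- by move=> x; rewrite patchE; case: ifP.
have mI : mu `[c, (c + tau)%R[ = tau%:E.
  by rewrite lebesgue_measure_itv/= lte_fin ltrDl t0 -EFinB addrC addKr.
transitivity (\int[mu]_(t in `[a, (a + tau)%R[) (tau%:E * P t)); last first.
  by apply: ge0_integralZl => //; [exact: measurable_funTS|rewrite lee_fin ltW].
rewrite [RHS]integral_mkcond; apply: eq_integral => t _; rewrite patchE.
case: ifPn => [/set_mem ta|]; last first.
  rewrite notin_setE => nt; apply: integral0_eq => y _; rewrite patchE ifF//.
  by apply/negbTE; rewrite notin_setE => -[].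
have -> : tau%:E * P t = \int[mu]_(y in `[c, (c + tau)%R[) cst (P t) y by rewrite integral_cst// muleC; congr (_ * _).
rewrite [RHS]integral_mkcond; apply: eq_integral => y _; rewrite !patchE.
have -> // : ((t, y) \in tile a c tau) = (y \in `[c, (c + tau)%R[%classic).
by apply/idP/idP => /set_mem H; apply/mem_set; [case: H|split].
Qed.

Lemma tile_snd a c tau (P : R -> \bar R) : (0 < tau)%R -> measurable_fun setT P -> (forall t, 0 <= P t) ->
  \int[leb2]_(x in tile a c tau) P x.2 = tau%:E * \int[mu]_(t in `[c, (c + tau)%R[) P t.
Proof.
move=> t0 mP P0; rewrite -(@integral_ori _ true (tile a c tau) (fun x => P x.2)) //.
- by rewrite (_ : ori true @^-1` tile a c tau = tile c a tau); [exact: tile_fst|exact: tile_swp].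
- exact: measurable_tile.
- by apply: measurable_funTS; apply: measurableT_comp.
Qed.

Lemma measurable_section_integral c (tau : R) F : continuous F -> (forall x, (0 <= F x)%R) ->
  measurable_fun setT (fun t => \int[mu]_(y in `[c, (c + tau)%R]) (F (t, y))%:E).
Proof.
move=> cF F0; pose f : plane -> \bar R := (fun x => (F x)%:E) \_ (setT `*` `[c, (c + tau)%R]%classic).
have -> : (fun t => \int[mu]_(y in `[c, (c + tau)%R]) (F (t, y))%:E) = fun t => \int[mu]_y f (t, y).
  apply/funext => t; rewrite integral_mkcond; apply: eq_integral => y _; rewrite /f !patchE.
  have -> // : ((t, y) \in setT `*` `[c, (c + tau)%R]%classic) = (y \in `[c, (c + tau)%R]%classic).
  by apply/idP/idP => /set_mem H; apply/mem_set; [case: H|split].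
apply: measurable_inner.
- apply/(measurable_restrictT _ _).1; first exact: measurableX.
  by apply: measurable_funTS; apply/measurable_EFinP; exact: continuous_plane_measurable.
- by move=> x; rewrite /f patchE; case: ifP => // _; rewrite lee_fin.
Qed.

Lemma L2_sqr_add_fin (T : set (R * R)) (f g : R * R -> R) : measurable (T : set plane) -> L2 T f -> L2 T g ->
  \int[leb2]_(x in T) ((f x) ^+ 2 + (g x) ^+ 2)%:E =
  (\int[leb2]_(x in T) ((f x) ^+ 2) + \int[leb2]_(x in T) ((g x) ^+ 2))%R%:E.
Proof.
move=> mT Lf Lg; rewrite EFinD -(L2_sqr_fin mT Lf) -(L2_sqr_fin mT Lg).
under eq_integral do rewrite EFinD.
apply: ge0_integralD => //; try (by move=> x _; rewrite lee_fin sqr_ge0).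
- by apply: measurable_sqr; case: Lf.
- by apply: measurable_sqr; case: Lg.
Qed.

Lemma two_step (p q r tau : R) (P Q : \bar R) :
  ((p - q) ^+ 2)%:E <= tau%:E * P -> ((q - r) ^+ 2)%:E <= tau%:E * Q ->
  ((p - r) ^+ 2)%:E <= (2 * tau)%:E * P + (2 * tau)%:E * Q.
Proof.
move=> D2 D1; rewrite !EFinM -!muleA.
apply: (@le_trans _ _ (2%:E * ((p - q) ^+ 2)%:E + 2%:E * ((q - r) ^+ 2)%:E)); last first.
  by apply: leeD; apply: lee_wpmul2l; rewrite ?lee_fin.
rewrite -!EFinM -EFinD lee_fin; clear.
by have := sqr_ge0 (p - q - (q - r)); nra.
Qed.

(** The square of [w x - w y] is bounded along a vertical and then a horizontal segment and
    integrated over [y], then over [x]. The mean of [w] is kept as a separate term, to be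
    annihilated later by the choice of a combination. *)
Lemma tile_poincare a c tau w : (0 < tau)%R -> Ck 1 w ->
  \int[leb2]_(x in tile a c tau) ((w x) ^+ 2)%:E <=
  (4 / tau ^+ 2 * (\int[leb2]_(x in tile a c tau) w x) ^+ 2)%:E +
  (4 * tau ^+ 2)%:E * \int[leb2]_(x in tile a c tau) ((d1 w x) ^+ 2 + (d2 w x) ^+ 2)%:E.
Proof.
move=> t0 /CkU_setT w1; set T := tile a c tau.
have mT : measurable (T : set plane) by exact: measurable_tile.
have cw : continuous w by move=> x; exact: (CkU_cont w1).
have c1 : continuous (d1 w) by move=> x; exact: (CkU_cont (CkU_d1 w1)).
have c2 : continuous (d2 w) by move=> x; exact: (CkU_cont (CkU_d2 w1)).
have csq (h : R * R -> R) : continuous h -> continuous (fun x => h x ^+ 2)%R.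
  by move=> ch x; rewrite /continuous_at; apply: cvgM; exact: ch.
have mT' (h : R * R -> R) : continuous h -> measurable_fun (T : set plane) (h : plane -> R).
  by move=> ch; apply: measurable_funTS; exact: continuous_plane_measurable.
have Tb : T `<=` (cbox (0 : R * R) (`|a| + `|c| + tau))%R.
  move=> x [/=]; rewrite !in_itv/= => /andP[h1 h2] /andP[h3 h4].
  have := ler_norm a; have := ler_norm (- a)%R; have := ler_norm c; have := ler_norm (- c)%R.
  have := normr_ge0 a; have := normr_ge0 c.
  by rewrite !normrN => *; split; rewrite subr0 ler_norml; lra.
have LT (h : R * R -> R) : continuous h -> L2 T h.
  move=> ch; apply: L2_continuous_bounded => //; first exact: leb2_bounded_set Tb.
  have [B B0 HB] := compact_bounded_fun (@compact_cbox R (0 : R * R)%R (`|a| + `|c| + tau)%R) (fun x _ => ch x).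
  by exists B => x /Tb/HB.
pose I1 := (\int[leb2]_(x in T) ((d1 w x) ^+ 2))%R.
pose I2 := (\int[leb2]_(x in T) ((d2 w x) ^+ 2))%R.
pose A := (\int[leb2]_(x in T) w x)%R.
pose J := (\int[leb2]_(x in T) ((w x) ^+ 2))%R.
have J0 : (0 <= J)%R by apply: Rintegral_ge0 => x _; exact: sqr_ge0.
have I10 : (0 <= I1)%R by apply: Rintegral_ge0 => x _; exact: sqr_ge0.
have I20 : (0 <= I2)%R by apply: Rintegral_ge0 => x _; exact: sqr_ge0.
pose P (t : R) := \int[mu]_(y in `[c, (c + tau)%R]) ((d2 w (t, y)) ^+ 2)%:E.
have P0 t : 0 <= P t by apply: integral_ge0 => y _; rewrite lee_fin sqr_ge0.
have mP : measurable_fun setT P.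
  by apply: (@measurable_section_integral c tau (fun x => d2 w x ^+ 2)%R); [exact: csq|move=> x; exact: sqr_ge0].
have intP : \int[mu]_(t in `[a, (a + tau)%R[) P t = I2%:E.
  by rewrite /I2 -L2_sqr_fin//; [rewrite -(@tile_tonelli _ _ _ (fun x => d2 w x ^+ 2)%R)//; [exact: csq|move=> x; exact: sqr_ge0]|exact: LT].
pose Q (y : R) := \int[mu]_(t in `[a, (a + tau)%R]) ((d1 w (t, y)) ^+ 2)%:E.
have Q0 t : 0 <= Q t by apply: integral_ge0 => y _; rewrite lee_fin sqr_ge0.
have cs : continuous (fun x : R * R => d1 w (swp x)) by exact: (@continuous_ori_comp R true _ c1).
have mQ : measurable_fun setT Q.
  by apply: (@measurable_section_integral a tau (fun x => d1 w (swp x) ^+ 2)%R); [exact: csq|move=> x; exact: sqr_ge0].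
have intQ : \int[mu]_(y in `[c, (c + tau)%R[) Q y = I1%:E.
  by rewrite /I1 -L2_sqr_fin//; [rewrite -(@tile_tonelli2 _ _ _ (fun x => d1 w x ^+ 2)%R)//; [exact: csq|move=> x; exact: sqr_ge0]|exact: LT].
have diff (x y : R * R) : T x -> T y -> ((w x - w y) ^+ 2)%:E <= (2 * tau)%:E * P x.1 + (2 * tau)%:E * Q y.2.
  move=> [/=]; rewrite !in_itv/= => xa xc [/=]; rewrite !in_itv/= => ya yc.
  have le' (s b : R) : (b <= s < b + tau)%R -> (b <= s <= b + tau)%R by move=> /andP[-> /ltW].
  have k2 : continuous (fun t => d2 w (x.1, t)) by exact: continuous_section1.
  have k1 : continuous (fun t => d1 w (t, y.2)) by exact: (@continuous_section1 R (fun x => d1 w (swp x)) y.2 cs).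
  have e2 (t : R) : is_derive t (1%R : R) (fun t => w (x.1, t)) (d2 w (x.1, t)).
    by apply/(is_derive_e2 w (x.1, t)); exact: (CkU_is_d2 w1 I).
  have e1 (t : R) : is_derive t (1%R : R) (fun t => w (t, y.2)) (d1 w (t, y.2)).
    by apply/(is_derive_e1 w (t, y.2)); exact: (CkU_is_d1 w1 I).
  have D2 := @diff_sq_le R (fun t => w (x.1, t)) (fun t => d2 w (x.1, t)) c (c + tau)%R x.2 y.2
    k2 e2 (le' _ _ xc) (le' _ _ yc).
  have D1 := @diff_sq_le R (fun t => w (t, y.2)) (fun t => d1 w (t, y.2)) a (a + tau)%R x.1 y.1
    k1 e1 (le' _ _ xa) (le' _ _ ya).
  rewrite [X in X%:E * _]addrC addKr in D2; rewrite [X in X%:E * _]addrC addKr in D1.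
  rewrite -!surjective_pairing in D1 D2.
  exact: (two_step D2 D1).
clearbody P Q.
have Too : leb2 T < +oo by exact: leb2_bounded_set Tb.
have cT (r : \bar R) : \int[leb2]_(y in T) r = r * (tau ^+ 2)%:E.
  by rewrite -(leb2_tile a c t0) integral_cst.
(* The square is expanded, the term [w^2] is dropped, and the cross term is absorbed by Young's
   inequality. *)
have var (q : R) : (tau ^+ 2 / 2 * q ^+ 2 - 2 * A ^+ 2 / tau ^+ 2)%R%:E <= \int[leb2]_(y in T) ((q - w y) ^+ 2)%:E.
  have L1 : L2 T (fun=> 1%R) by apply: LT; exact: cst_continuous.
  have Lw := LT _ cw.
  have Iw : leb2.-integrable T (EFin \o w : plane -> \bar R).
    have := L2_mul_integrable mT Lw L1; apply: eq_integrable => // x _ /=.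
    by rewrite mulr1.
  have I1' : leb2.-integrable T (EFin \o (fun=> 1%R) : plane -> \bar R).
    have := L2_mul_integrable mT L1 L1; apply: eq_integrable => // x _ /=.
    by rewrite mulr1.
  have Iq : leb2.-integrable T (fun y : plane => (q ^+ 2)%:E * 1%:E) by exact: integrableZl.
  have Iqw : leb2.-integrable T (fun y : plane => (- (2 * q))%:E * (w y)%:E) by exact: integrableZl.
  have E : \int[leb2]_(y in T) ((q ^+ 2)%:E * 1%:E + (- (2 * q))%:E * (w y)%:E) = (q ^+ 2 * tau ^+ 2 - 2 * q * A)%:E.
    rewrite integralD// integralZl// integralZl//.
    rewrite (_ : \int[leb2]_(x in T) (w x)%:E = A%:E); last first.
      by rewrite /A /Rintegral fineK//; apply: integrable_fin_num.
    by rewrite cT mul1e -!EFinM -EFinD mulNr.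
  apply: (@le_trans _ _ (q ^+ 2 * tau ^+ 2 - 2 * q * A)%:E).
    rewrite lee_fin; set a2 := (A / tau)%R.
    have -> : (2 * A ^+ 2 / tau ^+ 2 = 2 * a2 ^+ 2)%R by rewrite /a2; field; rewrite gt_eqF.
    have -> : (2 * q * A = 2 * (q * tau) * a2)%R by rewrite /a2; field; rewrite gt_eqF.
    rewrite -subr_ge0 (_ : (_ - _ = (q * tau - 2 * a2) ^+ 2 / 2)%R); first by rewrite divr_ge0 ?sqr_ge0.
    by field.
  rewrite -E.
  apply: le_integral => //; first exact: integrableD.
    have Lq : L2 T (fun y => q - w y)%R by apply: LT => y; apply: cvgB; [exact: cvg_cst|exact: cw].
    exact: (L2_sqr_integrable Lq).
  by move=> y _; rewrite -!EFinM -EFinD lee_fin; have := sqr_ge0 (w y); clear; nra.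
have pt x : T x -> ((w x) ^+ 2)%:E <= (4 * A ^+ 2 / tau ^+ 4 + 4 * I1)%:E + (4 * tau)%:E * P x.1.
  move=> Tx; have := P0 x.1.
  have ub : \int[leb2]_(y in T) ((w x - w y) ^+ 2)%:E <= (2 * tau)%:E * P x.1 * (tau ^+ 2)%:E + (2 * tau ^+ 2 * I1)%:E.
    apply: (@le_trans _ _ (\int[leb2]_(y in T) ((2 * tau)%:E * P x.1 + (2 * tau)%:E * Q y.2))).
      apply: ge0_le_integral => //.
      - by move=> y _; rewrite lee_fin sqr_ge0.
      - by apply/measurable_EFinP; apply: mT' => y; rewrite /continuous_at; apply: cvgM; apply: cvgB; (exact: cvg_cst || exact: cw).
      - apply: emeasurable_funD; first exact: measurable_cst.
        by apply: measurable_funeM; apply: measurable_funTS; apply: measurableT_comp.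
      - by move=> y Ty; exact: diff.
    rewrite ge0_integralD//; last 3 first.
    - by move=> y _; rewrite mule_ge0// lee_fin mulr_ge0// ltW.
    - by move=> y _; rewrite mule_ge0// lee_fin mulr_ge0// ltW.
    - by apply: measurable_funeM; apply: measurable_funTS; apply: measurableT_comp.
    have -> : \int[leb2]_(y in T) ((2 * tau)%:E * P x.1) = (2 * tau)%:E * P x.1 * (tau ^+ 2)%:E.
      by rewrite cT.
    rewrite leeD2l// ge0_integralZl//; last 2 first.
    - by apply: measurable_funTS; apply: measurableT_comp.
    - by rewrite lee_fin mulr_ge0// ltW.
    by rewrite (tile_snd a c t0 mQ Q0) intQ -!EFinM lee_fin expr2 !mulrA.
  (* The section integral is an extended real; where it is infinite the bound is trivial. *)
  have := le_trans (var (w x)) ub; case: (P x.1) => [p| |] //.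
    rewrite -!EFinM -!EFinD !lee_fin => H p0.
    have t2 : (0 < tau ^+ 2)%R by rewrite exprn_gt0.
    have -> : (4 * A ^+ 2 / tau ^+ 4 = 4 * (A ^+ 2 / tau ^+ 2) / tau ^+ 2)%R by field; rewrite gt_eqF.
    have : (tau ^+ 2 / 2 * w x ^+ 2 <= 2 * (A ^+ 2 / tau ^+ 2) + 2 * tau * p * tau ^+ 2 + 2 * tau ^+ 2 * I1)%R by move: H; rewrite -[(2 * A ^+ 2 / _)%R]mulrA; set u := (A ^+ 2 / _)%R; clearbody u; clear; lra.
    set u := (A ^+ 2 / tau ^+ 2)%R => H'.
    rewrite -(ler_pM2l t2).
    have -> : (tau ^+ 2 * (4 * u / tau ^+ 2 + 4 * I1 + 4 * tau * p) = 4 * u + 4 * tau ^+ 2 * I1 + 4 * tau * p * tau ^+ 2)%R by field; rewrite gt_eqF.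
    by move: H'; clearbody u; clear; lra.
  by move=> _ _; rewrite gt0_muley ?lte_fin ?mulr_gt0// addey// leey.
have -> : \int[leb2]_(x in T) ((d1 w x) ^+ 2 + (d2 w x) ^+ 2)%:E = (I1 + I2)%:E.
  by apply: L2_sqr_add_fin; [|exact: LT..].
rewrite -/A; clearbody A I1 I2.
have al0 : (0 <= 4 * A ^+ 2 / tau ^+ 4 + 4 * I1)%R.
  by apply: addr_ge0; [apply: divr_ge0; [apply: mulr_ge0; [|exact: sqr_ge0]|apply: exprn_ge0; exact: ltW]|exact: mulr_ge0].
apply: (@le_trans _ _ (\int[leb2]_(x in T) ((4 * A ^+ 2 / tau ^+ 4 + 4 * I1)%:E + (4 * tau)%:E * P x.1))).
  apply: ge0_le_integral => //.
  - by move=> y _; rewrite lee_fin sqr_ge0.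
  - by apply/measurable_EFinP; apply: mT'; exact: csq.
  - apply: emeasurable_funD; first exact: measurable_cst.
    by apply: measurable_funeM; apply: measurable_funTS; apply: measurableT_comp.
rewrite ge0_integralD//; last 2 first.
- by move=> y _; rewrite mule_ge0// lee_fin mulr_ge0// ltW.
- by apply: measurable_funeM; apply: measurable_funTS; apply: measurableT_comp.
rewrite ge0_integralZl//; last 2 first.
- by apply: measurable_funTS; apply: measurableT_comp.
- by rewrite lee_fin mulr_ge0// ltW.
rewrite (tile_fst a c t0 mP P0) intP cT -!EFinM -!EFinD lee_fin.
rewrite le_eqVlt; apply/orP; left; apply/eqP; field.
by rewrite gt_eqF.
Qed.

End poincare.

(** * Finite multiplicity *)

Section truncation_energy.
Context {R : realType}.
Local Notation plane := (measurableTypeR R * measurableTypeR R)%type.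
Implicit Types (W K : set (R * R)) (x y : R * R) (u v th f g : R * R -> R).

End truncation_energy.

Section truncation_energy.
Context {R : realType}.
Local Notation plane := (measurableTypeR R * measurableTypeR R)%type.
Implicit Types (W K : set (R * R)) (x y : R * R) (u v th f g : R * R -> R).

(** Equal to 0 for [|t| <= e] and to [t] for [t^2 >= 2 e^2]; the step is taken in [t^2], which keeps
    it smooth. *)
Definition trunc_fun (e t : R) := t * sstep (t ^+ 2 / e ^+ 2 - 1).
Definition trunc_der (e t : R) :=
  sstep (t ^+ 2 / e ^+ 2 - 1) + t * ((2 * t / e ^+ 2) * sstepd (t ^+ 2 / e ^+ 2 - 1)).

Lemma is_derive_trunc (e t : R) : is_derive t (1 : R) (trunc_fun e) (trunc_der e t).
Proof.
have d1' : is_derive t (1 : R) (fun t : R => t ^+ 2 / e ^+ 2 - 1) (2 * t / e ^+ 2).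
  by apply: is_derive_eq; rewrite /GRing.scale /=; ring.
have d2' := @is_derive1_comp R sstep (fun t : R => t ^+ 2 / e ^+ 2 - 1) t _ _ (is_derive_sstep (t ^+ 2 / e ^+ 2 - 1)) d1'.
have d3' : is_derive t (1 : R) (fun t : R => t) 1 by exact: is_derive_id.
rewrite (_ : trunc_der e t = t *: (sstepd (t ^+ 2 / e ^+ 2 - 1) * (2 * t / e ^+ 2)) +
  sstep (t ^+ 2 / e ^+ 2 - 1) *: (1 : R)); first exact: (is_deriveM d3' d2').
by rewrite /trunc_der /GRing.scale /=; ring.
Qed.

(** The derivative depends on [e] and [t] only through [t^2 / e^2], and the term with [sstepd] lives
    where this ratio is at most 2: a single constant works for all truncation levels. *)
Lemma trunc_der_bound : exists2 C : R, 1 <= C & forall e t : R, 0 < e ->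
  sstep (t ^+ 2 / e ^+ 2 - 1) <= trunc_der e t <= C.
Proof.
have [B B0 HB] := @sstepd_bound R; exists (1 + 4 * B); first by lra.
move=> e t e0; set q := t ^+ 2 / e ^+ 2.
have q0 : 0 <= q by rewrite divr_ge0 ?sqr_ge0.
have -> : trunc_der e t = sstep (q - 1) + 2 * q * sstepd (q - 1).
  by rewrite /trunc_der /q; field; rewrite gt_eqF.
have s0 := sstepd_ge0 (q - 1); rewrite lerDl (mulr_ge0 (mulr_ge0 _ q0) s0)//=.
have s1 := sstep_le1 (q - 1); have [q2|q2] := leP q 2.
  by have := HB (q - 1); rewrite ger0_norm// => H; nra.
rewrite sstepd_eq0; first by rewrite mulr0; lra.
by apply/orP; right; lra.
Qed.

Lemma smoothU_trunc W v (e : R) : open W -> smoothU W v -> smoothU W (fun x => trunc_fun e (v x)).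
Proof.
move=> oW sv; apply: smoothU_mul => //.
apply: (@smoothU_sstep _ W (fun x => v x ^+ 2 / e ^+ 2 - 1)) => //.
apply: smoothU_sub => //; last exact: smoothU_cst.
apply: smoothU_mul => //; last exact: smoothU_cst.
exact: smoothU_mul.
Qed.

Lemma trunc_fun0 (e t : R) : 0 < e -> `|t| < e -> trunc_fun e t = 0.
Proof.
move=> e0 te; rewrite /trunc_fun sstep0 ?mulr0// subr_le0 ler_pdivrMr ?exprn_gt0// mul1r.
by rewrite -[leLHS]real_normK ?num_real// lerXn2r ?nnegrE ?(ltW e0)// ltW.
Qed.

Lemma test_patch W K u : open W -> compact K -> K `<=` W -> smoothU W u ->
  (forall x, W x -> ~ K x -> u x = 0) -> test_fun W (u \_ W).
Proof.
move=> oW cK KW su u0; split; last first.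
  exists K; split => // x nK; rewrite patchE; case: ifPn => // /set_mem Wx; exact: u0.
apply/smoothP => n; apply: CkU_local; first exact: openT.
move=> x _; have [Kx|nKx] := pselect (K x).
  exists W, u; split => //; first exact: KW.
  by move=> y Wy; rewrite patchE mem_set.
exists (~` K), (fun=> 0); split => //.
- by apply: closed_openC; exact: compact_closed_plane.
- exact: CkU_cst.
- by move=> y nKy; rewrite patchE; case: ifPn => // /set_mem Wy; exact: u0.
Qed.

Lemma test_d W a : test_fun W a -> test_fun W (d1 a) /\ test_fun W (d2 a).
Proof.
move=> [sa [K [cK KW a0]]]; have kK := compact_closed_plane cK.
have out x : ~ K x -> d1 a x = 0 /\ d2 a x = 0 by move=> nK; exact: test_out nK.
split; split; [exact: smooth_d1| |exact: smooth_d2|]; exists K; split => // x nK; have [e1 e2] := out x nK.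
- exact: e1.
- exact: e2.
Qed.

Lemma test_integrable W a : open W -> test_fun W a ->
  leb2.-integrable W (EFin \o a : plane -> \bar R) /\ \int[leb2]_(x in W) a x = \int[leb2]_x a x.
Proof.
move=> oW [sa [K [cK KW a0]]].
have mW : measurable (W : set plane) by exact: open_plane_measurable.
have [L L0 KL] : exists2 L, 0 < L & K `<=` cbox 0 L by apply: bounded_cbox; exact: compact_bounded.
have I : leb2.-integrable setT (EFin \o a : plane -> \bar R).
  apply: (@integrable_csupp R _ L); first exact: smooth_continuous.
  by move=> x nx; apply: a0 => /KL.
split; first by apply: integrableS I.
rewrite Rintegral_mkcond; apply: eq_Rintegral => x _; rewrite patchE.
by case: ifPn => //; rewrite notin_setE => nW; rewrite a0// => /KW.
Qed.

Lemma test_d_int W a : open W -> test_fun W a ->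
  \int[leb2]_(x in W) d1 a x = 0 /\ \int[leb2]_(x in W) d2 a x = 0.
Proof.
move=> oW ta; have [t1 t2] := test_d ta.
rewrite (test_integrable oW t1).2 (test_integrable oW t2).2.
have [s1 _] := t1; have [s2 _] := t2; have [sa [K [cK KW a0]]] := ta.
have kK := compact_closed_plane cK.
have [L L0 KL] : exists2 L, 0 < L & K `<=` cbox 0 L by apply: bounded_cbox; exact: compact_bounded.
have out x : ~ cbox 0 L x -> [/\ a x = 0, d1 a x = 0 & d2 a x = 0].
  by move=> nx; have nK : ~ K x by [move=> /KL]; have [] := test_out sa kK a0 nK; rewrite a0.
have sa1 := (smoothP _).1 sa 1%N.
have D1 (x : R * R) : is_derive x (1, 0) a (d1 a x) by exact: (CkU_is_d1 sa1).
have D2 (x : R * R) : is_derive x (0, 1) a (d2 a x) by exact: (CkU_is_d2 sa1).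
have o1 x : ~ cbox 0 L x -> a x = 0 /\ d1 a x = 0 by case/out.
have o2 x : ~ cbox 0 L x -> a x = 0 /\ d2 a x = 0 by case/out.
have E1 := int_d1_eq0 (smooth_continuous s1) D1 o1.
have E2 := int_d2_eq0 (smooth_continuous s2) D2 o2.
by rewrite /Rintegral E1 E2.
Qed.

(** The algebra of the energy estimate: [(p, q)] is the gradient of [v], [a] the cutoff with
    gradient [(b, c)], [v s] the truncation and [g] its derivative, [l1 + l2] the Laplacian. The
    bracket after [4 C] is the divergence of the truncation times [a^2] times the gradient of [v];
    it disappears on integration. *)
Lemma energy_pointwise (k C p q a b c v s g l1 l2 : R) : 0 <= s <= 1 -> s <= g <= C -> 0 <= a <= 1 ->
  l1 + l2 + k ^+ 2 * v = 0 -> 1 <= C ->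
  (p * g * a + v * s * b) ^+ 2 + (q * g * a + v * s * c) ^+ 2 <=
  4 * C * ((p * g * (a * (a * p)) + v * s * (b * (a * p) + a * (b * p + a * l1))) +
           (q * g * (a * (a * q)) + v * s * (c * (a * q) + a * (c * q + a * l2))))
  + (4 * C * k ^+ 2 * v ^+ 2 + (8 * C + 2) * ((b * v) ^+ 2 + (c * v) ^+ 2)).
Proof.
move=> /andP[s0 s1] /andP[sg gC] /andP[a0 a1] E C1.
have g0 : 0 <= g by lra.
set P := p ^+ 2 + q ^+ 2; have P0 : 0 <= P by rewrite addr_ge0 ?sqr_ge0.
set V := (b * v) ^+ 2 + (c * v) ^+ 2; have V0 : 0 <= V by rewrite addr_ge0 ?sqr_ge0.
set G := g * (a ^+ 2 * P); have aP0 : 0 <= a ^+ 2 * P by rewrite mulr_ge0 ?sqr_ge0.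
have Q0 : 0 <= k ^+ 2 * v ^+ 2 by rewrite mulr_ge0 ?sqr_ge0.
have S1 : (p * g * a + v * s * b) ^+ 2 + (q * g * a + v * s * c) ^+ 2 <= 2 * C * G + 2 * V.
  apply: (@le_trans _ _ (2 * (g * G) + 2 * (s ^+ 2 * V))).
    rewrite /G /V /P.
    have := sqr_ge0 (p * g * a - v * s * b); have := sqr_ge0 (q * g * a - v * s * c).
    clear; nra.
  have G0 : 0 <= G by rewrite mulr_ge0.
  have H1 : g * G <= C * G by rewrite ler_wpM2r.
  have H2 : s ^+ 2 * V <= V by rewrite ler_piMl// exprn_ile1.
  by move: H1 H2; clear; lra.
set Br := (X in 4 * C * X).
have EB : Br = G + 2 * s * a * (b * v * p + c * v * q) + s * a ^+ 2 * v * (l1 + l2).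
  by rewrite /Br /G /P; ring.
have El : l1 + l2 = - (k ^+ 2 * v) by lra.
have S2 : G / 2 - 2 * V - k ^+ 2 * v ^+ 2 <= Br.
  rewrite EB El.
  have T1 : - (s * (a ^+ 2 * P)) / 2 - 2 * (s * V) <= 2 * s * a * (b * v * p + c * v * q).
    rewrite -subr_ge0.
    have -> : 2 * s * a * (b * v * p + c * v * q) - (- (s * (a ^+ 2 * P)) / 2 - 2 * (s * V)) =
      s * ((a * p + 2 * (b * v)) ^+ 2 + (a * q + 2 * (c * v)) ^+ 2) / 2 by rewrite /P /V; field.
    by rewrite divr_ge0// mulr_ge0// addr_ge0 ?sqr_ge0.
  have T2 : s * (a ^+ 2 * P) <= G by rewrite ler_wpM2r.
  have T3 : s * V <= V by rewrite ler_piMl.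
  have T4 : s * a ^+ 2 * (k ^+ 2 * v ^+ 2) <= k ^+ 2 * v ^+ 2.
    by rewrite ler_piMl// mulr_ile1 ?sqr_ge0// exprn_ile1.
  have -> : s * a ^+ 2 * v * (- (k ^+ 2 * v)) = - (s * a ^+ 2 * (k ^+ 2 * v ^+ 2)) by ring.
  by move: T1 T2 T3 T4; clear; lra.
have S3 : 4 * C * (G / 2 - 2 * V - k ^+ 2 * v ^+ 2) <= 4 * C * Br by rewrite ler_wpM2l// mulr_ge0//; lra.
have E3 : 4 * C * (G / 2 - 2 * V - k ^+ 2 * v ^+ 2) = 2 * C * G - 8 * C * V - 4 * C * k ^+ 2 * v ^+ 2 by field.
by move: S1 S3; rewrite E3 mulrDl; clear; lra.
Qed.

(* Test the equation with trunc_fun e v * th^2: as trunc_fun e vanishes near 0, this product has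
   compact support in W although v is only small, not zero, near the boundary. *)
Lemma truncation_energy W K v th (k C e : R) : open W -> compact K -> K `<=` W -> smoothU W v ->
  (forall x, W x -> d1 (d1 v) x + d2 (d2 v) x + k ^+ 2 * v x = 0) -> L2 W v ->
  smooth th -> (forall x, 0 <= th x <= 1) -> 0 < e ->
  (forall x, W x -> th x != 0 -> e <= `|v x| -> K x) ->
  L2 W (fun x => d1 th x * v x) -> L2 W (fun x => d2 th x * v x) -> 1 <= C ->
  (forall e t : R, 0 < e -> sstep (t ^+ 2 / e ^+ 2 - 1) <= trunc_der e t <= C) ->
  let w := (fun x => trunc_fun e (v x) * th x) \_ W in
  test_fun W w /\
  \int[leb2]_(x in W) ((d1 w x) ^+ 2) + \int[leb2]_(x in W) ((d2 w x) ^+ 2) <=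
  4 * C * k ^+ 2 * \int[leb2]_(x in W) ((v x) ^+ 2) + (8 * C + 2) *
   (\int[leb2]_(x in W) ((d1 th x * v x) ^+ 2) + \int[leb2]_(x in W) ((d2 th x * v x) ^+ 2)).
Proof.
move=> oW cK KW sv hv Lv sth th01 e0 HK Lt1 Lt2 C1 HC w.
have mW : measurable (W : set plane) by exact: open_plane_measurable.
have sthW : smoothU W th by move=> n; apply: (@CkU_sub _ W setT) => //; exact: (smoothP _).1.
have sT := smoothU_trunc e oW sv.
have out x : W x -> ~ K x -> trunc_fun e (v x) * th x = 0.
  move=> Wx nK; have [->|t0] := eqVneq (th x) 0; first by rewrite mulr0.
  by rewrite trunc_fun0 ?mul0r// ltNge; apply/negP => /(HK x Wx t0).
have tw : test_fun W w by apply: (test_patch oW cK KW) => //; exact: smoothU_mul.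
split => //.
(* The two components of the field whose divergence integrates to 0, extended by zero off [W]. *)
pose a1 := (fun x => trunc_fun e (v x) * (th x * (th x * d1 v x))) \_ W.
pose a2 := (fun x => trunc_fun e (v x) * (th x * (th x * d2 v x))) \_ W.
have sv1 := smoothU_d1 sv; have sv2 := smoothU_d2 sv.
have t1 : test_fun W a1.
  apply: (test_patch oW cK KW); first by do !apply: smoothU_mul => //.
  by move=> x Wx nK; rewrite mulrA out// mul0r.
have t2 : test_fun W a2.
  apply: (test_patch oW cK KW); first by do !apply: smoothU_mul => //.
  by move=> x Wx nK; rewrite mulrA out// mul0r.
have [J1 _] := test_d_int oW t1; have [_ J2] := test_d_int oW t2.
have patchd f x : W x -> d1 (f \_ W) x = d1 f x /\ d2 (f \_ W) x = d2 f x.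
  by move=> Wx; apply: (@d_eq _ W) => // y Wy; rewrite patchE mem_set.
have Dv1 x : W x -> is_derive x (1, 0) v (d1 v x) by exact: (CkU_is_d1 (sv 1%N)).
have Dv2 x : W x -> is_derive x (0, 1) v (d2 v x) by exact: (CkU_is_d2 (sv 1%N)).
have Dt1 x : W x -> is_derive x (1, 0) th (d1 th x) by exact: (CkU_is_d1 (sthW 1%N)).
have Dt2 x : W x -> is_derive x (0, 1) th (d2 th x) by exact: (CkU_is_d2 (sthW 1%N)).
have Dv11 x : W x -> is_derive x (1, 0) (d1 v) (d1 (d1 v) x) by exact: (CkU_is_d1 (sv1 1%N)).
have Dv22 x : W x -> is_derive x (0, 1) (d2 v) (d2 (d2 v) x) by exact: (CkU_is_d2 (sv2 1%N)).
have DT1 x : W x -> is_derive x (1, 0) (fun y => trunc_fun e (v y)) (d1 v x * trunc_der e (v x)).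
  by move=> Wx; apply: is_derive_comp_e1; [exact: is_derive_trunc|exact: Dv1].
have DT2 x : W x -> is_derive x (0, 1) (fun y => trunc_fun e (v y)) (d2 v x * trunc_der e (v x)).
  by move=> Wx; apply: is_derive_comp_e2; [exact: is_derive_trunc|exact: Dv2].
have w1 x : W x -> d1 w x = d1 v x * trunc_der e (v x) * th x + trunc_fun e (v x) * d1 th x.
  move=> Wx; rewrite (patchd _ _ Wx).1; apply: is_derive_d1.
  by apply: is_deriveM_fun; [exact: DT1|exact: Dt1].
have w2 x : W x -> d2 w x = d2 v x * trunc_der e (v x) * th x + trunc_fun e (v x) * d2 th x.
  move=> Wx; rewrite (patchd _ _ Wx).2; apply: is_derive_d2.
  by apply: is_deriveM_fun; [exact: DT2|exact: Dt2].
have a1E x : W x -> d1 a1 x = d1 v x * trunc_der e (v x) * (th x * (th x * d1 v x)) +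
    trunc_fun e (v x) * (d1 th x * (th x * d1 v x) + th x * (d1 th x * d1 v x + th x * d1 (d1 v) x)).
  move=> Wx; rewrite (patchd _ _ Wx).1; apply: is_derive_d1.
  apply: is_deriveM_fun; first exact: DT1.
  apply: is_deriveM_fun; first exact: Dt1.
  by apply: is_deriveM_fun; [exact: Dt1|exact: Dv11].
have a2E x : W x -> d2 a2 x = d2 v x * trunc_der e (v x) * (th x * (th x * d2 v x)) +
    trunc_fun e (v x) * (d2 th x * (th x * d2 v x) + th x * (d2 th x * d2 v x + th x * d2 (d2 v) x)).
  move=> Wx; rewrite (patchd _ _ Wx).2; apply: is_derive_d2.
  apply: is_deriveM_fun; first exact: DT2.
  apply: is_deriveM_fun; first exact: Dt2.
  by apply: is_deriveM_fun; [exact: Dt2|exact: Dv22].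
have pt x : W x -> (d1 w x) ^+ 2 + (d2 w x) ^+ 2 <= 4 * C * (d1 a1 x + d2 a2 x) +
    (4 * C * k ^+ 2 * (v x) ^+ 2 + (8 * C + 2) * ((d1 th x * v x) ^+ 2 + (d2 th x * v x) ^+ 2)).
  move=> Wx; rewrite w1// w2// a1E// a2E// /trunc_fun.
  by apply: energy_pointwise => //; [rewrite sstep_ge0 sstep_le1|exact: HC|exact: hv].
clearbody a1 a2 w.
pose I (f : R * R -> R) := leb2.-integrable W (EFin \o f : plane -> \bar R).
have Isq (f : R * R -> R) : L2 W f -> I (fun x => f x ^+ 2) by exact: L2_sqr_integrable.
have ID (f g : R * R -> R) : I f -> I g -> I (fun x => f x + g x) by move=> If Ig; exact: (integrableD mW If Ig).
have IZ (c : R) (f : R * R -> R) : I f -> I (fun x => c * f x) by move=> If; exact: (integrableZl mW c If).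
have It (f : R * R -> R) : test_fun W f -> I f by move=> tf; exact: (test_integrable oW tf).1.
have [tw1 tw2] := test_d tw.
have Iw1 : I (fun x => d1 w x ^+ 2) by apply: It; apply: test_mul => //; case: tw1.
have Iw2 : I (fun x => d2 w x ^+ 2) by apply: It; apply: test_mul => //; case: tw2.
have Ia1 : I (d1 a1) by apply: It; case: (test_d t1).
have Ia2 : I (d2 a2) by apply: It; case: (test_d t2).
have Iv := Isq _ Lv; have It1 := Isq _ Lt1; have It2 := Isq _ Lt2.
have H1 := ID _ _ Ia1 Ia2; have H2 := ID _ _ It1 It2.
have H3 := IZ (4 * C) _ H1; have H4 := IZ (4 * C * k ^+ 2) _ Iv; have H5 := IZ (8 * C + 2) _ H2.
have H6 := ID _ _ H4 H5.
have := le_Rintegral mW (ID _ _ Iw1 Iw2) (ID _ _ H3 H6) pt.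
rewrite (RintegralD mW Iw1 Iw2) (RintegralD mW H3 H6) (RintegralD mW H4 H5).
rewrite (RintegralZl _ mW H1) (RintegralZl _ mW Iv) (RintegralZl _ mW H2).
have E1 := RintegralD mW Ia1 Ia2; rewrite J1 J2 addr0 in E1.
have E2 := RintegralD mW It1 It2.
by rewrite E1 E2 mulr0 add0r => H; exact: H.
Qed.

End truncation_energy.

Section kernel.
Context {R : realType}.

(** A matrix with one more row than columns has a nonzero left kernel. *)
Lemma nontrivial_combination (F : fieldType) (I : finType) (a : 'I_#|I|.+1 -> I -> F) :
  exists2 c : 'I_#|I|.+1 -> F, (exists j, c j != 0) & forall p, \sum_j c j * a j p = 0.
Proof.
pose M : 'M[F]_(#|I|.+1, #|I|) := \matrix_(i, j) a i (enum_val j).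
have : kermx M != 0 by rewrite -mxrank_eq0 mxrank_ker -lt0n subn_gt0 ltnS rank_leq_col.
case/matrix0Pn => i [j ij].
exists (fun j => kermx M i j); first by exists j.
move=> p; have H : (kermx M *m M) i (enum_rank p) = 0 by rewrite mulmx_ker mxE.
by apply: etrans H; rewrite [RHS]mxE; apply: eq_bigr => l _; rewrite [M l _]mxE enum_rankK.
Qed.

End kernel.

(** * The Poincare inequality on a grid *)

Section tiling.
Context {R : realType}.
Local Notation plane := (measurableTypeR R * measurableTypeR R)%type.
Implicit Types (W : set (R * R)) (w : R * R -> R) (L tau : R) (n : nat).

Definition tile_cell n L (p : 'I_n * 'I_n) : set (R * R) :=
  tile (- L + p.1%:R * (2 * L / n%:R)) (- L + p.2%:R * (2 * L / n%:R)) (2 * L / n%:R).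

Lemma grid_index n L (t : R) : 0 < L -> (0 < n)%N -> - L <= t < L ->
  exists i : 'I_n, - L + i%:R * (2 * L / n%:R) <= t < - L + i%:R * (2 * L / n%:R) + 2 * L / n%:R.
Proof.
move=> L0 n0 /andP[t1 t2]; have nR : 0 < n%:R :> R by rewrite ltr0n.
have tau0 : 0 < 2 * L / n%:R by rewrite divr_gt0// mulr_gt0.
set tau := 2 * L / n%:R in tau0 *; have q0 : 0 <= (t + L) / tau by rewrite divr_ge0 ?(ltW tau0)//; lra.
have ntau : n%:R * tau = 2 * L by rewrite /tau mulrC divfK// gt_eqF.
have /andP[] := truncn_itv q0; rewrite ler_pdivlMr// ltr_pdivrMr//; set i := Num.truncn _ => i1 i2.
have ilt : (i < n)%N.
  rewrite -(ltr_nat R) -(ltr_pM2r tau0) ntau; lra.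
by exists (Ordinal ilt) => /=; move: i2; rewrite -natr1 mulrDl mul1r => i2; apply/andP; split; lra.
Qed.

Lemma grid_index_uniq n L (t : R) (i j : 'I_n) : 0 < L ->
  - L + i%:R * (2 * L / n%:R) <= t < - L + i%:R * (2 * L / n%:R) + 2 * L / n%:R ->
  - L + j%:R * (2 * L / n%:R) <= t < - L + j%:R * (2 * L / n%:R) + 2 * L / n%:R -> i = j.
Proof.
move=> L0; have n0 : (0 < n)%N by case: i => i; case: (n).
have nR : 0 < n%:R :> R by rewrite ltr0n.
have tau0 : 0 < 2 * L / n%:R by rewrite divr_gt0// mulr_gt0.
set tau := 2 * L / n%:R in tau0 * => /andP[a1 a2] /andP[b1 b2].
have H (a b : nat) : a%:R * tau < b%:R * tau + tau -> (a <= b)%N.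
  by move=> ab; rewrite -ltnS -(ltr_nat R) -(ltr_pM2r tau0) -natr1 mulrDl mul1r.
by apply/val_inj/eqP; rewrite eqn_leq; apply/andP; split; apply: H; lra.
Qed.

Lemma measurable_grid n L p : measurable (@tile_cell n L p : set plane).
Proof. exact: measurable_tile. Qed.

Lemma grid_trivI n L (s : seq ('I_n * 'I_n)) : 0 < L -> trivIset [set` s] (@tile_cell n L).
Proof.
move=> L0 p q _ _ [x [[/=]]]; rewrite !in_itv/= => h1 h2 [/=]; rewrite !in_itv/= => h3 h4.
case: p q h1 h2 h3 h4 => [p1 p2] [q1 q2] /= h1 h2 h3 h4.
by rewrite (grid_index_uniq L0 h1 h3) (grid_index_uniq L0 h2 h4).
Qed.

Lemma grid_poincare_ereal n L w : 0 < L -> (0 < n)%N -> Ck 1 w ->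
  (\int[leb2]_(x in \big[setU/set0]_(p <- index_enum ('I_n * 'I_n)%type) tile_cell L p) ((w x) ^+ 2)%:E <=
  (4 / (2 * L / n%:R) ^+ 2 * \sum_(p : 'I_n * 'I_n) (\int[leb2]_(x in tile_cell L p) w x)%R ^+ 2)%R%:E +
  (4 * (2 * L / n%:R) ^+ 2)%R%:E *
    \int[leb2]_(x in \big[setU/set0]_(p <- index_enum ('I_n * 'I_n)%type) tile_cell L p) ((d1 w x) ^+ 2 + (d2 w x) ^+ 2)%:E)%E.
Proof.
move=> L0 n0 cw; have w1 := (CkU_setT 1 w).1 cw.
have tau0 : 0 < 2 * L / n%:R by rewrite divr_gt0 ?mulr_gt0 ?ltr0n.
have c0 : continuous w by move=> x; exact: (CkU_cont w1).
have c1 : continuous (d1 w) by move=> x; exact: (CkU_cont (CkU_d1 w1)).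
have c2 : continuous (d2 w) by move=> x; exact: (CkU_cont (CkU_d2 w1)).
have m0 (D : set (R * R)) : measurable_fun (D : set plane) (fun x : plane => ((w x) ^+ 2)%:E).
  by apply: measurable_sqr; apply: measurable_funTS; exact: continuous_plane_measurable.
have m1 (D : set (R * R)) : measurable_fun (D : set plane) (fun x : plane => ((d1 w x) ^+ 2 + (d2 w x) ^+ 2)%:E).
  apply/measurable_EFinP; apply: measurable_funD; apply: measurable_funX; apply: measurable_funTS;
    exact: continuous_plane_measurable.
have g0 (x : R * R) : (0 <= ((d1 w x) ^+ 2 + (d2 w x) ^+ 2)%:E)%E by rewrite lee_fin addr_ge0 ?sqr_ge0.
have tI := @grid_trivI n L (index_enum ('I_n * 'I_n)%type) L0.
have uI := index_enum_uniq ('I_n * 'I_n)%type.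
rewrite (ge0_integral_bigsetU _ (@measurable_grid n L) uI tI) ?(ge0_integral_bigsetU _ (@measurable_grid n L) uI tI)//; last first.
  by move=> x _; rewrite lee_fin sqr_ge0.
rewrite ge0_sume_distrr; last by move=> p _; apply: integral_ge0 => x _; exact: g0.
rewrite mulr_sumr -sumEFin -big_split/=; apply: lee_sum => p _.
exact: tile_poincare.
Qed.

(** The function vanishes off a compact subset of [W], so integrals over [W] and over the grid
    agree; the cells need no relation with the boundary of [W]. *)
Lemma grid_poincare W n L w : open W -> W `<=` [set x | - L <= x.1 < L /\ - L <= x.2 < L] ->
  0 < L -> (0 < n)%N -> test_fun W w ->
  \int[leb2]_(x in W) ((w x) ^+ 2) <=
  4 / (2 * L / n%:R) ^+ 2 * (\sum_(p : 'I_n * 'I_n) (\int[leb2]_(x in W) (w x * \1_(tile_cell L p) x)) ^+ 2)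
  + 4 * (2 * L / n%:R) ^+ 2 * (\int[leb2]_(x in W) ((d1 w x) ^+ 2) + \int[leb2]_(x in W) ((d2 w x) ^+ 2)).
Proof.
move=> oW WL L0 n0 tw; have [sw [K [cK KW w0]]] := tw; have cw : Ck 1 w by exact: sw.
have mW : measurable (W : set plane) by exact: open_plane_measurable.
set D := \big[setU/set0]_(p <- index_enum ('I_n * 'I_n)%type) tile_cell L p.
have mD : measurable (D : set plane) by apply: bigsetU_measurable => p _; exact: measurable_grid.
have WD : W `<=` D.
  move=> x /WL[x1 x2]; have [i Hi] := grid_index L0 n0 x1; have [j Hj] := grid_index L0 n0 x2.
  rewrite /D -bigcup_seq; exists (i, j); first by rewrite /= mem_index_enum.
  by split; rewrite /= in_itv.
have [t1 t2] := test_d tw; have [s1 _] := t1; have [s2 _] := t2.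
have msq (f : R * R -> R) (E : set (R * R)) : smooth f -> measurable_fun (E : set plane) (fun x : plane => ((f x) ^+ 2)%:E).
  by move=> sf; apply: measurable_sqr; apply: measurable_funTS; apply: continuous_plane_measurable; exact: smooth_continuous.
have fin (f : R * R -> R) : test_fun W f ->
    (\int[leb2]_(x in W) ((f x) ^+ 2)%:E = (\int[leb2]_(x in W) ((f x) ^+ 2))%:E)%E.
  move=> tf; have tf2 : test_fun W (fun x => f x ^+ 2) by apply: test_mul => //; case: tf.
  by rewrite /Rintegral fineK//; apply: integrable_fin_num => //; exact: (test_integrable oW tf2).1.
have L2t (f : R * R -> R) : test_fun W f -> L2 W f.
  move=> tf; split; first by apply: measurable_funTS; apply: continuous_plane_measurable; apply: smooth_continuous; case: tf.
  by rewrite fin// ltry.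
have E := grid_poincare_ereal L0 n0 cw.
rewrite -lee_fin EFinD -fin//; apply: le_trans (le_trans _ E) _.
  by apply: ge0_subset_integral => //; [exact: msq|move=> x _; rewrite lee_fin sqr_ge0].
apply: leeD.
  rewrite le_eqVlt; apply/orP; left; apply/eqP; congr (_%:E); congr (_ * _).
  apply: eq_bigr => p _; congr (_ ^+ 2).
  rewrite Rintegral_mkcond [RHS]Rintegral_mkcond; apply: eq_Rintegral => x _; rewrite !patchE indicE.
  case: ifPn => xp; case: ifPn => xW //; rewrite ?mulr1 ?mulr0//.
  by apply: w0 => /KW/mem_set; rewrite (negbTE xW).
rewrite [leRHS]EFinM; apply: lee_wpmul2l; first by rewrite lee_fin mulr_ge0// sqr_ge0.
rewrite -(L2_sqr_add_fin mW (L2t _ t1) (L2t _ t2)).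
rewrite integral_mkcond [leRHS]integral_mkcond; apply: ge0_le_integral => //.
- by move=> x _; rewrite patchE; case: ifP => // _; rewrite lee_fin addr_ge0 ?sqr_ge0.
- apply/(measurable_restrictT _ _).1 => //.
  by apply/measurable_EFinP; apply: measurable_funD; apply: measurable_funX; apply: measurable_funTS;
    apply: continuous_plane_measurable; exact: smooth_continuous.
- apply/(measurable_restrictT _ _).1 => //.
  by apply/measurable_EFinP; apply: measurable_funD; apply: measurable_funX; apply: measurable_funTS;
    apply: continuous_plane_measurable; exact: smooth_continuous.
- move=> x _; rewrite !patchE; case: ifPn => xD; case: ifPn => xW //.
    have nK : ~ K x by move=> /KW/mem_set; rewrite (negbTE xW).
    have [-> ->] := test_out sw (compact_closed_plane cK) w0 nK.
    by rewrite expr0n addr0.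
  by move/set_mem/WD/mem_set : xW; rewrite (negbTE xD).
Qed.

End tiling.

Section finite_multiplicity.
Context {R : realType}.
Local Notation plane := (measurableTypeR R * measurableTypeR R)%type.
Implicit Types (W K : set (R * R)) (u v : R * R -> R) (th : nat -> R * R -> R).

Definition cutoffs W th := [/\ forall m, smooth (th m), forall m x, 0 <= th m x <= 1 &
  forall x, W x -> \forall m \near \oo, th m x = 1].

(* Solutions vanishing on the boundary in a weak sense: the part of the boundary where they
   are not known to be small is masked by the cutoffs. *)
Definition vanishing_solution W (k : R) th v :=
  [/\ smoothU W v, forall x, W x -> d1 (d1 v) x + d2 (d2 v) x + k ^+ 2 * v x = 0, L2 W v,
    forall m (e : R), 0 < e -> exists K, [/\ compact K, K `<=` W &
      forall x, W x -> th m x != 0 -> e <= `|v x| -> K x] &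
    L2_cvg W (fun m x => d1 (th m) x * v x) (fun=> 0) /\
    L2_cvg W (fun m x => d2 (th m) x * v x) (fun=> 0)].

Lemma L2_bounded_mul W (f v : R * R -> R) : open W -> bounded_set W -> continuous f -> L2 W v -> L2 W (fun x => f x * v x).
Proof.
move=> oW bW cf Lv; have mW : measurable (W : set plane) by exact: open_plane_measurable.
have [M M0 WM] := bounded_cbox bW.
have [B B0 HB] := compact_bounded_fun (@compact_cbox R 0 M) (fun x _ => cf x).
apply: (@L2_bmul _ _ mW v f B) => //; last by move=> x /WM/HB.
by apply: measurable_funTS; exact: continuous_plane_measurable.
Qed.

Lemma d_lin W (c : R) u v x : open W -> smoothU W u -> smoothU W v -> W x ->
  d1 (fun y => c * u y + v y) x = c * d1 u x + d1 v x /\ d2 (fun y => c * u y + v y) x = c * d2 u x + d2 v x.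
Proof.
move=> oW su sv Wx; split.
- apply: is_derive_d1; have -> : c * d1 u x + d1 v x = (0 * u x + c * d1 u x) + d1 v x by rewrite mul0r add0r.
  apply: is_deriveD_fun; last exact: (CkU_is_d1 (sv 1%N)).
  by apply: is_deriveM_fun; exact: (CkU_is_d1 (su 1%N)).
- apply: is_derive_d2; have -> : c * d2 u x + d2 v x = (0 * u x + c * d2 u x) + d2 v x by rewrite mul0r add0r.
  apply: is_deriveD_fun; last exact: (CkU_is_d2 (sv 1%N)).
  by apply: is_deriveM_fun; exact: (CkU_is_d2 (su 1%N)).
Qed.

Definition helmholtz_sol U (k : R) f :=
  smoothU U f /\ forall x, U x -> d1 (d1 f) x + d2 (d2 f) x + k ^+ 2 * f x = 0.

Lemma helmholtz_sol_lin U (k c : R) u v : open U -> helmholtz_sol U k u -> helmholtz_sol U k v ->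
  helmholtz_sol U k (fun x => c * u x + v x).
Proof.
move=> oW [su hu] [sv hv]; split.
  by apply: smoothU_add => //; apply: smoothU_mul => //; exact: smoothU_cst.
move=> x Wx; have D1 y : U y -> _ := fun Wy => (d_lin c oW su sv Wy).1.
have D2 y : U y -> _ := fun Wy => (d_lin c oW su sv Wy).2.
rewrite (d_eq oW D1 Wx).1 (d_eq oW D2 Wx).2.
rewrite (d_lin c oW (smoothU_d1 su) (smoothU_d1 sv) Wx).1 (d_lin c oW (smoothU_d2 su) (smoothU_d2 sv) Wx).2.
have := hu x Wx; have := hv x Wx; set p := d1 (d1 u) x; set q := d2 (d2 u) x.
set r := d1 (d1 v) x; set s := d2 (d2 v) x; set a := u x; set b := v x; clearbody p q r s a b; clear.
move=> H1 H2; have -> : c * p + r + (c * q + s) + k ^+ 2 * (c * a + b) =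
  c * (p + q + k ^+ 2 * a) + (r + s + k ^+ 2 * b) by ring.
by rewrite H1 H2 mulr0 addr0.
Qed.

(** Where the combination is at least [e] in absolute value, [|v| >= e / 2] or
    [|u| >= e / (2 (|c| + 1))]; the union of the two compact sets serves. *)
Lemma vanishing_lin W (k c : R) th u v : open W -> bounded_set W -> cutoffs W th ->
  vanishing_solution W k th u -> vanishing_solution W k th v ->
  vanishing_solution W k th (fun x => c * u x + v x).
Proof.
move=> oW bW [sth _ _] [su hu Lu Ku [cu1 cu2]] [sv hv Lv Kv [cv1 cv2]].
have mW : measurable (W : set plane) by exact: open_plane_measurable.
have ct1 m : continuous (d1 (th m)) by apply: smooth_continuous; exact: smooth_d1.
have ct2 m : continuous (d2 (th m)) by apply: smooth_continuous; exact: smooth_d2.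
have lin (b : nat -> R * R -> R) : (forall m, continuous (b m)) ->
    L2_cvg W (fun m x => b m x * u x) (fun=> 0) -> L2_cvg W (fun m x => b m x * v x) (fun=> 0) ->
    L2_cvg W (fun m x => b m x * (c * u x + v x)) (fun=> 0).
  move=> cb Hu Hv.
  have -> : (fun m x => b m x * (c * u x + v x)) = (fun m x => c * (b m x * u x) + b m x * v x).
    by apply/funext => m; apply/funext => x; ring.
  have -> : (fun=> 0) = (fun x : R * R => c * 0 + 0 : R) by apply/funext => x; rewrite mulr0 addr0.
  have L0 : L2 W (fun=> 0) by apply: L2_bounded_domain => //; exact: cst_continuous.
  have Lm (f : R * R -> R) m : L2 W f -> L2 W (fun x => b m x * f x) by exact: L2_bounded_mul.
  apply: L2_cvg_add => //.
  - by move=> m; apply: L2_scale => //; exact: Lm.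
  - by move=> m; exact: Lm.
  - exact: L2_scale.
  - by apply: (@L2_cvg_bmul _ W _ _ (fun=> c) `|c|) => // m; exact: Lm.
split; last by split; exact: lin.
- by apply: smoothU_add => //; apply: smoothU_mul => //; exact: smoothU_cst.
- by have [_] := helmholtz_sol_lin c oW (conj su hu) (conj sv hv).
- by apply: L2_add => //; exact: L2_scale.
- move=> m e e0; have c0 : 0 < `|c| + 1 by have := normr_ge0 c; lra.
  have e1 : 0 < e / (2 * (`|c| + 1)) by rewrite divr_gt0// mulr_gt0.
  have e2 : 0 < e / 2 by rewrite divr_gt0.
  have [K1 [cK1 K1W H1]] := Ku m _ e1; have [K2 [cK2 K2W H2]] := Kv m _ e2.
  exists (K1 `|` K2); split; [exact: compactU|by move=> x [/K1W|/K2W]|].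
  move=> x Wx tx H; have [G|G] := leP (e / 2) `|v x|; first by right; exact: H2.
  left; apply: H1 => //; rewrite ler_pdivrMr ?mulr_gt0//.
  have := ler_normD (c * u x) (v x); rewrite normrM => T.
  by have := normr_ge0 (u x); have := normr_ge0 c; nra.
Qed.

Lemma vanishing0 W k th : open W -> bounded_set W -> cutoffs W th -> vanishing_solution W k th (fun=> 0).
Proof.
move=> oW bW [sth _ _]; split.
- exact: smoothU_cst.
- move=> x Wx; have E1 : d1 (fun=> 0 : R) = (fun _ : R * R => 0 : R) by apply/funext => y; exact: (d_cst 0 y).1.
  have E2 : d2 (fun=> 0 : R) = (fun _ : R * R => 0 : R) by apply/funext => y; exact: (d_cst 0 y).2.
  by rewrite E1 E2 E1 E2 !mulr0 !addr0.
- by apply: L2_bounded_domain => //; exact: cst_continuous.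
- move=> m e e0; exists set0; split => //; first exact: compact0.
  by move=> x _ _; rewrite normr0 => /(lt_le_trans e0); rewrite ltxx.
- by split; apply: cvg_near_cst; apply: nearW => m; apply: integral0_eq => x _; rewrite mulr0 subr0 expr0n.
Qed.

Lemma vanishing_sum W k th (I : Type) (s : seq I) (c : I -> R) (v : I -> R * R -> R) :
  open W -> bounded_set W -> cutoffs W th -> (forall i, vanishing_solution W k th (v i)) ->
  vanishing_solution W k th (fun x => \sum_(i <- s) c i * v i x).
Proof.
move=> oW bW ct hv; elim: s => [|i s IH].
  by under eq_fun do rewrite big_nil; exact: vanishing0.
by under eq_fun do rewrite big_cons; exact: vanishing_lin.
Qed.

Lemma L2_zero_continuous W v : open W -> L2 W v -> (forall x, W x -> {for x, continuous v}) ->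
  \int[leb2]_(x in W) ((v x) ^+ 2) <= 0 -> forall x, W x -> v x = 0.
Proof.
move=> oW Lv cv X0 x Wx; apply: contrapT => /eqP vx.
have mW : measurable (W : set plane) by exact: open_plane_measurable.
have m0 : 0 < `|v x| / 2 by rewrite divr_gt0// normr_gt0.
have N1 : nbhs x [set y | `|v x - v y| < `|v x| / 2] by have /cvgrPdist_lt := cv x Wx; apply.
have N2 : nbhs x W by exact: near_open.
have N12 : nbhs x (W `&` [set y | `|v x - v y| < `|v x| / 2]) by exact: filterI.
move/nbhs_boxP : N12 => [r r0 Hr].
have r2 : 0 < r / 2 by rewrite divr_gt0.
have cb : cbox x (r / 2) `<=` box x r by move=> y [y1 y2]; split; lra.
have mC : measurable (cbox x (r / 2) : set plane) by apply: closed_plane_measurable; exact: cbox_closed.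
have : (((`|v x| / 2) ^+ 2 * (2 * (r / 2)) ^+ 2)%:E <= \int[leb2]_(y in W) ((v y) ^+ 2)%:E)%E.
  apply: (@le_trans _ _ (\int[leb2]_(y in cbox x (r / 2)) ((v y) ^+ 2)%:E)%E); last first.
    apply: ge0_subset_integral => //; first by apply: measurable_sqr; case: Lv.
      by move=> y _; rewrite lee_fin sqr_ge0.
    by move=> y /cb/Hr[].
  rewrite EFinM -(leb2_cboxE x r2) -integral_cst//; apply: ge0_le_integral => //.
  - by move=> y _; rewrite lee_fin sqr_ge0.
  - by apply: measurable_sqr; apply: measurable_funS (Lv.1) => //; move=> y /cb/Hr[].
  - move=> y /cb/Hr[_ /= H]; rewrite lee_fin -[leRHS]real_normK ?num_real// lerXn2r ?nnegrE ?(ltW m0)//.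
    by have := ler_normD (v y) (v x - v y); rewrite addrC subrK; lra.
rewrite L2_sqr_fin// lee_fin => /le_trans/(_ X0); rewrite leNgt => /negP; apply.
by rewrite mulr_gt0 ?exprn_gt0// mulr_gt0.
Qed.

Lemma L2_cvg_real W (a_ : nat -> R * R -> R) a : L2_cvg W a_ a ->
  (fun n => \int[leb2]_(x in W) ((a_ n x - a x) ^+ 2)) @ \oo --> (0 : R).
Proof. by move=> H; exact: fine_cvg H. Qed.

Lemma cvg_sum_real (I : Type) (s : seq I) (f : I -> nat -> R) (l : I -> R) :
  (forall i, f i @ \oo --> l i) -> (fun m => \sum_(i <- s) f i m) @ \oo --> \sum_(i <- s) l i.
Proof.
move=> H; elim: s => [|i s IH].
  by under eq_fun do rewrite big_nil; rewrite big_nil; exact: cvg_cst.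
by under eq_fun do rewrite big_cons; rewrite big_cons; apply: cvgD.
Qed.

Lemma vanishing_eq0 W (k L C : R) n th v : open W -> bounded_set W -> cutoffs W th ->
  W `<=` [set x | - L <= x.1 < L /\ - L <= x.2 < L] -> 0 < L -> (0 < n)%N -> 1 <= C ->
  (forall e t : R, 0 < e -> sstep (t ^+ 2 / e ^+ 2 - 1) <= trunc_der e t <= C) ->
  64 * C * k ^+ 2 * (2 * L / n%:R) ^+ 2 <= 1 ->
  vanishing_solution W k th v -> (forall p : 'I_n * 'I_n, \int[leb2]_(x in W) (v x * \1_(tile_cell L p) x) = 0) ->
  forall x, W x -> v x = 0.
Proof.
move=> oW bW ct WL L0 n0 C1 HC small [sv hv Lv Kv [cv1 cv2]] av; have [sth th01 th1] := ct.
have mW : measurable (W : set plane) by exact: open_plane_measurable.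
apply: L2_zero_continuous => //; first by move=> x Wx; exact: (CkU_cont (sv 0%N)).
set X := \int[leb2]_(x in W) ((v x) ^+ 2).
have e0 m : 0 < (m.+1%:R : R)^-1 by rewrite invr_gt0.
have ct1 m : continuous (d1 (th m)) by apply: smooth_continuous; exact: smooth_d1.
have ct2 m : continuous (d2 (th m)) by apply: smooth_continuous; exact: smooth_d2.
have L1 m : L2 W (fun x => d1 (th m) x * v x) by exact: L2_bounded_mul.
have L2' m : L2 W (fun x => d2 (th m) x * v x) by exact: L2_bounded_mul.
pose w m := (fun x => trunc_fun (m.+1%:R^-1) (v x) * th m x) \_ W.
pose Y m := \int[leb2]_(x in W) ((d1 (th m) x * v x - 0) ^+ 2) + \int[leb2]_(x in W) ((d2 (th m) x * v x - 0) ^+ 2).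
have en m : test_fun W (w m) /\ \int[leb2]_(x in W) ((d1 (w m) x) ^+ 2) + \int[leb2]_(x in W) ((d2 (w m) x) ^+ 2) <=
    4 * C * k ^+ 2 * X + (8 * C + 2) * Y m.
  have [K [cK KW HK]] := Kv m _ (e0 m).
  have := @truncation_energy R W K v (th m) k C (m.+1%:R^-1) oW cK KW sv hv Lv (sth m) (th01 m) (e0 m) HK (L1 m) (L2' m) C1 HC.
  by rewrite /Y; under [X in _ -> _ /\ _ <= _ + _ * (X + _)]eq_Rintegral do rewrite subr0;
    under [X in _ -> _ /\ _ <= _ + _ * (_ + X)]eq_Rintegral do rewrite subr0.
have tw m : test_fun W (w m) by case: (en m).
have Lw m : L2 W (w m) by apply: L2_bounded_domain => //; apply: smooth_continuous; case: (tw m).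
have wE m x : W x -> w m x = sstep (v x ^+ 2 / m.+1%:R^-1 ^+ 2 - 1) * th m x * v x.
  by move=> Wx; rewrite /w patchE mem_set// /trunc_fun; ring.
have wv : L2_cvg W w v.
  have mm m : measurable_fun (W : set plane) (fun x : plane => ((w m x - v x) ^+ 2)%:E).
    by apply: measurable_sqr; apply: measurable_funB; [case: (Lw m)|case: Lv].
  have := @dominated_convergence _ _ _ (@leb2 R) W mW
    (fun m (x : plane) => ((w m x - v x) ^+ 2)%:E) (fun=> 0%E) (fun x => ((v x) ^+ 2)%:E) mm.
  case=> //.
  - apply: aeW => x Wx; apply: cvg_near_cst; have [vx|vx] := eqVneq (v x) 0.
      by apply: nearW => m; rewrite wE// vx mulr0 subrr expr0n.
    have v0 : 0 < `|v x| / 2 by rewrite divr_gt0// normr_gt0.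
    apply: filterS2 (th1 x Wx) (mesh_small v0) => m tE me; rewrite wE// tE sstep1.
      by rewrite !mul1r subrr expr0n.
    rewrite lerBrDr ler_pdivlMr ?exprn_gt0// -[leRHS]real_normK ?num_real//.
    have := e0 m; move: me v0; set e := m.+1%:R^-1; set q := `|v x|; clearbody e q; clear; nra.
  - exact: L2_sqr_integrable.
  - apply: aeW => x m Wx; rewrite /= lee_fin ger0_norm ?sqr_ge0// wE//.
    set s := sstep _; have s0 : 0 <= s by exact: sstep_ge0.
    have s1 : s <= 1 by exact: sstep_le1.
    have /andP[t0 t1] := th01 m x.
    have -> : s * th m x * v x - v x = (s * th m x - 1) * v x by ring.
    rewrite exprMn ler_piMl ?sqr_ge0//.
    have : 0 <= s * th m x <= 1 by rewrite mulr_ge0//= mulr_ile1.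
    set q := s * th m x; clearbody q; clear; nra.
  - by move=> _ _; rewrite integral0.
pose Z m := \int[leb2]_(x in W) ((w m x - v x) ^+ 2).
pose S m := \sum_(p : 'I_n * 'I_n) (\int[leb2]_(x in W) (w m x * \1_(tile_cell L p) x)) ^+ 2.
pose tau := 2 * L / n%:R.
(* [Z] is the truncation error, [S] the cell means and [Y] the cutoff gradients; all three tend to
   0, the means because those of [v] vanish. *)
have main m : X <= 2 * Z m + 2 * (4 / tau ^+ 2 * S m + 4 * tau ^+ 2 * (4 * C * k ^+ 2 * X + (8 * C + 2) * Y m)).
  have H1 : X <= 2 * Z m + 2 * \int[leb2]_(x in W) ((w m x) ^+ 2).
    have Lz := L2_sub mW (Lw m) Lv.
    by rewrite -lee_fin EFinD !EFinM -!L2_sqr_fin//; apply: int_sqr_le => //; [case: Lv|case: (Lw m)].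
  have H2 := grid_poincare oW WL L0 n0 (tw m).
  have t4 : 0 <= 4 * tau ^+ 2 by rewrite mulr_ge0// sqr_ge0.
  have H3 := ler_wpM2l t4 (en m).2.
  rewrite -/tau -/(S m) in H2.
  have ar (a b c d e f : R) : a <= 2 * b + 2 * c -> c <= d + e -> e <= f -> a <= 2 * b + 2 * (d + f) by clear; lra.
  exact: ar H1 H2 H3.
have Y0 : Y @ \oo --> (0 : R).
  have E0 : (0 : R) + 0 = 0 by rewrite addr0.
  by rewrite -[X in _ --> X]E0; exact: (cvgD (L2_cvg_real cv1) (L2_cvg_real cv2)).
have Z0 : Z @ \oo --> (0 : R) by exact: L2_cvg_real.
have Lg p : L2 W (\1_(tile_cell L p) : R * R -> R).
  have [M M0 WM] := bounded_cbox bW.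
  apply: (@L2_bounded _ _ mW _ 1); first exact: leb2_bounded_set WM.
    by apply: measurable_funTS; apply: measurable_indic; exact: measurable_grid.
  by move=> x _; rewrite indicE; case: (_ \in _); rewrite ?normr1 ?normr0.
have S0 : S @ \oo --> (0 : R).
  have -> : 0 = \sum_(p : 'I_n * 'I_n) (0 : R) by rewrite big1.
  apply: cvg_sum_real => p; rewrite -[0 in X in _ --> X](mul0r 0).
  have G : (fun m => \int[leb2]_(x in W) (w m x * \1_(tile_cell L p) x)) @ \oo --> (0 : R).
    by rewrite -(av p); apply: cvg_L2_inner.
  exact: (cvgM G G).
have lim : (fun m => 2 * Z m + 2 * (4 / tau ^+ 2 * S m + 4 * tau ^+ 2 * (4 * C * k ^+ 2 * X + (8 * C + 2) * Y m))) @ \oo -->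
    2 * 0 + 2 * (4 / tau ^+ 2 * 0 + 4 * tau ^+ 2 * (4 * C * k ^+ 2 * X + (8 * C + 2) * 0)).
  apply: cvgD; first exact: cvgMr Z0.
  apply: cvgMr; apply: cvgD; first exact: cvgMr S0.
  apply: cvgMr; apply: cvgD; first exact: cvg_cst.
  exact: cvgMr Y0.
have X0 : 0 <= X by apply: Rintegral_ge0 => x _; exact: sqr_ge0.
have near_main : \forall m \near \oo, X <= 2 * Z m + 2 * (4 / tau ^+ 2 * S m + 4 * tau ^+ 2 * (4 * C * k ^+ 2 * X + (8 * C + 2) * Y m)).
  by apply: nearW => m; exact: main.
have : X <= 2 * 0 + 2 * (4 / tau ^+ 2 * 0 + 4 * tau ^+ 2 * (4 * C * k ^+ 2 * X + (8 * C + 2) * 0)).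
  exact: (ler_cvg_to (cvg_cst X) lim near_main).
rewrite !mulr0 !add0r !addr0.
have -> : 2 * (4 * tau ^+ 2 * (4 * C * k ^+ 2 * X)) = (64 * C * k ^+ 2 * tau ^+ 2) * X / 2 by field.
move: small; rewrite -/tau; set q := 64 * C * k ^+ 2 * tau ^+ 2; clearbody q; move: X0; clearbody X; clear.
by move=> X0 q1 H; have := ler_wpM2r X0 q1; lra.
Qed.

(* With more solutions than cells, some combination has zero mean on every cell; on a fine grid the
   Poincare inequality then contradicts the energy estimate, unless the combination vanishes. *)
Lemma finite_multiplicity W (k : R) th : open W -> bounded_set W -> cutoffs W th ->
  exists N : nat, forall v : 'I_N -> R * R -> R, (forall i, vanishing_solution W k th (v i)) ->
  exists2 c : 'I_N -> R, exists j, c j != 0 & forall x, W x -> \sum_j c j * v j x = 0.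
Proof.
move=> oW bW ct; have [M M0 WM] := bounded_cbox bW; have [C C1 HC] := @trunc_der_bound R.
have mW : measurable (W : set plane) by exact: open_plane_measurable.
pose L := M + 1; have L0 : 0 < L by rewrite /L; lra.
have WL : W `<=` [set x | - L <= x.1 < L /\ - L <= x.2 < L].
  by move=> x /WM[] /=; rewrite !subr0 !ler_norml /L => /andP[? ?] /andP[? ?]; split; lra.
pose Q := 64 * C * k ^+ 2 + 1.
have Q0 : 0 <= 64 * C * k ^+ 2 by rewrite mulr_ge0 ?sqr_ge0// mulr_ge0//; lra.
(* Cells fine enough that [tau Q <= 1]; since [Q] is at least 1, this gives the smallness condition,
   which is quadratic in [tau]. *)
pose n := (Num.truncn (2 * L * Q)).+1.
have nQ : 2 * L * Q < n%:R.
  have /truncn_itv/andP[_] // : 0 <= 2 * L * Q by rewrite !mulr_ge0// ?ltW// /Q ltr_pwDr.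
have nR : 0 < n%:R :> R by rewrite ltr0n.
have small : 64 * C * k ^+ 2 * (2 * L / n%:R) ^+ 2 <= 1.
  set tau := 2 * L / n%:R; have t0 : 0 <= tau by rewrite divr_ge0 ?mulr_ge0// ltW.
  have : tau * Q <= 1 by rewrite /tau mulrAC ler_pdivrMr// mul1r ltW.
  rewrite /Q; move: Q0 t0; set q := 64 * C * k ^+ 2; clearbody q tau; clear => q0 t0 H.
  have : 0 <= tau * q by rewrite mulr_ge0.
  nra.
exists #|{: 'I_n * 'I_n}|.+1 => v hv.
have [c c0 cE] := nontrivial_combination (fun j (p : 'I_n * 'I_n) => \int[leb2]_(x in W) (v j x * \1_(tile_cell L p) x)).
exists c => //; apply: (vanishing_eq0 oW bW ct WL L0 _ C1 HC small) => //; first exact: vanishing_sum.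
move=> p.
have Lg : L2 W (\1_(tile_cell L p) : R * R -> R).
  apply: (@L2_bounded _ _ mW _ 1); first exact: leb2_bounded_set WM.
    by apply: measurable_funTS; apply: measurable_indic; exact: measurable_grid.
  by move=> x _; rewrite indicE; case: (_ \in _); rewrite ?normr1 ?normr0.
have Lv j : L2 W (v j) by case: (hv j).
rewrite -[RHS](cE p).
have sumE (s : seq 'I_#|{: 'I_n * 'I_n}|.+1) : leb2.-integrable W (EFin \o (fun x => (\sum_(j <- s) c j * v j x) * \1_(tile_cell L p) x) : plane -> \bar R) /\
    \int[leb2]_(x in W) ((\sum_(j <- s) c j * v j x) * \1_(tile_cell L p) x) =
    \sum_(j <- s) c j * \int[leb2]_(x in W) (v j x * \1_(tile_cell L p) x).
  have Ls (s' : seq 'I_#|{: 'I_n * 'I_n}|.+1) : L2 W (fun x => \sum_(j <- s') c j * v j x).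
    by case: (vanishing_sum s' c oW bW ct hv).
  elim: s => [|j s [I E]].
    split; first by exact: L2_mul_integrable.
    rewrite big_nil /Rintegral integral0_eq// => x _; by rewrite big_nil mul0r.
  split; first by exact: L2_mul_integrable.
  have Ij := L2_mul_integrable mW (Lv j) Lg.
  rewrite big_cons -E -RintegralZl// -RintegralD//.
    by apply: eq_Rintegral => x _; rewrite big_cons mulrDl mulrA.
  by apply: (integrableZl mW (c j) Ij).
exact: (sumE _).2.
Qed.

End finite_multiplicity.

(** * Independence of point sources *)

Section point_source_field.
Context {R : realType}.
Local Notation plane := (measurableTypeR R * measurableTypeR R)%type.
Implicit Types (U W K : set (R * R)) (x y z : R * R) (f u v : R * R -> R).

Definition src (k : R) z x : R := complex.Re (incident_field k z x).

Lemma helmholtz_sol0 U (k : R) : helmholtz_sol U k (fun=> 0).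
Proof.
split=> [|x Ux]; first exact: smoothU_cst.
have E1 : d1 (fun=> 0 : R) = (fun _ : R * R => 0 : R) by apply/funext => y; exact: (d_cst 0 y).1.
have E2 : d2 (fun=> 0 : R) = (fun _ : R * R => 0 : R) by apply/funext => y; exact: (d_cst 0 y).2.
by rewrite E1 E2 E1 E2 !mulr0 !addr0.
Qed.

Lemma helmholtz_sol_add U (k : R) u v : open U -> helmholtz_sol U k u -> helmholtz_sol U k v ->
  helmholtz_sol U k (fun x => u x + v x).
Proof.
move=> oU hu hv; have := helmholtz_sol_lin 1 oU hu hv.
by under eq_fun do rewrite mul1r.
Qed.

Lemma helmholtz_sol_sub U W (k : R) u : W `<=` U -> helmholtz_sol U k u -> helmholtz_sol W k u.
Proof. by move=> WU [su hu]; split=> [n|x /WU]; [exact: CkU_sub WU (su n)|exact: hu]. Qed.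

Lemma helmholtz_sol_sum U (k : R) (I : Type) (s : seq I) (t : I -> R * R -> R) : open U ->
  (forall i, helmholtz_sol U k (t i)) -> helmholtz_sol U k (fun x => \sum_(i <- s) t i x).
Proof.
move=> oU ht; elim: s => [|i s IH].
  by under eq_fun do rewrite big_nil; exact: helmholtz_sol0.
by under eq_fun do rewrite big_cons; exact: helmholtz_sol_add.
Qed.

Lemma qq_gt0 x z : x != z -> 0 < qq (x - z).
Proof.
move=> xz; rewrite lt_neqAle qq_ge0 andbT eq_sym; apply: contra xz => /eqP q0.
have [a0 b0] : (x - z).1 = 0 /\ (x - z).2 = 0.
  move: q0; rewrite /qq => q0.
  have a2 := sqr_ge0 (x - z).1; have b2 := sqr_ge0 (x - z).2.
  by split; apply/eqP; rewrite -sqrf_eq0; apply/eqP; lra.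
by rewrite -subr_eq0; apply/eqP; rewrite [x - z]surjective_pairing a0 b0.
Qed.

Lemma srcE (k : R) z x : 0 < k -> x != z -> src k z x = Gfun k (ln (qq (x - z))) (qq (x - z)).
Proof. by move=> k0 xz; have e := enorm_sqr (x - z); rewrite /src Re_incident// e. Qed.

Lemma continuous_qqB z : continuous (fun x : R * R => qq (x - z)).
Proof. by apply: continuous_translate; apply: smooth_continuous; apply/smoothP; exact: smooth_qq. Qed.

Lemma open_qq_gt (a : R) z : open [set x : R * R | a < qq (x - z)].
Proof. by apply: open_lt_fun; [exact: cst_continuous|exact: continuous_qqB]. Qed.

(** Near each point other than [z] the source coincides with a regularized one, which is smooth and
    whose right-hand side vanishes there. *)
Lemma helmholtz_src (k : R) z : 0 < k -> helmholtz_sol [set x | x != z] k (src k z).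
Proof.
move=> k0.
have loc x : x != z -> exists2 al : R, 0 < al & al < qq (x - z).
  by move=> /qq_gt0 q0; exists (qq (x - z) / 2); rewrite ?divr_gt0//; lra.
have E (al : R) : 0 < al -> forall y, [set y | al < qq (y - z)] y -> src k z y = gsrc k al z y.
  by move=> al0 y /= ay; rewrite gsrc_out// ltW.
have oz : open [set x | x != z].
  rewrite (_ : [set x | x != z] = ~` [set z]); last by apply/seteqP; split=> y /eqP.
  by apply: closed_openC; apply: compact_closed_plane; exact: compact_set1.
split.
  move=> n; apply: CkU_local => // x /loc[al al0 ax].
  exists [set y | al < qq (y - z)], (gsrc k al z); split => //; first exact: open_qq_gt.
  by apply: (@CkU_sub _ _ setT) => //; apply: (smoothP _).1; exact: smooth_gsrc.
  exact: E.
move=> x /loc[al al0 ax]; have oV : open [set y : R * R | al < qq (y - z)] by exact: open_qq_gt.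
  have Ea := E al al0.
have D1 y : [set y | al < qq (y - z)] y -> _ := fun Vy => (d_eq oV Ea Vy).1.
have D2 y : [set y | al < qq (y - z)] y -> _ := fun Vy => (d_eq oV Ea Vy).2.
rewrite (d_eq oV D1 ax).1 (d_eq oV D2 ax).2 (Ea x ax) helmholtz_gsrc// /fsrc freg_out ?(ltW ax)//.
by rewrite add0r addNr.
Qed.

Lemma src_sym (k : R) z x : src k z x = src k x z.
Proof.
have e : enorm (x - z) = enorm (z - x).
  by rewrite -opprB /enorm /= !sqrrN.
by rewrite /src /incident_field e.
Qed.

Lemma continuous_src (k : R) z x : 0 < k -> x != z -> {for x, continuous (src k z)}.
Proof. by move=> k0 xz; have [s _] := helmholtz_src z k0; exact: (CkU_cont (s 0%N)). Qed.

(** Near the source [J] exceeds 1/2 and [S] stays bounded, so the logarithm dominates. *)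
Lemma src_blowup (k M : R) z : 0 < k -> \forall x \near z, x != z -> M <= `|src k z x|.
Proof.
move=> k0; have a0 := bessel_a_gt0 k0.
have cJ := is_derive_cont (is_derive_Jn a0 0 0); have cS := is_derive_cont (is_derive_Sn a0 0 0).
have q0 : qq (z - z) = 0 by rewrite subrr /qq /= expr0n addr0.
have pi20 : 0 < 2 * pi :> R by rewrite mulr_gt0// pi_gt0.
pose B := `|Sn (bessel_a k) 0 0| + 1.
(* For [ln s < - T] the logarithmic factor is below [- 2 (B + 2 pi |M|)]; multiplying by [J > 1/2]
   and correcting by [|S| < B] leaves [- 2 pi |M|]. *)
pose T := 2 * (log_cst k + 2 * (B + 2 * pi * `|M|)).
have B0 : 0 <= B by rewrite /B addr_ge0.
have N1 : \forall x \near z, 2^-1 < Jn (bessel_a k) 0 (qq (x - z)).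
  have c : {for z, continuous (fun x => Jn (bessel_a k) 0 (qq (x - z)))}.
    apply: (@continuous_comp _ _ _ (fun x => qq (x - z)) (Jn (bessel_a k) 0)); first exact: continuous_qqB.
    by rewrite q0; exact: cJ.
  apply: (cvgr_gt _ c); rewrite q0 Jn0; lra.
have N2 : \forall x \near z, `|Sn (bessel_a k) 0 (qq (x - z))| < B.
  have c : {for z, continuous (fun x => `|Sn (bessel_a k) 0 (qq (x - z))|)}.
    apply: cvg_norm; apply: (@continuous_comp _ _ _ (fun x => qq (x - z)) (Sn (bessel_a k) 0)); first exact: continuous_qqB.
    by rewrite q0; exact: cS.
  apply: (cvgr_lt _ c); rewrite q0 /B; lra.
have N3 : \forall x \near z, qq (x - z) < expR (- T).
  by apply: (cvgr_lt _ (@continuous_qqB z z)); rewrite q0 expR_gt0.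
near=> x; move=> xz; rewrite srcE//; have := qq_gt0 xz.
have J1 : 2^-1 < Jn (bessel_a k) 0 (qq (x - z)) by near: x.
have S1 : `|Sn (bessel_a k) 0 (qq (x - z))| < B by near: x.
have E1 : qq (x - z) < expR (- T) by near: x.
rewrite /Gfun; move: J1 S1 E1; set s := qq (x - z); set J := Jn _ _ s; set S := Sn _ _ s => J1 S1 E1 s0.
have L1 : ln s < - T by rewrite -(expRK (- T)) ltr_ln ?posrE ?expR_gt0.
have H : 2 * pi * `|M| <= - ((ln s / 2 + log_cst k) * J - S).
  have : ln s / 2 + log_cst k <= - (2 * (B + 2 * pi * `|M|)) by rewrite /T in L1; lra.
  have X0 : 0 <= B + 2 * pi * `|M| by rewrite addr_ge0// mulr_ge0// ltW.
  move: S1; rewrite ltr_norml => /andP[S1 S2].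
  move: X0 J1 S1 S2; set Y := 2 * pi * `|M|; set l := ln s / 2 + log_cst k; clearbody l Y B J S; clear.
  by move=> X0 J1 S1 S2 l1; nra.
apply: le_trans (ler_norm M) _; apply: le_trans (ler_norm _).
by rewrite mulNr -mulrN mulrC ler_pdivlMr// mulrC.
Unshelve. all: by end_near. Qed.

End point_source_field.

(** * Unique continuation and linear independence *)

Section unique_continuation.
Context {R : realType}.
Implicit Types (U W K : set (R * R)) (x y z : R * R) (f u v : R * R -> R).

Lemma dfam_eq0 U f i j : open U -> (forall x, U x -> f x = 0) -> forall x, U x -> dfam f i j x = 0.
Proof.
move=> oU f0; have step1 g : (forall x, U x -> g x = 0) -> forall x, U x -> d1 g x = 0.
  by move=> g0 x Ux; rewrite (d_eq oU (g := fun=> 0) g0 Ux).1 (d_cst 0 x).1.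
have step2 g : (forall x, U x -> g x = 0) -> forall x, U x -> d2 g x = 0.
  by move=> g0 x Ux; rewrite (d_eq oU (g := fun=> 0) g0 Ux).2 (d_cst 0 x).2.
rewrite /dfam; elim: i => [|i IH] /=; last exact: step1.
by elim: j => [|j IH] //=; exact: step2.
Qed.

(** Vanishing of all derivatives at a point is stable under Taylor steps. *)
Lemma unique_continuation_segment U W (k : R) f a b : open U -> open W -> W `<=` U -> helmholtz_sol U k f ->
  (forall x, W x -> f x = 0) -> W a -> (forall t, 0 <= t <= 1 -> U (segment_pt a b t)) -> f b = 0.
Proof.
move=> oU oW WU [sf hf] f0 Wa sU.
have H := helm_dfam oU sf hf.
suff : forall i j, dfam f i j b = 0 by move=> /(_ 0 0)%N.
have c01 : 0 < taylor_radius k <= 2^-1 by rewrite taylor_radius_gt0 taylor_radius_le.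
apply: (@taylor_stable_segment R U (taylor_radius k) (fun p => forall i j, dfam f i j p = 0) a b oU c01) => //.
  move=> p h t hh pU tc Pp; split=> i j.
  - have := helm_taylor1 hh pU (helm_shift i j H) tc.
    rewrite (_ : (fun m => _) = (fun=> 0)); last by apply/funext => m; rewrite Pp mul0r mul0r.
    rewrite (_ : series _ = (fun=> 0)); last by apply/funext => n; rewrite /series /= big1.
    by move/cvg_lim => <- //; exact: lim_cst.
  - have := helm_taylor2 hh pU (helm_shift i j H) tc.
    rewrite (_ : (fun m => _) = (fun=> 0)); last by apply/funext => m; rewrite Pp mul0r mul0r.
    rewrite (_ : series _ = (fun=> 0)); last by apply/funext => n; rewrite /series /= big1.
    by move/cvg_lim => <- //; exact: lim_cst.
by move=> i j; exact: (dfam_eq0 _ _ oW f0).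
Qed.

Lemma qq_segment (a b : R * R) (t : R) : qq (a - segment_pt a b t) = t ^+ 2 * qq (a - b).
Proof. by rewrite /qq /segment_pt /=; ring. Qed.

(* Continue along the segment from W to the nearest source with a nonzero coefficient: the logarithmic
   singularity at its end is not compensated by the other terms. *)
Lemma independent_sources (rho k : R) (N : nat) (z : 'I_N -> R * R) (w : 'I_N -> R * R -> R) (c : 'I_N -> R) W :
  0 < k -> injective z -> (forall j, disc rho (z j)) -> (forall j, helmholtz_sol (disc rho) k (w j)) ->
  open W -> W `<=` disc rho -> W !=set0 -> (forall j, ~ W (z j)) ->
  (forall x, W x -> \sum_j c j * (w j x + src k (z j) x) = 0) -> forall j, c j = 0.
Proof.
move=> k0 zi zr hw oW Wr [a Wa] nW F0 j0; apply: contrapT => /eqP cj0.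
have [i ci imin] := @Order.TotalTheory.arg_minP _ _ _ j0 (fun j => c j != 0) (fun j => qq (a - z j)) cj0.
pose t j x := c j * (w j x + src k (z j) x).
pose P := [set j : 'I_N | c j != 0].
pose U := disc rho `\` (z @` P).
have cP : closed (z @` P).
  by apply: compact_closed_plane; apply: finite_compact; exact: finite_image.
have oU : open U by apply: openI; [exact: open_disc|exact: closed_openC].
have WU : W `<=` U by move=> x Wx; split; [exact: Wr|move=> [j _ E]; apply: (nW j); rewrite E].
have ht j : helmholtz_sol U k (t j).
  have [cj|cj] := eqVneq (c j) 0.
    have -> : t j = (fun=> 0) by apply/funext => x; rewrite /t cj mul0r.
    exact: helmholtz_sol0.
  have -> : t j = (fun x => c j * (w j x + src k (z j) x) + 0) by apply/funext => x; rewrite addr0.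
  apply: helmholtz_sol_lin => //; last exact: helmholtz_sol0.
  apply: helmholtz_sol_add => //; first by apply: helmholtz_sol_sub (hw j) => x [].
  apply: helmholtz_sol_sub (helmholtz_src (z j) k0) => x [_ nx] /=.
  by apply/eqP => E; apply: nx; exists j.
have hF := helmholtz_sol_sum (index_enum 'I_N) oU ht.
have az : a != z i by apply/eqP => E; apply: (nW i); rewrite -E.
(* Along the half-open segment the distance to [a] is less than that of [z i], the nearest source
   with nonzero coefficient, so no removed point is met. *)
have seg s : 0 <= s < 1 -> U (segment_pt a (z i) s).
  move=> /andP[s0 s1]; split.
    by apply: convex_disc; [exact: Wr|exact: zr|rewrite s0 ltW].
  move=> [j cj E]; have := imin j cj; rewrite E qq_segment leNgt => /negP; apply.
  by rewrite gtr_pMl ?qq_gt0// exprn_ilt1.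
have sub_seg s t' : segment_pt a (segment_pt a (z i) s) t' = segment_pt a (z i) (s * t').
  by rewrite /segment_pt /=; congr pair; ring.
have F0' s : 0 <= s < 1 -> \sum_j t j (segment_pt a (z i) s) = 0.
  move=> /andP[s0 s1]; apply: (unique_continuation_segment oU oW WU hF F0 Wa) => t' /andP[t0 t1].
  rewrite sub_seg; apply: seg; rewrite mulr_ge0//=; apply: le_lt_trans s1; exact: ler_piMr.
(* Everything except the singular term of the source [z i]; it is continuous at [z i], because the
   sources are distinct. *)
pose r x := c i * w i x + \sum_(j | j != i) t j x.
have cr : {for z i, continuous r}.
  apply: cvgD.
    apply: cvgMr; exact: (CkU_cont ((hw i).1 0%N) (zr i)).
  have -> : (fun x => \sum_(j | j != i) t j x) = (fun x => \sum_(j <- index_enum 'I_N) (if j != i then t j x else 0)).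
    by apply/funext => x; rewrite big_mkcond.
  rewrite big_mkcond /=; elim: (index_enum _) => [|j s IH].
    by under eq_fun do rewrite big_nil; rewrite big_nil; exact: cvg_cst.
  under eq_fun do rewrite big_cons; rewrite big_cons; apply: cvgD => //.
  have [->|ji] := eqVneq j i; first exact: cvg_cst.
  apply: cvgMr; apply: cvgD; first exact: (CkU_cont ((hw j).1 0%N) (zr i)).
  by apply: continuous_src => //; apply: contra ji => /eqP/zi ->.
have N1 : \forall x \near z i, `|r (z i) - r x| < 1 by move/cvgrPdist_lt : cr; apply.
(* Near [z i] this threshold makes the singular term at least [|r (z i)| + 2], while the sum
   vanishes and [|r|] is below [|r (z i)| + 1]. *)
have N2 := src_blowup ((`|r (z i)| + 2) / `|c i|) (z i) k0.
have N12 : \forall x \near z i, `|r (z i) - r x| < 1 /\ (x != z i -> (`|r (z i)| + 2) / `|c i| <= `|src k (z i) x|).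
  by apply: filterS2 N1 N2.
have s1E : segment_pt a (z i) 1 = z i by rewrite /segment_pt /= !mul1r !addrA [a.1 + _]addrC [a.2 + _]addrC !addrK -surjective_pairing.
have N3 : \forall s \near (1 : R), `|r (z i) - r (segment_pt a (z i) s)| < 1 /\
   (segment_pt a (z i) s != z i -> (`|r (z i)| + 2) / `|c i| <= `|src k (z i) (segment_pt a (z i) s)|).
  by have := @continuous_segment_pt R a (z i) 1; rewrite /continuous_at s1E => /(_ _ N12).
move/nbhs_ballP : N3 => [e /= e0 He].
(* A parameter within [e] of 1 but strictly below it, where the sum is known to vanish. *)
pose s := 1 - Num.min (e / 2) 2^-1.
have s01 : 0 <= s < 1.
  rewrite /s; have [h|h] := leP (e / 2) 2^-1; apply/andP; split; lra.
have sb : ball (1 : R) e s.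
  rewrite /ball /= /s opprB addrC subrK.
  by have [h|h] := leP (e / 2) 2^-1; rewrite ger0_norm; lra.
have [Hr Hs] := He _ sb; have Fs := F0' _ s01.
have xz : segment_pt a (z i) s != z i.
  by have [_ nz] := seg _ s01; apply/eqP => E; apply: nz; exists i.
move: Fs (Hs xz) Hr; rewrite (bigD1 i)//= {1}/t; move: (segment_pt a (z i) s) => x Fx Sx Rx.
have Ex : c i * src k (z i) x = - r x by rewrite /r; move: Fx; rewrite mulrDr; lra.
have : `|r (z i)| + 2 <= `|r x| by rewrite -(normrN (r x)) -Ex normrM mulrC -ler_pdivrMr ?normr_gt0.
have := lerB_dist (r x) (r (z i)); rewrite distrC in Rx; lra.
Qed.

End unique_continuation.

(** * Sources with vanishing field on the boundary *)

Section boundary_topology.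
Context {R : realType}.
Local Notation plane := (measurableTypeR R * measurableTypeR R)%type.
Implicit Types (A D : set (R * R)) (p x : R * R).

Lemma ori_preimage_bd b A p : open A -> bd A p -> open (ori b @^-1` A) /\ bd (ori b @^-1` A) (ori b p).
Proof.
move=> oA bp; have oA' : open (ori b @^-1` A) by move/continuousP : (@continuous_ori R b); apply.
split => //; have /bdE[//|clA nA] := bp; apply/bdE => //; split; last by rewrite /= oriK.
by apply: (@ori_cvg_closure R b (ori b @^-1` A)); rewrite (_ : ori b @^-1` (ori b @^-1` A) = A)//;
  apply/seteqP; split => x; rewrite /= oriK.
Qed.

Lemma bd_graph A p (r : R) : open A -> C2_boundary A -> bd A p -> 0 < r ->
  exists b gm, exists2 d : R, 0 < d & forall t, `|t - (ori b p).1| < d ->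
    bd A (ori b (t, gm t)) /\ box p r (ori b (t, gm t)).
Proof.
move=> oA cA bp r0; have [b [d [e [L [gm [up VC]]]]]] := C2_oriented_chart cA bp.
have [d0 e0 gL ge _] := VC; have [oA' bp'] := ori_preimage_bd b oA bp.
have gmp := vchart_center oA' bp' VC; have L1 : 0 < `|L| + 1 by have := normr_ge0 L; lra.
exists b, gm; exists (Num.min d (Num.min r (r / (`|L| + 1)))).
  by rewrite !lt_min d0 r0 divr_gt0.
move=> t; rewrite !lt_min => /and3P[t1 t2 t3]; split; first exact: chart_bd VC t1.
apply/(ori_box b); rewrite oriK; split => //=; rewrite -gmp; apply: le_lt_trans (gL _ _) _.
apply: (@le_lt_trans _ _ (`|L| * `|t - (ori b p).1|)); first by rewrite ler_wpM2r// ler_norm.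
rewrite ltr_pdivlMr// in t3; have := normr_ge0 (t - (ori b p).1); have := normr_ge0 L.
move: t3 t2; clear; nra.
Qed.

(** In a chart, a small move across the graph reaches the far side, which is open and misses the
    domain. This is where a slit is excluded, and it makes the difference sets nonempty. *)
Lemma exterior_near A p (r : R) : open A -> C2_boundary A -> bd A p -> 0 < r ->
  exists2 x, box p r x & ~ closure A x.
Proof.
move=> oA cA bp r0; have [b [d [e [L [gm [up VC]]]]]] := C2_oriented_chart cA bp.
have [d0 e0 gL ge H] := VC; have [oA' bp'] := ori_preimage_bd b oA bp.
have gmp := vchart_center oA' bp' VC; have cg := lip_continuous gL.
set q := ori b p in gmp H *; pose s := Num.min (r / 2) (e / 2).
have s0 : 0 < s by rewrite lt_min !divr_gt0.
have sr : s <= r / 2 by rewrite ge_min lexx.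
have se : s <= e / 2 by rewrite ge_min lexx orbT.
pose y := (q.1, if up then q.2 - s else q.2 + s).
have y2 : `|y.2 - q.2| = s.
  by rewrite /y /=; case: up {H VC y}; rewrite addrAC subrr add0r ?normrN gtr0_norm.
have yb : box q r y by split; rewrite ?y2 /= ?subrr ?normr0//; lra.
exists (ori b y); first by apply/(ori_box b); rewrite oriK.
move=> cl.
have cgy : {for y, continuous (fun x : R * R => gm x.1 - x.2)}.
  by apply: cvgB; [exact: (continuous_comp_fst cg)|exact: continuous_snd_plane].
have N0 : nbhs y [set x : R * R | `|x.1 - q.1| < d /\ `|x.2 - q.2| < e].
  have m0 : 0 < Num.min d (e / 2) by rewrite lt_min d0 divr_gt0.
  have : nbhs y (box y (Num.min d (e / 2))) by apply: near_open; [exact: open_box|exact: boxxx].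
  apply: filterS => x [x1 x2]; split; first by apply: lt_le_trans x1 _; rewrite ge_min lexx.
  have x2' : `|x.2 - y.2| < e / 2 by apply: lt_le_trans x2 _; rewrite ge_min lexx orbT.
  by have := ler_distD y.2 x.2 q.2; lra.
have N1 : nbhs y [set x : R * R | if up then 0 < gm x.1 - x.2 else gm x.1 - x.2 < 0].
  case: up @y y2 yb cl cgy N0 {H VC} => y y2 yb cl cgy N0.
  - by apply: (cvgr_gt _ cgy); rewrite /y /= gmp; lra.
  - by apply: (cvgr_lt _ cgy); rewrite /y /= gmp; lra.
have N2 : nbhs (ori b y) (ori b @^-1` ([set x : R * R | `|x.1 - q.1| < d /\ `|x.2 - q.2| < e] `&`
    [set x : R * R | if up then 0 < gm x.1 - x.2 else gm x.1 - x.2 < 0])).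
  have N : nbhs (ori b (ori b y)) ([set x : R * R | `|x.1 - q.1| < d /\ `|x.2 - q.2| < e] `&`
    [set x : R * R | if up then 0 < gm x.1 - x.2 else gm x.1 - x.2 < 0]) by rewrite oriK; exact: filterI.
  by have := @continuous_ori R b (ori b y); apply.
have [x [Ax [[x1 x2] /= xg]]] := cl _ N2.
have := (H (ori b x) x1 x2).1; rewrite /= oriK => /(_ Ax).
by case: up xg {y y2 yb cl cgy N0 N1 N2 H VC}; lra.
Qed.

Lemma bd_not_isolated A p (r : R) : open A -> C2_boundary A -> bd A p -> 0 < r ->
  exists2 x, bd A x & box p r x /\ x != p.
Proof.
move=> oA cA bp r0; have [b [gm [d d0 H]]] := bd_graph oA cA bp r0.
have [|bt xt] := H ((ori b p).1 + d / 2); first by rewrite addrAC subrr add0r gtr0_norm ?divr_gt0//; lra.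
eexists; first exact: bt; split => //; apply/eqP => /(congr1 (ori b)); rewrite oriK => /(congr1 fst) /=.
by move: d0; clear; lra.
Qed.

Lemma connected_avoid_bd D A : connected D -> open D -> open A -> (forall x, D x -> ~ bd A x) ->
  D `<=` A \/ (forall x, D x -> ~ A x).
Proof.
move=> conD oD oA nb; have [[x [Dx Ax]]|nx] := pselect (exists x, D x /\ A x); last first.
  by right => x Dx Ax; apply: nx; exists x.
left; have <- : D `&` A = D; last by move=> y [].
apply: conD; first by exists x.
- by exists A.
- exists (closure A); first exact: closed_closure.
  apply/seteqP; split => y [Dy Ay]; split => //; first exact: subset_closure.
  by apply: contrapT => nA; apply: (nb y Dy); apply/bdE.
Qed.

(** A point of [A] outside the disc would be followed radially outwards until it leaves the bounded
    set [A], meeting the boundary at a norm at least as large. *)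
Lemma closure_in_disc A (rho : R) : open A -> bounded_set A -> 0 < rho -> bd A `<=` disc rho ->
  closure A `<=` disc rho.
Proof.
move=> oA bA r0 br x clx; have [Ax|nAx] := pselect (A x); last by apply: br; apply/bdE.
apply: contrapT => /negP; rewrite /disc /= -leNgt => xr.
have [M M0 AM] := bounded_cbox bA.
have x0 : 0 < enorm x by exact: lt_le_trans xr.
(* The dilated point has norm [enorm x + 2 M + 1], too large for the square of half-side [M] that
   contains [A]. *)
pose T := 1 + (2 * M + 1) / enorm x; have T1 : 1 <= T by rewrite lerDl divr_ge0 ?enorm_ge0//; lra.
have sc t : 0 <= t -> enorm (t * x.1, t * x.2) = t * enorm x.
  by move=> t0; rewrite /enorm /= !exprMn -mulrDr sqrtrM ?sqr_ge0// sqrtr_sqr ger0_norm.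
have nT : ~ A (T * x.1, T * x.2).
  move=> /AM[] /=; rewrite !subr0 => h1 h2.
  have := enorm_le_abs (T * x.1, T * x.2); rewrite /= sc; last lra.
  have -> : T * enorm x = enorm x + (2 * M + 1) by rewrite /T mulrDl mul1r divfK// gt_eqF.
  lra.
have [t t01 bt] := bd_on_segment oA Ax nT.
have := br _ bt; rewrite /disc /=.
have -> : (x.1 + t * (T * x.1 - x.1), x.2 + t * (T * x.2 - x.2)) = ((1 + t * (T - 1)) * x.1, (1 + t * (T - 1)) * x.2).
  by congr pair; ring.
have t1 : 1 <= 1 + t * (T - 1) by rewrite lerDl mulr_ge0//; [case/andP: t01|lra].
rewrite sc; last lra.
by move=> H; have := ler_wpM2r (ltW x0) t1; lra.
Qed.

Lemma compact_level (C : set (R * R)) (f : R * R -> R) (e : R) : compact C -> (forall x, C x -> {for x, continuous f}) ->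
  compact (C `&` [set x | e <= `|f x|]).
Proof.
move=> cC cf F PF FC; have FC' : F C by apply: filterS FC => x [].
have [x [Cx clx]] := cC F PF FC'; exists x; split => //; split => //=.
rewrite leNgt; apply/negP => fx.
have N : nbhs x [set y | `|f y| < e] by apply: (cvgr_lt _ (cvg_norm (cf x Cx))).
by have [y [[_ /= ey] /= fy]] := clx _ _ FC N; move: (lt_le_trans fy ey); rewrite ltxx.
Qed.

Lemma L2_ext D (f g : R * R -> R) : measurable (D : set plane) -> (forall x, D x -> f x = g x) -> L2 D f -> L2 D g.
Proof.
move=> mD fg [mf foo]; split; first by apply: (eq_measurable_fun f) => // x /set_mem; exact: fg.
by under eq_integral => x /set_mem Dx do rewrite -fg//.
Qed.

End boundary_topology.

(** * Fields that vanish on the boundary of the second domain *)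

Section common_zeros.
Context {R : realType}.
Local Notation plane := (measurableTypeR R * measurableTypeR R)%type.
Context (k rho : R) (D K : set (R * R)) (S w : R * R -> R * R -> R).
Context (k0 : 0 < k) (oD : open D) (bD : bounded_set D) (cD : C2_boundary D).
Context (cK : compact K) (KD : K `<=` D) (Drho : D `<=` disc rho).
Context (hS : forall z, D z -> dirichlet_solution D k (S z) (fun x => - complex.Re (incident_field k z x))).
Context (hw : forall z, K z -> analytic_helmholtz (disc rho) k (w z)).
Context (hwS : forall z, K z -> {ae leb2, forall x, D x -> w z x = S z x}).
Implicit Types (W : set (R * R)) (z x : R * R).

Definition total (z x : R * R) : R := w z x + src k z x.

Let w_sol z : K z -> helmholtz_sol (disc rho) k (w z).
Proof. by move=> Kz; split=> [|x xr]; [exact: (w_smooth hw)|case: (hw Kz xr)]. Qed.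

Let w_continuous z x : K z -> disc rho x -> {for x, continuous (w z)}.
Proof. by move=> Kz xr; have [sw _] := w_sol Kz; exact: CkU_cont (sw 0%N) _ xr. Qed.

Lemma total_gsrc (al : R) z x : 0 < al -> al <= qq (x - z) -> total z x = w z x + gsrc k al z x.
Proof. by move=> al0 ax; rewrite /total gsrc_out. Qed.

Lemma far_closure W (al : R) z x : (forall y, W y -> al <= qq (y - z)) -> closure W x -> al <= qq (x - z).
Proof.
move=> Wf clx; rewrite leNgt; apply/negP => qx.
have N : nbhs x [set y : R * R | qq (y - z) < al] by apply: (cvgr_lt _ (@continuous_qqB R z x)).
by have [y [Wy /= qy]] := clx _ N; have := Wf y Wy; rewrite leNgt qy.
Qed.

Lemma total_sol W (al : R) z : K z -> W `<=` disc rho -> 0 < al -> (forall y, W y -> al <= qq (y - z)) -> open W ->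
  helmholtz_sol W k (total z).
Proof.
move=> Kz Wr al0 Wf oW; apply: helmholtz_sol_add => //; first exact: helmholtz_sol_sub (w_sol Kz).
apply: helmholtz_sol_sub (helmholtz_src z k0) => x /Wf qx /=; apply/eqP => E.
by move: qx; rewrite E subrr /qq /= expr0n addr0 leNgt al0.
Qed.

(** Boundary points of [W] inside [D] are zeros of the field, and those on [bd D] are masked by the
    supports of the cutoffs, which are compact in [D]. A level set of the field within such a
    support thus stays in [W]; the gradient condition is inherited from the zero trace on [D]. *)
Lemma vanishing_inside W th (al : R) z : good_cutoffs D th -> K z -> open W -> W `<=` D -> 0 < al ->
  (forall y, W y -> al <= qq (y - z)) -> (forall x, D x -> closure W x -> ~ W x -> total z x = 0) ->
  vanishing_solution W k th (total z).
Proof.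
move=> gth Kz oW WD al0 Wf W0; have [tth th01 th1 thK] := gth.
have Wr : W `<=` disc rho by move=> x /WD/Drho.
have mW : measurable (W : set plane) by exact: open_plane_measurable.
have mD : measurable (D : set plane) by exact: open_plane_measurable.
have [al2 al20 Hal2] := qq_far cK oD KD.
(* One regularization radius valid both on [W] and on [bd D], so that the same smooth function
   represents the field in [W] and has zero trace. *)
pose be := Num.min al al2; have be0 : 0 < be by rewrite lt_min al0.
have bal y : W y -> be <= qq (y - z) by move=> /Wf; apply: le_trans; rewrite ge_min lexx.
have bbd x : bd D x -> be <= qq (x - z).
  by move=> /bdE[]// _ nDx; apply: le_trans (Hal2 z x Kz nDx); rewrite ge_min lexx orbT.
have [h1 [h2 [_ [[LV L1 L2'] _ trV _]]]] := point_source_sol oD bD k0 be0 bbd (hS (KD Kz)).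
have [sG hG] := total_sol Kz Wr al0 Wf oW.
have LW : L2 W (total z).
  apply: (@L2_ext _ W (fun x => w z x + gsrc k be z x)) => //; first by move=> x Wx; rewrite (total_gsrc be0 (bal _ Wx)).
  apply: (L2_subset mW mD WD); apply: L2_add => //; first exact: (w_L2 oD KD Drho hS hw hwS).
  by apply: L2_bounded_domain => //; apply: smooth_continuous; exact: smooth_gsrc.
have cvgW (b : nat -> R * R -> R) : (forall m, continuous (b m)) ->
    L2_cvg D (fun m x => b m x * (S z x + gsrc k be z x)) (fun=> 0) -> L2_cvg W (fun m x => b m x * total z x) (fun=> 0).
  move=> cb; apply: squeeze_cvge0 => m; apply/andP; split.
    by apply: integral_ge0 => x _; rewrite lee_fin sqr_ge0.
  have mb (E : set (R * R)) : measurable_fun (E : set plane) (b m : plane -> R).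
    by apply: measurable_funTS; exact: continuous_plane_measurable.
  have m2 : measurable_fun (D : set plane) (fun x : plane => ((b m x * (S z x + gsrc k be z x) - 0) ^+ 2)%:E).
    by apply: measurable_sqr; apply: measurable_funB => //; apply: measurable_funM => //; case: LV.
  apply: (@le_trans _ _ (\int[leb2]_(x in W) ((b m x * (S z x + gsrc k be z x) - 0) ^+ 2)%:E)%E); last first.
    by apply: ge0_subset_integral => // x _; rewrite lee_fin sqr_ge0.
  apply: ae_ge0_le_integral => //.
  - by move=> x _; rewrite lee_fin sqr_ge0.
  - by apply: measurable_sqr; apply: measurable_funB => //; apply: measurable_funM => //; case: LW.
  - by move=> x _; rewrite lee_fin sqr_ge0.
  - exact: measurable_funS m2.
  - case: (hwS Kz) => N [mN N0 HN]; exists N; split => // x /= nx; apply: HN => /= H; apply: nx => Wx.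
    by rewrite (total_gsrc be0 (bal _ Wx)) H//; exact: WD.
have [C1 C2] := thK _ h1 h2 LV L1 L2' trV.
split => //; last first.
  by split; apply: cvgW => // m; apply: smooth_continuous; [apply: smooth_d1|apply: smooth_d2]; case: (tth m).
move=> m e e0; have [_ [Km [cKm KmD Km0]]] := tth m.
pose gh x := w z x + gsrc k be z x.
have cgh x : D x -> {for x, continuous gh}.
  move=> Dx; apply: cvgD; first by apply: w_continuous => //; exact: Drho.
  by apply: smooth_continuous; exact: smooth_gsrc.
have cC : compact (Km `&` closure W) by apply: compact_closedI => //; exact: closed_closure.
exists ((Km `&` closure W) `&` [set x | e <= `|gh x|]); split.
- by apply: compact_level => // x [/KmD Dx _]; exact: cgh.
- move=> x [[Kmx clx] /= ex]; apply: contrapT => nW.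
  have Dx := KmD _ Kmx; have := W0 x Dx clx nW.
  rewrite (total_gsrc be0); last by apply: (far_closure bal).
  by rewrite -/(gh x) => g0; move: ex; rewrite g0 normr0 leNgt e0.
- move=> x Wx tx; rewrite (total_gsrc be0 (bal _ Wx)) => ex; split => //; split; last exact: subset_closure.
  by apply: contrapT => nK; move: tx; rewrite Km0// eqxx.
Qed.

(** The extended field is continuous on the closure of [W] and vanishes on its whole boundary;
    nothing has to be masked and the cutoffs are constant. *)
Lemma vanishing_outside W (al : R) z : K z -> open W -> bounded_set W -> closure W `<=` disc rho -> 0 < al ->
  (forall y, W y -> al <= qq (y - z)) -> (forall x, closure W x -> ~ W x -> total z x = 0) ->
  vanishing_solution W k (fun _ _ => 1) (total z).
Proof.
move=> Kz oW bW clWr al0 Wf W0; have Wr : W `<=` disc rho by move=> x Wx; apply: clWr; exact: subset_closure.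
have mW : measurable (W : set plane) by exact: open_plane_measurable.
have [sG hG] := total_sol Kz Wr al0 Wf oW.
pose gh x := w z x + gsrc k al z x.
have cgh x : disc rho x -> {for x, continuous gh}.
  move=> xr; apply: cvgD; first exact: w_continuous.
  by apply: smooth_continuous; exact: smooth_gsrc.
have [M M0 WM] := bounded_cbox bW.
have cC : compact (closure W).
  by apply: (@closed_bounded_compact _ _ M); [exact: closed_closure|exact: closure_cbox].
split => //.
- apply: (@L2_ext _ W gh) => //; first by move=> x Wx; rewrite (total_gsrc al0)// Wf.
  have [B B0 HB] := compact_bounded_fun cC (fun x clx => cgh x (clWr x clx)).
  apply: (@L2_bounded _ _ mW _ B); first exact: leb2_bounded_set WM.
    by apply: continuous_plane_measurable_within => // x /Wr; exact: cgh.
  by move=> x Wx; apply: HB; exact: subset_closure.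
- move=> m e e0; exists (closure W `&` [set x | e <= `|gh x|]); split.
  + by apply: compact_level => // x /clWr; exact: cgh.
  + move=> x [clx /= ex]; apply: contrapT => nW; have := W0 x clx nW.
    rewrite (total_gsrc al0); last by apply: (far_closure Wf).
    by rewrite -/(gh x) => g0; move: ex; rewrite g0 normr0 leNgt e0.
  + move=> x Wx _; rewrite (total_gsrc al0 (Wf _ Wx)) => ex; split => //; exact: subset_closure.
- by split; apply: cvg_near_cst; apply: nearW => m; apply: integral0_eq => x _;
    rewrite ?(d_cst 1 x).1 ?(d_cst 1 x).2 mul0r subr0 expr0n.
Qed.

(** An infinite set of such sources contains as many distinct ones as [finite_multiplicity] asks
    for; the linear relation it yields contradicts [independent_sources]. *)
Lemma few_vanishing W th (Z : set (R * R)) : open W -> bounded_set W -> W `<=` disc rho -> W !=set0 -> cutoffs W th ->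
  Z `<=` K -> (forall z, Z z -> ~ W z /\ vanishing_solution W k th (total z)) -> finite_set Z.
Proof.
move=> oW bW Wr W0 ct ZK HZ; apply: contrapT => infZ.
have [N HN] := finite_multiplicity k oW bW ct.
have [B BZ cB] := infinite_set_fset N infZ.
have sB (i : 'I_N) : (i < size (finmap.enum_fset B))%N by apply: leq_trans (ltn_ord i) _.
pose z (i : 'I_N) := nth (0 : R * R) (finmap.enum_fset B) i.
have Zz i : Z (z i) by apply: BZ; exact: mem_nth.
have zi : injective z.
  by move=> i j /eqP; rewrite nth_uniq ?finmap.fset_uniq// => /eqP/val_inj.
have [c [j cj] c0] := HN (fun i => total (z i)) (fun i => (HZ _ (Zz i)).2).
have zr i : disc rho (z i) by apply: Drho; apply: KD; apply: ZK.
have := @independent_sources R rho k N z (fun i => w (z i)) c W k0 zi zr (fun i => w_sol (ZK _ (Zz i))) oW Wr W0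
  (fun i => (HZ _ (Zz i)).1) c0 j.
by move=> E; rewrite E eqxx in cj.
Qed.

Lemma far_from_open (N W : set (R * R)) z : open N -> N z -> (forall x, W x -> ~ N x) ->
  exists2 al : R, 0 < al & forall x, W x -> al <= qq (x - z).
Proof.
move=> oN Nz WN; have cz : compact [set z] by exact: compact_set1.
have zN : [set z] `<=` N by move=> x ->.
have [al al0 H] := qq_far cz oN zN.
by exists al => // x /WN nx; exact: H.
Qed.

Section obstacle.
Context (D' : set (R * R)) (oD' : open D') (bD' : bounded_set D') (cD' : C2_boundary D') (conD : connected D).
Context (D0 : D !=set0) (D'0 : D' !=set0) (Lrho : bd D' `<=` disc rho).

(** The point [x = z] is left out, since the incident field has only a default value there. *)
Definition null_source : set (R * R) := [set z | K z /\ forall x, bd D' x -> x != z -> total z x = 0].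

(** The boundary of [D'] has points arbitrarily close to [z] other than [z], where the source is
    larger than the bounded scattered part. *)
Lemma null_source_bd z : null_source z -> ~ bd D' z.
Proof.
move=> [Kz H] bz; have zr : disc rho z by apply: Drho; exact: KD.
have N1 : \forall x \near z, `|w z x| < `|w z z| + 1.
  by apply: (cvgr_lt _ (cvg_norm (w_continuous Kz zr))); rewrite ltrDl.
have N2 := src_blowup (`|w z z| + 1) z k0.
have N : \forall x \near z, `|w z x| < `|w z z| + 1 /\ (x != z -> `|w z z| + 1 <= `|src k z x|) by apply: filterS2 N1 N2.
move/nbhs_boxP : N => [r r0 Hr].
have [x bx [xr xz]] := bd_not_isolated oD' cD' bz r0.
have [wx sx] := Hr _ xr; have := H x bx xz; rewrite /total => /eqP; rewrite addr_eq0 => /eqP E.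
by move: (sx xz) wx; rewrite E normrN leNgt => /negP.
Qed.

(** The open set is chosen so that the source stays at positive distance from it and its boundary
    consists of points where the field vanishes, pointwise or by trace. The choice depends on
    whether [bd D'] enters [D]. *)
Lemma null_source_finite : D' <> D -> finite_set null_source.
Proof.
move=> DD; have [th gth] := good_cutoffs_exist oD bD cD.
have mD := open_plane_measurable oD.
have rho0 : 0 < rho by have [a /Drho] := D0; apply: le_lt_trans; exact: enorm_ge0.
have cl' : closure D' `<=` disc rho by exact: closure_in_disc.
have ctD W : W `<=` D -> cutoffs W th.
  by case: gth => tth th01 th1 _ WD; split => // [m|x /WD]; [case: (tth m)|exact: th1].
have bsub (A B : set (R * R)) : A `<=` B -> bounded_set B -> bounded_set A.
  by move=> AB [M [rM HM]]; exists M; split => // y My x Ax; apply: (HM y My); exact: AB.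
have nK z x : null_source z -> bd D' x -> total z x = 0.
  by move=> Nz bx; apply: Nz.2 => //; apply/eqP => E; apply: (null_source_bd Nz); rewrite -E.
have [[p [bp Dp]]|nop] := pselect (exists p, bd D' p /\ D p).
- have /openP_box/(_ p Dp)[r r0 rD] := oD.
  suff [f1 f2] : finite_set (null_source `&` D') /\ finite_set (null_source `\` D').
    apply: (@sub_finite_set _ _ ((null_source `&` D') `|` (null_source `\` D'))); last by rewrite finite_setU.
    by move=> z Nz; have [|] := pselect (D' z); [left|right].
  split.
  (* Sources in [D']. The set is nonempty because the exterior of [D'] comes arbitrarily close to
     [p], which lies in the open set [D]. *)
  + pose W := D `\` closure D'.
    have oW : open W by apply: openI => //; apply: closed_openC; exact: closed_closure.
    have WD : W `<=` D by move=> x [].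
    apply: (@few_vanishing W th) => //; [exact: bsub bD|by move=> x /WD/Drho| |exact: ctD|by move=> z [[]]|].
      by have [x bx nx] := exterior_near oD' cD' bp r0; exists x; split => //; exact: rD.
    move=> z [Nz D'z]; have nWz : ~ W z by move=> [_]; apply; exact: subset_closure.
    split => //; have [al al0 Hal] := @far_from_open D' W z oD' D'z (fun x Wx D'x => Wx.2 (subset_closure D'x)).
    apply: (vanishing_inside gth Nz.1 oW WD al0 Hal) => x Dx clx nWx; apply: nK => //; apply/bdE => //.
    split; first by apply: contrapT => nc; apply: nWx.
    move=> D'x; have [y [[_ ny] D'y]] := clx _ (near_open oD' D'x); apply: ny; exact: subset_closure.
  (* Sources outside [D']; not lying on its boundary either, they are away from its closure. *)
  + pose W := D `&` D'.
    have oW : open W by exact: openI.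
    have WD : W `<=` D by move=> x [].
    apply: (@few_vanishing W th) => //; [exact: bsub bD|by move=> x /WD/Drho| |exact: ctD|by move=> z [[]]|].
      by have /bdE[//|clp _] := bp; have [x [D'x Dx]] := clp _ (near_open oD Dp); exists x.
    move=> z [Nz nD'z]; have nWz : ~ W z by move=> [].
    have ncz : (~` closure D') z by move=> clz; apply: (null_source_bd Nz); apply/bdE.
    have oN : open (~` closure D') by apply: closed_openC; exact: closed_closure.
    split => //; have [al al0 Hal] := @far_from_open _ W z oN ncz (fun x Wx nx => nx (subset_closure Wx.2)).
    apply: (vanishing_inside gth Nz.1 oW WD al0 Hal) => x Dx clx nWx; apply: nK => //; apply/bdE => //.
    by split; [apply: closureS clx => y []|move=> D'x; apply: nWx].
- have nbd x : D x -> ~ bd D' x by move=> Dx bx; apply: nop; exists x.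
  pose W := D' `\` closure D.
  have oW : open W by apply: openI => //; apply: closed_openC; exact: closed_closure.
  have WD' : W `<=` D' by move=> x [].
  have WD x : W x -> ~ D x by move=> [_ nx] Dx; apply: nx; exact: subset_closure.
  have clW x : closure W x -> closure D' x by exact: closureS.
  have W0 : W !=set0.
    (* [D] is connected and misses [bd D'], so it is inside [D'] or disjoint from it. In the first
       case a point of [D'] outside [D] is, or has near it, an exterior point of [D]; in the second,
       the open [D'] misses the closure of [D]. *)
    have [DD'|nDD'] := connected_avoid_bd conD oD oD' nbd.
      have [x D'x nDx] : exists2 x, D' x & ~ D x.
        apply: contrapT => nx; apply: DD; apply/seteqP; split => // x D'x.
        by apply: contrapT => nDx; apply: nx; exists x.
      have [cx|ncx] := pselect (closure D x); last by exists x.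
      have bx : bd D x by apply/bdE.
      have /openP_box/(_ x D'x)[r r0 rD'] := oD'.
      by have [y yr ny] := exterior_near oD cD bx r0; exists y; split => //; exact: rD'.
    have [x D'x] := D'0; exists x; split => // clx.
    by have [y [Dy D'y]] := clx _ (near_open oD' D'x); exact: (nDD' y).
  apply: (@few_vanishing W (fun _ _ => 1)) => //.
  + exact: bsub bD'.
  + by move=> x /WD' D'x; apply: cl'; exact: subset_closure.
  + split; first by move=> m; apply/smoothP; exact: smoothU_cst.
      by move=> m x; rewrite ler01 lexx.
    by move=> x _; apply: nearW.
  + by move=> z [].
  + move=> z Nz; have Kz := Nz.1; have Dz := KD Kz; split; first by move=> /WD.
    have [al al0 Hal] := @far_from_open D (~` D) z oD Dz (fun x nx => nx).
    have Wal x : W x -> al <= qq (x - z) by move=> /WD; exact: Hal.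
    apply: (vanishing_outside Kz oW _ _ al0 Wal); [exact: bsub bD'|by move=> x /clW/cl'|].
    move=> x clx nWx; have [D'x|nD'x] := pselect (D' x); last by apply: nK => //; apply/bdE => //; split => //; exact: clW.
    have cDx : closure D x by apply: contrapT => nc; apply: nWx.
    have nDx : ~ D x by move=> Dx; have [y [/WD ny Dy]] := clx _ (near_open oD Dx).
    (* The boundary points of [W] inside [D'] lie on [bd D]; there the field vanishes pointwise, by
       zero trace and continuity of the extension. *)
    have bx : bd D x by apply/bdE.
    have bal y : bd D y -> al <= qq (y - z) by move=> /bdE[]// _ ny; exact: Hal.
    have [h1 [h2 [_ [[LV L1 L2'] _ trV _]]]] := point_source_sol oD bD k0 al0 bal (hS Dz).
    have xr : disc rho x by apply: cl'; exact: subset_closure.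
    rewrite (total_gsrc al0 (bal _ bx)).
    apply: (@zero_trace_boundary_value R D _ h1 h2 (fun x => w z x + gsrc k al z x) x oD bD cD LV L1 L2' trV bx).
      apply: cvgD; first exact: w_continuous.
      by apply: smooth_continuous; exact: smooth_gsrc.
    by case: (hwS Kz) => N [mN N0 HN]; exists N; split => // y /= ny; apply: HN => /= H; apply: ny => Dy; rewrite H.
Qed.

End obstacle.

End common_zeros.

(** * Positivity of the double integral *)

Section arc_length_lemmas.
Local Open Scope ereal_scope.
Context {R : realType}.
Local Notation plane := (measurableTypeR R * measurableTypeR R)%type.
Local Notation cara := (caratheodory_type (@hausdorff1 R)).
Implicit Types (A C Z : set (R * R)) (f : R * R -> \bar R).

(* The integral is a supremum over simple minorants, so f may be nonmeasurable. *)
Lemma arc_integral_ge A C f (c : R) : measurable (A : set plane) -> A `<=` C -> (0 <= c)%R ->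
  (forall x, 0 <= f x) -> (forall x, A x -> c%:E <= f x) -> c%:E * hausdorff1 A <= arc_integral C f.
Proof.
move=> mA AC c0 f0 cf; have mA' : measurable (A : set cara) by exact: borel_caratheodory.
pose mu := @arc_length_measure R.
have E1 : c%:E * hausdorff1 A = \int[mu]_(x in setT) (c%:E * (\1_A (x : cara))%:E).
  have mi : measurable_fun setT (fun x : cara => ((\1_A x)%:E : \bar R)).
    by apply/measurable_EFinP; exact: measurable_indic.
  have i0 (x : cara) : setT x -> 0 <= ((\1_A x)%:E : \bar R) by move=> _; rewrite lee_fin.
  rewrite (@ge0_integralZl_EFin _ _ _ mu setT measurableT (fun x : cara => (\1_A x)%:E) i0 mi c c0).
  by rewrite (@integral_indic _ _ _ mu setT measurableT A mA') setIT.
have E2 : arc_integral C f = \int[mu]_(x in C) f x by [].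
rewrite E1 E2 ge0_integralTE; last by move=> x; rewrite -EFinM lee_fin mulr_ge0.
rewrite ge0_integralE//; apply: ereal_sup_le => _ [h /= hg <-]; exists h => //= x.
apply: le_trans (hg x) _; rewrite patchE indicE; case: ifPn => xC.
  have [xA|xA] := boolP (x \in A); first by rewrite mule1; apply: cf; exact: set_mem.
  by rewrite mule0.
have -> : (x \in A) = false by apply/negbTE; apply: contra xC => /set_mem/AC/mem_set.
by rewrite mule0.
Qed.

Lemma arc_integral_ge0 C f : (forall x, 0 <= f x) -> 0 <= arc_integral C f.
Proof. by move=> f0; exact: (@integral_ge0 _ _ _ (@arc_length_measure R)). Qed.

Lemma hausdorff1_finite Z : finite_set Z -> hausdorff1 Z = 0.
Proof.
move=> /finite_seqP[s ->]; apply/eqP; rewrite eq_le hausdorff1_ge0 andbT.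
apply: (@hausdorff1_le _ _ _ 1%R) => // d /andP[d0 _].
(* Beyond the end of [s] the default point 0 is repeated; it is still a singleton, of diameter 0. *)
pose F (i : nat) : set (R * R) := [set nth 0%R s i].
have F0 i : ediam (F i) = 0.
  apply/eqP; rewrite eq_le ediam_ge0 andbT; apply: ge_ereal_sup => e /= [->//|[x [y [-> -> ->]]]].
  by rewrite subrr /enorm /= expr0n /= addr0 sqrtr0.
have -> : 0 = \sum_(i <oo) ediam (F i) by rewrite eseries0.
apply: ereal_inf_lbound; exists F => //; split => [i|x /= xs].
  by rewrite F0 lee_fin ltW.
by exists (index x s) => //; rewrite /F /= nth_index.
Qed.

Lemma hausdorff1_bigcup_null (F : nat -> set (R * R)) : (forall i, hausdorff1 (F i) <= 0) ->
  hausdorff1 (\bigcup_i F i) <= 0.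
Proof.
move=> F0; apply: le_trans (hausdorff1_sigma_subadditive F) _.
by rewrite eseries0// => i _ _; apply/eqP; rewrite eq_le F0 hausdorff1_ge0.
Qed.

Lemma hausdorff1_setU A Z : hausdorff1 (A `|` Z) <= hausdorff1 A + hausdorff1 Z.
Proof. exact: outer_measureU2. Qed.

Lemma hausdorff1_interval_gt0 (g : R * R -> R) A (a b : R) : lip1 g -> (a < b)%R ->
  (forall t, (a <= t <= b)%R -> exists2 x, A x & g x = t) -> 0 < hausdorff1 A.
Proof.
move=> lg ab H; have sub : `[a, b]%classic `<=` g @` A.
  by move=> t /=; rewrite in_itv/= => /H[x Ax <-]; exists x.
have := @le_hausdorff1_proj R g A `[a, b] lg (measurable_itv _) sub.
by rewrite lebesgue_measure_itv/= lte_fin ab -EFinD; apply: lt_le_trans; rewrite lte_fin subr_gt0.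
Qed.

End arc_length_lemmas.

(** * Arcs of positive length *)

Section curves.
Context {R : realType}.
Implicit Types (C : set (R * R)).

(** At distance [s = r / 2] from the centre the terms are bounded by some [B]; for [|h| <= s / 2]
    the terms of positive degree form a geometric series with sum at most [2 B |h| / s]. *)
Lemma analytic_at_continuous (f : R -> R) (t : R) : analytic_at f t -> {for t, continuous f}.
Proof.
move=> [a [r [r0 H]]]; pose s := r / 2; have s0 : 0 < s by rewrite divr_gt0.
have sr : `|s| < r by rewrite gtr0_norm// /s; lra.
have [B B0 HB] : exists2 B : R, 0 < B & forall n, `|a n| * s ^+ n <= B.
  have cs : cvgn (series (fun n => a n * s ^+ n)) by apply/cvg_ex; eexists; exact: H sr.
  have /cvg_seq_bounded := cvgP _ (cvg_series_cvg_0 cs).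
  move=> [M [Mr HM]]; exists (`|M| + 1); first by have := normr_ge0 M; lra.
  move=> n; have := HM (`|M| + 1) _ n I; rewrite /= normrM normrX (gtr0_norm s0); apply.
  by have := ler_norm M; lra.
have a0 : f t = a 0%N.
  have := H 0; rewrite normr0 addr0 => /(_ r0) C0.
  have E : series (fun n => a n * 0 ^+ n) @ \oo --> a 0%N.
    rewrite -cvg_shiftS; rewrite (_ : (fun n => _) = (fun=> a 0%N)); first exact: cvg_cst.
    apply/funext => n; rewrite /series /= big_nat_recl//= expr0 mulr1 big1 ?addr0// => i _.
    by rewrite exprS mul0r mulr0.
  by rewrite -(cvg_lim (@norm_hausdorff _ R) C0) -(cvg_lim (@norm_hausdorff _ R) E).
have bnd (h : R) : `|h| <= s / 2 -> `|f (t + h) - f t| <= 2 * B * (`|h| / s).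
  move=> hs; set q := `|h| / s.
  have q0 : 0 <= q by rewrite divr_ge0// ltW.
  have q2 : q <= 2^-1 by rewrite ler_pdivrMr//; lra.
  have hr : `|h| < r by apply: le_lt_trans hs _; rewrite /s; lra.
  have term n : `|a n * h ^+ n| <= B * q ^+ n.
    have hE : `|h| = q * s by rewrite /q divfK// gt_eqF.
    rewrite normrM normrX hE exprMn mulrCA mulrC.
    by rewrite ler_wpM2r// exprn_ge0.
  have Bq0 : 0 <= 2 * B * q by rewrite mulr_ge0// mulr_ge0// ltW.
  clearbody q.
  have part n : `|series (fun n => a n * h ^+ n) n.+1 - a 0%N| <= 2 * B * q * (1 - 2^-1 ^+ n).
    elim: n => [|n IH].
      by rewrite /series /= big_nat1 expr0 mulr1 subrr normr0 expr0 subrr mulr0.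
    have -> : series (fun n => a n * h ^+ n) n.+2 = series (fun n => a n * h ^+ n) n.+1 + a n.+1 * h ^+ n.+1.
      by rewrite /series /= big_nat_recr.
    rewrite addrAC; apply: le_trans (ler_normD _ _) _.
    have Q : q ^+ n.+1 <= q * 2^-1 ^+ n by rewrite exprS ler_wpM2l// lerXn2r// nnegrE.
    have T := le_trans (term n.+1) (ler_wpM2l (ltW B0) Q).
    have -> : 2 * B * q * (1 - 2^-1 ^+ n.+1) = 2 * B * q * (1 - 2^-1 ^+ n) + B * (q * 2^-1 ^+ n).
      by rewrite exprS; field.
    exact: lerD IH T.
  have part' n : `|series (fun n => a n * h ^+ n) n.+1 - a 0%N| <= 2 * B * q.
    apply: le_trans (part n) _; by rewrite ler_piMr.
  have C1 : (fun n => `|series (fun n => a n * h ^+ n) n.+1 - a 0%N|) @ \oo --> `|f (t + h) - f t|.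
    apply: cvg_norm; rewrite a0; apply: cvgB; last exact: cvg_cst.
    by have := H h hr; rewrite -cvg_shiftS.
  have near_le : \forall n \near \oo, `|series (fun n => a n * h ^+ n) n.+1 - a 0%N| <= 2 * B * q.
    by apply: nearW.
  exact: (ler_cvg_to C1 (cvg_cst _) near_le).
apply/cvgrPdist_lt => e e0; pose d := Num.min (s / 2) (e * s / (4 * B)).
have d0 : 0 < d by rewrite lt_min !divr_gt0 ?mulr_gt0.
have : nbhs t (ball t d) by exact: nbhsx_ballx.
apply: filterS => u; rewrite /ball /= distrC => ud.
have := bnd (u - t); rewrite [t + _]addrC subrK => bu; rewrite distrC.
have us : `|u - t| <= s / 2 by apply: le_trans (ltW ud) _; rewrite ge_min lexx.
have ue : `|u - t| < e * s / (4 * B) by apply: lt_le_trans ud _; rewrite ge_min lexx orbT.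
apply: le_lt_trans (bu us) _; rewrite mulrA ltr_pdivrMr//.
by rewrite ltr_pdivlMr ?mulr_gt0// in ue; have := mulr_gt0 e0 s0; lra.
Qed.

Lemma const_derive1 (f : R -> R) (t e : R) : 0 < e -> (forall u, `|u - t| < e -> f u = f t) -> derive1 f t = 0.
Proof.
move=> e0 H; rewrite derive1E.
have E : \forall u \near t, f u = (fun=> f t) u.
  have : nbhs t (ball t e) by exact: nbhsx_ballx.
  by apply: filterS => u; rewrite /ball /= distrC => /H.
have dc : is_derive t (1 : R) (fun=> f t) 0 by exact: is_derive_cst.
rewrite (near_eq_derive _ E).
by case: dc.
Qed.

(** The image of [[-1/2, 1/2]] under a local parametrization. One coordinate has nonzero derivative
    at 0, so it is not constant, its values fill an interval, and the length is positive.
    Compactness keeps the sources away from [bd D]. *)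
Lemma compact_subcurve C : analytic_1manifold C -> C !=set0 ->
  exists K, [/\ compact K, K `<=` C & (0 < hausdorff1 K)%E].
Proof.
move=> mC [p Cp]; have [V [c [_ [[_ Vp] ic cE _ _]]]] := mC p Cp.
have half (t : R) : `[(- 2^-1)%R, 2^-1]%classic t -> t \in `](-1)%R, 1[.
  by rewrite /= !in_itv/= => /andP[h1 h2]; apply/andP; split; lra.
have cc (t : R) : `[(- 2^-1)%R, 2^-1]%classic t ->
    {for t, continuous (fun s => (c s).1)} /\ {for t, continuous (fun s => (c s).2)}.
  by move=> /half/ic[a1 a2 _]; split; exact: analytic_at_continuous.
have cw : {within `[(- 2^-1)%R, 2^-1]%classic, continuous c}.
  apply: continuous_in_subspaceT => t /set_mem/cc[c1 c2].
  have -> : c = (fun s => ((c s).1, (c s).2)) by apply/funext => s; rewrite -surjective_pairing.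
  exact: (@continuous_pair_at _ _ (fun s => (c s).1) (fun s => (c s).2) t c1 c2).
pose K := c @` `[(- 2^-1)%R, 2^-1]%classic; exists K; split.
- by apply: continuous_compact => //; exact: segment_compact.
- move=> _ [t /half tI <-].
  by have [] : (C `&` V) (c t) by rewrite -cE; exists t.
- have h0 : `[(- 2^-1)%R, 2^-1]%classic (0 : R) by rewrite /= in_itv/=; apply/andP; split; lra.
  have gen (g : R * R -> R) : lip1 g -> (forall t, `[(- 2^-1)%R, 2^-1]%classic t -> {for t, continuous (fun s => g (c s))}) ->
      derive1 (fun s => g (c s)) 0 != 0 -> (0 < hausdorff1 K)%E.
    move=> lg cg dg; have [s sI gs] : exists2 s : R, `[(- 2^-1)%R, 2^-1]%classic s & g (c s) != g (c 0).
      apply: contrapT => ns; move/eqP : dg; apply; apply: (@const_derive1 _ 0 2^-1); first by rewrite invr_gt0.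
      move=> u; rewrite subr0 ltr_norml => /andP[u1 u2]; apply: contrapT => /eqP gu; apply: ns; exists u => //.
      by rewrite /= in_itv/= !ltW.
    have cg' : {within `[(- 2^-1)%R, 2^-1]%classic, continuous (fun s => g (c s))}.
      by apply: continuous_in_subspaceT => t /set_mem; exact: cg.
    have /connected_intervalP iI := connected_continuous_connected (@segment_connected R _ _) cg'.
    have img (x y z : R) : `[(- 2^-1)%R, 2^-1]%classic x -> `[(- 2^-1)%R, 2^-1]%classic y ->
        g (c x) <= z <= g (c y) -> exists2 q, K q & g q = z.
      move=> xI yI zI; have [u uI <-] := iI (g (c x)) (g (c y)) (ex_intro2 _ _ x xI erefl) (ex_intro2 _ _ y yI erefl) z zI.
      by exists (c u) => //; exists u.
    move: gs; rewrite neq_lt => /orP[lt|lt].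
    + by apply: (hausdorff1_interval_gt0 lg lt) => t; exact: img.
    + by apply: (hausdorff1_interval_gt0 lg lt) => t; exact: img.
  have [_ _] := ic 0 (half _ h0); rewrite xpair_eqE negb_and => /orP[dn|dn].
  + by refine (gen fst lip1_fst _ dn) => t /cc[c1 _]; exact: c1.
  + by refine (gen snd lip1_snd _ dn) => t /cc[_ c2]; exact: c2.
Qed.

Lemma boundary_arc_gt0 (A : set (R * R)) p (r : R) : open A -> C2_boundary A -> bd A p -> 0 < r ->
  (0 < hausdorff1 (bd A `&` box p r))%E.
Proof.
move=> oA cA bp r0; have [b [gm [d d0 H]]] := bd_graph oA cA bp r0.
pose g (x : R * R) := (ori b x).1.
have lg : lip1 g by rewrite /g; case: (b) => x y; [exact: lip1_snd|exact: lip1_fst].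
apply: (@hausdorff1_interval_gt0 _ g _ (ori b p).1 ((ori b p).1 + d / 2) lg); first by rewrite ltrDl divr_gt0.
move=> t /andP[t1 t2]; have [|b1 b2] := H t; first by rewrite ger0_norm ?subr_ge0//; lra.
by exists (ori b (t, gm t)) => //; rewrite /g oriK.
Qed.

End curves.

Section positivity.
Context {R : realType}.
Local Notation plane := (measurableTypeR R * measurableTypeR R)%type.

Lemma normc_ge_Re (a : R[i]) : `|complex.Re a| <= ComplexField.Normc.normc a.
Proof. by case: a => x y /=; rewrite -sqrtr_sqr ler_wsqrtr// lerDl sqr_ge0. Qed.

(** The rational squares as a sequence; codes of no square give the empty set. *)
Definition rbox (n : nat) : set (R * R) := if unpickle n is Some q then @ratbox R q else set0.

Lemma open_rbox n : open (rbox n).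
Proof. by rewrite /rbox; case: unpickle => [q|]; [exact: open_box|exact: open0]. Qed.

Lemma rbox_sub (p : R * R) (U : set (R * R)) : open U -> U p -> exists n, rbox n p /\ rbox n `<=` U.
Proof.
move=> oU Up; have /openP_box/(_ p Up)[h h0 hU] := oU; have [q [qp qh]] := ratbox_sub p h0.
by exists (pickle q); rewrite /rbox pickleK; split => // x /qh/hU.
Qed.

Context (k rho : R) (D K : set (R * R)) (S w : R * R -> R * R -> R).
Context (k0 : 0 < k) (oD : open D) (bD : bounded_set D) (cD : C2_boundary D).
Context (cK : compact K) (KD : K `<=` D) (Drho : D `<=` disc rho).
Context (hS : forall z, D z -> dirichlet_solution D k (S z) (fun x => - complex.Re (incident_field k z x))).
Context (hw : forall z, K z -> analytic_helmholtz (disc rho) k (w z)).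
Context (hwS : forall z, K z -> {ae leb2, forall x, D x -> w z x = S z x}).
Context (D' : set (R * R)) (oD' : open D') (cD' : C2_boundary D') (D0 : D !=set0) (Lrho : bd D' `<=` disc rho).

Lemma measurable_total x : disc rho x -> measurable_fun (K : set plane) (fun z : plane => total k w z x).
Proof.
move=> xr; apply: measurable_funD; first exact: (measurable_w k0 oD bD cD cK KD Drho hS hw hwS D0 xr).
apply: (@measurable_funS _ _ _ _ setT) => //.
have c1 : closed [set x] by apply: compact_closed_plane; exact: compact_set1.
have m1 : measurable (~` [set x] : set plane) by apply: measurableC; exact: closed_plane_measurable.
have m2 : measurable ([set x] : set plane) by exact: closed_plane_measurable.
(* At [z = x] the source has a default value, so the singleton is treated apart; elsewhere the
   symmetry of the source in its two points gives continuity in [z]. *)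
rewrite -(setUv [set x]); apply/measurable_funU => //; split.
  apply: (@eq_measurable_fun _ _ _ _ _ (fun=> src k x x)); last exact: measurable_cst.
  by move=> z /set_mem ->.
apply: (@eq_measurable_fun _ _ _ _ _ (src k x)); first by move=> z _; rewrite src_sym.
apply: continuous_plane_measurable_within; first exact: closed_openC.
by move=> z zx; apply: continuous_src => //; apply/eqP.
Qed.

Lemma total_continuous z x : K z -> disc rho x -> x != z -> {for x, continuous (total k w z)}.
Proof.
move=> Kz xr xz; apply: cvgD; last exact: continuous_src.
exact: (w_cont hw Kz xr).
Qed.

(** For a source that is not null, continuity gives a rational square and a bound [1 / (m + 1)]
    below the field on its part of the curve. There are countably many such pairs and finitely many
    null sources, so some pair serves a set of sources of positive length. *)
Lemma double_integral_gt0 (C : set (R * R)) (g : R * R -> R * R -> R) : K `<=` C -> (0 < hausdorff1 K)%E ->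
  (forall z x, 0 <= g z x) -> (forall z x, `|total k w z x| <= g z x) ->
  finite_set (null_source k K w D') ->
  (0 < arc_integral C (fun z => arc_integral (bd D') (fun x => (g z x)%:E)))%E.
Proof.
move=> KC hK g0 gt fN; pose L := bd D'.
have mK : measurable (K : set plane) by apply: closed_plane_measurable; exact: compact_closed_plane.
have mL : measurable (L : set plane) by apply: closed_plane_measurable; exact: closed_bd.
have mrb n : measurable (rbox n : set plane) by apply: open_plane_measurable; exact: open_rbox.
have [xs Hxs] : {xs : nat -> R * R & forall n, L `&` rbox n !=set0 -> (L `&` rbox n) (xs n)}.
  apply: (@choice _ _ (fun n x => L `&` rbox n !=set0 -> (L `&` rbox n) x)) => n.
  by have [[x Lx]|nL] := pselect (L `&` rbox n !=set0); [exists x|exists 0 => /nL].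
(* The bound is required only at the sample points [xs j], countably many, so that the set of
   sources is Borel; continuity recovers it elsewhere. *)
pose B (i m j : nat) : set (R * R) := [set z | rbox j `<=` rbox i -> L `&` rbox j !=set0 -> m.+1%:R^-1 <= `|total k w z (xs j)|].
pose A (i m : nat) := \bigcap_j (K `&` B i m j).
have mA i m : measurable (A i m : set plane).
  apply: bigcapT_measurable => j; have [[ji Lj]|nj] := pselect (rbox j `<=` rbox i /\ L `&` rbox j !=set0).
    have -> : K `&` B i m j = K `&` (fun z : plane => `|total k w z (xs j)|) @^-1` `[(m.+1%:R^-1)%R, +oo[%classic.
      apply/seteqP; split => z [Kz Bz]; split => //.
        by rewrite /= in_itv/= andbT; exact: Bz.
      by move: Bz; rewrite /= in_itv/= andbT => Bz _ _.
    have xr : disc rho (xs j) by apply: Lrho; case: (Hxs j Lj).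
    have mt := measurable_total xr.
    by apply: (measurableT_comp (@normr_measurable R setT) mt) => //; exact: measurable_itv.
  have -> : K `&` B i m j = K; last exact: mK.
  by apply/seteqP; split => z; [case|move=> Kz; split => // ji Lj; exfalso; apply: nj].
have AK i m : A i m `<=` K by move=> z /(_ 0%N I)[].
pose N := null_source k K w D'.
(* When the square misses the curve no condition is imposed and [A i m] is all of [K]; such indices
   are discarded. *)
pose A' i m := if pselect (L `&` rbox i !=set0) then A i m else set0.
have cover : K `<=` N `|` \bigcup_i \bigcup_m A' i m.
  move=> z Kz; have [Nz|nNz] := pselect (N z); [by left|right].
  have [x [Lx xz tx]] : exists x, [/\ L x, x != z & total k w z x != 0].
    apply: contrapT => nx; apply: nNz; split => // x Lx xz; apply: contrapT => /eqP tx.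
    by apply: nx; exists x.
  have xr := Lrho Lx; have t0 : 0 < `|total k w z x| / 2 by rewrite divr_gt0// normr_gt0.
  have N1 : nbhs x [set y | `|total k w z x| / 2 < `|total k w z y|].
    by apply: (cvgr_gt _ (cvg_norm (total_continuous Kz xr xz))); lra.
  move/nbhs_boxP : N1 => [h h0 hU].
  have [i [ix ih]] := rbox_sub (@open_box R x h) (boxxx x h0).
  have [m _ Hm] := mesh_small t0.
  have Li : L `&` rbox i !=set0 by exists x.
  exists i => //; exists m => //; rewrite /A'; case: pselect => // _ j _; split => //.
  move=> ji Lj; have [_ xj] := Hxs j Lj; have /= := hU _ (ih _ (ji _ xj)).
  by move=> H; apply: ltW; apply: lt_trans H; apply: Hm; rewrite /=.
have [i [m [Li hA]]] : exists i m, L `&` rbox i !=set0 /\ (0 < hausdorff1 (A i m))%E.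
  apply: contrapT => nim.
  have z' i m : (hausdorff1 (A' i m) <= 0)%E.
    rewrite /A'; case: pselect => Li; last by rewrite hausdorff1_set0.
    by rewrite leNgt; apply/negP => h; apply: nim; exists i, m.
  have := le_hausdorff1 cover; rewrite leNgt => /negP; apply.
  apply: le_lt_trans (hausdorff1_setU _ _) _; rewrite hausdorff1_finite// add0e.
  apply: le_lt_trans hK; apply: hausdorff1_bigcup_null => i; exact: hausdorff1_bigcup_null.
pose c : R := m.+1%:R^-1; have c0 : 0 < c by rewrite invr_gt0.
(* A point where the field is below [c] has a neighbourhood with the same property, which contains a
   rational square inside [rbox i] and hence a sample point, a contradiction. *)
have big z x : A i m z -> L x -> rbox i x -> x != z -> c <= `|total k w z x|.
  move=> Az Lx ix xz; rewrite leNgt; apply/negP => tx; have Kz := AK _ _ _ Az; have xr := Lrho Lx.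
  have N1 : nbhs x [set y | `|total k w z y| < c] by apply: (cvgr_lt _ (cvg_norm (total_continuous Kz xr xz))).
  have N2 : nbhs x (rbox i) by apply: near_open => //; exact: open_rbox.
  have N12 : nbhs x (rbox i `&` [set y | `|total k w z y| < c]) by exact: filterI.
  move/nbhs_boxP : N12 => [h h0 hU].
  have [j [jx jh]] := rbox_sub (@open_box R x h) (boxxx x h0).
  have Lj : L `&` rbox j !=set0 by exists x.
  have ji : rbox j `<=` rbox i by move=> y /jh/hU[].
  have [_ xj] := Hxs j Lj; have [_ /= lt] := hU _ (jh _ xj).
  by have [_ /(_ ji Lj)] := Az j I; rewrite leNgt lt.
have hL : (0 < hausdorff1 (L `&` rbox i))%E.
  have [x [Lx ix]] := Li; have /openP_box/(_ x ix)[h h0 hU] := @open_rbox i.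
  apply: lt_le_trans (boundary_arc_gt0 oD' cD' Lx h0) _; apply: le_hausdorff1 => y [Ly /hU iy]; by split.
(* The length of the piece is not known to be finite; a positive real below the product is
   enough. *)
have [c' c'0 Hc'] : exists2 c' : R, 0 < c' & (c'%:E <= c%:E * hausdorff1 (L `&` rbox i))%E.
  move: hL; case: (hausdorff1 _) => [r| |] //= hr.
    by exists (c * r); [rewrite mulr_gt0|rewrite EFinM].
  by exists 1 => //; rewrite gt0_muley ?lte_fin// leey.
have inner z : A i m z -> (c'%:E <= arc_integral L (fun x => (g z x)%:E))%E.
  move=> Az; apply: le_trans Hc' _.
  (* The source may lie on the piece of curve; removing one point does not change its length. *)
  have E : (hausdorff1 (L `&` rbox i) <= hausdorff1 ((L `&` rbox i) `\ z))%E.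
    have sub : L `&` rbox i `<=` ((L `&` rbox i) `\ z) `|` [set z].
      by move=> x Lx; have [->|/eqP xz] := eqVneq x z; [right|left].
    apply: le_trans (le_hausdorff1 sub) _; apply: le_trans (hausdorff1_setU _ _) _.
    by rewrite (hausdorff1_finite (finite_set1 z)) adde0.
  apply: (@le_trans _ _ (c%:E * hausdorff1 ((L `&` rbox i) `\ z))%E).
    by apply: lee_wpmul2l => //; rewrite lee_fin ltW.
  apply: arc_integral_ge => //.
  - apply: measurableD; first exact: measurableI.
    by apply: closed_plane_measurable; apply: compact_closed_plane; exact: compact_set1.
  - by move=> x [[]].
  - exact: ltW.
  - by move=> x; rewrite lee_fin.
  - move=> x [[Lx ix] /eqP xz]; rewrite lee_fin; apply: le_trans (gt z x); exact: big.
have outer : (c'%:E * hausdorff1 (A i m) <= arc_integral C (fun z => arc_integral L (fun x => (g z x)%:E)))%E.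
  apply: arc_integral_ge => //; first by move=> z /AK/KC.
    exact: ltW.
  by move=> z; apply: arc_integral_ge0 => x; rewrite lee_fin.
by apply: lt_le_trans outer; rewrite mule_gt0.
Qed.

End positivity.

Theorem theorem3p1 (R : realType) (k r rho : R)
    (D Omega Gamma Gamma_R D' Lambda : set (R * R))
    (us us_ext : R * R -> R * R -> R[i])
    (hk : 0 < k)
    (hD : C2_domain D)
    (hDk : ~ dirichlet_eigenvalue D (k ^+ 2))
    (hGamma : admissible D k Gamma Omega)
    (hGamma_R : admissible D k Gamma_R (disc r))
    (hOmega : closure Omega `<=` disc r)
    (hr : disc r `<=` D)
    (hus : forall z, D z -> scattered_field D k z (us z))
    (hrho : D `<=` disc rho)
    (hext : forall z, Gamma z ->
      helmholtz_extension D (disc rho) k (us z) (us_ext z))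
    (hD' : C2_domain D')
    (hLambda : Lambda = bd D')
    (hLambda_rho : Lambda `<=` disc rho)
    (hint : arc_integral Gamma (fun z => arc_integral Lambda (fun x =>
      (ComplexField.Normc.normc (incident_field k z x + us_ext z x))%:E))
      = 0%E) :
  D' = D /\ Lambda = bd D.
Proof.
have [oD bD [D0 conD _] cD] := hD; have [oD' bD' [D'0 _ _] cD'] := hD'.
suff DD : D' = D by rewrite hLambda DD.
apply: contrapT => DD; have [_ _ _ _ _ Gsub _ Gman Gpos] := hGamma.
have G0 : Gamma !=set0.
  apply: contrapT => nG; move: Gpos; suff -> : Gamma = set0 by rewrite hausdorff1_set0 ltxx.
  by apply/seteqP; split => // z Gz; apply: nG; exists z.
(* A compact arc, so that a single regularization radius serves all of its sources. *)
have [K [cK KG hK]] := compact_subcurve Gman G0.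
have KD : K `<=` D by move=> z /KG/Gsub[clz _]; apply: hr; exact: hOmega.
(* From here on only real parts occur; [normc] dominates them, so a vanishing double integral of the
   modulus contradicts positivity for the real part. *)
pose w z x := complex.Re (us_ext z x); pose S z x := complex.Re (us z x).
have hS z : D z -> dirichlet_solution D k (S z) (fun x => - complex.Re (incident_field k z x)).
  by move=> /hus[].
have hw z : K z -> analytic_helmholtz (disc rho) k (w z) by move=> /KG/hext[].
have hwS z : K z -> {ae leb2, forall x, D x -> w z x = S z x}.
  move=> /KG/hext[_ _ [N [mN N0 HN]]]; exists N; split => // x /= nx; apply: HN => /= H; apply: nx => Dx.
  by rewrite /w /S H.
rewrite hLambda in hLambda_rho hint.
have fN := null_source_finite hk oD bD cD cK KD hrho hS hw hwS oD' bD' cD' conD D0 D'0 hLambda_rho DD.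
pose g z x := ComplexField.Normc.normc (incident_field k z x + us_ext z x).
have g0 z x : 0 <= g z x by rewrite /g; case: (incident_field k z x + us_ext z x) => a b; exact: sqrtr_ge0.
have gt z x : `|total k w z x| <= g z x.
  apply: le_trans (normc_ge_Re _); rewrite /total /src /w.
  by case: (incident_field k z x) => a b; case: (us_ext z x) => c d /=; rewrite addrC.
have := double_integral_gt0 hk oD bD cD cK KD hrho hS hw hwS oD' cD' D0 hLambda_rho KG hK g0 gt fN.
by rewrite /g hint ltxx.
Qed.
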